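(* Let $(M,g)$ be a compact connected Riemannian manifold without boundary of dimension $n\ge 3$, let $\psi\in C^\infty(M)$, $p=\frac{n+2}{n-2}$ and $c_n=\frac{4(n-1)}{n-2}$. Assume that $\lambda_1(\psi)<0$ and $\psi(x)<0$ for all $x\in M$. Let $u_0>0$ be a smooth function on $M$ and let $u(t)$, $t\in[0,\infty)$, be the smooth positive solution of the Yamabe-type flow $$u_t=u^{1-p}(c_n\Delta u-\psi u)+r(t)u,\qquad u(0)=u_0,$$ $$r(t)=\frac{\int_M\left(c_n|\nabla u(t)|^2+\psi\,u(t)^2\right)dv}{\int_M u(t)^{p+1}\,dv}.$$ Then, as $t\to\infty$, $u(t)$ converges in $C^\infty(M)$ to a smooth positive function $u_\infty$ whose pseudo-scalar curvature $u_\infty^{-p}(-c_n\Delta u_\infty+\psi u_\infty)$ is constant on $M$; that is, the metrics $u(t)^{4/(n-2)}g$ converge to a metric $u_\infty^{4/(n-2)}g$ of constant pseudo-scalar curvature.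
   Context: $\Delta$, $\nabla$ and $dv$ denote the Laplace–Beltrami operator (with the sign convention that $\int_M u\Delta u\,dv=-\int_M|\nabla u|^2dv$), the gradient and the volume measure of the fixed metric $g$. We write $u(t)=u(\cdot,t)$. Set $$\lambda_1(\psi)=\inf_{u\in H^1(M),\,u\ne0}\frac{\int_M(c_n|\nabla u|^2+\psi u^2)\,dv}{\int_M u^2\,dv}.$$ The pseudo-scalar curvature of a positive smooth function $u$ (or of the metric $u^{4/(n-2)}g$) is $R_\psi=u^{-p}(-c_n\Delta u+\psi u)$. For every smooth positive initial datum the flow exists for all $t\ge0$. *)

(* Defs.v *)
From HB Require Import structures.
From mathcomp Require Import all_boot all_order all_algebra.
From mathcomp Require Import all_classical all_reals all_analysis.

Set Implicit Arguments.
Unset Strict Implicit.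
Unset Printing Implicit Defensive.

Import Order.TTheory GRing.Theory Num.Theory.
Import numFieldNormedType.Exports.

Local Open Scope classical_set_scope.
Local Open Scope ring_scope.

(** [dirder [:: v1; ..; vk] f] is the iterated directional derivative
    [D_v1 (.. (D_vk f))].  In finite dimension, requiring all of these to exist
    and to be continuous is the same as requiring it for the partial
    derivatives. *)
Definition dirder {R : realType} {V W : normedModType R} (s : seq V)
    (f : V -> W) : V -> W :=
  foldr (fun v h => 'D_v h) f s.

(** [U] is meant to be open, so that derivatives at points of [U] depend only on
    the restriction of [f] to [U]. *)
Definition smooth_on {R : realType} {V W : normedModType R} (U : set V)
    (f : V -> W) : Prop :=
  forall (s : seq V) (x : V), U x ->
    {for x, continuous (dirder s f)} /\
    forall v : V, derivable (dirder s f) x v.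

(** Smoothness up to the boundary: smooth in the interior, every derivative
    extending continuously to [S] (for [S] contained in the closure of its
    interior). *)
Definition smooth_upto {R : realType} {V W : normedModType R} (S : set V)
    (f : V -> W) : Prop :=
  [/\ {within S, continuous f}, smooth_on (interior S) f &
    forall s : seq V, exists2 h : V -> W, {within S, continuous h} &
      forall x, interior S x -> h x = dirder s f x].

(** [C^oo_loc] convergence on the open set [U] as the parameter tends to [+oo]:
    uniform convergence of every derivative on the compact subsets of [U]. *)
Definition smooth_cvg_on {R : realType} {V W : normedModType R} (U : set V)
    (F : R -> V -> W) (f : V -> W) : Prop :=
  forall (s : seq V) (K : set V), compact K -> K `<=` U ->
    {uniform K, (fun t => dirder s (F t)) @ +oo --> dirder s f}.

Lemma product_sigma_finite d1 d2 (T1 : measurableType d1)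
    (T2 : measurableType d2) (R : realType)
    (m1 : {sigma_finite_measure set T1 -> \bar R})
    (m2 : {sigma_finite_measure set T2 -> \bar R}) :
  sigma_finite setT (m1 \x m2)%E.
Proof.
have /sigma_finiteP[F [TF ndF Foo]] := sigma_finiteT m1.
have /sigma_finiteP[G [TG ndG Goo]] := sigma_finiteT m2.
exists (fun k => F k `*` G k).
  rewrite -setXTT TF TG; apply/seteqP; split=> [[x y] [[/= i _ Fx] [j _ Gy]]|].
    exists (maxn i j) => //; split.
    - by move: x Fx; exact/subsetPset/ndF/leq_maxl.
    - by move: y Gy; exact/subsetPset/ndG/leq_maxr.
  by move=> [x y] [k _ [/= ? ?]]; split; exists k.
move=> k; have [? ?] := Foo k; have [? ?] := Goo k.
split; first exact: measurableX.
by rewrite product_measure1E// lte_mul_pinfty// ge0_fin_numE.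
Qed.

Section lebesgue_tuple.
Context {R : realType}.
Notation mR := (measurableTypeR R).

Definition tcons (n : nat) (x : mR * n.-tuple mR) : n.+1.-tuple mR :=
  [tuple of x.1 :: x.2].

Lemma measurable_tcons n : measurable_fun [set: mR * n.-tuple mR] (@tcons n).
Proof. exact: measurable_cons. Qed.

Section step.
Variables (n : nat) (mu : {sigma_finite_measure set (n.-tuple mR) -> \bar R}).

Definition lebesgue_cons : set (n.+1.-tuple mR) -> \bar R :=
  pushforward (lebesgue_measure \x mu)%E (@tcons n).

Let pm : {measure set (n.+1.-tuple mR) -> \bar R} :=
  measure_function_pushforward__canonical__measure_function_Measure
    (lebesgue_measure \x mu)%E (@measurable_tcons n).

Let lebesgue_cons0 : lebesgue_cons set0 = 0%E.
Proof. exact: (measure0 pm). Qed.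

Let lebesgue_cons_ge0 A : (0 <= lebesgue_cons A)%E.
Proof. exact: (measure_ge0 pm). Qed.

Let lebesgue_cons_sigma_additive : semi_sigma_additive lebesgue_cons.
Proof. exact: (@measure_semi_sigma_additive _ _ _ pm). Qed.

HB.instance Definition _ := isMeasure.Build _ _ _ lebesgue_cons
  lebesgue_cons0 lebesgue_cons_ge0 lebesgue_cons_sigma_additive.

Let lebesgue_cons_sigma_finite : sigma_finite setT lebesgue_cons.
Proof.
have [F FT Ffin] : sigma_finite setT (lebesgue_measure \x mu)%E.
  exact: product_sigma_finite.
pose g (t : n.+1.-tuple mR) : mR * n.-tuple mR := (thead t, [tuple of behead t]).
have gK x : g (tcons x) = x.
  case: x => x t; rewrite /g /tcons; congr pair.
  exact: val_inj.
have mg : measurable_fun setT g.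
  apply: measurable_fun_pair.
    exact: (@measurable_tnth _ mR n.+1 ord0).
  exact: measurable_behead.
exists (fun i => g @^-1` F i).
  by rewrite -preimage_bigcup -FT preimage_setT.
move=> i; have [mF Foo] := Ffin i; split.
  by rewrite -[X in measurable X]setTI; exact: mg.
rewrite /lebesgue_cons /pushforward -comp_preimage.
by rewrite (_ : g \o _ = id)//; apply/funext => x; exact: gK.
Qed.

HB.instance Definition _ := Measure_isSigmaFinite.Build _ _ _ lebesgue_cons
  lebesgue_cons_sigma_finite.

End step.

(** Lebesgue measure on [R^n], as an iterated product measure. *)
Fixpoint lebesgue_tuple (n : nat) :
    {sigma_finite_measure set (n.-tuple mR) -> \bar R} :=
  if n is m.+1 then lebesgue_cons (lebesgue_tuple m) else \d_([tuple]).

End lebesgue_tuple.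

(** A smooth [n]-manifold without boundary: a Hausdorff second countable space
    with a family of charts onto open subsets of [R^n].  [phi i] and [phiV i] are
    total functions; only their restrictions to the domain and to the image of
    the [i]-th chart are meaningful.  The space is pointed (hence nonempty) only
    because the library's measurable spaces are. *)
Record manifold (R : realType) (n : nat) := Manifold {
  points :> ptopologicalType;
  points_hausdorff : hausdorff_space points;
  points_second_countable : @second_countable points;
  chart : Type;
  dom : chart -> set points;
  phi : chart -> points -> 'rV[R]_n;
  phiV : chart -> 'rV[R]_n -> points;
  dom_cover : forall x, exists i, dom i x;
  dom_open : forall i, open (dom i);
  img_open : forall i, open (phi i @` dom i);
  phiK : forall i x, dom i x -> phiV i (phi i x) = x;
  phi_continuous : forall i, {within dom i, continuous (phi i)};
  phiV_continuous : forall i, {within phi i @` dom i, continuous (phiV i)};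
  transition_smooth : forall i j,
    smooth_on (phi i @` (dom i `&` dom j)) (phi j \o phiV i) }.

Notation borel M := (g_sigma_algebraType (@open (points M))).

Section manifold.
Context {R : realType} {n : nat}.
Implicit Types M : manifold R n.

Definition img M (i : chart M) : set 'rV[R]_n := phi i @` dom i.

Definition chart_at M (x : M) : chart M := projT1 (cid (dom_cover x)).

Definition smooth_fun M (f : M -> R) : Prop :=
  forall i : chart M, smooth_on (img i) (f \o phiV i).

Definition partials (h : 'rV[R]_n -> R) (y : 'rV[R]_n) : 'rV[R]_n :=
  \row_a 'D_(delta_mx 0 a) h y.

Definition is_posdef (A : 'M[R]_n) : Prop :=
  A^T = A /\ forall v : 'rV[R]_n, v != 0 -> 0 < (v *m A *m v^T) 0 0.

(** [gmx g i y] is the matrix [(g_ab)] of the metric in the [i]-th chart, at the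
    point of coordinates [y].  The library's Jacobian acts on row vectors on the
    right, whence the position of the transpose. *)
Record metric M := Metric {
  gmx : chart M -> 'rV[R]_n -> 'M[R]_n;
  gmx_smooth : forall i, smooth_on (img i) (gmx i);
  gmx_posdef : forall i y, img i y -> is_posdef (gmx i y);
  gmx_transition : forall i j x, dom i x -> dom j x ->
    let J := 'J (phi j \o phiV i) (phi i x) in
    gmx i (phi i x) = J *m gmx j (phi j x) *m J^T }.

Section operators.
Variables (M : manifold R n) (g : metric M).

Definition sqrtdet (i : chart M) (y : 'rV[R]_n) : R :=
  Num.sqrt (\det (gmx g i y)).

(** [|grad f|^2 = g^ab d_a f d_b f], read in an arbitrary chart around [x]; by
    [gmx_transition] the value does not depend on that chart. *)
Definition grad2 (f : M -> R) (x : M) : R :=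
  let i := chart_at x in
  let y := phi i x in
  let df := partials (f \o phiV i) y in
  (df *m invmx (gmx g i y) *m df^T) 0 0.

(** [(det g)^(-1/2) d_a ((det g)^(1/2) g^ab d_b f)], so that
    [\int f laplacian f = - \int |grad f|^2]. *)
Definition laplacian (f : M -> R) (x : M) : R :=
  let i := chart_at x in
  let flux z := sqrtdet i z *: (partials (f \o phiV i) z *m invmx (gmx g i z)) in
  (sqrtdet i (phi i x))^-1 *
    \sum_a 'D_(delta_mx 0 a) (fun z => flux z 0 a) (phi i x).

End operators.

(** [vol] has density [sqrt (det g)] with respect to Lebesgue measure in every
    chart, which determines it. *)
Definition is_volume M (g : metric M) (vol : {measure set (borel M) -> \bar R}) :
    Prop :=
  forall (i : chart M) (A : set (borel M)), measurable A -> A `<=` dom i ->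
    vol A =
    (\int[lebesgue_tuple n]_(t in [set t | (phi i @` A) (\row_a tnth t a)])
       (sqrtdet g i (\row_a tnth t a))%:E)%E.

Section sobolev.
Variables (M : manifold R n) (g : metric M).
Variable vol : {measure set (borel M) -> \bar R}.

Definition square_integrable (u : M -> R) : Prop :=
  measurable_fun (setT : set (borel M)) (u : borel M -> R) /\
  vol.-integrable setT (fun x => (u x ^+ 2)%:E).

(** [H^1(M)] is the completion of [C^oo(M)] for the norm
    [(|u|_2^2 + |grad u|_2^2)^(1/2)], realized inside [L^2(M)]: [v] is a Cauchy
    sequence of smooth functions for this norm, converging to [u] in [L^2]. *)
Definition H1_approx (u : M -> R) (v : nat -> M -> R) : Prop :=
  [/\ forall k, smooth_fun (v k),
    (fun k => \int[vol]_x (v k x - u x) ^+ 2) @ \oo --> (0 : R) &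
    forall e : R, 0 < e -> exists N, forall k l, (N <= k)%N -> (N <= l)%N ->
      \int[vol]_x grad2 g (fun y => v k y - v l y) x < e].

Definition in_H1 (u : M -> R) : Prop :=
  square_integrable u /\ exists v, H1_approx u v.

(** The Dirichlet integral of [u] in [H^1(M)] is [E]; [E] does not depend on the
    approximating sequence. *)
Definition is_dirichlet (u : M -> R) (E : R) : Prop :=
  exists2 v, H1_approx u v &
    (fun k => \int[vol]_x grad2 g (v k) x) @ \oo --> E.

Definition conf_const : R := 4 * (n%:R - 1) / (n%:R - 2).

Definition lambda1 (psi : M -> R) : \bar R :=
  ereal_inf [set q | exists u E,
    [/\ in_H1 u, is_dirichlet u E, \int[vol]_x u x ^+ 2 != 0 &
      q = ((conf_const * E + \int[vol]_x (psi x * u x ^+ 2)) /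
           \int[vol]_x u x ^+ 2)%:E]].

Definition crit_exp : R := (n%:R + 2) / (n%:R - 2).

Definition pseudo_curvature (psi u : M -> R) (x : M) : R :=
  u x `^ (- crit_exp) * (- conf_const * laplacian g u x + psi x * u x).

Definition flow_r (psi u : M -> R) : R :=
  \int[vol]_x (conf_const * grad2 g u x + psi x * u x ^+ 2) /
  \int[vol]_x (u x `^ (crit_exp + 1)).

Definition smooth_spacetime (u : R -> M -> R) : Prop :=
  forall i : chart M,
    smooth_upto ([set z | 0 <= z.1 /\ img i z.2] : set (R * 'rV[R]_n)%type)
      (fun z => u z.1 (phiV i z.2)).

(** A smooth positive solution on [[0, +oo)].  The values [u t] for [t < 0] are
    irrelevant, so the equation is imposed for [t > 0]; as [u] is smooth up to
    [t = 0], it then holds at [t = 0] with the one-sided derivative. *)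
Definition is_yamabe_flow (psi u0 : M -> R) (u : R -> M -> R) : Prop :=
  [/\ smooth_spacetime u,
    forall (t : R) x, 0 <= t -> 0 < u t x,
    u 0 = u0 &
    forall (t : R) x, 0 < t ->
      derive1 (fun s => u s x) t =
      u t x `^ (1 - crit_exp) *
        (conf_const * laplacian g (u t) x - psi x * u t x) +
      flow_r psi (u t) * u t x].

Definition conf_gmx (u : M -> R) (i : chart M) (y : 'rV[R]_n) : 'M[R]_n :=
  u (phiV i y) `^ (4 / (n%:R - 2)) *: gmx g i y.

End sobolev.

Definition smooth_cvg M (u : R -> M -> R) (v : M -> R) : Prop :=
  forall i : chart M, smooth_cvg_on (img i) (fun t => u t \o phiV i) (v \o phiV i).

Definition conf_metric_cvg M (g : metric M) (u : R -> M -> R) (v : M -> R) : Prop :=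
  forall i : chart M,
    smooth_cvg_on (img i) (fun t => conf_gmx g (u t) i) (conf_gmx g v i).

End manifold.

(* Main.v *)
(** Write [u = mu U] with a scale [mu (t)] chosen so that
    [U_t = mu^(1-p) (U^(1-p) (c lap U - psi U) - U)] and [U_t <= 0] at some time.
    By the maximum principle [U_t <= 0] persists, and [psi < 0] bounds [U] from
    below, so that [U] decreases to a positive limit [w].  The flow preserves the
    integral of [u^(p+1)], whence [mu] is nondecreasing and bounded.

    For the regularity of [w]: weighted time averages of [U] over unit intervals
    have a bounded Laplacian, so a doubling of variables argument gives them a
    local Hoelder lower estimate; since they lie between [w] and [U], around each
    point [U] has eventually an arbitrarily small oscillation in space-time.
    This closes a Bernstein estimate for the gradient, with auxiliary function
    [1 + N (U - m)^2]; the higher derivatives follow by induction, the energy of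
    order [k] providing the auxiliary function for the order [k + 1].  Hence all
    the derivatives of [U] converge locally uniformly, [w] is smooth, and
    [c lap w - psi w = w^p], because otherwise [U] would decrease to [-oo]
    somewhere. *)

From HB Require Import structures.
Require Import Defs.
From mathcomp Require Import all_boot all_order all_algebra.
From mathcomp Require Import all_classical all_reals all_analysis.
From mathcomp Require Import measurable_realfun ring lra.

Set Implicit Arguments.
Unset Strict Implicit.
Unset Printing Implicit Defensive.

Import Order.TTheory GRing.Theory Num.Theory.
Import numFieldNormedType.Exports.

Local Open Scope classical_set_scope.
Local Open Scope ring_scope.

(** * Smooth functions on normed spaces *)

(** The obstacle is regularity. The maximum principle bounds [U] and fixes the sign of [dt U], but
    it controls neither the size of [dt U] nor the gradient. The diffusion coefficient [U^(1-p)]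
    depends on the solution, so the evolution of [|dU|^2] contains terms of order [|dU|^4] without a
    sign. The auxiliary function of the gradient estimate answers them by a term [- N |dU|^2]; it
    must stay between [1] and [2] although [N] is dictated by the equation, which is why the
    oscillation has to be small beforehand. From the second order on, the corresponding coefficient
    can be chosen small, and a bounded lower energy is enough. The constants never depend on the
    final time.

    The scale absorbs the only nonlocal term: after the normalization the equation is local, up to a
    positive factor depending on time alone.

    The Laplacian is read in one chosen chart per point. That its value does not depend on the chart
    is deduced from Green's formula in each chart, tested against bumps, rather than from the second
    derivatives of the transition maps. *)

Section Ck.
Context {R : realType} {V : normedModType R}.

(** [smooth_on] unfolded from the inside: [dirder] exposes the last derivative taken, whereas
    closure properties need the first one, so that they follow by induction on [k] with [f]
    generalized. *)
Fixpoint Ck {W : normedModType R} (k : nat) (U : set V) (f : V -> W) : Prop :=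
  (forall x, U x -> {for x, continuous f}) /\
  if k is k'.+1 then
    forall v, (forall x, U x -> derivable f x v) /\ Ck k' U ('D_v f)
  else True.

Lemma dirder_rcons (W : normedModType R) s v (f : V -> W) :
  dirder (rcons s v) f = dirder s ('D_v f).
Proof. by rewrite /dirder foldr_rcons. Qed.

Lemma smooth_onP (W : normedModType R) (U : set V) (f : V -> W) :
  smooth_on U f <-> forall k, Ck k U f.
Proof.
split=> [fS k|fC s x Ux].
  elim: k f fS => [|k IH] f fS /=; split => //.
  - by move=> x Ux; have [] := fS [::] x Ux.
  - by move=> x Ux; have [] := fS [::] x Ux.
  - move=> v; split=> [x Ux|]; first by have [_] := fS [::] x Ux; exact.
    by apply: IH => s x Ux; have := fS (rcons s v) x Ux; rewrite dirder_rcons.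
elim/last_ind: s f fC => [|s v IH] f fC.
  by have [? fd] := fC 1%N; split=> [|v]; [auto|have [+ _] := fd v; exact].
by rewrite dirder_rcons; apply: IH => k; have [_ /(_ v)[]] := fC k.+1.
Qed.

Lemma smooth_on_D (W : normedModType R) (U : set V) (f : V -> W) v :
  smooth_on U f -> smooth_on U ('D_v f).
Proof. by move=> fS s x Ux; have := fS (rcons s v) x Ux; rewrite dirder_rcons. Qed.

Lemma smooth_on_dirder (W : normedModType R) (U : set V) (f : V -> W) s :
  smooth_on U f -> smooth_on U (dirder s f).
Proof. by move=> fS; elim: s => //= v s; exact: smooth_on_D. Qed.

Lemma smooth_on_cts (W : normedModType R) (U : set V) (f : V -> W) x :
  smooth_on U f -> U x -> {for x, continuous f}.
Proof. by move=> fS Ux; have [] := fS [::] x Ux. Qed.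

Lemma smooth_on_derivable (W : normedModType R) (U : set V) (f : V -> W) x v :
  smooth_on U f -> U x -> derivable f x v.
Proof. by move=> fS Ux; have [_] := fS [::] x Ux; exact. Qed.

Lemma smooth_onS (W : normedModType R) (U U' : set V) (f : V -> W) :
  U' `<=` U -> smooth_on U f -> smooth_on U' f.
Proof. by move=> UU fS s x /UU; exact: fS. Qed.

Lemma open_near (T : topologicalType) (U : set T) x (P : T -> Prop) : open U -> U x ->
  (forall y, U y -> P y) -> \forall y \near x, P y.
Proof. by move=> oU Ux UP; apply: filterS (open_nbhs_nbhs (conj oU Ux)). Qed.

Lemma Ck_ext (W : normedModType R) k (U : set V) (f g : V -> W) : open U ->
  (forall x, U x -> f x = g x) -> Ck k U f -> Ck k U g.
Proof.
move=> oU; elim: k f g => [|k IH] f g fg /= [fc fd]; split => //.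
- move=> x Ux; rewrite /prop_for /continuous_at -fg//.
  apply: cvg_trans (fc _ Ux); apply: near_eq_cvg.
  by apply: (open_near oU Ux) => y Uy; rewrite fg.
- move=> x Ux; rewrite /prop_for /continuous_at -fg//.
  apply: cvg_trans (fc _ Ux); apply: near_eq_cvg.
  by apply: (open_near oU Ux) => y Uy; rewrite fg.
- move=> v; have [dv Cv] := fd v; split=> [x Ux|].
    apply: near_eq_derivable (dv _ Ux).
    by apply: (open_near oU Ux) => y Uy; rewrite fg.
  apply: IH Cv => x Ux; apply: near_eq_derive.
  by apply: (open_near oU Ux) => y Uy; rewrite fg.
Qed.

Lemma smooth_on_ext (W : normedModType R) (U : set V) (f g : V -> W) : open U ->
  (forall x, U x -> f x = g x) -> smooth_on U f -> smooth_on U g.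
Proof.
by move=> oU fg /smooth_onP fC; apply/smooth_onP => k; exact: Ck_ext fg (fC k).
Qed.

Lemma Ck_dec (W : normedModType R) k (U : set V) (f : V -> W) :
  Ck k.+1 U f -> Ck k U f.
Proof.
elim: k f => [|k IH] f /= [fc fd]; split => // v.
by have [dv Cv] := fd v; split => //; exact: IH Cv.
Qed.

Lemma Ck_cst (W : normedModType R) k (U : set V) (c : W) : Ck k U (cst c).
Proof.
elim: k c => [|k IH] c /=; split=> //; try (by move=> x _; exact: cvg_cst).
move=> v; split=> [x _|]; first exact: derivable_cst.
by rewrite (_ : 'D_v _ = cst 0)//; apply/funext => x; rewrite derive_cst.
Qed.

Lemma CkD (W : normedModType R) k (U : set V) (f g : V -> W) : open U ->
  Ck k U f -> Ck k U g -> Ck k U (fun x => f x + g x).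
Proof.
move=> oU; elim: k f g => [|k IH] f g /= [fc fd] [gc gd]; split => //.
- by move=> x Ux; apply: cvgD; [exact: fc|exact: gc].
- by move=> x Ux; apply: cvgD; [exact: fc|exact: gc].
- move=> v; have [dv Cv] := fd v; have [dw Cw] := gd v; split=> [x Ux|].
    by apply: derivableD; [exact: dv|exact: dw].
  apply: Ck_ext (IH _ _ Cv Cw) => // x Ux.
  by rewrite (@deriveD _ _ _ f g)//; [exact: dv|exact: dw].
Qed.

Lemma CkM k (U : set V) (f g : V -> R) : open U ->
  Ck k U f -> Ck k U g -> Ck k U (fun x => f x * g x).
Proof.
move=> oU; elim: k f g => [|k IH] f g.
  by move=> [fc _] [gc _]; split => // x Ux; apply: cvgM; [exact: fc|exact: gc].
move=> fC gC; have [fc fd] := fC; have [gc gd] := gC; split=> [x Ux|v].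
  by apply: cvgM; [exact: fc|exact: gc].
have [dv Cv] := fd v; have [dw Cw] := gd v; split=> [x Ux|].
  by apply: derivableM; [exact: dv|exact: dw].
apply: Ck_ext (CkD oU (IH _ _ (Ck_dec fC) Cw) (IH _ _ (Ck_dec gC) Cv)) => // x Ux.
by rewrite (@deriveM _ _ f g)//; [exact: dv|exact: dw].
Qed.

Lemma smooth_on_cst (W : normedModType R) (U : set V) (c : W) : smooth_on U (fun=> c).
Proof. by apply/smooth_onP => k; exact: Ck_cst. Qed.

Lemma smooth_onD (W : normedModType R) (U : set V) (f g : V -> W) : open U ->
  smooth_on U f -> smooth_on U g -> smooth_on U (fun x => f x + g x).
Proof. by move=> oU /smooth_onP ? /smooth_onP ?; apply/smooth_onP => k; exact: CkD. Qed.

Lemma smooth_onM (U : set V) (f g : V -> R) : open U ->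
  smooth_on U f -> smooth_on U g -> smooth_on U (fun x => f x * g x).
Proof. by move=> oU /smooth_onP ? /smooth_onP ?; apply/smooth_onP => k; exact: CkM. Qed.

Lemma smooth_onN (U : set V) (f : V -> R) : open U ->
  smooth_on U f -> smooth_on U (fun x => - f x).
Proof.
move=> oU fS.
have c : smooth_on U (fun=> -1 : R) by exact: smooth_on_cst.
apply: (smooth_on_ext oU _ (smooth_onM oU c fS)).
by move=> x _; rewrite mulN1r.
Qed.

Lemma smooth_onB (U : set V) (f g : V -> R) : open U ->
  smooth_on U f -> smooth_on U g -> smooth_on U (fun x => f x - g x).
Proof. by move=> oU fS gS; exact: (smooth_onD oU fS (smooth_onN oU gS)). Qed.

Lemma smooth_on_sum (W : normedModType R) I (r : seq I) (U : set V) (f : I -> V -> W) :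
  open U -> (forall i, smooth_on U (f i)) -> smooth_on U (fun x => \sum_(i <- r) f i x).
Proof.
move=> oU fS; elim: r => [|i r IH].
  apply: smooth_on_ext (@smooth_on_cst W U 0) => // x _.
  by rewrite big_nil.
apply: smooth_on_ext (smooth_onD oU (fS i) IH) => // x _.
by rewrite big_cons.
Qed.

Lemma smooth_on_prod I (r : seq I) (U : set V) (f : I -> V -> R) :
  open U -> (forall i, smooth_on U (f i)) -> smooth_on U (fun x => \prod_(i <- r) f i x).
Proof.
move=> oU fS; elim: r => [|i r IH].
  have c : smooth_on U (fun=> 1 : R) by exact: smooth_on_cst.
  by apply: (smooth_on_ext oU _ c) => x _; rewrite big_nil.
by apply: (smooth_on_ext oU _ (smooth_onM oU (fS i) IH)) => x _; rewrite big_cons.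
Qed.

End Ck.

(** * Mean values along lines and symmetry of mixed derivatives *)

Section lines.
Context {R : realType} {V : normedModType R}.

Lemma is_derive_line (W : normedModType R) (f : V -> W) (x v : V) (h : R) :
  derivable f (h *: v + x) v ->
  is_derive h 1 (fun s : R => f (s *: v + x)) ('D_v f (h *: v + x)).
Proof.
rewrite /derivable => df.
have E : (fun k : R => k^-1 *: (((fun s : R => f (s *: v + x)) \o shift h) (k *: 1) -
      f (h *: v + x))) =
    (fun k => k^-1 *: ((f \o shift (h *: v + x)) (k *: v) - f (h *: v + x))).
  by apply/funext => k /=; rewrite [k *: 1]mulr1 scalerDl addrA.
by split; rewrite /derivable /derive E.
Qed.

Lemma line_MVT (f : V -> R) (x v : V) (h : R) : 0 < h ->
  (forall s, 0 <= s <= h -> derivable f (s *: v + x) v) ->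
  exists2 s, 0 <= s <= h & f (h *: v + x) - f x = h * 'D_v f (s *: v + x).
Proof.
move=> h0 df.
have dl s : 0 <= s <= h ->
    is_derive s 1 (fun s : R => f (s *: v + x)) ('D_v f (s *: v + x)).
  by move=> sh; apply: is_derive_line; exact: df.
have [||c] := @MVT R (fun s => f (s *: v + x)) (fun s => 'D_v f (s *: v + x)) 0 h h0.
- by move=> s; rewrite in_itv/= => /andP[s0 sh]; apply: dl; rewrite !ltW.
- apply: derivable_within_continuous => s; rewrite in_itv/= => sh.
  by have [] := dl _ sh.
rewrite in_itv/= => /andP[c0 ch] E; exists c; first by rewrite !ltW.
by move: E; rewrite scale0r add0r subr0 => ->; rewrite mulrC.
Qed.

(** The mean value theorem is applied along [v] to the increment of [f] by [h *: w], then along [w]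
    to ['D_v f]. Exchanging [v] and [w] expresses the same second difference by the other mixed
    derivative. *)
Lemma rect_MVT (f : V -> R) (U : set V) (x v w : V) (h : R) : 0 < h ->
  smooth_on U f ->
  (forall s t, 0 <= s <= h -> 0 <= t <= h -> U (s *: v + (t *: w + x))) ->
  exists s t, [/\ 0 <= s <= h, 0 <= t <= h &
    f (h *: v + (h *: w + x)) - f (h *: w + x) - f (h *: v + x) + f x =
      h * (h * 'D_w ('D_v f) (s *: v + (t *: w + x)))].
Proof.
move=> h0 fS hU.
pose g := fun y => f (y + h *: w) - f y.
have hh : 0 <= h <= h by rewrite lexx ltW.
have h00 : 0 <= (0 : R) <= h by rewrite lexx ltW.
have U1 s : 0 <= s <= h -> U (s *: v + x).
  by move=> sh; have := hU s 0 sh h00; rewrite scale0r add0r.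
have U2 s : 0 <= s <= h -> U (s *: v + x + h *: w).
  by move=> sh; have := hU s h sh hh; rewrite -addrA (addrC _ x).
have dsh y : U (y + h *: w) ->
    is_derive y v (fun y => f (y + h *: w)) ('D_v f (y + h *: w)).
  move=> Uy; have dv : derivable f (y + h *: w) v by exact: smooth_on_derivable Uy.
  have E : (fun k : R => k^-1 *: (((fun y => f (y + h *: w)) \o shift y) (k *: v) -
      f (y + h *: w))) =
    (fun k => k^-1 *: ((f \o shift (y + h *: w)) (k *: v) - f (y + h *: w))).
    by apply/funext => k /=; rewrite addrA.
  by split; rewrite /derivable /derive E.
have [s sh Es] : exists2 s, 0 <= s <= h & g (h *: v + x) - g x = h * 'D_v g (s *: v + x).
  apply: (line_MVT (f := g) (x := x) (v := v) h0) => s sh; apply: derivableB.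
    by have [] := dsh _ (U2 _ sh).
  by apply: smooth_on_derivable fS (U1 _ sh).
have [t th Et] : exists2 t, 0 <= t <= h &
    'D_v f (h *: w + (s *: v + x)) - 'D_v f (s *: v + x) =
    h * 'D_w ('D_v f) (t *: w + (s *: v + x)).
  apply: (line_MVT (f := 'D_v f) (x := s *: v + x) (v := w) h0) => t th.
  apply: (@smooth_on_derivable _ _ _ U).
    exact: smooth_on_D.
  by rewrite addrCA; exact: hU.
exists s, t; split => //.
rewrite [t *: w + _]addrCA in Et; rewrite -Et.
have := Es; rewrite /g.
have ds := dsh _ (U2 _ sh).
rewrite (@deriveB _ _ _ (fun y => f (y + h *: w)) f); last first.
- by apply: smooth_on_derivable fS (U1 _ sh).
- by have [] := ds.
rewrite (@derive_val _ _ _ _ _ _ _ ds) => E1.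
rewrite (addrC (h *: w) (s *: v + x)) -E1 (addrC (h *: w) x) addrA.
by ring.
Qed.

(** The two mixed derivatives, at two points close to [x], equal the same second difference over a
    small parallelogram; their continuity at [x] does the rest. The argument lives on directional
    derivatives, so it serves space-time as well as charts. *)
Lemma schwarz (U : set V) (f : V -> R) (x v w : V) : open U -> smooth_on U f ->
  U x -> 'D_v ('D_w f) x = 'D_w ('D_v f) x.
Proof.
move=> oU fS Ux; apply/eqP; rewrite -subr_eq0 -normr_le0; apply/ler_addgt0Pr => e e0.
rewrite add0r; have e20 : 0 < e / 2 by rewrite divr_gt0.
have c1 : {for x, continuous ('D_v ('D_w f))}.
  by apply: smooth_on_cts Ux; do 2 apply: smooth_on_D.
have c2 : {for x, continuous ('D_w ('D_v f))}.
  by apply: smooth_on_cts Ux; do 2 apply: smooth_on_D.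
have /cvgrPdist_le/(_ _ e20) n1 := c1.
have /cvgrPdist_le/(_ _ e20) n2 := c2.
have n3 : \forall y \near x, U y by apply: (open_near oU Ux).
have [d /= d0 dP] := (nbhs_ballP _ _).1 (filterI (filterI n1 n2) n3).
set N := `|v| + `|w| + 1.
have N0 : 0 < N by rewrite ltr_wpDl// addr_ge0.
pose h := d / (2 * N).
have h0 : 0 < h by rewrite divr_gt0// mulr_gt0.
have inb s t : 0 <= s <= h -> 0 <= t <= h -> ball x d (s *: v + (t *: w + x)).
  move=> /andP[s0 sh] /andP[t0 th].
  rewrite -ball_normE /= addrA opprD [- _ - x]addrC addrA subrr add0r normrN.
  rewrite (le_lt_trans (ler_normD _ _))// !normrZ !ger0_norm//.
  apply: (@le_lt_trans _ _ (h * N)).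
    by rewrite /N; have := ler_wpM2r (normr_ge0 v) sh; have := ler_wpM2r (normr_ge0 w) th; nra.
  by rewrite /h invfM mulrA divfK ?gt_eqF// ltr_pdivrMr// ltr_pMr// ltr1n.
have [s [t [sh th E1]]] := rect_MVT (v := v) (w := w) h0 fS (fun s t sh th => (dP _ (inb s t sh th)).2).
have [|s' [t' [sh' th' E2]]] := rect_MVT (x := x) (v := w) (w := v) h0 fS.
  by move=> a b ah bh; have := (dP _ (inb b a bh ah)).2; rewrite addrCA.
have E : 'D_w ('D_v f) (s *: v + (t *: w + x)) = 'D_v ('D_w f) (s' *: w + (t' *: v + x)).
  apply: (mulfI (lt0r_neq0 h0)); apply: (mulfI (lt0r_neq0 h0)).
  apply: etrans (esym E1) _; apply: etrans _ E2.
  by rewrite (addrCA (h *: w)); congr (_ + _); exact: addrAC.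
have [[_ p1] _] := dP _ (inb _ _ sh th).
have [[p2 _] _] := dP _ (inb _ _ th' sh').
move: E p1 p2; rewrite /= (addrCA (s' *: w)).
move: ('D_w ('D_v f)) ('D_v ('D_w f)) => G H E p1 p2; rewrite -E in p2.
rewrite [leRHS]splitr; apply: le_trans (lerD p2 p1).
by rewrite [X in _ <= _ + X]distrC; apply: le_trans (ler_normD _ _); rewrite subrKA.
Qed.

End lines.

(** * Differentiability of smooth functions of several coordinates *)

Section differentiability.
Context {R : realType}.

Lemma line_MVT_sym (V : normedModType R) (f : V -> R) (x v : V) (h : R) :
  (forall s, `|s| <= `|h| -> derivable f (s *: v + x) v) ->
  exists2 s, `|s| <= `|h| & f (h *: v + x) - f x = h * 'D_v f (s *: v + x).
Proof.
move=> df; have [h0|h0|->] := ltgtP h 0.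
- have [||s /andP[s0 sh] E] := @line_MVT R V f (h *: v + x) v (- h).
  + by rewrite oppr_gt0.
  + move=> s /andP[s0 sh]; rewrite addrA -scalerDl; apply: df.
    by rewrite (ltr0_norm h0) ler_norml; apply/andP; split; lra.
  + exists (s + h).
      by rewrite (ltr0_norm h0) ler_norml; apply/andP; split; lra.
    move: E; rewrite scaleNr addKr addrA -scalerDl => E.
    by rewrite -[LHS]opprK opprB E mulNr opprK.
- have [|s /andP[s0 sh] E] := @line_MVT R V f x v h h0.
    by move=> s /andP[s0 sh]; apply: df; rewrite !ger0_norm// ltW.
  by exists s => //; rewrite !ger0_norm// ltW.
- by exists 0 => //; rewrite scale0r add0r subrr mul0r.
Qed.

Lemma ler_norm_coord n (h : 'rV[R]_n) a : `|h 0 a| <= `|h|.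
Proof.
rewrite [leRHS]/Num.norm/= mx_normrE.
exact: (le_bigmax _ (fun i : 'I_1 * 'I_n => `|h i.1 i.2|) (0, a)).
Qed.

Lemma ler_norm_rV n (h : 'rV[R]_n) (e : R) : 0 <= e ->
  (forall a, `|h 0 a| <= e) -> `|h| <= e.
Proof.
move=> e0 he; rewrite [leLHS]/Num.norm/= mx_normrE; apply/bigmax_leP; split => //.
by move=> [i a] _ /=; rewrite ord1.
Qed.

Lemma cvg_bigsum (W : normedModType R) T (F : set_system T) {FF : Filter F} I
    (r : seq I) (f : I -> T -> W) (l : I -> W) :
  (forall i, f i x @[x --> F] --> l i) ->
  \sum_(i <- r) f i x @[x --> F] --> \sum_(i <- r) l i.
Proof.
move=> fl; elim: r => [|i r IH].
  by under eq_fun do rewrite big_nil; rewrite big_nil; exact: cvg_cst.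
by under eq_fun do rewrite big_cons; rewrite big_cons; exact: cvgD.
Qed.

Definition lin_form n (c : 'I_n -> R) (h : 'rV[R]_n) : R := \sum_a h 0 a * c a.

Lemma lin_form_is_linear n (c : 'I_n -> R) : linear (lin_form c).
Proof.
move=> k u v; rewrite /lin_form scaler_sumr -big_split/=; apply: eq_bigr => a _.
by rewrite !mxE mulrDl -mulrA.
Qed.

HB.instance Definition _ n (c : 'I_n -> R) :=
  GRing.isLinear.Build R 'rV[R]_n R _ (lin_form c) (lin_form_is_linear c).

(** Vertices of a path from [0] to [h] that changes one coordinate at a time, so that the mean value
    theorem applies to each edge. *)
Definition trunc n (h : 'rV[R]_n) (k : nat) : 'rV[R]_n :=
  \row_a (if (a < k)%N then h 0 a else 0).

Lemma truncS n (h : 'rV[R]_n) (k : 'I_n) :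
  trunc h k.+1 = h 0 k *: delta_mx 0 k + trunc h k.
Proof.
apply/rowP => a; rewrite !mxE eqxx/= ltnS leq_eqVlt.
have [->|ak] := eqVneq a k; first by rewrite eqxx ltnn/= mulr1 addr0.
by rewrite mulr0 add0r (inj_eq val_inj) (negbTE ak).
Qed.

(** The increment of [f] telescopes along the truncations of [h]. On each edge it is [h 0 k] times a
    partial derivative at a point near [x], which continuity replaces by its value at [x]. *)
Lemma smooth_differentiable_aux n (U : set 'rV[R]_n) (f : 'rV[R]_n -> R) x :
  open U -> smooth_on U f -> U x ->
  f \o shift x = cst (f x) + lin_form (fun a => 'D_(delta_mx 0 a) f x) +o_ (0 : 'rV[R]_n) id.
Proof.
move=> oU fS Ux; apply/eqaddoP => e e0.
set c := fun a : 'I_n => 'D_(delta_mx 0 a) f x.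
(* One share of the error for each of the [n] edges; the [+ 1] keeps the divisor positive in
   dimension [0]. *)
pose e' := e / (n%:R + 1).
have n10 : 0 < n%:R + 1 :> R by rewrite ltr_wpDl.
have e'0 : 0 < e' by rewrite divr_gt0.
have near_x : \forall y \near x, U y /\ forall a, `|'D_(delta_mx 0 a) f y - c a| <= e'.
  apply: filterI; first by apply: (open_near oU Ux).
  apply: (@filter_forall _ _ (fun (a : 'I_n) y => `|'D_(delta_mx 0 a) f y - c a| <= e') (nbhs x)) => a.
  have : {for x, continuous ('D_(delta_mx 0 a) f)}.
    by apply: smooth_on_cts Ux; exact: smooth_on_D.
  by move/cvgrPdist_le/(_ _ e'0); apply: filterS => y; rewrite distrC.
have [d /= d0 dP] := (nbhs_ballP _ _).1 near_x.
near=> h.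
have hd : `|h| < d.
  near: h; apply/nbhs_ballP; exists d => //= z.
  by rewrite -ball_normE/= sub0r normrN.
have inb (k : 'I_n) s : `|s| <= `|h 0 k| -> ball x d (s *: delta_mx 0 k + (trunc h k + x)).
  move=> sh; rewrite -ball_normE/= addrA [_ + x]addrC opprD addrA subrr add0r normrN.
  apply: le_lt_trans hd; apply: ler_norm_rV => // a; rewrite !mxE eqxx/=.
  have [->|ak] := eqVneq a k; rewrite ?ltnn ?addr0 ?mulr1 ?mulr0 ?add0r.
    exact: le_trans sh (ler_norm_coord _ _).
  by case: ifP => _; rewrite ?normr0//; exact: ler_norm_coord.
have step (k : 'I_n) : `|f (trunc h k.+1 + x) - f (trunc h k + x) - h 0 k * c k| <= e' * `|h|.
  have [|s sh E] := @line_MVT_sym _ f (trunc h k + x) (delta_mx 0 k) (h 0 k).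
    by move=> s sh; apply: smooth_on_derivable fS _; have [] := dP _ (inb _ _ sh).
  rewrite truncS -(addrA _ _ x) E -mulrBr normrM mulrC ler_pM//.
  - by have [_ /(_ k)] := dP _ (inb _ _ sh).
  - exact: ler_norm_coord.
have E0 : trunc h 0 = 0 by apply/rowP => a; rewrite !mxE.
have En : trunc h n = h by apply/rowP => a; rewrite !mxE ltn_ord.
have tel : f (h + x) - f x = \sum_(k < n) (f (trunc h k.+1 + x) - f (trunc h k + x)).
  by rewrite -(big_mkord predT (fun k => f (trunc h k.+1 + x) - f (trunc h k + x)))
    telescope_sumr// En E0 add0r.
have -> : (f \o shift x - (cst (f x) + lin_form c)) h =
   \sum_(k < n) (f (trunc h k.+1 + x) - f (trunc h k + x) - h 0 k * c k).
  by rewrite sumrB -tel /= -![(_ + _ : _ -> _) _]/(_ + _) -![(- _ : _ -> _) _]/(- _) /= opprD addrA.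
apply: (le_trans (ler_norm_sum _ _ _)).
apply: (@le_trans _ _ (\sum_(k < n) e' * `|h|)); first exact: ler_sum.
rewrite sumr_const card_ord -mulr_natr /= mulrAC ler_wpM2r// /e'.
by rewrite mulrAC ler_pdivrMr// ler_pM2l// lerDl.
Unshelve. all: by end_near. Qed.

Lemma lin_form_continuous n (c : 'I_n -> R) : continuous (lin_form c).
Proof.
move=> h; rewrite /lin_form; apply: (cvg_bigsum (F := nbhs h)) => a.
apply: cvgM; last exact: cvg_cst.
exact: coord_continuous.
Qed.

Lemma smooth_differentiable n (U : set 'rV[R]_n) (f : 'rV[R]_n -> R) x :
  open U -> smooth_on U f -> U x -> differentiable f x.
Proof.
move=> oU fS Ux; have E := smooth_differentiable_aux oU fS Ux.
have D := diff_unique (@lin_form_continuous n _) E.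
by apply/diff_locallyP; rewrite D; split => //; exact: lin_form_continuous.
Qed.

Lemma smooth_derive n (U : set 'rV[R]_n) (f : 'rV[R]_n -> R) x v :
  open U -> smooth_on U f -> U x ->
  'D_v f x = \sum_a v 0 a * 'D_(delta_mx 0 a) f x.
Proof.
move=> oU fS Ux; rewrite deriveE; last exact: smooth_differentiable Ux.
by rewrite (diff_unique (@lin_form_continuous n _) (smooth_differentiable_aux oU fS Ux)).
Qed.

(** Along the line through [x] of direction [v] the inner function becomes a function of one real
    variable, for which derivable and differentiable mean the same; the chain rule for differentials
    then applies. *)
Lemma is_derive_comp (V W : normedModType R) (f : W -> R) (tau : V -> W) x v :
  differentiable f (tau x) -> derivable tau x v ->
  is_derive x v (fun y => f (tau y)) ('D_('D_v tau x) f (tau x)).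
Proof.
move=> df dtau.
have dg : differentiable (fun h : R => tau (h *: v + x)) 0.
  by apply/derivable1_diffP; apply: (iffLR (derivable1P tau x v)).
have tau0 : tau (0 *: v + x) = tau x by rewrite scale0r add0r.
have df0 : differentiable f (tau (0 *: v + x)) by rewrite tau0.
have dc := differentiable_comp dg df0.
have dfc : derivable (fun y => f (tau y)) x v.
  by apply: (iffRL (derivable1P (fun y => f (tau y)) x v)); apply/derivable1_diffP.
split; first by [].
have E (X : normedModType R) (F : V -> X) : derivable F x v ->
    'D_v F x = 'D_1 (fun h : R => F (h *: v + x)) 0.
  have := @is_derive_line R V X F x v 0.
  by rewrite scale0r add0r => H /H[_ ->].
rewrite E//.
rewrite (deriveE _ dc) (diff_comp dg df0) /= -(deriveE _ dg) -E//.
by rewrite -deriveE// tau0.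
Qed.

End differentiability.

(** * Compositions, matrices, powers and inverses *)

Section composition.
Context {R : realType}.

Lemma smooth_is_derive_comp (V : normedModType R) n (U : set V) (O : set 'rV[R]_n)
    (f : 'rV[R]_n -> R) (tau : V -> 'rV[R]_n) x v :
  open O -> smooth_on O f -> O (tau x) -> derivable tau x v ->
  is_derive x v (fun y => f (tau y))
    (\sum_a 'D_v (fun y => tau y 0 a) x * 'D_(delta_mx 0 a) f (tau x)).
Proof.
move=> oO fS Ox dtau.
have H := is_derive_comp (smooth_differentiable oO fS Ox) dtau.
apply: is_derive_eq H _; rewrite (smooth_derive _ oO fS Ox); apply: eq_bigr => a _.
by rewrite derive_mx// mxE.
Qed.

Lemma smooth_on_coord (V : normedModType R) m n (U : set V) (A : V -> 'M[R]_(m, n)) i j :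
  open U -> smooth_on U A -> smooth_on U (fun y => A y i j).
Proof.
move=> oU /smooth_onP AC; apply/smooth_onP => k.
elim: k A {AC}(AC k) => [|k IH] A [Ac Ad]; split => //.
- move=> x Ux; apply: (continuous_comp (g := fun M : 'M[R]_(m, n) => M i j)) (Ac _ Ux) _.
  exact: coord_continuous.
- move=> x Ux; apply: (continuous_comp (g := fun M : 'M[R]_(m, n) => M i j)) (Ac _ Ux) _.
  exact: coord_continuous.
- move=> v; have [dv Cv] := Ad v; split=> [x Ux|].
    by move/derivable_mxP: (dv _ Ux); exact.
  apply: Ck_ext (IH _ Cv) => // x Ux.
  by rewrite (derive_mx (dv _ Ux)) mxE.
Qed.

Lemma smooth_on_mx (V : normedModType R) m n (U : set V) (A : V -> 'M[R]_(m, n)) :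
  open U -> (forall i j, smooth_on U (fun y => A y i j)) -> smooth_on U A.
Proof.
move=> oU AS; apply/smooth_onP => k.
have {AS} AC i j : Ck k U (fun y => A y i j) by have /smooth_onP := AS i j; exact.
elim: k A AC => [|k IH] A AC.
  split => // x Ux; apply/cvgrPdist_le => e e0.
  have : \forall y \near x, forall ij : 'I_m * 'I_n, `|A x ij.1 ij.2 - A y ij.1 ij.2| <= e.
    apply: (@filter_forall _ _ (fun (ij : 'I_m * 'I_n) y =>
      `|A x ij.1 ij.2 - A y ij.1 ij.2| <= e) (nbhs x)) => -[i j].
    have [/(_ _ Ux) + _] := AC i j.
    by move/cvgrPdist_le/(_ _ e0).
  apply: filterS => y Ay; rewrite /Num.norm/= mx_normrE.
  by apply/bigmax_leP; split; [exact: ltW|move=> ij _; rewrite !mxE; exact: Ay].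
have A0 i j : Ck 0 U (fun y => A y i j) by have [] := AC i j.
split=> [x Ux|v].
  apply/cvgrPdist_le => e e0.
  have : \forall y \near x, forall ij : 'I_m * 'I_n, `|A x ij.1 ij.2 - A y ij.1 ij.2| <= e.
    apply: (@filter_forall _ _ (fun (ij : 'I_m * 'I_n) y =>
      `|A x ij.1 ij.2 - A y ij.1 ij.2| <= e) (nbhs x)) => -[i j].
    have [/(_ _ Ux) + _] := AC i j.
    by move/cvgrPdist_le/(_ _ e0).
  apply: filterS => y Ay; rewrite /Num.norm/= mx_normrE.
  by apply/bigmax_leP; split; [exact: ltW|move=> ij _; rewrite !mxE; exact: Ay].
have dA x : U x -> derivable A x v.
  by move=> Ux; apply/derivable_mxP => i j; have [_ /(_ v)[+ _]] := AC i j; exact.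
split => //; apply: IH => i j.
have [_ /(_ v)[_ Cv]] := AC i j.
by apply: Ck_ext Cv => // x Ux; rewrite (derive_mx (dA _ Ux)) mxE.
Qed.

(** The chain rule turns a derivative of [f \o tau] into products of derivatives of the coordinates
    of [tau] with ['D f \o tau], to which the induction applies because [f] is generalized. *)
Lemma smooth_on_compV (V : normedModType R) n (U : set V) (O : set 'rV[R]_n)
    (f : 'rV[R]_n -> R) (tau : V -> 'rV[R]_n) :
  open U -> open O -> smooth_on O f -> smooth_on U tau ->
  (forall x, U x -> O (tau x)) -> smooth_on U (fun y => f (tau y)).
Proof.
move=> oU oO fS tS UO; apply/smooth_onP => k.
elim: k f fS => [|k IH] f fS.
  split => // x Ux; apply: continuous_comp; first exact: smooth_on_cts Ux.
  by apply: smooth_on_cts fS _; exact: UO.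
split=> [x Ux|v].
  apply: continuous_comp; first exact: smooth_on_cts Ux.
  by apply: smooth_on_cts fS _; exact: UO.
have H x (Ux : U x) := smooth_is_derive_comp U oO fS (UO _ Ux) (smooth_on_derivable (v := v) tS Ux).
split=> [x Ux|]; first by have [] := H _ Ux.
apply: (@Ck_ext _ _ _ _ _ (fun x => \sum_a 'D_v (fun y => tau y 0 a) x * 'D_(delta_mx 0 a) f (tau x))) => //.
  by move=> x Ux; have [_ ->] := H _ Ux.
elim: (index_enum _) => [|a r IHr].
  by apply: (Ck_ext oU _ (Ck_cst k U (0 : R))) => x _; rewrite big_nil.
apply: (@Ck_ext _ _ _ _ _ (fun x => 'D_v (fun y => tau y 0 a) x * 'D_(delta_mx 0 a) f (tau x) +
  \sum_(a <- r) 'D_v (fun y => tau y 0 a) x * 'D_(delta_mx 0 a) f (tau x))) => //.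
  by move=> x _; rewrite big_cons.
apply: CkD => //; apply: CkM => //.
  by move: k {IH IHr}; apply/smooth_onP; apply: smooth_on_D; exact: smooth_on_coord.
by apply: (IH ('D_(delta_mx 0 a) f)); exact: smooth_on_D.
Qed.

Lemma derive_dir1 (f : R -> R) x u : differentiable f x -> 'D_u f x = u * 'D_1 f x.
Proof.
move=> df; rewrite (deriveE u df) (deriveE (1 : R) df) -[in LHS](mulr1 u).
by rewrite [LHS]linearZ.
Qed.

Lemma smooth_on_comp1 (V : normedModType R) (U : set V) (O : set R)
    (f : R -> R) (g : V -> R) :
  open U -> smooth_on O f -> smooth_on U g ->
  (forall x, U x -> O (g x)) -> smooth_on U (fun y => f (g y)).
Proof.
move=> oU fS gS UO; apply/smooth_onP => k.
elim: k f fS => [|k IH] f fS.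
  split => // x Ux; apply: continuous_comp; first exact: smooth_on_cts Ux.
  by apply: smooth_on_cts fS _; exact: UO.
split=> [x Ux|v].
  apply: continuous_comp; first exact: smooth_on_cts Ux.
  by apply: smooth_on_cts fS _; exact: UO.
have H x : U x -> is_derive x v (fun y => f (g y)) ('D_v g x * 'D_1 f (g x)).
  move=> Ux; have dg := smooth_on_derivable (v := v) gS Ux.
  have df : differentiable f (g x).
    by apply/derivable1_diffP; apply: smooth_on_derivable fS _; exact: UO.
  apply: is_derive_eq (is_derive_comp df dg) _.
  by rewrite derive_dir1.
split=> [x Ux|]; first by have [] := H _ Ux.
apply: (@Ck_ext _ _ _ _ _ (fun x => 'D_v g x * 'D_1 f (g x))) => //.
  by move=> x Ux; have [_ ->] := H _ Ux.
apply: CkM => //; last by apply: (IH ('D_1 f)); exact: smooth_on_D.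
by move: k {IH}; apply/smooth_onP; exact: smooth_on_D.
Qed.

Lemma smooth_on_powR1 (a : R) : smooth_on [set x : R | 0 < x] (fun x => x `^ a).
Proof.
have oP : open [set x : R | 0 < x] by exact: open_gt.
apply/smooth_onP => k; elim: k a => [|k IH] a.
  split => // x /= x0; apply/differentiable_continuous/derivable1_diffP.
  by have [] := is_derive1_powR a x0.
split=> [x /= x0|v].
  by apply/differentiable_continuous/derivable1_diffP; have [] := is_derive1_powR a x0.
have H (x : R) : 0 < x -> is_derive x v (fun y : R => y `^ a) (v * (a * x `^ (a - 1))).
  move=> x0; have [d e] := is_derive1_powR a x0.
  move/derivable1_diffP : (d) => df.
  apply: DeriveDef; first exact: diff_derivable.
  by rewrite derive_dir1// e.
split=> [x x0|]; first by have [] := H _ x0.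
apply: (@Ck_ext _ _ _ _ _ (fun x => v * (a * x `^ (a - 1)))) => //.
  by move=> x x0; have [_ ->] := H _ x0.
by apply: CkM => //; [exact: Ck_cst|apply: CkM => //; exact: Ck_cst].
Qed.

Lemma smooth_on_powR (V : normedModType R) (U : set V) (f : V -> R) (a : R) :
  open U -> smooth_on U f -> (forall x, U x -> 0 < f x) ->
  smooth_on U (fun x => f x `^ a).
Proof. by move=> oU fS f0; exact: smooth_on_comp1 (smooth_on_powR1 a) fS f0. Qed.

(** Powers are known to be smooth on positive numbers; a function of any sign is inverted as
    [f * (f * f)^-1]. *)
Lemma smooth_on_V (V : normedModType R) (U : set V) (f : V -> R) :
  open U -> smooth_on U f -> (forall x, U x -> f x != 0) ->
  smooth_on U (fun x => (f x)^-1).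
Proof.
move=> oU fS f0.
have S2 : smooth_on U (fun x => f x * (f x * f x) `^ (- 1)).
  apply: smooth_onM; [exact: oU|exact: fS|].
  apply: smooth_on_powR; [exact: oU|exact: smooth_onM|].
  by move=> x Ux; rewrite -expr2 exprn_even_gt0//= f0.
apply: (smooth_on_ext oU _ S2) => x Ux.
by rewrite powR_inv1 -?expr2 ?sqr_ge0// expr2 invfM mulrA divff ?mul1r// f0.
Qed.

Lemma smooth_on_sqrt (V : normedModType R) (U : set V) (f : V -> R) :
  open U -> smooth_on U f -> (forall x, U x -> 0 < f x) ->
  smooth_on U (fun x => Num.sqrt (f x)).
Proof.
move=> oU fS f0; apply: (smooth_on_ext oU _ (smooth_on_powR 2^-1 oU fS f0)) => x Ux.
by rewrite powR12_sqrt// ltW// f0.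
Qed.

End composition.

(** * Maximum principle and positive definite matrices *)

Section maxima.
Context {R : realType}.

Lemma derive_quotient (G : R -> R) (s d e : R) : is_derive s 1 G d -> 0 < e ->
  exists2 del, 0 < del & forall h, h != 0 -> `|h| < del ->
    `|d - (G (h + s) - G s) / h| <= e.
Proof.
move=> [dG dE] e0; move: dG; rewrite /derivable => dG.
have : h^-1 *: ((G \o shift s) (h *: 1) - G s) @[h --> 0^'] --> d by rewrite -dE.
move/cvgrPdist_le/(_ _ e0) => /=; rewrite near_withinE.
move=> /nbhs_ballP[del /= del0 D]; exists del => // h h0 hd.
have := D h; rewrite -ball_normE/= sub0r normrN => /(_ hd h0).
by rewrite [h%:A]mulr1 -[_ *: _]/(_ * _) mulrC.
Qed.

Lemma derive_left_max_ge0 (G : R -> R) (a s d : R) : a < s -> is_derive s 1 G d ->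
  (forall t, a <= t <= s -> G t <= G s) -> 0 <= d.
Proof.
move=> as_ dG Gm; rewrite leNgt; apply/negP => d0.
have e0 : 0 < - d / 2 by lra.
have [del del0 D] := derive_quotient dG e0.
pose h := - Num.min (s - a) (del / 2).
have m0 : 0 < Num.min (s - a) (del / 2) by rewrite lt_min; apply/andP; split; lra.
have h0 : h < 0 by rewrite oppr_lt0.
have h1 : `|h| < del by rewrite ltr0_norm// opprK gt_min; apply/orP; right; lra.
have ha : s - a >= - h by rewrite opprK ge_min lexx.
have := D h; rewrite lt_eqF// => /(_ isT h1); rewrite ler_norml => /andP[D1 _].
have q0 : 0 <= (G (h + s) - G s) / h.
  by rewrite ler_ndivlMr// mul0r subr_le0; apply: Gm; apply/andP; split; lra.
lra.
Qed.

(** If [g2] were positive, [G1] would be positive just to the right of [0], and the mean value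
    theorem would give values of [G] above [G 0]. *)
Lemma second_derivative_max (G G1 : R -> R) (g2 e : R) : 0 < e ->
  (forall s : R, `|s| < e -> is_derive s 1 G (G1 s)) ->
  (forall s : R, `|s| < e -> G s <= G 0) ->
  is_derive (0 : R) 1 G1 g2 -> G1 0 = 0 /\ g2 <= 0.
Proof.
move=> e0 dG Gm dG1.
have d0 : is_derive (0 : R) 1 G (G1 0) by apply: dG; rewrite normr0.
have G10 : G1 0 = 0.
  have E : is_derive (0 : R) 1 G 0.
    apply: (@derive1_at_max _ G (- e) e).
    - lra.
    - by move=> t; rewrite in_itv/= -ltr_norml => /dG[].
    - by rewrite in_itv/= oppr_lt0 e0.
    - by move=> t; rewrite in_itv/= -ltr_norml => /Gm.
  by case: d0 => _ <-; case: E.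
split => //; rewrite leNgt; apply/negP => g0.
have g20 : 0 < g2 / 2 by lra.
have [del del0 D] := derive_quotient dG1 g20.
pose h := Num.min (e / 2) (del / 2).
have h0 : 0 < h by rewrite lt_min; apply/andP; split; lra.
have he : h < e by rewrite gt_min; apply/orP; left; lra.
have hd : h < del by rewrite gt_min; apply/orP; right; lra.
have [||c] := @MVT R G G1 0 h h0.
- by move=> x; rewrite in_itv/= => /andP[x0 xh]; apply: dG; rewrite gtr0_norm//; lra.
- apply: derivable_within_continuous => x; rewrite in_itv/= => /andP[x0 xh].
  by have [] : is_derive x 1 G (G1 x) by apply: dG; rewrite ger0_norm//; lra.
rewrite in_itv/= subr0 => /andP[c0 ch] E.
have : G h <= G 0 by apply: Gm; rewrite gtr0_norm.
have := D c; rewrite gt_eqF// gtr0_norm// => /(_ isT (lt_trans ch hd)).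
rewrite addr0 G10 subr0 ler_norml => /andP[_ Dc] Gh.
have q0 : 0 < G1 c / c by lra.
have : 0 < G1 c by move: q0; rewrite pmulr_lgt0// invr_gt0.
move=> G1c; have : 0 < G1 c * h by rewrite mulr_gt0.
by lra.
Qed.

Lemma line_ball (V : normedModType R) (x v : V) (P : V -> Prop) :
  (\forall y \near x, P y) -> exists2 e : R, 0 < e & forall s : R, `|s| < e -> P (s *: v + x).
Proof.
move=> /nbhs_ballP[d /= d0 D]; exists (d / (`|v| + 1)).
  by rewrite divr_gt0// ltr_wpDl.
move=> s sd; apply: D; rewrite -ball_normE/= opprD addrCA subrr addr0 normrN normrZ.
have v1 : 0 < `|v| + 1 by rewrite ltr_wpDl.
apply: le_lt_trans (_ : `|s| * (`|v| + 1) < d); first by rewrite ler_wpM2l// lerDl.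
by rewrite -ltr_pdivlMr.
Qed.

Lemma smooth_line_derive (V : normedModType R) (U : set V) (f : V -> R) x v s :
  smooth_on U f -> U (s *: v + x) ->
  is_derive s 1 (fun s : R => f (s *: v + x)) ('D_v f (s *: v + x)).
Proof. by move=> fS Us; apply: is_derive_line; exact: smooth_on_derivable Us. Qed.

Lemma smooth_local_max (V : normedModType R) (U : set V) (f : V -> R) x v :
  open U -> smooth_on U f -> U x -> (\forall y \near x, f y <= f x) ->
  'D_v f x = 0 /\ 'D_v ('D_v f) x <= 0.
Proof.
move=> oU fS Ux fm.
have nU : \forall y \near x, U y by apply: (open_near oU Ux).
have [e e0 E] := line_ball v (filterI fm nU).
have x0 : 0 *: v + x = x by rewrite scale0r add0r.
have := @second_derivative_max (fun s : R => f (s *: v + x))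
  (fun s : R => 'D_v f (s *: v + x)) ('D_v ('D_v f) x) e e0.
rewrite x0; apply.
- by move=> s se; apply: (smooth_line_derive fS); have [] := E s se.
- by move=> s se; have [] := E s se.
- rewrite -[X in is_derive _ _ _ ('D_v ('D_v f) X)]x0.
  by apply: smooth_line_derive (smooth_on_D v fS) _; rewrite x0.
Qed.

(** Multiplication by [expR (- (C + 1) t)] makes the time derivative strictly negative at a positive
    spatial maximum, so a positive maximum over the compact cylinder cannot occur after [t0]. The
    differential inequality is only asked at positive spatial maxima, since this is where
    second-order operators have a sign. *)
Lemma max_principle (X : topologicalType) (K : set X) (f : R -> X -> R) (t0 t1 C : R) :
  compact K ->
  {within `[t0, t1]%classic `*` K, continuous (fun z : R * X => f z.1 z.2)} ->
  (forall x, K x -> f t0 x <= 0) ->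
  (forall t x, t0 < t <= t1 -> K x -> 0 < f t x -> (forall y, K y -> f t y <= f t x) ->
    exists2 d, is_derive t 1 (f^~ x) d & d <= C * f t x) ->
  forall t x, t0 <= t <= t1 -> K x -> f t x <= 0.
Proof.
move=> cK fc f0 fd t x tt Kx; rewrite leNgt; apply/negP => ftx.
pose E (s : R) := expR (- (C + 1) * s).
pose g (z : R * X) := E z.1 * f z.1 z.2.
have Ec : continuous (fun z : R * X => E z.1).
  move=> z; apply: (@continuous_comp _ _ _ fst E); first exact: cvg_fst.
  apply: continuous_comp; last exact: continuous_expR.
  exact: mulrl_continuous.
have gc : {within `[t0, t1]%classic `*` K, continuous g}.
  move=> z; apply: cvgM; last exact: fc.
  by have /(_ z) := continuous_subspaceT (A := `[t0, t1]%classic `*` K) Ec.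
have [|[s y]] := compact_EVT_max _ (compact_setX (@segment_compact _ t0 t1) cK) gc.
  by exists (t, x); split => //=; rewrite in_itv.
rewrite inE => -[/= + Ky] gm; rewrite in_itv/= => /andP[ts st].
have E0 r : 0 < E r by exact: expR_gt0.
have gs : 0 < g (s, y).
  apply: (@lt_le_trans _ _ (g (t, x))); first by rewrite mulr_gt0.
  by apply: gm; rewrite inE; split => //=; rewrite in_itv.
have fs : 0 < f s y by move: gs; rewrite /g /= pmulr_rgt0.
have ts' : t0 < s.
  by rewrite lt_neqAle ts andbT; apply/eqP => e; move: fs; rewrite -e ltNge f0.
have [|z Kz|d dd dC] := fd s y _ Ky fs; first by rewrite ts' st.
  have := gm (s, z); rewrite /g/= ler_pM2l//; apply.
  by rewrite inE; split => //=; rewrite in_itv/= ts st.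
have dE : is_derive s 1 E (- (C + 1) * E s).
  have H : is_derive s 1 (fun r : R => - (C + 1) * r) (- (C + 1)).
    by rewrite -[X in is_derive _ _ _ X]mulr1; exact: is_deriveZ.
  rewrite mulrC; exact: (is_derive1_comp (is_derive_expR _) H).
have dg : is_derive s 1 (fun r => E r * f r y) (E s *: d + f s y *: (- (C + 1) * E s)).
  exact: is_deriveM.
(* The maximum may occur at the final time, so the comparison is with earlier times only. *)
have : 0 <= E s *: d + f s y *: (- (C + 1) * E s).
  apply: derive_left_max_ge0 ts' dg _ => r /andP[r0 r1].
  apply: (gm (r, y)); rewrite inE; split => //=.
  by rewrite in_itv/= r0 (le_trans r1).
have -> : E s *: d + f s y *: (- (C + 1) * E s) = E s * (d - (C + 1) * f s y).
  by rewrite -![_ *: _]/(_ * _); ring.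
by rewrite pmulr_rge0//; lra.
Qed.

End maxima.

(** * Positive definite matrices *)

Section posdef.
Context {R : realType}.

Lemma quadE n (A : 'M[R]_n) (u v : 'rV[R]_n) :
  (u *m A *m v^T) 0 0 = \sum_i \sum_j A i j * u 0 i * v 0 j.
Proof.
rewrite mxE exchange_big/=; apply: eq_bigr => j _; rewrite !mxE big_distrl/=.
by apply: eq_bigr => i _; rewrite (mulrC (u 0 i)).
Qed.

(** Induction on the dimension through the Schur complement [C'] of the corner entry [a]. It is
    positive definite because its form at [w] is that of [A] at [row_mx x w], where [x] minimizes
    over the first coordinate and thus kills the first block. *)
Lemma posdef_cholesky n (A : 'M[R]_n) : is_posdef A -> exists S : 'M[R]_n, A = S^T *m S.
Proof.
elim: n A => [|n IH] A; first by exists A; apply/matrixP => -[].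
rewrite -[n.+1]/(1 + n)%N in A *; move=> [As Ap].
pose a := A 0 0; pose b := ursubmx A; pose C := drsubmx A.
have A0 : ulsubmx A = a%:M.
  apply/matrixP => i j; rewrite !ord1 !mxE eqxx mulr1n; congr (A _ _); exact: val_inj.
have dl : dlsubmx A = b^T by rewrite -[in LHS]As -trmx_ursub.
have Cs : C^T = C by rewrite /C trmx_drsub As.
have AE : A = block_mx a%:M b b^T C by rewrite -[LHS]submxK A0 dl.
have a0 : 0 < a.
  have e0 : (row_mx 1%:M 0 : 'rV[R]_(1 + n)) != 0.
    apply/eqP => /(congr1 lsubmx); rewrite row_mxKl linear0 => /matrixP/(_ 0 0)/eqP.
    by rewrite !mxE/= oner_eq0.
  have := Ap _ e0; rewrite AE mul_row_block tr_row_mx mul_row_col !mul1mx !mul0mx !addr0.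
  by rewrite trmx0 mulmx0 addr0 tr_scalar_mx mulmx1 !mxE eqxx mulr1n.
pose C' := C - a^-1 *: (b^T *m b).
have [|S' S'E] := IH C'.
  split; first by rewrite /C' linearB linearZ /= trmx_mul trmxK Cs.
  move=> w w0; pose x : 'M[R]_1 := - (a^-1 *: (w *m b^T)).
  have v0 : (row_mx x w : 'rV[R]_(1 + n)) != 0.
    by apply: contra w0 => /eqP/(congr1 rsubmx); rewrite row_mxKr linear0 => ->.
  have := Ap _ v0; rewrite AE mul_row_block tr_row_mx mul_row_col.
  have -> : x *m a%:M + w *m b^T = 0.
    by rewrite mul_mx_scalar /x scalerN scalerA divff ?gt_eqF// scale1r addNr.
  rewrite mul0mx add0r; suff -> : x *m b + w *m C = w *m C' by [].
  by rewrite /x /C' mulmxBr mulNmx -scalemxAl -scalemxAr mulmxA addrC.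
have s0 : Num.sqrt a != 0 by rewrite gt_eqF// sqrtr_gt0.
have ss : Num.sqrt a * Num.sqrt a = a by rewrite -expr2 sqr_sqrtr// ltW.
exists (block_mx (Num.sqrt a)%:M ((Num.sqrt a)^-1 *: b) 0 S').
rewrite tr_block_mx mulmx_block !trmx0 !mul0mx !mulmx0 !addr0 tr_scalar_mx -scalar_mxM ss.
rewrite mul_scalar_mx scalerA divff// scale1r mul_mx_scalar linearZ /= scalerA divff// scale1r.
rewrite -scalemxAl -scalemxAr scalerA -invfM ss -S'E /C' [X in block_mx _ _ _ X]addrC subrK.
exact: AE.
Qed.

Lemma posdef_unit n (A : 'M[R]_n) : is_posdef A -> A \in unitmx.
Proof.
move=> [_ Ap]; rewrite -row_free_unit -kermx_eq0; apply/negPn/negP => k0.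
have [v vk v0] := rowV0Pn k0.
by have := Ap v v0; rewrite (sub_kermxP vk) mul0mx mxE ltxx.
Qed.

Lemma posdef_det_gt0 n (A : 'M[R]_n) : is_posdef A -> 0 < \det A.
Proof.
move=> pA; have := posdef_unit pA; have [S ->] := posdef_cholesky pA.
rewrite unitmxE unitfE det_mulmx det_tr => d0.
by rewrite lt_neqAle eq_sym d0 -expr2 sqr_ge0.
Qed.

Lemma posdef_inv n (A : 'M[R]_n) : is_posdef A -> is_posdef (invmx A).
Proof.
move=> pA; have uA := posdef_unit pA; have [As Ap] := pA.
split; first by rewrite trmx_inv As.
move=> v v0; have w0 : v *m invmx A != 0.
  by apply: contra v0 => /eqP E; rewrite -[v](mulmxKV uA) E mul0mx.
by have := Ap _ w0; rewrite mulmxKV// trmx_mul trmx_inv As mulmxA.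
Qed.

(** The quadratic form attains a positive minimum on the product of [K] with the unit sphere;
    homogeneity extends the bound to all vectors. *)
Lemma posdef_uniform (X : topologicalType) (K : set X) n (A : X -> 'M[R]_n) :
  compact K -> (forall x i j, K x -> {for x, continuous (fun y => A y i j)}) ->
  (forall x, K x -> is_posdef (A x)) ->
  exists2 d : R, 0 < d & forall x (v : 'rV[R]_n), K x ->
    d * \sum_i v 0 i ^+ 2 <= (v *m A x *m v^T) 0 0.
Proof.
move=> cK cA pA.
pose S := [set v : 'rV[R]_n | `|v| = 1].
have cS : compact S.
  apply: bounded_closed_compact.
    by exists 1; split => // y y1 v /= ->; exact: ltW.
  rewrite (_ : S = (fun v : 'rV[R]_n => `|v|) @^-1` [set 1])//.
  apply: closed_comp; last exact: closed_eq.
  by move=> v _; exact: norm_continuous.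
(* The product is empty when [K] is empty or the dimension is [0]; any constant does then. *)
have [/set0P[[x0 v0] /= xv0]|/negP/negPn/eqP E] := pselect (K `*` S != set0); last first.
  exists 1 => // x v Kx; have [->|v0] := eqVneq v 0.
    by rewrite !mul0mx mxE big1 ?mulr0// => i _; rewrite mxE expr0n.
  have : (K `*` S) (x, `|v|^-1 *: v).
    by split => //=; rewrite /S/= normrZ normfV normr_id mulVf// normr_eq0.
  by rewrite E.
pose q (z : X * 'rV[R]_n) := \sum_i \sum_j A z.1 i j * z.2 0 i * z.2 0 j.
have qc : {within K `*` S, continuous q}.
  apply: continuous_in_subspaceT => -[x v]; rewrite inE => -[/= Kx _].
  apply: (cvg_bigsum (F := nbhs (x, v))) => i; apply: (cvg_bigsum (F := nbhs (x, v))) => j.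
  apply: cvgM; first (apply: cvgM).
  - apply: (@continuous_comp _ _ _ fst (fun y => A y i j)); first exact: cvg_fst.
    exact: cA.
  - apply: (@continuous_comp _ _ _ snd (fun v : 'rV[R]_n => v 0 i)); first exact: cvg_snd.
    exact: coord_continuous.
  - apply: (@continuous_comp _ _ _ snd (fun v : 'rV[R]_n => v 0 j)); first exact: cvg_snd.
    exact: coord_continuous.
have [|[x v]] := compact_EVT_min _ (compact_setX cK cS) qc; first by exists (x0, v0).
rewrite inE => -[/= Kx Sv] qm.
have v1 : v != 0 by rewrite -normr_eq0 Sv oner_eq0.
have m0 : 0 < q (x, v) by rewrite /q/= -quadE; have [_] := pA _ Kx; exact.
(* The sphere is that of the sup norm, and the sum of the squares of [n] coordinates is at most [n]
   times the square of this norm. *)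
exists (q (x, v) / (n%:R + 1)); first by rewrite divr_gt0// ltr_wpDl.
move=> y w Ky; have [->|w0] := eqVneq w 0.
  by rewrite !mul0mx mxE big1 ?mulr0// => i _; rewrite mxE expr0n.
have nw : 0 < `|w| by rewrite normr_gt0.
have := qm (y, `|w|^-1 *: w); rewrite inE => /(_ _)/wrap[].
  by split => //=; rewrite /S/= normrZ normfV normr_id mulVf// normr_eq0.
rewrite [X in _ <= X]/q/= => qw.
have -> : (w *m A y *m w^T) 0 0 = `|w| ^+ 2 *
    \sum_i \sum_j A y i j * (`|w|^-1 *: w) 0 i * (`|w|^-1 *: w) 0 j.
  rewrite quadE big_distrr/=; apply: eq_bigr => i _; rewrite big_distrr/=.
  by apply: eq_bigr => j _; rewrite !mxE; field; rewrite gt_eqF.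
have le1 : \sum_i w 0 i ^+ 2 <= (n%:R + 1) * `|w| ^+ 2.
  apply: (@le_trans _ _ (\sum_(i < n) `|w| ^+ 2)).
    apply: ler_sum => i _; rewrite -[w 0 i ^+ 2]ger0_norm ?sqr_ge0// normrX.
    by rewrite lerXn2r ?nnegrE//; exact: ler_norm_coord.
  by rewrite sumr_const card_ord -[leLHS]mulr_natl ler_wpM2r ?sqr_ge0// lerDl.
apply: (@le_trans _ _ (q (x, v) * `|w| ^+ 2)).
  by rewrite -mulrA ler_wpM2l ?(ltW m0)// ler_pdivrMl// ltr_wpDl.
by rewrite mulrC ler_wpM2l// sqr_ge0.
Qed.

End posdef.

(** * Charts and the Laplacian *)

Section smooth_matrix.
Context {R : realType} {V : normedModType R}.

Lemma smooth_on_det n (U : set V) (A : V -> 'M[R]_n) : open U ->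
  (forall i j, smooth_on U (fun y => A y i j)) -> smooth_on U (fun y => \det (A y)).
Proof.
move=> oU AS; rewrite /determinant.
apply: (smooth_on_sum _ oU) => s; apply: (smooth_onM oU); first exact: smooth_on_cst.
by apply: (smooth_on_prod _ oU) => i; exact: AS.
Qed.

Lemma smooth_on_inv n (U : set V) (A : V -> 'M[R]_n) i j : open U ->
  (forall i j, smooth_on U (fun y => A y i j)) -> (forall y, U y -> A y \in unitmx) ->
  smooth_on U (fun y => invmx (A y) i j).
Proof.
move=> oU AS uA.
have dS := smooth_on_det oU AS.
have cS : smooth_on U (fun y => cofactor (A y) j i).
  rewrite /cofactor; apply: (smooth_onM oU); first exact: smooth_on_cst.
  apply: (smooth_on_det oU) => a b.
  by apply: (smooth_on_ext oU _ (AS (lift j a) (lift i b))) => y _; rewrite !mxE.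
have dV : smooth_on U (fun y => (\det (A y))^-1).
  by apply: (smooth_on_V oU dS) => y Uy; rewrite -unitfE -unitmxE uA.
apply: (smooth_on_ext oU _ (smooth_onM oU dV cS)) => y Uy.
by rewrite /invmx uA// !mxE.
Qed.

Lemma is_derive_bigsum I (r : seq I) (f : I -> V -> R) (df : I -> R) z v :
  (forall i, is_derive z v (f i) (df i)) ->
  is_derive z v (fun y => \sum_(i <- r) f i y) (\sum_(i <- r) df i).
Proof.
move=> fd; elim: r => [|i r IH].
  rewrite big_nil (_ : (fun y => _) = cst 0); first exact: is_derive_cst.
  by apply/funext => y; rewrite big_nil.
rewrite big_cons (_ : (fun y => _) = (f i + (fun y => \sum_(i <- r) f i y))).
  exact: is_deriveD.
by apply/funext => y; rewrite big_cons.
Qed.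

End smooth_matrix.

Section charts.
Context {R : realType} {n : nat} (M : manifold R n).
Implicit Types (i j : chart M) (x : M) (y : 'rV[R]_n).

Lemma img_phi i x : dom i x -> img i (phi i x).
Proof. by move=> dx; exists x. Qed.

Lemma dom_phiV i y : img i y -> dom i (phiV i y).
Proof. by move=> [x dx <-]; rewrite phiK. Qed.

Lemma phiVK i y : img i y -> phi i (phiV i y) = y.
Proof. by move=> [x dx <-]; rewrite phiK. Qed.

Lemma open_img i : open (img i).
Proof. exact: img_open. Qed.

Lemma dom_nbhs i x : dom i x -> nbhs x (dom i).
Proof. by move=> dx; apply: open_nbhs_nbhs; split => //; exact: dom_open. Qed.

Lemma img_nbhs i y : img i y -> nbhs y (img i).
Proof. by move=> dx; apply: open_nbhs_nbhs; split => //; exact: open_img. Qed.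

Lemma phi_cts i x : dom i x -> {for x, continuous (phi i)}.
Proof.
move=> dx; have := phi_continuous (i := i).
by rewrite continuous_open_subspace; [apply; rewrite inE|exact: dom_open].
Qed.

Lemma phiV_cts i y : img i y -> {for y, continuous (phiV i)}.
Proof.
move=> dx; have := phiV_continuous (i := i).
by rewrite continuous_open_subspace; [apply; rewrite inE|exact: img_open].
Qed.

Lemma chart_atP x : dom (chart_at x) x.
Proof. by rewrite /chart_at; case: cid. Qed.

Definition overlap i j : set 'rV[R]_n := phi i @` (dom i `&` dom j).

Lemma overlapP i j y : overlap i j y <-> img i y /\ dom j (phiV i y).
Proof.
split=> [[x [dx dj] <-]|[iy dj]]; first by rewrite phiK//; split => //; exact: img_phi.
by exists (phiV i y); [split => //; exact: dom_phiV|exact: phiVK].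
Qed.

Lemma open_overlap i j : open (overlap i j).
Proof.
rewrite openE => y /overlapP[iy dj]; rewrite /interior.
have := phiV_cts iy (dom_nbhs dj); rewrite /= => N.
apply: (@filterS _ (nbhs y) _ _ _ _ (filterI (img_nbhs iy) N)) => z [/= iz dz].
by apply/overlapP.
Qed.

Lemma continuous_from_charts (T : topologicalType) (f : M -> T) :
  (forall i y, img i y -> {for y, continuous (f \o phiV i)}) -> continuous f.
Proof.
move=> fc x; have dx := chart_atP x; set i := chart_at x in dx.
have c := continuous_comp (phi_cts dx) (fc _ _ (img_phi dx)).
have E : {near x, (f \o phiV i) \o phi i =1 f}.
  by apply: filterS (dom_nbhs dx) => z dz /=; rewrite phiK.
rewrite /continuous_at -[f x](_ : ((f \o phiV i) \o phi i) x = _); last by rewrite /= phiK.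
by apply: cvg_trans c; apply: near_eq_cvg; apply: filterS E => z ->.
Qed.

Lemma smooth_fun_continuous (f : M -> R) : smooth_fun f -> continuous f.
Proof.
by move=> fS; apply: continuous_from_charts => i y iy; exact: smooth_on_cts (fS i) iy.
Qed.

Lemma smooth_on_local (V W : normedModType R) (U : set V) (f : V -> W) :
  (forall z, U z -> exists2 O, open O /\ O z & smooth_on O f) -> smooth_on U f.
Proof.
by move=> H s z Uz; have [Q [oO Oz] fS] := H z Uz; exact: fS.
Qed.

(** The smooth transition maps carry smoothness from one chart around a point to all the others; the
    open sets leave room for functions known on a part of a chart only. *)
Lemma smooth_fun_local (f : M -> R) :
  (forall x, exists2 j, dom j x & exists2 O : set 'rV[R]_n, open O /\ O (phi j x) &
    smooth_on O (f \o phiV j)) -> smooth_fun f.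
Proof.
move=> H i; apply: smooth_on_local => y iy.
have [j dj [Q [oO Oy] fS]] := H (phiV i y).
have ov : overlap i j y by apply/overlapP.
exists (overlap i j `&` (phi j \o phiV i) @^-1` Q); first split.
- rewrite openE => z [oz Oz]; rewrite /interior; apply: filterI.
    exact: open_nbhs_nbhs (conj (@open_overlap i j) oz).
  have c : {for z, continuous (phi j \o phiV i)}.
    by apply: smooth_on_cts (@transition_smooth R n M i j) oz.
  exact: (c _ (open_nbhs_nbhs (conj oO Oz))).
- by split.
set U := _ `&` _.
have oU : open U.
  rewrite openE => z [oz Oz]; rewrite /interior; apply: filterI.
    exact: open_nbhs_nbhs (conj (@open_overlap i j) oz).
  have c : {for z, continuous (phi j \o phiV i)}.
    by apply: smooth_on_cts (@transition_smooth R n M i j) oz.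
  exact: (c _ (open_nbhs_nbhs (conj oO Oz))).
have tS : smooth_on U (phi j \o phiV i).
  by apply: smooth_onS (@transition_smooth R n M i j) => z [].
have UO z : U z -> Q ((phi j \o phiV i) z) by case.
apply: (smooth_on_ext oU _ (smooth_on_compV oU oO fS tS UO)) => z [/overlapP[iz dz] _] /=.
by rewrite phiK.
Qed.

End charts.

Section laplace.
Context {R : realType} {n : nat} {M : manifold R n} (g : metric M).
Implicit Types (i j : chart M) (x : M) (y : 'rV[R]_n) (h k : 'rV[R]_n -> R).
Local Notation E a := (delta_mx 0 a : 'rV[R]_n).

Definition ginv i y := invmx (gmx g i y).

Definition flux i h y (a : 'I_n) : R :=
  sqrtdet g i y * \sum_b 'D_(E b) h y * ginv i y b a.

Definition lap i h y : R :=
  (sqrtdet g i y)^-1 * \sum_a 'D_(E a) (fun z => flux i h z a) y.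

(** The first-order coefficients of the Laplacian once its divergence form is expanded, as in
    [lapE]. *)
Definition drift i y (b : 'I_n) : R :=
  (sqrtdet g i y)^-1 * \sum_a 'D_(E a) (fun z => sqrtdet g i z * ginv i z b a) y.

Definition gam i h k y : R := \sum_a \sum_b ginv i y a b * 'D_(E a) h y * 'D_(E b) k y.

Lemma laplacian_lap (f : M -> R) x :
  laplacian g f x = lap (chart_at x) (f \o phiV (chart_at x)) (phi (chart_at x) x).
Proof.
rewrite /laplacian /lap; congr (_ * _); apply: eq_bigr => a _.
congr ('D_(E a) _ _); apply/funext => z; rewrite !mxE /flux; congr (_ * _).
by apply: eq_bigr => b _; rewrite !mxE.
Qed.

Lemma grad2_gam (f : M -> R) x :
  grad2 g f x = gam (chart_at x) (f \o phiV (chart_at x)) (f \o phiV (chart_at x))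
    (phi (chart_at x) x).
Proof.
rewrite /grad2 quadE /gam; apply: eq_bigr => a _; apply: eq_bigr => b _.
by rewrite !mxE.
Qed.

Lemma ginv_smooth i a b : smooth_on (img i) (fun y => ginv i y a b).
Proof.
apply: smooth_on_inv; first exact: open_img.
- by move=> c d; apply: smooth_on_coord; [exact: open_img|exact: gmx_smooth].
- by move=> y iy; apply: posdef_unit; exact: gmx_posdef.
Qed.

Lemma ginv_posdef i y : img i y -> is_posdef (ginv i y).
Proof. by move=> iy; apply: posdef_inv; exact: gmx_posdef. Qed.

Lemma ginv_sym i y a b : img i y -> ginv i y a b = ginv i y b a.
Proof. by move=> /ginv_posdef[s _]; rewrite -[in LHS]s mxE. Qed.

Lemma sqrtdet_gt0 i y : img i y -> 0 < sqrtdet g i y.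
Proof. by move=> iy; rewrite sqrtr_gt0; apply: posdef_det_gt0; exact: gmx_posdef. Qed.

Lemma sqrtdet_smooth i : smooth_on (img i) (sqrtdet g i).
Proof.
apply: smooth_on_sqrt; first exact: open_img.
- apply: smooth_on_det; first exact: open_img.
  by move=> c d; apply: smooth_on_coord; [exact: open_img|exact: gmx_smooth].
- by move=> y iy; apply: posdef_det_gt0; exact: gmx_posdef.
Qed.

Lemma sqrtdetV_smooth i : smooth_on (img i) (fun y => (sqrtdet g i y)^-1).
Proof.
apply: smooth_on_V; [exact: open_img|exact: sqrtdet_smooth|].
by move=> y iy; rewrite gt_eqF// sqrtdet_gt0.
Qed.

Lemma flux_smooth i h a (U : set 'rV[R]_n) : open U -> U `<=` img i -> smooth_on U h ->
  smooth_on U (fun y => flux i h y a).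
Proof.
move=> oU Ui hS; apply: (smooth_onM oU); first exact: smooth_onS (@sqrtdet_smooth i).
apply: (smooth_on_sum _ oU) => b; apply: (smooth_onM oU); first exact: smooth_on_D.
exact: smooth_onS (@ginv_smooth i b a).
Qed.

Lemma lap_smooth i h (U : set 'rV[R]_n) : open U -> U `<=` img i -> smooth_on U h ->
  smooth_on U (lap i h).
Proof.
move=> oU Ui hS; apply: (smooth_onM oU); first exact: smooth_onS (@sqrtdetV_smooth i).
apply: (smooth_on_sum _ oU) => a; apply: smooth_on_D; exact: flux_smooth.
Qed.

Lemma drift_smooth i b : smooth_on (img i) (fun y => drift i y b).
Proof.
have oU := @open_img _ _ M i.
apply: (smooth_onM oU); first exact: sqrtdetV_smooth.
apply: (smooth_on_sum _ oU) => a; apply: smooth_on_D; apply: (smooth_onM oU).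
  exact: sqrtdet_smooth.
exact: ginv_smooth.
Qed.

Lemma lapE i h y (U : set 'rV[R]_n) : open U -> U `<=` img i -> smooth_on U h -> U y ->
  lap i h y = \sum_a \sum_b ginv i y a b * 'D_(E a) ('D_(E b) h) y +
    \sum_b drift i y b * 'D_(E b) h y.
Proof.
move=> oU Ui hS Uy; have iy := Ui _ Uy.
have s0 := sqrtdet_gt0 iy.
have D a : 'D_(E a) (fun z => flux i h z a) y =
    \sum_b ('D_(E b) h y * 'D_(E a) (fun z => sqrtdet g i z * ginv i z b a) y +
      sqrtdet g i y * ginv i y b a * 'D_(E a) ('D_(E b) h) y).
  have -> : (fun z => flux i h z a) =
      (fun z => \sum_b ('D_(E b) h z * (sqrtdet g i z * ginv i z b a))).
    apply/funext => z; rewrite /flux big_distrr/=; apply: eq_bigr => b _.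
    by rewrite mulrCA.
  have [] := @is_derive_bigsum _ _ _ (index_enum 'I_n)
    (fun b z => 'D_(E b) h z * (sqrtdet g i z * ginv i z b a))
    (fun b => 'D_(E b) h y * 'D_(E a) (fun z => sqrtdet g i z * ginv i z b a) y +
      sqrtdet g i y * ginv i y b a * 'D_(E a) ('D_(E b) h) y) y (E a); last by [].
  move=> b.
  have d1 : derivable ('D_(E b) h) y (E a).
    by apply: smooth_on_derivable (smooth_on_D (E b) hS) Uy.
  have d2 : derivable (fun z => sqrtdet g i z * ginv i z b a) y (E a).
    apply: smooth_on_derivable iy; apply: smooth_onM; first exact: open_img.
      exact: sqrtdet_smooth.
    exact: ginv_smooth.
  have := is_deriveM (derivableP d1) (derivableP d2).
  by move=> H; exact: H.
rewrite /lap (eq_bigr _ (fun a _ => D a)).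
under eq_bigr do rewrite big_split/=.
rewrite big_split/= mulrDr addrC; congr (_ + _).
  rewrite big_distrr/=; apply: eq_bigr => a _; rewrite big_distrr/=; apply: eq_bigr => b _.
  by rewrite (ginv_sym a b iy) !mulrA mulVf ?mul1r// gt_eqF.
rewrite exchange_big/= big_distrr/=; apply: eq_bigr => b _.
by rewrite /drift -mulrA big_distrl/=; congr (_ * _); apply: eq_bigr => a _; rewrite mulrC.
Qed.

(** A factorization of the coefficients turns the operator into a sum of pure second derivatives
    along the rows of [S], each of which has a sign at an extremum. *)
Lemma hess_cholesky (U : set 'rV[R]_n) h y (A S : 'M[R]_n) :
  open U -> smooth_on U h -> U y -> A = S^T *m S ->
  \sum_a \sum_b A a b * 'D_(E a) ('D_(E b) h) y =
  \sum_c 'D_(row c S) ('D_(row c S) h) y.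
Proof.
move=> oU hS Uy AE.
have alg (H : 'I_n -> 'I_n -> R) : \sum_a \sum_b A a b * H a b =
    \sum_c \sum_a \sum_b S c a * S c b * H a b.
  rewrite [RHS]exchange_big/=; apply: eq_bigr => a _.
  rewrite [RHS]exchange_big/=; apply: eq_bigr => b _.
  by rewrite AE mxE big_distrl/=; apply: eq_bigr => c _; rewrite mxE.
have D c : 'D_(row c S) ('D_(row c S) h) y =
    \sum_a \sum_b S c a * S c b * 'D_(E a) ('D_(E b) h) y.
  rewrite (smooth_derive _ oU (smooth_on_D _ hS) Uy); apply: eq_bigr => a _.
  rewrite mxE -[RHS](_ : S c a * (\sum_b S c b * 'D_(E a) ('D_(E b) h) y) = _); last first.
    by rewrite big_distrr/=; apply: eq_bigr => b _; rewrite mulrA.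
  congr (_ * _).
  have ev : {near y, 'D_(row c S) h =1 (fun z => \sum_b S c b * 'D_(E b) h z)}.
    apply: (open_near oU Uy) => z Uz; rewrite (smooth_derive _ oU hS Uz).
    by apply: eq_bigr => b _; rewrite mxE.
  rewrite (near_eq_derive (E a) ev).
  have [] := @is_derive_bigsum _ _ _ (index_enum 'I_n)
    (fun b z => S c b * 'D_(E b) h z) (fun b => S c b * 'D_(E a) ('D_(E b) h) y) y (E a); last by [].
  move=> b; apply: is_deriveZ; apply: derivableP.
  by apply: smooth_on_derivable (smooth_on_D (E b) hS) Uy.
rewrite (eq_bigr _ (fun c _ => D c)).
exact: (alg (fun a b => 'D_(E a) ('D_(E b) h) y)).
Qed.

Lemma lap_max (U : set 'rV[R]_n) i h y : open U -> U `<=` img i -> smooth_on U h -> U y ->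
  (\forall z \near y, h z <= h y) -> lap i h y <= 0.
Proof.
move=> oU Ui hS Uy hm; rewrite (lapE oU Ui hS Uy).
rewrite [X in _ + X]big1 ?addr0; last first.
  by move=> b _; have [-> _] := smooth_local_max (E b) oU hS Uy hm; rewrite mulr0.
have [S SE] := posdef_cholesky (ginv_posdef (Ui _ Uy)).
rewrite (hess_cholesky oU hS Uy SE); apply: sumr_le0 => c _.
by have [_] := smooth_local_max (row c S) oU hS Uy hm.
Qed.

Lemma laplacian_max (f : M -> R) x : smooth_fun f -> (forall z, f z <= f x) ->
  laplacian g f x <= 0.
Proof.
move=> fS fm; rewrite laplacian_lap; set i := chart_at x.
have dx : dom i x by exact: chart_atP.
apply: (@lap_max (img i)); [exact: open_img|by []|exact: fS|exact: img_phi|].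
by near=> z; rewrite /= (phiK dx).
Unshelve. all: by end_near. Qed.

End laplace.

(** * Integration and Green's formula *)

Section lebesgue_rows.
Context {R : realType}.
Notation mR := (measurableTypeR R).

Definition rowt n (t : n.-tuple mR) : 'rV[R]_n := \row_a tnth t a.

Lemma measurable_box n (c : 'I_n -> R) (r : R) :
  measurable [set t : n.-tuple mR | forall a, `|tnth t a - c a| <= r].
Proof.
rewrite (_ : [set t | _] = \bigcap_(a in [set: 'I_n])
    ((fun t : n.-tuple mR => tnth t a) @^-1` `[c a - r, c a + r]%classic)).
  apply: fin_bigcap_measurable => // a _; rewrite -[X in measurable X]setTI.
  by apply: measurable_tnth => //; exact: measurable_itv.
apply/seteqP; split => t /= H a.
  by move=> _; have := H a; rewrite /= in_itv/= ler_distl.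
by have := H a I; rewrite /= in_itv/= ler_distl.
Qed.

(** The measurable sets of tuples come from the coordinates, the open sets of rows from the norm.
    They are reconciled by writing an open set as the countable union of the closed boxes it
    contains with rational centre and radius [1/(k+1)]. *)
Lemma measurable_rowt_open n (O : set 'rV[R]_n) : open O ->
  measurable (@rowt n @^-1` O : set (n.-tuple mR)).
Proof.
move=> oO.
pose B (qk : n.-tuple rat * nat) :=
  [set t : n.-tuple mR | forall a, `|tnth t a - ratr (tnth qk.1 a)| <= qk.2.+1%:R^-1].
(* The inclusion is part of the set, so that the union ranges over a whole countable type; a box
   that is not contained contributes the empty set. *)
pose F qk := [set t | B qk `<=` @rowt n @^-1` O /\ B qk t].
suff -> : @rowt n @^-1` O = \bigcup_qk F qk.
  apply: countable_bigcupT_measurable; first exact: countableP.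
  move=> qk; have [H|H] := pselect (B qk `<=` @rowt n @^-1` O).
    rewrite (_ : F qk = B qk); first exact: measurable_box.
    by apply/seteqP; split => [t []|t].
  rewrite (_ : F qk = set0); first exact: measurable0.
  by apply/seteqP; split => [t []|t].
apply/seteqP; split=> [t /= Ot|t [qk _ [H /H]]]//.
have [e /= e0 eO] := (nbhs_ballP _ _).1 (open_nbhs_nbhs (conj oO Ot)).
have [k ke] : exists k : nat, 2 * k.+1%:R^-1 < e.
  have := archi_boundP (divr_ge0 (ler0n R 2) (ltW e0)); set m := Num.bound _ => hm.
  exists m; rewrite ltr_pdivrMr// mulrC -ltr_pdivrMr//.
  by rewrite (lt_le_trans hm)// ler_nat.
have k0 : 0 < k.+1%:R^-1 :> R by rewrite invr_gt0.
have qd (x d : R) : 0 < d -> exists q : rat, `|x - ratr q| <= d.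
  move=> d0; have [|q] := @rat_in_itvoo R (x - d) (x + d); first lra.
  by rewrite in_itv/= => /andP[q1 q2]; exists q; rewrite ler_distl; apply/andP; split; lra.
have qa a : {q : rat | `|tnth t a - ratr q| <= k.+1%:R^-1} by apply: cid; exact: qd.
pose q := [tuple sval (qa a) | a < n].
have tB : B (q, k) t by move=> a /=; rewrite tnth_mktuple; exact: (svalP (qa a)).
exists (q, k) => //; split => // s sB /=; apply: eO.
rewrite -ball_normE/=; apply: le_lt_trans ke; apply: ler_norm_rV; first by rewrite mulr_ge0// ltW.
move=> a; rewrite !mxE.
have := lerD (tB a) (sB a); rewrite /= [`|tnth s a - _|]distrC => H.
rewrite mulr_natl mulr2n; apply: le_trans H; apply: le_trans (ler_normD _ _).
by rewrite subrKA.
Qed.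

Lemma measurable_fun_rowt n (O : set 'rV[R]_n) (f : 'rV[R]_n -> R) : open O ->
  (forall y, O y -> {for y, continuous f}) ->
  measurable_fun (@rowt n @^-1` O : set (n.-tuple mR)) (fun t => f (rowt t)).
Proof.
move=> oO fc mD; apply: (measurability _ (RGenOInfty.measurableE R)) => //.
move=> /= _ [_ [x ->] <-].
rewrite (_ : _ `&` _ = @rowt n @^-1` (O `&` f @^-1` `]x, +oo[%classic)); last first.
  by apply/seteqP; split => t /=.
apply: measurable_rowt_open; rewrite openE => y [/= Oy fy].
apply: filterI; first exact: open_nbhs_nbhs.
by apply: (fc y Oy); apply: open_nbhs_nbhs; split => //; exact: itv_open.
Qed.

Definition cube n (L : R) : set 'rV[R]_n := [set v | forall a, `|v 0 a| <= L].

Lemma measurable_cube n L : measurable (@rowt n @^-1` @cube n L : set (n.-tuple mR)).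
Proof.
rewrite (_ : _ @^-1` _ = [set t : n.-tuple mR | forall a, `|tnth t a - 0| <= L]).
  exact: (measurable_box (fun=> 0)).
by apply/seteqP; split => t H a; have := H a; rewrite /= !mxE subr0.
Qed.

Lemma lebesgue_tupleS n (A : set (n.+1.-tuple mR)) :
  lebesgue_tuple n.+1 A = (lebesgue_measure \x lebesgue_tuple n)%E (@tcons R n @^-1` A).
Proof. by []. Qed.

Lemma lebesgue_box n (c : 'I_n -> R) (r : R) : 0 <= r ->
  lebesgue_tuple n [set t : n.-tuple mR | forall a, `|tnth t a - c a| <= r] =
  ((2 * r) ^+ n)%:E.
Proof.
move=> r0; elim: n c => [|n IH] c.
  by rewrite expr0 /= diracE mem_set//= => -[].
rewrite lebesgue_tupleS (_ : _ @^-1` _ = `[c ord0 - r, c ord0 + r]%classic `*`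
    [set t : n.-tuple mR | forall a, `|tnth t a - c (lift ord0 a)| <= r]); last first.
  apply/seteqP; split => [[x t] /= H|[x t] /= [H1 H2] a].
    split; first by have := H ord0; rewrite in_itv/= ler_distl.
    by move=> a; have := H (lift ord0 a); rewrite tnthS.
  case: (unliftP ord0 a) => [b ->|->]; first by rewrite tnthS; exact: H2.
  by move: H1; rewrite in_itv/= -ler_distl.
rewrite product_measure1E//=; last exact: measurable_box.
rewrite IH lebesgue_measure_itv/= lte_fin; case: ifPn => [_|].
  by rewrite -EFinB -EFinM exprS; congr (_ * _)%:E; lra.
rewrite -leNgt => rr; have -> : r = 0 by lra.
by rewrite mul0e mulr0 expr0n.
Qed.

Lemma lebesgue_cube_fin n L : 0 <= L ->
  (lebesgue_tuple n (@rowt n @^-1` @cube n L) < +oo)%E.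
Proof.
move=> L0; rewrite (_ : _ @^-1` _ = [set t : n.-tuple mR | forall a, `|tnth t a - 0| <= L]).
  by rewrite (lebesgue_box (fun=> 0))// ltry.
by apply/seteqP; split => t H a; have := H a; rewrite /= !mxE subr0.
Qed.

Lemma continuous_cube_bounded n (f : 'rV[R]_n -> R) L : continuous f ->
  exists2 C, 0 <= C & forall v, cube L v -> `|f v| <= C.
Proof.
move=> fc.
have cK : compact (@cube n L).
  have := @rV_compact R n (fun=> `[- L, L]%classic) (fun=> @segment_compact _ _ _).
  rewrite (_ : [set v : 'rV[R]_n | _] = @cube n L)//.
  by apply/seteqP; split => v H a; have := H a; rewrite /= in_itv/= ler_norml.
have := compact_bounded (continuous_compact (continuous_subspaceT fc) cK).
move=> [C [_ CP]]; exists (`|C| + 1); first by rewrite addr_ge0.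
by move=> v vL; apply: (CP (`|C| + 1)); [rewrite ltr_pwDr// ler_norm|exists v].
Qed.

Lemma integrable_rowt n (f : 'rV[R]_n -> R) L : 0 <= L -> continuous f ->
  (forall v, ~ cube L v -> f v = 0) ->
  (lebesgue_tuple n).-integrable setT (fun t => (f (rowt t))%:E).
Proof.
move=> L0 fc f0; have [C C0 fC] := continuous_cube_bounded L fc.
have mf : measurable_fun setT (fun t : n.-tuple mR => f (rowt t)).
  by have := @measurable_fun_rowt n setT f openT (fun y _ => fc y); rewrite preimage_setT.
rewrite (_ : (fun t => _) = (fun t => (f (rowt t))%:E) \_ (@rowt n @^-1` @cube n L)).
  apply/(integrable_mkcond _ (@measurable_cube n L)).
  apply: measurable_bounded_integrable; first exact: measurable_cube.
  - exact: lebesgue_cube_fin.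
  - exact: measurable_funTS.
  - exists C; split; [exact: num_real|move=> M CM t /= tL]; exact: le_trans (fC _ tL) (ltW CM).
apply/funext => t; rewrite patchE; case: ifPn => //; rewrite notin_setE /= => H.
by rewrite f0.
Qed.

Definition rcons0 n (x : R) (v : 'rV[R]_n) : 'rV[R]_n.+1 :=
  \row_a (if unlift ord0 a is Some b then v 0 b else x).

Lemma rowt_tcons n (x : mR) (t : n.-tuple mR) : rowt (tcons (x, t)) = rcons0 x (rowt t).
Proof.
apply/rowP => a; rewrite !mxE; case: unliftP => [b ->|->]; rewrite ?mxE//.
by rewrite /tcons /= tnthS.
Qed.

Lemma smooth_coord n a (U : set 'rV[R]_n) : open U -> smooth_on U (fun v : 'rV[R]_n => v 0 a).
Proof.
move=> oU; apply/smooth_onP => -[|k]; split => //; try by move=> x _; exact: coord_continuous.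
have H (v x : 'rV[R]_n) : is_derive x v (fun v : 'rV[R]_n => v 0 a) (v 0 a).
  have dl : derivable (fun v : 'rV[R]_n => v) x v by exact: derivable_id.
  have := derivable_mxP _ _ _ => /(_ _ _ _ _ (fun v : 'rV[R]_n => v) x v)/iffLR/(_ dl 0 a) d.
  split => //; have := derive_mx dl; rewrite derive_id => /matrixP/(_ 0 a).
  by rewrite mxE.
move=> v; split=> [x _|]; first by have [] := H v x.
rewrite (_ : 'D_v _ = cst (v 0 a)); first exact: Ck_cst.
by apply/funext => x; have [_ ->] := H v x.
Qed.

Lemma smooth_rcons0 n x : smooth_on setT (@rcons0 n x).
Proof.
apply: smooth_on_mx; first exact: openT.
move=> i a; rewrite ord1; case: (unliftP ord0 a) => [b ->|->].
  apply: (smooth_on_ext openT _ (smooth_coord b openT)) => v _.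
  by rewrite mxE liftK.
have c : smooth_on (setT : set 'rV[R]_n) (fun=> x : R) by exact: smooth_on_cst.
by apply: (smooth_on_ext openT _ c) => v _; rewrite mxE unlift_none.
Qed.

(** The two difference quotients are the same function of [h], so the values agree whether or not
    the limit exists. *)
Lemma derive_slice (V W X : normedModType R) (f : W -> X) (s : V -> W) (u v : V) w :
  (forall h : R, s (h *: v + u) = h *: w + s u) ->
  'D_v (f \o s) u = 'D_w f (s u).
Proof.
move=> E; rewrite /derive.
suff -> : (fun h : R => h^-1 *: ((f \o s \o shift u) (h *: v) - (f \o s) u)) =
  (fun h => h^-1 *: ((f \o shift (s u)) (h *: w) - f (s u))) by [].
by apply/funext => h /=; rewrite E.
Qed.

Lemma derivable_slice (V W X : normedModType R) (f : W -> X) (s : V -> W) (u v : V) w :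
  (forall h : R, s (h *: v + u) = h *: w + s u) ->
  derivable f (s u) w -> derivable (f \o s) u v.
Proof.
move=> E; rewrite /derivable.
suff -> : (fun h : R => h^-1 *: ((f \o s \o shift u) (h *: v) - (f \o s) u)) =
  (fun h => h^-1 *: ((f \o shift (s u)) (h *: w) - f (s u))) by [].
by apply/funext => h /=; rewrite E.
Qed.

(** Induction on the dimension with Fubini. A derivative in a later coordinate is a derivative of
    the slices at fixed first coordinate, covered by the induction; a derivative in the first
    coordinate is integrated along it by the fundamental theorem of calculus. *)
Lemma lebesgue_divergence0 n (h : 'rV[R]_n -> R) a L : 0 <= L -> smooth_on setT h ->
  (forall v, ~ cube L v -> h v = 0) ->
  (\int[lebesgue_tuple n]_t ('D_(delta_mx 0 a) h (rowt t))%:E)%E = 0%E.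
Proof.
move=> L0; elim: n h a => [|n IH] h a hS h0; first by case: a.
have dS := smooth_on_D (delta_mx 0 a : 'rV[R]_n.+1) hS.
have dc : continuous ('D_(delta_mx 0 a) h) by move=> y; exact: smooth_on_cts dS _.
have oc : open (~` @cube n.+1 L).
  rewrite (_ : ~` _ = \bigcup_b [set v : 'rV[R]_n.+1 | L < `|v 0 b|]).
    apply: bigcup_open => b _; apply: (@open_comp _ _ (fun v : 'rV[R]_n.+1 => `|v 0 b|) [set x | L < x]).
      move=> v _; apply: (continuous_comp (f := fun v : 'rV[R]_n.+1 => v 0 b)).
        exact: coord_continuous.
      exact: norm_continuous.
    exact: open_gt.
  apply/seteqP; split => [v /existsNP[b /negP]|v [b _ /= Lb] H].
    by rewrite -ltNge => Lb; exists b.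
  by have := H b; rewrite leNgt Lb.
have d0 v : ~ cube L v -> 'D_(delta_mx 0 a) h v = 0.
  move=> cv; rewrite (near_eq_derive (g := cst 0)) ?derive_cst//.
  by apply: (open_near oc cv) => z; exact: h0.
have ig := integrable_rowt L0 dc d0.
pose F (z : mR * n.-tuple mR) : \bar R := ('D_(delta_mx 0 a) h (rcons0 z.1 (rowt z.2)))%:E.
pose G (t : n.+1.-tuple mR) : \bar R := ('D_(delta_mx 0 a) h (rowt t))%:E.
have FE : G \o @tcons R n = F.
  by apply/funext => -[x t]; rewrite /F /G /= rowt_tcons.
have mF := measurable_int _ ig.
have iF : (lebesgue_measure \x lebesgue_tuple n)%E.-integrable setT F.
  rewrite -FE; apply/integrableP; split.
    move=> _ Y mY; rewrite setTI comp_preimage.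
    have := mF measurableT Y mY; rewrite setTI => mG.
    by have := @measurable_tcons R n measurableT _ mG; rewrite setTI.
  move/integrableP : ig => [_]; rewrite /= /lebesgue_cons.
  rewrite ge0_integral_pushforward//; first exact: measurable_tcons.
  apply/measurable_EFinP.
  have := @measurable_fun_rowt n.+1 setT (fun y => `|'D_(delta_mx 0 a) h y|) openT.
  rewrite preimage_setT; apply => y _.
  by apply: continuous_comp; [exact: dc|exact: norm_continuous].
rewrite [LHS](_ : _ = (\int[lebesgue_measure \x lebesgue_tuple n]_z F z)%E); last first.
  have ip : (lebesgue_measure \x lebesgue_tuple n)%E.-integrable
      (@tcons R n @^-1` setT) (G \o @tcons R n) by rewrite preimage_setT FE.
  have := integral_pushforward (@measurable_tcons R n) mF ip measurableT.
  by rewrite preimage_setT FE.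
case: (unliftP ord0 a) => [b ab|a0].
  rewrite -integral12_prod_meas1//; apply: integral0_eq => x _.
  rewrite -[RHS](IH (h \o rcons0 x) b).
  - apply: eq_integral => t _; rewrite /F/= ab; congr (_%:E).
    apply/esym/derive_slice => s; apply/rowP => c; rewrite !mxE /=.
    case: unliftP => [d ->|->]; rewrite ?mxE ?eqxx/=.
      by rewrite (inj_eq lift_inj).
    by rewrite mulr0 add0r.
  - by apply: (smooth_on_compV openT openT hS (@smooth_rcons0 n x)).
  - move=> v cv; apply: h0 => H; apply: cv => c; have := H (lift ord0 c).
    by rewrite mxE liftK.
rewrite -integral21_prod_meas1//; apply: integral0_eq => t _.
(* The interval is larger than the support, so that [k] vanishes at its ends and its length is
   positive even when [L] is [0]. *)
have L1 : - (`|L| + 1) < `|L| + 1 by have := normr_ge0 L; lra.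
pose k (x : R) := h (rcons0 x (rowt t)).
have sl (s x : R) : rcons0 (s *: (1 : R) + x) (rowt t) = s *: delta_mx 0 a + rcons0 x (rowt t).
  apply/rowP => c; rewrite !mxE a0 /=.
  by case: unliftP => [d ->|->]; rewrite ?mxE ?eqxx/= ?mulr0 ?add0r.
have kE x : 'D_1 k x = 'D_(delta_mx 0 a) h (rcons0 x (rowt t)) by exact: derive_slice.
have kd x : derivable k x 1.
  apply: (derivable_slice (fun s => sl s x)).
  exact: smooth_on_derivable hS I.
have kc : continuous k by move=> x; apply/differentiable_continuous/derivable1_diffP; exact: kd.
have k0 x : ~ (`|x| <= L) -> k x = 0.
  by move=> Lx; apply: h0 => /(_ ord0); rewrite mxE unlift_none.
have cts : continuous (fun x : R => 'D_(delta_mx 0 a) h (rcons0 x (rowt t))).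
  move=> x; apply: (@continuous_comp _ _ _ (fun x => rcons0 x (rowt t)) ('D_(delta_mx 0 a) h)); last exact: dc.
  have -> : (fun x => rcons0 x (rowt t)) = (fun x : R => x *: delta_mx 0 a + rcons0 0 (rowt t)).
    by apply/funext => y; rewrite -sl /= addr0 [_ *: _]mulr1.
  by apply: cvgD; [exact: scalel_continuous|exact: cvg_cst].
have z0 : k (`|L| + 1) = 0.
  by apply: k0; apply/negP; rewrite -ltNge ger0_norm ?addr_ge0// (le_lt_trans (ler_norm L))// ltrDl.
have z1 : k (- (`|L| + 1)) = 0.
  by apply: k0; apply/negP; rewrite -ltNge normrN ger0_norm ?addr_ge0// (le_lt_trans (ler_norm L))// ltrDl.
transitivity (\int[lebesgue_measure]_(x in `[(- (`|L| + 1))%R, (`|L| + 1)%R]%classic)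
    ('D_(delta_mx 0 a) h (rcons0 x (rowt t)))%:E)%E.
  rewrite [RHS]integral_mkcond; apply: eq_integral => x _; rewrite /F /=.
  rewrite patchE; case: ifPn => //; rewrite notin_setE/= in_itv/= => /negP.
  rewrite -ler_norml -ltNge => Lx; rewrite d0// => /(_ ord0); rewrite mxE unlift_none => H.
  by have := ler_norm L; lra.
rewrite (continuous_FTC2 (F := k) L1).
- by rewrite z0 z1 subee.
- exact: continuous_subspaceT.
- split; first by move=> x _; exact: kd.
    by apply: cvg_at_right_filter; apply: kc.
  by apply: cvg_at_left_filter; apply: kc.
- by move=> x _; rewrite derive1E kE.
Qed.

End lebesgue_rows.

(** * Chart independence of the product of gradients *)

Section gam_invariance.
Context {R : realType} {n : nat} {M : manifold R n} (g : metric M).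
Local Notation E a := (delta_mx 0 a : 'rV[R]_n).

Lemma gamE i h k y : gam g i h k y = (partials h y *m ginv g i y *m (partials k y)^T) 0 0.
Proof.
by rewrite quadE /gam; apply: eq_bigr => a _; apply: eq_bigr => b _; rewrite !mxE.
Qed.

Lemma smooth_differentiable_rV m k (U : set 'rV[R]_m) (tau : 'rV[R]_m -> 'rV[R]_k) y :
  open U -> smooth_on U tau -> U y -> differentiable tau y.
Proof.
move=> oU tS Uy.
have -> : tau = \sum_c (fun z => tau z 0 c *: (delta_mx 0 c : 'rV[R]_k)).
  by apply/funext => z; rewrite fct_sumE [LHS]row_sum_delta.
apply: differentiable_sum => c; apply: differentiableZl.
exact: smooth_differentiable oU (smooth_on_coord 0 c oU tS) Uy.
Qed.

Lemma partials_comp (U O : set 'rV[R]_n) (h : 'rV[R]_n -> R) (tau : 'rV[R]_n -> 'rV[R]_n) y :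
  open U -> smooth_on U tau -> U y -> open O -> smooth_on O h -> O (tau y) ->
  partials (h \o tau) y = partials h (tau y) *m ('J tau y)^T.
Proof.
move=> oU tS Uy oO hS Oy; apply/rowP => a; rewrite !mxE.
have dt := smooth_on_derivable (v := E a) tS Uy.
have [_ ->] := smooth_is_derive_comp U oO hS Oy dt.
apply: eq_bigr => c _; rewrite !mxE mulrC; congr (_ * _).
have d := smooth_differentiable_rV oU tS Uy.
rewrite -deriveE//.
by rewrite derive_mx// !mxE.
Qed.

(** The partial derivatives change by the transpose of the Jacobian, and the inverse of the metric
    absorbs both factors. *)
Lemma gam_change i j (h k : M -> R) x : smooth_on (img j) (h \o phiV j) ->
  smooth_on (img j) (k \o phiV j) -> dom i x -> dom j x ->
  gam g i (h \o phiV i) (k \o phiV i) (phi i x) =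
  gam g j (h \o phiV j) (k \o phiV j) (phi j x).
Proof.
move=> hS kS di dj.
have ov : overlap i j (phi i x) by exists x.
have oo := @open_overlap _ _ M i j.
have tS := @transition_smooth R n M i j.
have tx : (phi j \o phiV i) (phi i x) = phi j x by rewrite /= phiK.
have P (f : M -> R) : smooth_on (img j) (f \o phiV j) ->
    partials (f \o phiV i) (phi i x) =
    partials (f \o phiV j) (phi j x) *m ('J (phi j \o phiV i) (phi i x))^T.
  move=> fS; rewrite -[in RHS]tx.
  rewrite -(partials_comp oo tS ov (@open_img _ _ M j) fS); last first.
    by rewrite tx; exact: img_phi.
  apply/rowP => a; rewrite !mxE; apply: near_eq_derive.
  by apply: (open_near oo ov) => z /overlapP[iz dz] /=; rewrite phiK.
rewrite !gamE (P h hS) (P k kS) trmx_mul trmxK.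
set J := 'J _ _.
have GE : gmx g i (phi i x) = J *m gmx g j (phi j x) *m J^T by exact: gmx_transition.
have uj : gmx g j (phi j x) \in unitmx by apply/posdef_unit/gmx_posdef/img_phi.
have ui : gmx g i (phi i x) \in unitmx by apply/posdef_unit/gmx_posdef/img_phi.
(* The determinant of the metric in the chart [i] is a unit and has [\det J] as a factor, so the
   Jacobian is invertible. *)
have uJ : J \in unitmx.
  move: ui; rewrite GE !unitmxE !det_mulmx det_tr !unitrM => /andP[/andP[]//].
have inv : J^T *m ginv g i (phi i x) *m J = ginv g j (phi j x).
  have X : gmx g j (phi j x) *m (J^T *m ginv g i (phi i x) *m J) = 1%:M.
    have E1 : J *m (gmx g j (phi j x) *m (J^T *m ginv g i (phi i x) *m J)) = J.
      by rewrite !mulmxA -GE mulmxV// mul1mx.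
    by rewrite -[LHS](mulKmx uJ) E1 mulVmx.
  by rewrite -[LHS](mulKmx uj) X mulmx1.
by rewrite -inv !mulmxA.
Qed.

End gam_invariance.

(** * Bump functions *)

Section bump.
Context {R : realType}.

(** The classical flat function is the case [k = 0]. The power is a parameter because the derivative
    of a member is a combination of members, which makes smoothness an induction. *)
Definition expV (k : nat) (x : R) : R := if 0 < x then x^-1 ^+ k * expR (- x^-1) else 0.

(** From [exp y >= y^(k+1) / (k+1)!] at [y = 1/x]. The difference quotient of [expV k] at [0] is
    [expV k.+1], so this linear bound gives the derivative [0] there. *)
Lemma expV_le k x : `|expV k x| <= k.+1`!%:R * `|x|.
Proof.
rewrite /expV; case: ifPn => x0; last by rewrite normr0 mulr_ge0.
rewrite !ger0_norm ?(ltW x0)//; last first.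
  by rewrite mulr_ge0 ?expR_ge0// exprn_ge0// invr_ge0 ltW.
have y0 : 0 <= x^-1 by rewrite invr_ge0 ltW.
have := expR_ge1Dxn k y0; set f := k.+1`!%:R; rewrite expRN => H.
have f0 : 0 < f by rewrite ltr0n fact_gt0.
rewrite ler_pdivrMr ?expR_gt0//.
rewrite -[leLHS]mul1r -[X in X * _ <= _](divff (lt0r_neq0 x0)) -mulrA -exprS.
rewrite [f * x]mulrC -mulrA ler_pM2l// -ler_pdivrMl// mulrC.
by apply: le_trans H; rewrite lerDr.
Qed.

Lemma is_derive_expV k (x : R) : is_derive x 1 (expV k) (expV k.+2 x - k%:R * expV k.+1 x).
Proof.
have [x0|x0|->] := ltgtP x 0.
- have E : \near x, (cst 0 : R -> R) x = expV k x.
    near=> y; rewrite /expV ifF//; apply/negbTE; rewrite -leNgt ltW//.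
    by near: y; exact: lt_nbhsl.
  have := near_eq_is_derive E (is_derive_cst 0 x 1).
  by move/is_derive_eq; apply; rewrite /expV lt_gtF// mulr0 subr0.
- have E : \near x, (fun y : R => y^-1 ^+ k * expR (- y^-1)) x = expV k x.
    near=> y; rewrite /expV ifT//; near: y; exact: lt_nbhsr.
  apply: (near_eq_is_derive E).
  have x1 : x != 0 by rewrite gt_eqF.
  have di : is_derive x 1 (fun y : R => y^-1) (- x ^- 2).
    apply: DeriveDef; first by apply: derivableV => //; exact: derivable_id.
    by rewrite deriveV// derive_id [_ *: _]mulr1.
  have d1 : is_derive x 1 (fun y : R => y^-1 ^+ k) ((k%:R * x^-1 ^+ k.-1) * - x ^- 2).
    rewrite (_ : (fun y : R => y^-1 ^+ k) = (fun y : R => y^-1) ^+ k); first exact: is_deriveX.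
    apply/funext => y; elim: k {E} => [|m IH]; first by rewrite !expr0.
    by rewrite !exprS IH.
  have d2 : is_derive x 1 (fun y : R => expR (- y^-1)) (expR (- x^-1) * x ^- 2).
    have dn : is_derive x 1 (fun y : R => - y^-1) (x ^- 2).
      by rewrite -[X in is_derive _ _ _ X]opprK; exact: is_deriveN.
    have := is_derive1_comp (is_derive_expR _) dn; move/is_derive_eq; apply.
    by rewrite mulrC.
  have := is_deriveM d1 d2; move/is_derive_eq; apply.
  rewrite /expV x0 -![_ *: _]/(_ * _) /= !exprVn.
  case: k {E d1} => [|k]; first by rewrite !expr0 mul0r mul0r invr1; field.
  rewrite /= !exprS; field.
  by rewrite x1 expf_neq0.
- have z j : expV j 0 = 0 by rewrite /expV ltxx.
  rewrite !z mulr0 subr0.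
  have H : h^-1 *: ((expV k \o shift 0) (h *: (1:R)) - expV k 0) @[h --> 0^'] --> (0 : R).
    apply/cvgr0Pnorm_le => e e0; near=> h.
    rewrite /= addr0 [h%:A]mulr1 z subr0 -[_ *: _]/(_ * _).
    have h0 : h != 0 by near: h; exact: nbhs_dnbhs_neq.
    have -> : h^-1 * expV k h = expV k.+1 h.
      rewrite /expV; case: ifP => _; last by rewrite mulr0.
      by rewrite exprS mulrA.
    apply: le_trans (expV_le _ _) _.
    have f0 : 0 < k.+2`!%:R :> R by rewrite ltr0n fact_gt0.
    rewrite -ler_pdivlMl// mulrC ltW//; near: h; apply: dnbhs0_lt.
    by rewrite divr_gt0.
  split; first by apply/cvg_ex; exists 0.
  exact: cvg_lim.
Unshelve. all: by end_near. Qed.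

Lemma smooth_expV k : smooth_on setT (expV k).
Proof.
apply/smooth_onP => m; elim: m k => [|m IH] k.
  split => // x _; apply/differentiable_continuous/derivable1_diffP.
  by have [] := is_derive_expV k x.
split=> [x _|v].
  by apply/differentiable_continuous/derivable1_diffP; have [] := is_derive_expV k x.
have df x : differentiable (expV k) x.
  by apply/derivable1_diffP; have [] := is_derive_expV k x.
split=> [x _|]; first exact: diff_derivable.
apply: (@Ck_ext _ _ _ _ _ (fun x => v * (expV k.+2 x + (- k%:R) * expV k.+1 x))).
- exact: openT.
- move=> x _; rewrite derive_dir1//; have [_ ->] := is_derive_expV k x.
  by rewrite mulNr.
- apply: CkM; [exact: openT|exact: Ck_cst|].
  apply: CkD; [exact: openT|exact: IH|].
  by apply: CkM; [exact: openT|exact: Ck_cst|exact: IH].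
Qed.

Definition box n (y0 : 'rV[R]_n) (r : R) : set 'rV[R]_n :=
  [set y | forall a, `|y 0 a - y0 0 a| <= r].

Lemma box_compact n (y0 : 'rV[R]_n) r : compact (box y0 r).
Proof.
have := @rV_compact R n (fun a => `[y0 0 a - r, y0 0 a + r]%classic)
  (fun=> @segment_compact _ _ _).
rewrite (_ : [set v : 'rV[R]_n | _] = box y0 r)//.
by apply/seteqP; split => v H a; have := H a; rewrite /= in_itv/= ler_distl.
Qed.

Lemma box_in_open n (O : set 'rV[R]_n) (y0 : 'rV[R]_n) : open O -> O y0 ->
  exists2 r : R, 0 < r & box y0 r `<=` O.
Proof.
move=> oO Oy; have [e /= e0 eO] := (nbhs_ballP _ _).1 (open_nbhs_nbhs (conj oO Oy)).
exists (e / 2); first by rewrite divr_gt0.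
move=> y yb; apply: eO; rewrite -ball_normE/= (@le_lt_trans _ _ (e / 2))//; last lra.
by apply: ler_norm_rV => [|a]; [lra|rewrite !mxE distrC].
Qed.

Lemma box_nbhs n (y0 : 'rV[R]_n) r : 0 < r -> nbhs y0 (box y0 r).
Proof.
move=> r0; apply/nbhs_ballP; exists r => //= y; rewrite -ball_normE/= => yr a.
rewrite distrC (le_trans _ (ltW yr))//; have := ler_norm_coord (y0 - y) a.
by rewrite !mxE.
Qed.

Definition bump_rV n (y0 : 'rV[R]_n) (r : R) (y : 'rV[R]_n) : R :=
  \prod_a expV 0 (r ^+ 2 - (y 0 a - y0 0 a) ^+ 2).

Lemma bump_rV_smooth n (y0 : 'rV[R]_n) r (U : set 'rV[R]_n) : open U ->
  smooth_on U (bump_rV y0 r).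
Proof.
move=> oU; apply: (smooth_on_prod _ oU) => a.
have cS (c : R) : smooth_on U (fun=> c : R) by exact: smooth_on_cst.
apply: (smooth_on_comp1 oU (smooth_expV 0)) => //.
have S1 : smooth_on U (fun y : 'rV[R]_n => y 0 a - y0 0 a).
  by apply: (smooth_onB oU _ (cS _)); exact: smooth_coord.
exact: (smooth_onB oU (cS _) (smooth_onM oU S1 S1)).
Qed.

Lemma bump_rV_ge0 n (y0 : 'rV[R]_n) r y : 0 <= bump_rV y0 r y.
Proof.
apply: prodr_ge0 => a _; rewrite /expV; case: ifP => // _.
by rewrite expr0 mul1r expR_ge0.
Qed.

Lemma bump_rV_gt0 n (y0 : 'rV[R]_n) r : 0 < r -> 0 < bump_rV y0 r y0.
Proof.
move=> r0; apply: prodr_gt0 => a _; rewrite /expV subrr expr0n subr0 exprn_gt0//.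
by rewrite expr0 mul1r expR_gt0.
Qed.

Lemma bump_rV_out n (y0 : 'rV[R]_n) r y : 0 <= r -> ~ box y0 r y -> bump_rV y0 r y = 0.
Proof.
move=> r0 /existsNP[a /negP]; rewrite -ltNge => ya.
rewrite /bump_rV (bigD1 a)//= /expV ifF ?mul0r//; apply/negbTE; rewrite -leNgt subr_le0.
by rewrite -[leRHS]real_normK ?num_real// ler_sqr ?nnegrE// ltW.
Qed.

End bump.

(** * Integrals with respect to a measure given by a density *)

Section density_transfer.
Context {R : realType} d1 d2 (T1 : measurableType d1) (T2 : measurableType d2).
Variables (mu : {measure set T1 -> \bar R}) (nu : {measure set T2 -> \bar R}).
Variables (D : set T1) (psi : T2 -> T1) (w : T2 -> R).
Hypotheses (mpsi : measurable_fun setT psi) (mw : measurable_fun setT w)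
  (w0 : forall t, 0 <= w t)
  (muE : forall A, measurable A -> A `<=` D ->
    mu A = (\int[nu]_(t in psi @^-1` A) (w t)%:E)%E).
Local Open Scope ereal_scope.

Import HBNNSimple.

(** Approximation by simple functions and monotone convergence on both sides. The measures are
    compared on subsets of [D] only, which suffices because the nonzero level sets of the
    approximations lie in [D]. *)
Lemma ge0_density_transfer (F : T1 -> \bar R) : measurable_fun setT F ->
  (forall x, 0 <= F x) -> (forall x, ~ D x -> F x = 0) ->
  \int[mu]_x F x = \int[nu]_t (F (psi t) * (w t)%:E).
Proof.
move=> mF F0 FD.
pose h := nnsfun_approx measurableT mF.
have hF x : (EFin \o h n) x @[n --> \oo] --> F x.
  by apply: cvg_nnsfun_approx => // y _; exact: F0.
have mh n : measurable_fun setT (EFin \o h n) by exact/measurable_EFinP.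
have mhp n : measurable_fun setT (fun t => (EFin \o h n) (psi t)).
  exact: (measurableT_comp (mh n) mpsi).
have mwE : measurable_fun setT (fun t => (w t)%:E) by exact/measurable_EFinP.
have -> : \int[mu]_x F x = limn (fun n => \int[mu]_x (EFin \o h n) x).
  rewrite -monotone_convergence//.
  - by apply: eq_integral => x _; apply/esym/cvg_lim => //; exact: hF.
  - by move=> n x _ /=; rewrite lee_fin.
  - by move=> x _ m n mn /=; rewrite lee_fin; exact/lefP/nd_nnsfun_approx.
have -> : \int[nu]_t (F (psi t) * (w t)%:E) =
    limn (fun n => \int[nu]_t ((EFin \o h n) (psi t) * (w t)%:E)).
  rewrite -monotone_convergence//.
  - apply: eq_integral => x _; apply/esym/cvg_lim => //.
    by apply: cvgeZr => //; exact: hF.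
  - by move=> n; exact: emeasurable_funM.
  - by move=> n x _ /=; rewrite mule_ge0 ?lee_fin.
  - move=> x _ m n mn /=; rewrite lee_wpmul2r ?lee_fin//.
    exact/lefP/nd_nnsfun_approx.
suff suf n : \int[mu]_x (EFin \o h n) x = \int[nu]_t ((EFin \o h n) (psi t) * (w t)%:E).
  by congr (limn _); apply/funext => n; exact: suf.
have ind (r : R) : (0 <= r)%R -> measurable_fun setT (fun x => (r * \1_(h n @^-1` [set r]) x)%:E).
  by move=> r0; apply/measurable_EFinP; exact: measurable_funM.
transitivity (\int[mu]_x (\sum_(y \in range (h n)) (y * \1_(h n @^-1` [set y]) x)%:E)).
  by apply: eq_integral => t tE; rewrite /= fimfunE -fsumEFin.
have indich r : measurable_fun setT (fun x => (r * \1_(h n @^-1` [set r]) x)%:E).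
  by apply/measurable_EFinP; exact: measurable_funM.
rewrite ge0_integral_fsum//; last by move=> y x _; exact: nnfun_muleindic_ge0.
transitivity (\int[nu]_t (\sum_(y \in range (h n))
    (y * \1_(h n @^-1` [set y]) (psi t))%:E * (w t)%:E)); last first.
  apply: eq_integral => t _.
  rewrite -ge0_mule_fsuml => [|y]; last exact: nnfun_muleindic_ge0.
  by rewrite fsumEFin // -(fimfunE _ (psi t)).
rewrite ge0_integral_fsum//; last 2 first.
  - by move=> y; apply: emeasurable_funM => //; exact: (measurableT_comp (indich y) mpsi).
  - by move=> y t _; rewrite mule_ge0 ?lee_fin// -lee_fin nnfun_muleindic_ge0.
apply: eq_fsbigr => r; rewrite inE => -[x _ hx].
have mA : measurable (h n @^-1` [set r]) by exact: measurable_sfunP.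
under eq_integral do rewrite EFinM.
rewrite integralZl_indic_nnsfun// integral_indic// setIT.
have r0 : (0 <= r)%R by rewrite -hx.
under [RHS]eq_integral do rewrite EFinM -muleA.
have mpA : measurable (psi @^-1` (h n @^-1` [set r])).
  by rewrite -[X in measurable X]setTI; exact: mpsi.
have [->|rn0] := eqVneq r 0%R.
  by rewrite mul0e; apply/esym/integral0_eq => t _; rewrite mul0e.
rewrite ge0_integralZl//.
- congr (_ * _); rewrite muE//.
    rewrite integral_mkcond; apply: eq_integral => t _.
    rewrite patchE /= indicE; case: ifPn => tA.
      by rewrite mem_set ?mul1e//; move: tA; rewrite inE.
    by rewrite memNset ?mul0e//; move: tA; rewrite notin_setE.
  (* The approximations increase to [F], which vanishes off [D], so they are at most [0] there and
     cannot take the positive value [r]. *)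
  move=> y /= hy; apply: contrapT => Dy.
  have : (h n y <= 0)%R.
    rewrite -lee_fin; have -> : 0%:E = F y by rewrite FD.
    have hn : nondecreasing_seq (fun k => (EFin \o h k) y).
      by move=> a b ab; rewrite lee_fin; exact/lefP/nd_nnsfun_approx.
    have -> : F y = ereal_sup (range (fun k => (EFin \o h k) y)).
      by apply: (cvg_unique _ (hF y)) => //; exact: ereal_nondecreasing_cvgn.
    by apply: ereal_sup_ubound; exists n.
  by rewrite hy leNgt lt_neqAle eq_sym rn0 r0.
- apply: emeasurable_funM => //; apply/measurable_EFinP.
  by apply: (measurableT_comp _ mpsi); exact: measurable_indic.
- by move=> t _; rewrite mule_ge0 ?lee_fin.
Qed.

Lemma density_transfer (F : T1 -> R) : measurable_fun setT F ->
  (forall x, ~ D x -> F x = 0%R) ->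
  \int[mu]_x (F x)%:E = \int[nu]_t (F (psi t) * w t)%:E.
Proof.
move=> mF FD; have mFE : measurable_fun setT (fun x => (F x)%:E) by exact/measurable_EFinP.
rewrite integralE [RHS]integralE; congr (_ - _).
  rewrite ge0_density_transfer.
  - apply: eq_integral => t _; rewrite !funeposE -EFin_max -EFinM.
    by rewrite maxr_pMl// mul0r EFin_max.
  - exact: measurable_funepos.
  - by move=> x; exact: funepos_ge0.
  - by move=> x /FD; rewrite funeposE => ->; rewrite maxxx.
rewrite ge0_density_transfer.
- apply: eq_integral => t _; rewrite !funenegE -!EFinN -EFin_max -EFinM.
  by rewrite maxr_pMl// mul0r mulNr EFin_max.
- exact: measurable_funeneg.
- by move=> x; exact: funeneg_ge0.
- by move=> x /FD; rewrite funenegE => ->; rewrite oppe0 maxxx.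
Qed.

End density_transfer.

(** * The volume measure in charts *)

Section volume.
Context {R : realType} {n : nat} {M : manifold R n} (g : metric M).
Variable vol : {measure set (borel M) -> \bar R}.
Hypothesis volP : is_volume g vol.
Notation mR := (measurableTypeR R).

Lemma measurable_openM (A : set M) : open A -> measurable (A : set (borel M)).
Proof. by move=> oA; exact: sub_gen_smallest. Qed.

Lemma measurable_continuousM (f : M -> R) : continuous f ->
  measurable_fun setT (f : borel M -> R).
Proof.
move=> fc mD; apply: (measurability _ (RGenOInfty.measurableE R)) => //.
move=> /= _ [_ [x ->] <-]; rewrite setTI; apply: measurable_openM.
rewrite (_ : _ @^-1` _ = f @^-1` [set y | x < y]).
  by apply: open_comp; [move=> y _; exact: fc|exact: open_gt].
by apply/seteqP; split => y /=; rewrite in_itv/= andbT.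
Qed.

(** The inverse of the chart as a total measurable map: off the image, where [phiV] is arbitrary, it
    takes a default value, and [chart_density] is [0] there. *)
Definition unchart (i : chart M) (t : n.-tuple mR) : borel M :=
  if pselect (img i (rowt t)) then phiV i (rowt t) else point.

Lemma unchart_in i t : img i (rowt t) -> unchart i t = phiV i (rowt t).
Proof. by rewrite /unchart; case: pselect. Qed.

Lemma unchart_out i t : ~ img i (rowt t) -> unchart i t = point.
Proof. by rewrite /unchart; case: pselect. Qed.

Lemma measurable_unchart i : measurable_fun setT (unchart i).
Proof.
apply: (@measurability _ _ _ (borel M) setT (unchart i) (@open M) erefl).
move=> /= _ [A oA <-]; rewrite setTI.
have oU : open (img i `&` phiV i @^-1` A).
  rewrite openE => y [iy Ay]; rewrite /interior; apply: filterI; first exact: img_nbhs.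
  exact: (phiV_cts iy (open_nbhs_nbhs (conj oA Ay))).
have m1 := measurable_rowt_open oU.
have m2 := measurableC (measurable_rowt_open (@open_img _ _ M i)).
have [Ap|Ap] := pselect (A point).
  rewrite (_ : _ @^-1` A = @rowt R n @^-1` (img i `&` phiV i @^-1` A) `|`
      ~` (@rowt R n @^-1` img i)); first exact: measurableU.
  apply/seteqP; split => t /=.
    have [it|it] := pselect (img i (rowt t)); last by right.
    by rewrite unchart_in//; left.
  by move=> [[it At]|it]; [rewrite unchart_in|rewrite unchart_out].
rewrite (_ : _ @^-1` A = @rowt R n @^-1` (img i `&` phiV i @^-1` A))//.
apply/seteqP; split => t /=.
  have [it|it] := pselect (img i (rowt t)); first by rewrite unchart_in.
  by rewrite unchart_out.
by move=> [it At]; rewrite unchart_in.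
Qed.

Definition chart_density i : n.-tuple mR -> R :=
  (fun t => sqrtdet g i (rowt t)) \_ (@rowt R n @^-1` img i).

Lemma measurable_chart_density i : measurable_fun setT (chart_density i).
Proof.
apply/(measurable_restrictT _ (measurable_rowt_open (@open_img _ _ M i))).
apply: measurable_fun_rowt; first exact: open_img.
by move=> y iy; apply: smooth_on_cts iy; exact: sqrtdet_smooth.
Qed.

Lemma chart_density_ge0 i t : 0 <= chart_density i t.
Proof.
rewrite /chart_density patchE; case: ifPn => //; rewrite inE => it.
by rewrite ltW// sqrtdet_gt0.
Qed.

Lemma vol_chart i (A : set M) : measurable (A : set (borel M)) -> A `<=` dom i ->
  vol A = (\int[lebesgue_tuple n]_(t in unchart i @^-1` A) (chart_density i t)%:E)%E.
Proof.
move=> mA Ai; rewrite (volP mA Ai) integral_mkcond [RHS]integral_mkcond.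
apply: eq_integral => t _; rewrite !patchE.
have [it|it] := pselect (img i (rowt t)).
  have E : ((phi i @` A) (rowt t)) <-> A (unchart i t).
    rewrite unchart_in//; split=> [[x Ax <-]|At]; first by rewrite phiK//; exact: Ai.
    by exists (phiV i (rowt t)) => //; rewrite phiVK.
  have [At|At] := pselect (A (unchart i t)).
    rewrite mem_set; last exact/E.
    rewrite mem_set// /chart_density patchE mem_set//.
  rewrite memNset; last by move/E.
  by rewrite memNset.
rewrite memNset; last by move=> /= [x Ax xt]; apply: it; exists x => //; exact: Ai.
by case: ifPn => // _; rewrite /chart_density patchE memNset.
Qed.

Lemma chart_integral i (F : M -> R) (H : 'rV[R]_n -> R) :
  continuous F -> (forall x, ~ dom i x -> F x = 0) ->
  (forall y, img i y -> H y = F (phiV i y) * sqrtdet g i y) ->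
  (forall y, ~ img i y -> H y = 0) ->
  (\int[vol]_x (F x)%:E)%E = (\int[lebesgue_tuple n]_t (H (rowt t))%:E)%E.
Proof.
move=> Fc F0 H1 H2.
rewrite (density_transfer (@measurable_unchart i) (@measurable_chart_density i)
  (@chart_density_ge0 i) (@vol_chart i) (measurable_continuousM Fc) F0).
apply: eq_integral => t _; congr (_%:E); rewrite /chart_density patchE.
have [it|it] := pselect (img i (rowt t)).
  by rewrite mem_set// unchart_in// H1.
by rewrite memNset// mulr0 H2.
Qed.

(** On a compact box the continuous positive density lies between two positive constants, which
    compares the volume with that of a Euclidean box. Finiteness of the total volume and positivity
    on open sets both come from here. *)
Lemma vol_box i (y0 : 'rV[R]_n) r : 0 < r -> box y0 r `<=` img i ->
  measurable (phiV i @` box y0 r : set (borel M)) /\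
  (0 < vol (phiV i @` box y0 r) < +oo)%E.
Proof.
move=> r0 bi.
have cK : compact (phiV i @` box y0 r).
  apply: continuous_compact; last exact: box_compact.
  by apply: continuous_in_subspaceT => y /[1!inE] /bi iy; exact: phiV_cts.
have mK : measurable (phiV i @` box y0 r : set (borel M)).
  rewrite -[X in measurable X]setCK; apply: measurableC; apply: measurable_openM.
  by apply: closed_openC; apply: compact_closed cK; exact: points_hausdorff.
split => //; rewrite (vol_chart (i := i) mK); last by move=> _ [y /bi iy <-]; exact: dom_phiV.
have sc : {within box y0 r, continuous (sqrtdet g i)}.
  apply: continuous_in_subspaceT => y /[1!inE] /bi iy.
  by apply: smooth_on_cts iy; exact: sqrtdet_smooth.
have b0 : box y0 r !=set0 by exists y0 => a; rewrite subrr normr0 ltW.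
have [c /[1!inE] cb cm] := compact_EVT_min b0 (@box_compact _ _ y0 r) sc.
have [d /[1!inE] db dm] := compact_EVT_max b0 (@box_compact _ _ y0 r) sc.
pose B := [set t : n.-tuple mR | forall a, `|tnth t a - y0 0 a| <= r].
have mB : measurable B by exact: measurable_box.
have BE t : B t <-> box y0 r (rowt t).
  by split => H a; have := H a; rewrite /= !mxE.
have -> : (\int[lebesgue_tuple n]_(t in unchart i @^-1` (phiV i @` box y0 r))
    (chart_density i t)%:E = \int[lebesgue_tuple n]_(t in B) (chart_density i t)%:E)%E.
  rewrite integral_mkcond [RHS]integral_mkcond; apply: eq_integral => t _; rewrite !patchE.
  have [it|it] := pselect (img i (rowt t)); last first.
    have -> : chart_density i t = 0 by rewrite /chart_density patchE memNset.
    by case: ifP; case: ifP.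
  congr (if _ then _ else _); apply/idP/idP; rewrite !inE => H; last first.
    by rewrite /= unchart_in//; exists (rowt t) => //; exact/BE.
  move: H; rewrite /= unchart_in// => -[y yb E]; apply/BE.
  by rewrite -(phiVK it) -E phiVK//; exact: bi.
have lB : lebesgue_tuple n B = ((2 * r) ^+ n)%:E by exact: lebesgue_box (ltW r0).
have cB (k : R) : (\int[lebesgue_tuple n]_(t in B) k%:E)%E = (k * (2 * r) ^+ n)%:E.
  by rewrite integral_cst// EFinM; congr (_ * _)%E; exact: lB.
have mD : measurable_fun B (fun t => (chart_density i t)%:E).
  by apply/measurable_EFinP/measurable_funTS; exact: measurable_chart_density.
have DE t : B t -> chart_density i t = sqrtdet g i (rowt t).
  by move=> /BE /bi it; rewrite /chart_density patchE mem_set.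
apply/andP; split.
  apply: (@lt_le_trans _ _ (\int[lebesgue_tuple n]_(t in B) (sqrtdet g i c)%:E)%E).
    rewrite cB lte_fin mulr_gt0//.
      by apply: sqrtdet_gt0; exact: bi.
    by rewrite exprn_gt0// mulr_gt0.
  apply: ge0_le_integral => //.
  - by move=> t _; rewrite lee_fin ltW//; apply: sqrtdet_gt0; exact: bi.
  - move=> t Bt; rewrite lee_fin DE//; apply: cm; rewrite inE; exact/BE.
apply: (@le_lt_trans _ _ (\int[lebesgue_tuple n]_(t in B) (sqrtdet g i d)%:E)%E).
  apply: ge0_le_integral => //.
  - by move=> t _; rewrite lee_fin; exact: chart_density_ge0.
  - move=> t Bt; rewrite lee_fin DE//; apply: dm; rewrite inE; exact/BE.
by rewrite cB ltry.
Qed.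

Lemma vol_fin : compact [set: M] -> (vol setT < +oo)%E.
Proof.
rewrite compact_cover => cM.
have ch (x : M) : exists O : set M, [/\ open O, O x & (vol O < +oo)%E].
  have dx := chart_atP x; set i := chart_at x in dx.
  have [r r0 ri] := box_in_open (@open_img _ _ M i) (img_phi dx).
  have [mK /andP[_ vK]] := vol_box r0 ri.
  have oO : open (dom i `&` phi i @^-1` (interior (box (phi i x) r))).
    rewrite openE => z [dz bz]; rewrite /interior; apply: filterI; first exact: dom_nbhs.
    apply: (phi_cts dz); apply: open_nbhs_nbhs; split => //; exact: open_interior.
  exists (dom i `&` phi i @^-1` (interior (box (phi i x) r))); split => //.
    by split => //; exact: box_nbhs.
  apply: le_lt_trans vK; apply: le_measure; rewrite ?inE//; first exact: measurable_openM.
  by move=> z [dz bz]; exists (phi i z); [exact: interior_subset bz|exact: phiK].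
have [||D' D'D cov] := cM _ setT (fun x => projT1 (cid (ch x))).
- by move=> x _; case: cid => O [].
- by move=> x _; exists x => //; case: cid => O [].
have sf (s : seq M) : let B := \big[setU/set0]_(x <- s) projT1 (cid (ch x)) in
    open B /\ (vol B < +oo)%E.
  elim: s => [|x s [oB vB]]; first by rewrite big_nil; split; [exact: open0|rewrite measure0].
  rewrite big_cons; case: cid => O [oO _ vO] /=; split; first exact: openU.
  apply: (@le_lt_trans _ _ (vol O + vol (\big[setU/set0]_(x <- s) projT1 (cid (ch x))))%E).
    by apply: measureU2; exact: measurable_openM.
  by rewrite lte_add_pinfty.
have [oB vB] := sf (finmap.enum_fset D').
apply: le_lt_trans vB; apply: le_measure; rewrite ?inE; [exact: measurableT|exact: measurable_openM|].
by move=> z /cov[x D'x Ox]; rewrite -bigcup_seq; exists x.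
Qed.

Lemma vol_open_gt0 (O : set M) x : open O -> O x -> (0 < vol O)%E.
Proof.
move=> oO Ox; have dx := chart_atP x; set i := chart_at x in dx.
have oU : open (img i `&` phiV i @^-1` O).
  rewrite openE => y [iy Ay]; rewrite /interior; apply: filterI; first exact: img_nbhs.
  exact: (phiV_cts iy (open_nbhs_nbhs (conj oO Ay))).
have [|r r0 ri] := box_in_open oU (y0 := phi i x).
  by split; [exact: img_phi|rewrite /= phiK].
have [|mK /andP[vK _]] := vol_box r0 (i := i) (y0 := phi i x); first by move=> y /ri[].
apply: (lt_le_trans vK); apply: le_measure; rewrite ?inE//; first exact: measurable_openM.
by move=> _ [y /ri[_ Oy] <-].
Qed.

Hypothesis cM : compact [set: M].

Lemma continuousM_bounded (f : M -> R) : continuous f -> exists2 C, 0 <= C & forall x, `|f x| <= C.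
Proof.
move=> fc; have := compact_bounded (continuous_compact (continuous_subspaceT fc) cM).
move=> [C [_ CP]]; exists (`|C| + 1); first by rewrite addr_ge0.
by move=> v; apply: (CP (`|C| + 1)); [rewrite ltr_pwDr// ler_norm|exists v].
Qed.

Lemma continuousM_integrable (f : M -> R) : continuous f ->
  vol.-integrable setT (fun x => (f x)%:E).
Proof.
move=> fc; apply: measurable_bounded_integrable => //; first exact: vol_fin.
  exact: measurable_continuousM.
have [C C0 fC] := continuousM_bounded fc.
exists C; split; first exact: num_real.
by move=> D CD x _; exact: le_trans (fC x) (ltW CD).
Qed.

Lemma Rintegral_gt0 (f : M -> R) x : continuous f -> (forall z, 0 <= f z) -> 0 < f x ->
  0 < \int[vol]_z f z.
Proof.
move=> fc f0 fx.
pose O := f @^-1` [set y | f x / 2 < y].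
have oO : open O by apply: open_comp; [move=> y _; exact: fc|exact: open_gt].
have Ox : O x by rewrite /O/=; lra.
have vO := vol_open_gt0 oO Ox.
have mO := measurable_openM oO.
have fO : vol O \is a fin_num.
  rewrite ge0_fin_numE//; apply: le_lt_trans (vol_fin cM).
  by apply: le_measure; rewrite ?inE//; exact: measurableT.
have le1 : \int[vol]_(z in O) (f x / 2) <= \int[vol]_z f z.
  rewrite [leLHS]Rintegral_mkcond; apply: le_Rintegral => //.
  - rewrite (_ : EFin \o _ = (cst (f x / 2)%:E) \_ O); last first.
      by apply/funext => z; rewrite /= !patchE; case: ifP.
    apply/(integrable_mkcond _ mO); apply: measurable_bounded_integrable => //.
      by rewrite -ge0_fin_numE.
    by exists `|f x / 2|; split => // C fC z _ /=; exact: ltW.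
  - exact: continuousM_integrable.
  - by move=> z _; rewrite patchE; case: ifPn => //; rewrite inE => /ltW.
apply: lt_le_trans le1; rewrite Rintegral_cst// mulr_gt0//; first lra.
by rewrite fine_gt0// vO -ge0_fin_numE.
Qed.

End volume.

Lemma compact_cover_seq (T : ptopologicalType) (O : T -> set T) : compact [set: T] ->
  (forall x, open (O x)) -> (forall x, O x x) ->
  exists s : seq T, forall z, exists2 x, x \in s & O x z.
Proof.
rewrite compact_cover => cT oO Ox; have [||D' _ cov] := cT T setT O.
- by move=> x _; exact: oO.
- by move=> x _; exists x.
by exists (finmap.enum_fset D') => z; have [x xD bz] := cov z I; exists x.
Qed.

Section smooth_fun_closure.
Context {R : realType} {n : nat} {M : manifold R n}.
Implicit Types f h : M -> R.

Lemma smooth_funD f h : smooth_fun f -> smooth_fun h -> smooth_fun (fun x => f x + h x).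
Proof. by move=> fS hS i; exact: (smooth_onD (@open_img _ _ M i) (fS i) (hS i)). Qed.

Lemma smooth_funM f h : smooth_fun f -> smooth_fun h -> smooth_fun (fun x => f x * h x).
Proof. by move=> fS hS i; exact: (smooth_onM (@open_img _ _ M i) (fS i) (hS i)). Qed.

Lemma smooth_fun_cst (c : R) : @smooth_fun _ _ M (fun=> c).
Proof. by move=> i; exact: smooth_on_cst. Qed.

Lemma smooth_fun_sum I (r : seq I) (f : I -> M -> R) : (forall k, smooth_fun (f k)) ->
  smooth_fun (fun x => \sum_(k <- r) f k x).
Proof. by move=> fS i; apply: (smooth_on_sum r (@open_img _ _ M i)) => k; exact: fS. Qed.

Lemma smooth_funV f : smooth_fun f -> (forall x, 0 < f x) -> smooth_fun (fun x => (f x)^-1).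
Proof.
move=> fS f0 i; apply: (smooth_on_V (@open_img _ _ M i) (fS i)) => y _ /=.
by rewrite gt_eqF.
Qed.

Lemma smooth_fun_powR f (a : R) : smooth_fun f -> (forall x, 0 < f x) ->
  smooth_fun (fun x => f x `^ a).
Proof. by move=> fS f0 i; apply: (smooth_on_powR a (@open_img _ _ M i) (fS i)) => y _ /=. Qed.

Lemma near_phiV (i : chart M) x (P : M -> Prop) : dom i x -> (\forall z \near x, P z) ->
  \forall y \near phi i x, P (phiV i y).
Proof.
move=> dx Px; have := phiV_cts (img_phi dx).
by rewrite /prop_for /continuous_at phiK// => /(_ _ Px).
Qed.

Definition ext (i : chart M) (q : 'rV[R]_n -> R) (x : M) : R :=
  if pselect (dom i x) then q (phi i x) else 0.

Lemma ext_in i q x : dom i x -> ext i q x = q (phi i x).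
Proof. by rewrite /ext; case: pselect. Qed.

Lemma ext_out i q x : ~ dom i x -> ext i q x = 0.
Proof. by rewrite /ext; case: pselect. Qed.

Lemma ext_ge0 i q x : (forall y, 0 <= q y) -> 0 <= ext i q x.
Proof.
by move=> q0; have [dx|dx] := pselect (dom i x); [rewrite ext_in|rewrite ext_out].
Qed.

Lemma open_off_compact (i : chart M) (K : set 'rV[R]_n) : compact K -> K `<=` img i ->
  open (~` (phiV i @` K)).
Proof.
move=> cK Ki; apply: closed_openC; apply: compact_closed; first exact: points_hausdorff.
apply: continuous_compact cK.
by apply: continuous_in_subspaceT => y /[1!inE] /Ki iy; exact: phiV_cts.
Qed.

(** The support, compact in a Hausdorff space, is closed; its complement, where the extension is
    [0], covers [M] together with the domain of the chart. *)
Lemma ext_smooth (i : chart M) (q : 'rV[R]_n -> R) (K : set 'rV[R]_n) :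
  compact K -> K `<=` img i -> smooth_on (img i) q ->
  (forall y, img i y -> ~ K y -> q y = 0) -> smooth_fun (ext i q).
Proof.
move=> cK Ki qS q0; have oN := open_off_compact cK Ki.
apply: smooth_fun_local => x; have [dx|dx] := pselect (dom i x).
  exists i => //; exists (img i); first by split; [exact: open_img|exact: img_phi].
  apply: (smooth_on_ext (@open_img _ _ M i) _ qS) => y iy /=.
  by rewrite ext_in ?phiVK//; exact: dom_phiV.
have dj := chart_atP x; exists (chart_at x) => //.
have oU : open (img (chart_at x) `&` phiV (chart_at x) @^-1` (~` (phiV i @` K))).
  rewrite openE => y [iy Ay]; rewrite /interior; apply: filterI; first exact: img_nbhs.
  exact: (phiV_cts iy (open_nbhs_nbhs (conj oN Ay))).
exists (img (chart_at x) `&` phiV (chart_at x) @^-1` (~` (phiV i @` K))).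
  split => //; split; first exact: img_phi.
  by rewrite /= phiK// => -[y /Ki iy yx]; apply: dx; rewrite -yx; exact: dom_phiV.
have c : smooth_on (img (chart_at x) `&` phiV (chart_at x) @^-1` (~` (phiV i @` K)))
    (fun=> 0 : R) by exact: smooth_on_cst.
apply: (smooth_on_ext oU _ c) => y [jy yK] /=.
have [dz|dz] := pselect (dom i (phiV (chart_at x) y)); last by rewrite ext_out.
rewrite ext_in// q0//; first exact: img_phi.
by move=> Kz; apply: yK; exists (phi i (phiV (chart_at x) y)); rewrite ?phiK.
Qed.

End smooth_fun_closure.

(** * Green's formula and chart independence of the Laplacian *)

Section green.
Context {R : realType} {n : nat} {M : manifold R n} (g : metric M).
Variable vol : {measure set (borel M) -> \bar R}.
Hypothesis volP : is_volume g vol.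
Hypothesis cM : compact [set: M].
Local Notation E a := (delta_mx 0 a : 'rV[R]_n).
Implicit Types (f h : M -> R) (i j : chart M).

Definition Gam h f (x : M) : R :=
  gam g (chart_at x) (h \o phiV (chart_at x)) (f \o phiV (chart_at x)) (phi (chart_at x) x).

Lemma Gam_chart i h f x : smooth_fun h -> smooth_fun f -> dom i x ->
  Gam h f x = gam g i (h \o phiV i) (f \o phiV i) (phi i x).
Proof.
by move=> hS fS dx; apply: (gam_change g (hS i) (fS i)) => //; exact: chart_atP.
Qed.

Lemma gam_near0 i (h k : 'rV[R]_n -> R) y : (\forall z \near y, h z = 0) -> gam g i h k y = 0.
Proof.
move=> h0; apply: big1 => a _; apply: big1 => b _.
rewrite (near_eq_derive (g := cst 0))//.
by rewrite derive_cst mulr0 mul0r.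
Qed.

Lemma Gam_near0 h f x : (\forall z \near x, h z = 0) -> Gam h f x = 0.
Proof.
by move=> h0; apply: gam_near0; exact: near_phiV (chart_atP x) h0.
Qed.

(** The Laplacian computed in a prescribed chart; it is [lapc_le], used in both directions, that
    removes the dependence on [i]. *)
Definition lapc i f (x : M) : R := lap g i (f \o phiV i) (phi i x).

Lemma integral_bigsum_fin d (T : measurableType d) (mu : {measure set T -> \bar R})
    I (s : seq I) (F : I -> T -> R) :
  (forall k, mu.-integrable setT (fun x => (F k x)%:E)) ->
  mu.-integrable setT (fun x => (\sum_(k <- s) F k x)%:E) /\
  (\int[mu]_x (\sum_(k <- s) F k x)%:E = \sum_(k <- s) \int[mu]_x (F k x)%:E)%E.
Proof.
move=> iF; elim: s => [|k s [IH1 IH2]].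
  rewrite big_nil (_ : (fun x => _) = cst 0%E); last by apply/funext => x; rewrite big_nil.
  by split; [exact: integrable0|exact: integral0].
rewrite big_cons (_ : (fun x => _) = (fun x => (F k x)%:E + (\sum_(k <- s) F k x)%:E)%E).
  split; first exact: integrableD.
  by rewrite integralD// IH2.
by apply/funext => x; rewrite big_cons EFinD.
Qed.

Section local.
Variables (i : chart M) (p f : M -> R) (K : set 'rV[R]_n).
Hypotheses (cK : compact K) (Ki : K `<=` img i) (pS : smooth_fun p) (fS : smooth_fun f)
  (pK : forall x, p x != 0 -> dom i x /\ K (phi i x)).

Let oK : open (~` K).
Proof. by apply: closed_openC; apply: compact_closed; [exact: norm_hausdorff|]. Qed.

Let p0 y : img i y -> ~ K y -> p (phiV i y) = 0.
Proof.
move=> iy Ky; apply: contrapT => /eqP/pK[_]; rewrite phiVK//.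
Qed.

Let q y := (p \o phiV i) y * lap g i (f \o phiV i) y + gam g i (p \o phiV i) (f \o phiV i) y.

Let pnear0 y : ~ K y -> \forall z \near y, img i z -> p (phiV i z) = 0.
Proof. by move=> Ky; apply: (open_near oK Ky) => z Kz iz; exact: p0. Qed.

Let qS : smooth_on (img i) q.
Proof.
have oU := @open_img _ _ M i; apply: (smooth_onD oU).
  apply: (smooth_onM oU); [exact: pS|]; apply: (lap_smooth g oU); [by []|exact: fS].
apply: (smooth_on_sum _ oU) => a; apply: (smooth_on_sum _ oU) => b.
apply: (smooth_onM oU); last by apply: smooth_on_D; exact: fS.
apply: (smooth_onM oU); first exact: ginv_smooth.
by apply: smooth_on_D; exact: pS.
Qed.

Let q0 y : img i y -> ~ K y -> q y = 0.
Proof.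
move=> iy Ky; rewrite /q /= p0// mul0r add0r; apply: gam_near0.
by apply: filterS2 (img_nbhs iy) (pnear0 Ky) => z iz; exact.
Qed.

Lemma local_greenE : (fun x => p x * lapc i f x + Gam p f x) = ext i q.
Proof.
apply/funext => x; have [dx|dx] := pselect (dom i x).
  by rewrite ext_in// /q /= phiK// (Gam_chart pS fS dx).
have off z : ~ (phiV i @` K) z -> p z = 0.
  move=> zK; apply: contrapT => /eqP/pK[dz Kz]; apply: zK.
  by exists (phi i z) => //; exact: phiK.
rewrite ext_out// Gam_near0 ?addr0; last first.
  apply: (open_near (open_off_compact cK Ki)) => // -[y /Ki iy yx].
  by apply: dx; rewrite -yx; exact: dom_phiV.
rewrite off ?mul0r// => -[y /Ki iy yx].
by apply: dx; rewrite -yx; exact: dom_phiV.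
Qed.

Lemma local_green_smooth : smooth_fun (fun x => p x * lapc i f x + Gam p f x).
Proof. by rewrite local_greenE; exact: ext_smooth cK Ki qS q0. Qed.

Let fl a y : R := if pselect (img i y) then (p \o phiV i) y * flux g i (f \o phiV i) y a else 0.

Let fl_in a y : img i y -> fl a y = (p \o phiV i) y * flux g i (f \o phiV i) y a.
Proof. by rewrite /fl; case: pselect. Qed.

Let fl0 a y : ~ K y -> fl a y = 0.
Proof. by move=> Ky; rewrite /fl; case: pselect => // iy; rewrite /= p0// mul0r. Qed.

Let pfS a : smooth_on (img i) (fun y => (p \o phiV i) y * flux g i (f \o phiV i) y a).
Proof.
have oU := @open_img _ _ M i; apply: (smooth_onM oU); first exact: pS.
by apply: (flux_smooth g a oU); [by []|exact: fS].
Qed.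

Let flS a : smooth_on setT (fl a).
Proof.
apply: smooth_on_local => y _; have [iy|iy] := pselect (img i y).
  exists (img i); first by split => //; exact: open_img.
  by apply: (smooth_on_ext (@open_img _ _ M i) _ (pfS a)) => z iz; rewrite fl_in.
have Ky : ~ K y by move=> /Ki.
exists (~` K); first (split; [exact: oK|exact: Ky]).
have c : smooth_on (~` K) (fun=> 0 : R) by exact: smooth_on_cst.
by apply: (smooth_on_ext oK _ c) => z Kz; rewrite fl0.
Qed.

Let fl_sum y : img i y -> \sum_a 'D_(E a) (fl a) y = ext i q (phiV i y) * sqrtdet g i y.
Proof.
move=> iy; rewrite ext_in ?phiVK//; last exact: dom_phiV.
have oU := @open_img _ _ M i; have s0 := sqrtdet_gt0 g iy.
have D a : 'D_(E a) (fl a) y = p (phiV i y) * 'D_(E a) (fun z => flux g i (f \o phiV i) z a) y +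
    flux g i (f \o phiV i) y a * 'D_(E a) (p \o phiV i) y.
  rewrite (near_eq_derive (g := fun y => (p \o phiV i) y * flux g i (f \o phiV i) y a)); last first.
    by apply: (open_near oU iy) => z iz; exact: fl_in.
  have d1 : derivable (p \o phiV i) y (E a) by apply: smooth_on_derivable iy; exact: pS.
  have d2 : derivable (fun z => flux g i (f \o phiV i) z a) y (E a).
    by apply: smooth_on_derivable iy; apply: (flux_smooth g a oU); [by []|exact: fS].
  exact: (deriveM d1 d2).
rewrite (eq_bigr _ (fun a _ => D a)) big_split/= /q mulrDl; congr (_ + _).
  by rewrite -big_distrr/= /lap /= -mulrA; congr (_ * _); rewrite mulrAC mulVf ?mul1r// gt_eqF.
rewrite /gam big_distrl/=; apply: eq_bigr => a _.
rewrite /flux mulrC mulrCA mulrC; congr (_ * _).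
rewrite big_distrr/=; apply: eq_bigr => b _.
by rewrite (ginv_sym g b a iy) mulrA mulrC mulrA.
Qed.

(** Multiplied by [sqrtdet], the integrand is the divergence of [p] times the flux of [f]. As [p] is
    compactly supported in the chart, this field extends by [0] to a smooth compactly supported one
    on the whole space, whose divergence integrates to [0]. *)
Lemma local_green : (\int[vol]_x (p x * lapc i f x + Gam p f x)%:E = 0)%E.
Proof.
rewrite [X in integral _ _ X](_ : _ = (fun x => (ext i q x)%:E)); last first.
  by apply/funext => x; rewrite -local_greenE.
pose H y := \sum_a 'D_(E a) (fl a) y.
have eS : smooth_fun (ext i q) by exact: ext_smooth cK Ki qS q0.
have [L L0 KL] : exists2 L : R, 0 <= L & K `<=` cube L.
  have [C [_ CP]] := compact_bounded cK; exists (`|C| + 1); first by rewrite addr_ge0.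
  move=> y Ky a; apply: le_trans (ler_norm_coord _ _) _.
  by apply: (CP (`|C| + 1)) => //; rewrite ltr_pwDr// ler_norm.
have fl0' a y : ~ cube L y -> fl a y = 0 by move=> cy; apply: fl0 => /KL.
have Dfl a y : ~ K y -> 'D_(E a) (fl a) y = 0.
  move=> Ky; rewrite (near_eq_derive (g := cst 0)) ?derive_cst//.
  by apply: (open_near oK Ky) => z; exact: fl0.
rewrite (chart_integral volP (i := i) (H := H)).
- have iD a : (lebesgue_tuple n).-integrable setT (fun t => ('D_(E a) (fl a) (rowt t))%:E).
    apply: (@integrable_rowt R n ('D_(E a) (fl a)) L L0).
      by move=> y; apply: smooth_on_cts I; apply: smooth_on_D; exact: flS.
    by move=> y cy; apply: Dfl => /KL.
  have [_] := integral_bigsum_fin (index_enum 'I_n) iD.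
  rewrite /H => ->; apply: big1 => a _.
  exact: (lebesgue_divergence0 a L0 (flS a) (fl0' a)).
- exact: (smooth_fun_continuous eS).
- by move=> x dx; rewrite ext_out.
- by move=> y iy; exact: fl_sum.
- by move=> y iy; apply: big1 => a _; apply: Dfl => /Ki.
Qed.

End local.

Lemma lapc_continuous i f : smooth_fun f ->
  forall x, dom i x -> {for x, continuous (lapc i f)}.
Proof.
move=> fS x dx; apply: (@continuous_comp _ _ _ (phi i) (lap g i (f \o phiV i))).
  exact: phi_cts.
apply: smooth_on_cts (img_phi dx); apply: (lap_smooth g (@open_img _ _ M i)); [by []|exact: fS].
Qed.

(** If the inequality failed at [x], it would fail on a neighbourhood. Test [local_green] in both
    charts against one bump supported there: the gradient terms are the same, so the difference is
    the integral of a nonnegative function that is positive at [x], yet both integrals vanish. *)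
Lemma lapc_le i j f x : smooth_fun f -> dom i x -> dom j x -> lapc i f x <= lapc j f x.
Proof.
move=> fS di dj; rewrite leNgt; apply/negP => lt.
pose P z := dom j z /\ lapc j f z < lapc i f z.
have nP : \forall z \near x, P z.
  apply: filterI; first exact: dom_nbhs.
  have c : {for x, continuous (fun z => lapc i f z - lapc j f z)}.
    by apply: cvgB; exact: lapc_continuous.
  have : lapc i f x - lapc j f x > 0 by rewrite subr_gt0.
  move=> lt0; have N := c _ (lt_nbhsr lt0).
  by apply: (@filterS _ (nbhs x) _ _ _ _ N) => z /=; rewrite subr_gt0.
have nV : \forall y \near phi i x, img i y /\ P (phiV i y).
  apply: filterI; first exact: img_nbhs (img_phi di).
  exact: near_phiV.
have [r r0 rP] : exists2 r : R, 0 < r & box (phi i x) r `<=` [set y | img i y /\ P (phiV i y)].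
  have [r r0 rP] := box_in_open (@open_interior _ [set y | img i y /\ P (phiV i y)]) nV.
  by exists r => // y /rP; exact: interior_subset.
have bi : box (phi i x) r `<=` img i by move=> y /rP[].
pose p := ext i (bump_rV (phi i x) r).
have pS : smooth_fun p.
  apply: (ext_smooth (@box_compact _ _ (phi i x) r) bi).
    by apply: bump_rV_smooth; exact: open_img.
  by move=> y _; apply: bump_rV_out; exact: ltW.
have pK z : p z != 0 -> dom i z /\ box (phi i x) r (phi i z).
  have [dz|dz] := pselect (dom i z); last by rewrite /p ext_out ?eqxx.
  rewrite /p ext_in// => pz; split => //; apply: contrapT => bz.
  by move: pz; rewrite bump_rV_out ?eqxx// ltW.
(* The support of the bump as seen in the chart [j], which makes the same test function admissible
   in both charts. *)
pose K' := phi j @` (phiV i @` box (phi i x) r).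
have pK' z : p z != 0 -> dom j z /\ K' (phi j z).
  move=> /pK[dz bz]; have [_ []] := rP _ bz; rewrite phiK// => djz _.
  split => //; exists z => //; exists (phi i z) => //; exact: phiK.
have cK' : compact K'.
  apply: continuous_compact; last apply: continuous_compact; last exact: box_compact.
    apply: continuous_in_subspaceT => z /[1!inE] -[y /rP[iy [djy _]] <-].
    exact: phi_cts.
  by apply: continuous_in_subspaceT => y /[1!inE] /rP[iy _]; exact: phiV_cts.
have K'j : K' `<=` img j.
  by move=> _ [_ [y /rP[iy [djy _]] <-] <-]; exact: img_phi.
have g1 := local_green (@box_compact _ _ (phi i x) r) bi pS fS pK.
have g2 := local_green cK' K'j pS fS pK'.
have s1 := smooth_fun_continuous (local_green_smooth (@box_compact _ _ (phi i x) r) bi pS fS pK).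
have s2 := smooth_fun_continuous (local_green_smooth cK' K'j pS fS pK').
pose F z := (p z * lapc i f z + Gam p f z) - (p z * lapc j f z + Gam p f z).
have Fc : continuous F by move=> z; apply: cvgB; [exact: s1|exact: s2].
have FE z : F z = p z * (lapc i f z - lapc j f z) by rewrite /F; ring.
have p_ge0 z : 0 <= p z.
  by apply: ext_ge0 => y; exact: bump_rV_ge0.
have : 0 < \int[vol]_z F z.
  apply: (Rintegral_gt0 volP cM (x := x) Fc) => [z|].
    rewrite FE; have [->|pz] := eqVneq (p z) 0; first by rewrite mul0r.
    rewrite mulr_ge0// subr_ge0 ltW//; have [dz bz] := pK _ pz.
    by have [_ []] := rP _ bz; rewrite phiK.
  rewrite FE mulr_gt0//; last by rewrite subr_gt0.
  by rewrite /p ext_in// bump_rV_gt0.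
rewrite RintegralB//; last 2 first.
  exact: continuousM_integrable volP cM _ s1.
  exact: continuousM_integrable volP cM _ s2.
by rewrite /Rintegral g1 g2 subrr ltxx.
Qed.

Lemma laplacian_chart i f x : smooth_fun f -> dom i x ->
  laplacian g f x = lap g i (f \o phiV i) (phi i x).
Proof.
move=> fS dx; rewrite laplacian_lap; have dj := chart_atP x.
apply/eqP; rewrite eq_le; apply/andP; split.
  exact: (lapc_le fS dj dx).
exact: (lapc_le fS dx dj).
Qed.

Lemma laplacian_smooth f : smooth_fun f -> smooth_fun (laplacian g f).
Proof.
move=> fS i; have oU := @open_img _ _ M i.
apply: (smooth_on_ext oU _ (lap_smooth g oU (fun y iy => iy) (fS i))) => y iy /=.
by rewrite (laplacian_chart fS (dom_phiV iy)) phiVK.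
Qed.

Lemma grad2_Gam f : grad2 g f = Gam f f.
Proof. by apply/funext => x; rewrite grad2_gam. Qed.

Lemma Gam_smooth h f : smooth_fun h -> smooth_fun f -> smooth_fun (Gam h f).
Proof.
move=> hS fS i; have oU := @open_img _ _ M i.
have S : smooth_on (img i) (gam g i (h \o phiV i) (f \o phiV i)).
  apply: (smooth_on_sum _ oU) => a; apply: (smooth_on_sum _ oU) => b.
  apply: (smooth_onM oU); last by apply: smooth_on_D; exact: fS.
  apply: (smooth_onM oU); first exact: ginv_smooth.
  by apply: smooth_on_D; exact: hS.
apply: (smooth_on_ext oU _ S) => y iy /=.
by rewrite (Gam_chart hS fS (dom_phiV iy)) phiVK.
Qed.

Lemma Gam_suml I (s : seq I) (h : I -> M -> R) f x : (forall k, smooth_fun (h k)) ->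
  Gam (fun z => \sum_(k <- s) h k z) f x = \sum_(k <- s) Gam (h k) f x.
Proof.
move=> hS; rewrite /Gam /gam [RHS]exchange_big/=; apply: eq_bigr => a _.
rewrite [RHS]exchange_big/=; apply: eq_bigr => b _.
have dh k : is_derive (phi (chart_at x) x) (E a) (h k \o phiV (chart_at x))
    ('D_(E a) (h k \o phiV (chart_at x)) (phi (chart_at x) x)).
  apply: derivableP; apply: smooth_on_derivable (hS k (chart_at x)) _.
  exact: img_phi (chart_atP x).
have [_ dE] := is_derive_bigsum s dh.
rewrite (_ : (fun z => \sum_(k <- s) h k z) \o phiV (chart_at x) =
  fun y => \sum_(k <- s) (h k \o phiV (chart_at x)) y)//.
by rewrite dE big_distrr/= big_distrl/=.
Qed.

(** A partition of unity made of normalized bumps cuts the first factor into pieces, each compactly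
    supported in a chart; the second factor stays whole, and the local identities add up. *)
Lemma green f : smooth_fun f ->
  \int[vol]_x (f x * laplacian g f x) = - \int[vol]_x grad2 g f x.
Proof.
move=> fS.
have loc (x : M) : exists r, 0 < r /\ box (phi (chart_at x) x) r `<=` img (chart_at x).
  by have [r r0 rP] := box_in_open (@open_img _ _ M _) (img_phi (chart_atP x)); exists r.
pose r x := projT1 (cid (loc x)).
have r0 x : 0 < r x by rewrite /r; case: cid => ? [].
have ri x : box (phi (chart_at x) x) (r x) `<=` img (chart_at x) by rewrite /r; case: cid => ? [].
pose b (x : M) := ext (chart_at x) (bump_rV (phi (chart_at x) x) (r x)).
have bS x : smooth_fun (b x).
  apply: (ext_smooth (@box_compact _ _ (phi (chart_at x) x) (r x)) (ri x)).
    by apply: bump_rV_smooth; exact: open_img.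
  by move=> y _; apply: bump_rV_out; exact: ltW.
have bK x z : b x z != 0 -> dom (chart_at x) z /\ box (phi (chart_at x) x) (r x) (phi (chart_at x) z).
  have [dz|dz] := pselect (dom (chart_at x) z); last by rewrite /b ext_out ?eqxx.
  rewrite /b ext_in// => pz; split => //; apply: contrapT => bz.
  by move: pz; rewrite bump_rV_out ?eqxx// ltW.
have b_ge0 x z : 0 <= b x z by apply: ext_ge0 => y; exact: bump_rV_ge0.
have bx x : 0 < b x x by rewrite /b ext_in ?bump_rV_gt0//; exact: chart_atP.
have [s sP] : exists s : seq M, forall z, exists2 x, x \in s & 0 < b x z.
  apply: (compact_cover_seq cM (O := fun x => [set z | 0 < b x z])) => [x|x]; last exact: bx.
  apply: (@open_comp _ _ (b x) [set t | 0 < t]); last exact: open_gt.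
  by move=> y _; exact: (smooth_fun_continuous (bS x)).
pose S z := \sum_(x <- s) b x z.
have S0 z : 0 < S z.
  have [x xs bz] := sP z; rewrite /S (perm_big _ (perm_to_rem xs))/= big_cons.
  by rewrite ltr_pwDl// sumr_ge0.
have SS : smooth_fun S by exact: smooth_fun_sum.
pose p (x z : M) := b x z * (S z)^-1 * f z.
have pS x : smooth_fun (p x).
  exact: (smooth_funM (smooth_funM (bS x) (smooth_funV SS S0)) fS).
have pK x z : p x z != 0 -> dom (chart_at x) z /\ box (phi (chart_at x) x) (r x) (phi (chart_at x) z).
  by rewrite /p => H; apply: bK; apply: contra H => /eqP ->; rewrite !mul0r.
pose F x z := p x z * lapc (chart_at x) f z + Gam (p x) f z.
have cK x := @box_compact _ _ (phi (chart_at x) x) (r x).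
have FS x : smooth_fun (F x) := local_green_smooth (cK x) (ri x) (pS x) fS (pK x).
have F0 x : (\int[vol]_z (F x z)%:E = 0)%E := local_green (cK x) (ri x) (pS x) fS (pK x).
have psum z : \sum_(x <- s) p x z = f z.
  by rewrite -big_distrl -big_distrl/= -/(S z) divff ?mul1r// gt_eqF.
have FE z : \sum_(x <- s) F x z = f z * laplacian g f z + grad2 g f z.
  rewrite big_split/= -Gam_suml//; congr (_ + _).
    rewrite -[in RHS](psum z) big_distrl/=; apply: eq_bigr => x _.
    have [->|pz] := eqVneq (p x z) 0; first by rewrite !mul0r.
    by rewrite (laplacian_chart fS (pK _ _ pz).1).
  by rewrite grad2_Gam; congr (Gam _ f z); apply/funext => y; exact: psum.
have iF x := continuousM_integrable volP cM (smooth_fun_continuous (FS x)).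
have [_] := integral_bigsum_fin s iF.
rewrite [RHS]big1; last by move=> x _; exact: F0.
move=> Z.
have c1 : continuous (fun x => f x * laplacian g f x).
  exact: (smooth_fun_continuous (smooth_funM fS (laplacian_smooth fS))).
have c2 : continuous (grad2 g f).
  by rewrite grad2_Gam; exact: (smooth_fun_continuous (Gam_smooth fS fS)).
apply/eqP; rewrite -addr_eq0 -RintegralD//; last 2 first.
  exact: continuousM_integrable volP cM _ c1.
  exact: continuousM_integrable volP cM _ c2.
apply/eqP; rewrite /Rintegral.
rewrite [X in integral _ _ X](_ : _ = (fun x => (\sum_(k <- s) F k x)%:E)) ?Z//.
by apply/funext => x; rewrite FE.
Qed.

End green.

(** * Smooth functions on space-time *)

Section affine.
Context {R : realType}.

(** Slices and projections of space-time are affine, and along an affine map a derivative in the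
    direction [v] is one in the direction [L v]. This works between arbitrary normed spaces. *)
Lemma Ck_affine (V W X : normedModType R) k (U : set V) (O : set W) (f : W -> X)
    (s : V -> W) (L : V -> W) :
  open U -> continuous s -> (forall (h : R) v u, s (h *: v + u) = h *: L v + s u) ->
  (forall x, U x -> O (s x)) -> Ck k O f -> Ck k U (f \o s).
Proof.
move=> oU sc sL UO; elim: k f => [|k IH] f [fc fd]; split => //.
- by move=> x Ux; apply: continuous_comp; [exact: sc|apply: fc; exact: UO].
- by move=> x Ux; apply: continuous_comp; [exact: sc|apply: fc; exact: UO].
move=> v; have [dv Cv] := fd (L v); split=> [x Ux|].
  by apply: (derivable_slice (fun h => sL h v x)); apply: dv; exact: UO.
apply: (Ck_ext oU _ (IH _ Cv)) => x Ux.
by apply/esym; apply: derive_slice => h; exact: sL.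
Qed.

Lemma smooth_on_affine (V W X : normedModType R) (U : set V) (O : set W) (f : W -> X)
    (s : V -> W) (L : V -> W) :
  open U -> continuous s -> (forall (h : R) v u, s (h *: v + u) = h *: L v + s u) ->
  (forall x, U x -> O (s x)) -> smooth_on O f -> smooth_on U (f \o s).
Proof.
move=> oU sc sL UO /smooth_onP fC; apply/smooth_onP => k.
exact: Ck_affine oU sc sL UO (fC k).
Qed.

End affine.

Section spacetime.
Context {R : realType} {n : nat} {M : manifold R n} (g : metric M).
Hypothesis lapC : forall i f x, smooth_fun f -> dom i x ->
  laplacian g f x = lap g i (f \o phiV i) (phi i x).
Local Notation ST := (R * 'rV[R]_n)%type.
Local Notation E a := (delta_mx 0 a : 'rV[R]_n).
Implicit Types (i j : chart M) (F G : R -> M -> R).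

Definition stdom (a : R) i : set ST := [set z | a < z.1 /\ img i z.2].

Definition st (F : R -> M -> R) i (z : ST) : R := F z.1 (phiV i z.2).

Definition st_smooth (a : R) F := forall i, smooth_on (stdom a i) (st F i).

Lemma open_stdom a i : open (stdom a i).
Proof.
rewrite (_ : stdom a i = (fst @^-1` [set t : R | a < t]) `&` (snd @^-1` img i)).
  apply: openI; apply: open_comp.
  - by move=> z _; exact: cvg_fst.
  - exact: open_gt.
  - by move=> z _; exact: cvg_snd.
  - exact: open_img.
by apply/seteqP; split.
Qed.

Lemma open_gtR (a : R) : open [set t : R | a < t].
Proof. exact: open_gt. Qed.

Lemma st_smoothS a b F : a <= b -> st_smooth a F -> st_smooth b F.
Proof.
move=> ab FS i; apply: smooth_onS (FS i) => z [zb iz]; split => //.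
exact: le_lt_trans zb.
Qed.

Lemma smooth_spacetime_st u : smooth_spacetime u -> st_smooth 0 u.
Proof.
move=> uS i; have [_ + _] := uS i; apply: smooth_onS.
move=> z zd; apply: filterS (open_nbhs_nbhs (conj (@open_stdom 0 i) zd)).
by move=> w [w0 iw]; split => //; exact: ltW.
Qed.

Lemma st_smoothB a F G : st_smooth a F -> st_smooth a G -> st_smooth a (fun t x => F t x - G t x).
Proof. by move=> FS GS i; exact: (smooth_onB (@open_stdom a i) (FS i) (GS i)). Qed.

Lemma st_smoothM a F G : st_smooth a F -> st_smooth a G -> st_smooth a (fun t x => F t x * G t x).
Proof. by move=> FS GS i; exact: (smooth_onM (@open_stdom a i) (FS i) (GS i)). Qed.

Lemma st_smooth_cst a (c : R) : st_smooth a (fun _ _ => c).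
Proof. by move=> i; exact: smooth_on_cst. Qed.

Lemma st_smooth_powR a F (b : R) : st_smooth a F -> (forall t x, a < t -> 0 < F t x) ->
  st_smooth a (fun t x => F t x `^ b).
Proof.
move=> FS F0 i; apply: (smooth_on_powR b (@open_stdom a i) (FS i)) => z [za iz].
exact: F0.
Qed.

Lemma st_smoothV a F : st_smooth a F -> (forall t x, a < t -> 0 < F t x) ->
  st_smooth a (fun t x => (F t x)^-1).
Proof.
move=> FS F0 i; apply: (smooth_on_V (@open_stdom a i) (FS i)) => z [za iz].
by rewrite gt_eqF//; exact: F0.
Qed.

Lemma st_smooth_space a (f : M -> R) : smooth_fun f -> st_smooth a (fun _ x => f x).
Proof.
move=> fS i; apply: (@smooth_on_affine _ _ _ _ _ (img i) (f \o phiV i) snd snd (@open_stdom a i)) => //.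
- by move=> z; exact: cvg_snd.
- by move=> z [].
Qed.

Lemma st_smooth_time (a : R) (q : R -> R) : smooth_on [set t : R | a < t] q -> st_smooth a (fun t _ => q t).
Proof.
move=> qS i; apply: (@smooth_on_affine _ _ _ _ _ [set t : R | a < t] q fst fst (@open_stdom a i)) => //.
- by move=> z; exact: cvg_fst.
- by move=> z [].
Qed.

Lemma pair_continuousl (V W : normedModType R) (v : V) : continuous (fun w : W => (v, w)).
Proof. by move=> w; apply: cvg_pair => /=; [exact: cvg_cst|exact: cvg_id]. Qed.

Lemma pair_continuousr (V W : normedModType R) (w : W) : continuous (fun v : V => (v, w)).
Proof. by move=> v; apply: cvg_pair => /=; [exact: cvg_id|exact: cvg_cst]. Qed.

Lemma slice_rV (t : R) (h : R) (v y : 'rV[R]_n) :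
  ((t, h *: v + y) : ST) = h *: ((0, v) : ST) + (t, y).
Proof. by apply/pair_equal_spec; split => //=; rewrite scaler0 add0r. Qed.

Lemma slice_R (y : 'rV[R]_n) (h : R) (v t : R) :
  ((h *: v + t, y) : ST) = h *: ((v, 0) : ST) + (t, y).
Proof. by apply/pair_equal_spec; split => //=; rewrite scaler0 add0r. Qed.

Lemma st_smooth_slice a F t : st_smooth a F -> a < t -> smooth_fun (F t).
Proof.
move=> FS ta i.
apply: (@smooth_on_affine _ _ _ _ _ (stdom a i) (st F i) (fun y => (t, y)) (fun v => (0, v))
  (@open_img _ _ M i)) => //.
- exact: pair_continuousl.
- by move=> h v y; exact: slice_rV.
Qed.

Lemma st_smooth_point a F x : st_smooth a F -> smooth_on [set t : R | a < t] (F^~ x).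
Proof.
move=> FS; have dx := chart_atP x.
have := @smooth_on_affine _ _ _ _ [set t : R | a < t] (stdom a (chart_at x)) (st F (chart_at x))
  (fun t => (t, phi (chart_at x) x)) (fun v => (v, 0)) (@open_gtR a).
move=> /(_ (@pair_continuousr _ _ _)) /(_ (fun h v t => slice_R _ h v t)) H.
apply: (smooth_on_ext (@open_gtR a) _ (H _ (FS _))) => [t _|t /= ta].
  by rewrite /st /= phiK.
by split => //=; exact: img_phi.
Qed.

Lemma st_smooth_continuous a F t x : st_smooth a F -> a < t ->
  {for (t, x), continuous (fun z : R * M => F z.1 z.2)}.
Proof.
move=> FS ta; have dx := chart_atP x; set i := chart_at x in dx.
have c1 : {for (t, x), continuous (fun z : R * M => (z.1, phi i z.2))}.
  have c0 : {for (t, x), continuous (fun z : R * M => phi i z.2)}.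
    by apply: (@continuous_comp _ _ _ snd (phi i)); [exact: cvg_snd|exact: phi_cts].
  exact: (cvg_pair (@cvg_fst _ _ (nbhs t) (nbhs x) _) c0).
have c2 : {for (t, phi i x), continuous (st F i)}.
  by apply: smooth_on_cts (FS i) _; split => //=; exact: img_phi.
have c := continuous_comp (g := st F i) c1 c2.
have N : {near (t, x), (st F i) \o (fun z : R * M => (z.1, phi i z.2)) =1 (fun z : R * M => F z.1 z.2)}.
  have : \forall z \near (t, x), dom i z.2.
    by apply: (@cvg_snd _ _ (nbhs t) (nbhs x)); exact: dom_nbhs.
  by apply: filterS => z dz; rewrite /st /= phiK.
rewrite /prop_for /continuous_at -[X in _ --> X](nbhs_singleton N).
by apply: cvg_trans c; apply: near_eq_cvg; apply: filterS N => z ->.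
Qed.

Definition dt F (t : R) (x : M) : R := 'D_1 (F^~ x) t.

Lemma dtE F i t y : dt F t (phiV i y) = 'D_((1, 0) : ST) (st F i) (t, y).
Proof.
rewrite /dt; apply: (@derive_slice R R ST R (st F i) (fun t => (t, y)) t 1 (1, 0)) => h.
exact: slice_R.
Qed.

Lemma st_smooth_dt a F : st_smooth a F -> st_smooth a (dt F).
Proof.
move=> FS i; have S := smooth_on_D ((1, 0) : ST) (FS i).
by apply: (smooth_on_ext (@open_stdom a i) _ S) => -[t y] _; rewrite /st /= dtE.
Qed.

Lemma st_is_derive a F t x : st_smooth a F -> a < t -> is_derive t 1 (F^~ x) (dt F t x).
Proof.
move=> FS ta; apply: derivableP; apply: smooth_on_derivable (st_smooth_point x FS) _.
exact: ta.
Qed.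

Lemma derive_st F i t y v : 'D_v (F t \o phiV i) y = 'D_((0, v) : ST) (st F i) (t, y).
Proof.
by apply: (@derive_slice R _ ST R (st F i) (fun y => (t, y)) y v (0, v)) => h; exact: slice_rV.
Qed.

Lemma derive2_st F i t y v w : 'D_v ('D_w (F t \o phiV i)) y =
  'D_((0, v) : ST) ('D_((0, w) : ST) (st F i)) (t, y).
Proof.
rewrite (_ : 'D_w (F t \o phiV i) = 'D_((0, w) : ST) (st F i) \o (fun y => (t, y))).
  by apply: derive_slice => h; exact: slice_rV.
by apply/funext => z; exact: derive_st.
Qed.

(** The Laplacians of all the slices as one operator on functions of space-time, so that smoothness
    in time and commutation with [dt] reduce to rules for directional derivatives. *)
Definition st_lap F i (z : ST) : R :=
  \sum_a \sum_b ginv g i z.2 a b * 'D_((0, E a) : ST) ('D_((0, E b) : ST) (st F i)) z +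
  \sum_b drift g i z.2 b * 'D_((0, E b) : ST) (st F i) z.

Lemma laplacian_st a F i t y : st_smooth a F -> a < t -> img i y ->
  laplacian g (F t) (phiV i y) = st_lap F i (t, y).
Proof.
move=> FS ta iy; have Ft := st_smooth_slice FS ta.
rewrite (lapC Ft (dom_phiV iy)) phiVK//.
apply: etrans (lapE g (@open_img _ _ M i) (fun y iy => iy) (Ft i) iy) _.
apply: f_equal2.
  apply: eq_bigr => c _; apply: eq_bigr => b _.
  exact: (f_equal (fun d => ginv g i y c b * d) (derive2_st F i t y (E c) (E b))).
apply: eq_bigr => b _.
exact: (f_equal (fun d => drift g i y b * d) (derive_st F i t y (E b))).
Qed.

Lemma smooth_on_snd a i (q : 'rV[R]_n -> R) : smooth_on (img i) q ->
  smooth_on (stdom a i) (fun z => q z.2).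
Proof.
move=> qS; apply: (@smooth_on_affine _ _ _ _ _ (img i) q snd snd (@open_stdom a i)) => //.
- by move=> z; exact: cvg_snd.
- by move=> z [].
Qed.

Lemma st_smooth_laplacian a F : st_smooth a F -> st_smooth a (fun t => laplacian g (F t)).
Proof.
move=> FS i; have oU := @open_stdom a i.
have S : smooth_on (stdom a i) (st_lap F i).
  apply: (smooth_onD oU).
    apply: (smooth_on_sum _ oU) => c; apply: (smooth_on_sum _ oU) => b; apply: (smooth_onM oU).
      exact: (smooth_on_snd (q:= fun y => ginv g i y c b) (a:=a) (ginv_smooth g c b)).
    by do 2 apply: smooth_on_D; exact: FS.
  apply: (smooth_on_sum _ oU) => b; apply: (smooth_onM oU).
    exact: (smooth_on_snd (q:= fun y => drift g i y b) (a:=a) (drift_smooth g b)).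
  by apply: smooth_on_D; exact: FS.
apply: (smooth_on_ext oU _ S) => -[t y] [/= ta iy].
by rewrite /st /= (laplacian_st FS ta iy).
Qed.

(** The coefficients in a chart do not depend on time, so this is the symmetry of mixed derivatives
    between the time direction and the spatial ones. *)
Lemma dt_laplacian a F t x : st_smooth a F -> a < t ->
  dt (fun s => laplacian g (F s)) t x = laplacian g (dt F t) x.
Proof.
move=> FS ta; have dx := chart_atP x; set i := chart_at x in dx.
rewrite -(phiK dx); set y := phi i x; have iy : img i y by exact: img_phi.
have oU := @open_stdom a i; have Uy : stdom a i (t, y) by split.
rewrite dtE (laplacian_st (st_smooth_dt FS) ta iy).
have N : {near (t, y), st (fun s => laplacian g (F s)) i =1 st_lap F i}.
  apply: (open_near oU Uy) => -[s z] [/= sa iz].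
  by rewrite /st /= (laplacian_st FS sa iz).
rewrite (near_eq_derive _ N).
have N1 : st (dt F) i = 'D_((1, 0) : ST) (st F i).
  by apply/funext => -[s z]; rewrite {1}/st /= dtE.
have cD (q : 'rV[R]_n -> R) (h : ST -> R) : smooth_on (img i) q -> smooth_on (stdom a i) h ->
    is_derive ((t, y) : ST) (1, 0) (fun z => q z.2 * h z) (q y * 'D_((1, 0) : ST) h (t, y)).
  move=> qS hS.
  have dq : is_derive ((t, y) : ST) (1, 0) (fun z => q z.2) 0.
    have d : derivable (fun z : ST => q z.2) (t, y) (1, 0).
      exact: smooth_on_derivable (@smooth_on_snd a i q qS) Uy.
    split => //; have := @derive_slice R ST 'rV[R]_n R q snd (t, y) (1, 0) 0.
    by rewrite derive0 => ->// h; rewrite /= !scaler0.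
  have dh : derivable h (t, y) (1, 0) by exact: smooth_on_derivable hS Uy.
  have := is_deriveM dq (derivableP dh); move/is_derive_eq; apply.
  by rewrite scaler0 addr0.
have S1 b : smooth_on (stdom a i) ('D_((0, E b) : ST) (st F i)) by apply: smooth_on_D; exact: FS.
have S2 c b : smooth_on (stdom a i) ('D_((0, E c) : ST) ('D_((0, E b) : ST) (st F i))).
  exact: smooth_on_D.
have T1 b z : stdom a i z -> 'D_((1, 0) : ST) ('D_((0, E b) : ST) (st F i)) z =
    'D_((0, E b) : ST) (st (dt F) i) z.
  by move=> Uz; rewrite N1; apply: schwarz (FS i) Uz.
rewrite /st_lap.
have d1 : is_derive ((t, y) : ST) (1, 0)
    (fun z => \sum_c \sum_b ginv g i z.2 c b * 'D_((0, E c) : ST) ('D_((0, E b) : ST) (st F i)) z)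
    (\sum_c \sum_b ginv g i y c b * 'D_((0, E c) : ST) ('D_((0, E b) : ST) (st (dt F) i)) (t, y)).
  apply: is_derive_bigsum => c; apply: is_derive_bigsum => b.
  have e : 'D_((1, 0) : ST) ('D_((0, E c) : ST) ('D_((0, E b) : ST) (st F i))) (t, y) =
      'D_((0, E c) : ST) ('D_((0, E b) : ST) (st (dt F) i)) (t, y).
    apply: etrans (schwarz _ _ oU (S1 b) Uy) _; apply: near_eq_derive.
    exact: (open_near oU Uy) (T1 b).
  exact: (is_derive_eq (cD (fun y => ginv g i y c b) _ (ginv_smooth g c b) (S2 c b))
    (f_equal (fun d => ginv g i y c b * d) e)).
have d2 : is_derive ((t, y) : ST) (1, 0)
    (fun z => \sum_b drift g i z.2 b * 'D_((0, E b) : ST) (st F i) z)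
    (\sum_b drift g i y b * 'D_((0, E b) : ST) (st (dt F) i) (t, y)).
  apply: is_derive_bigsum => b.
  exact: (is_derive_eq (cD (fun y => drift g i y b) _ (drift_smooth g b) (S1 b))
    (f_equal (fun d => drift g i y b * d) (T1 b _ Uy))).
by have [_ ->] := is_deriveD d1 d2.
Qed.

End spacetime.

(** * The normalized flow *)

Section linear_ode.
Context {R : realType}.
Implicit Types (a b t : R) (f r : R -> R).

Lemma Ck_of_derivative k (U : set R) f F : open U -> Ck k U f ->
  (forall t, U t -> is_derive t 1 F (f t)) -> Ck k.+1 U F.
Proof.
move=> oU fS dF.
have dd t : U t -> differentiable F t by move=> Ut; apply/derivable1_diffP; have [] := dF t Ut.
split => [t Ut|v]; first exact: differentiable_continuous (dd t Ut).
split=> [t Ut|]; first exact: diff_derivable (dd t Ut).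
have S : Ck k U (fun t => v * f t).
  by apply: CkM => //; move: k {fS}; apply/smooth_onP; exact: smooth_on_cst.
apply: (Ck_ext oU _ S) => t Ut; rewrite (derive_dir1 v (dd t Ut)).
by have [_ ->] := dF t Ut.
Qed.

Lemma smooth_on_of_derivative (U : set R) f F : open U -> smooth_on U f ->
  (forall t, U t -> is_derive t 1 F (f t)) -> smooth_on U F.
Proof.
move=> oU /smooth_onP fS dF; apply/smooth_onP => -[|k]; last exact: Ck_of_derivative dF.
by have [] := Ck_of_derivative oU (fS 0) dF.
Qed.

Lemma smooth_on_expR (U : set R) : open U -> smooth_on U expR.
Proof.
move=> oU; apply/smooth_onP; elim=> [|k IH]; first by split => // t _; exact: continuous_expR.
by apply: (Ck_of_derivative oU IH) => t _; exact: is_derive_expR.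
Qed.

Lemma smooth_primitive a b f : a < b -> smooth_on [set t : R | a < t] f ->
  exists2 F : R -> R, smooth_on [set t : R | b < t] F &
    forall t, b < t -> is_derive t 1 F (f t).
Proof.
move=> ab fS.
pose F t := (\int[lebesgue_measure]_(s in [set` Interval (BLeft b) (BRight t)]) f s)%R.
have dF t : b < t -> is_derive t 1 F (f t).
  move=> bt; have [] := @continuous_FTC1_closed R f b t (t + 1).
  - by rewrite ltrDl.
  - apply: continuous_compact_integrable; first exact: segment_compact.
    apply: continuous_in_subspaceT => s; rewrite inE /= in_itv /= => /andP[bs _].
    by apply: smooth_on_cts fS _; exact: lt_le_trans bs.
  - exact: bt.
  - by apply: smooth_on_cts fS _; exact: lt_trans bt.
  by move=> d e; split; [exact: d|exact: etrans (esym (derive1E _ _)) e].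
exists F => //; apply: smooth_on_of_derivative dF; first exact: open_gt.
by apply: smooth_onS fS => t /=; exact: lt_trans.
Qed.

Lemma deriv_MVT (F f : R -> R) a b : a <= b ->
  (forall t, a <= t <= b -> is_derive t 1 F (f t)) ->
  exists2 t, a <= t <= b & F b - F a = f t * (b - a).
Proof.
move=> ab dF; have [||t] := @MVT_segment R F f a b ab.
- by move=> t; rewrite in_itv /= => /andP[at_ tb]; apply: dF; rewrite !ltW.
- apply: derivable_within_continuous => t; rewrite in_itv /= => tab.
  by have [] := dF t tab.
by rewrite in_itv /= => tab E; exists t.
Qed.

(** Integrating factor: with [P' = r] and [Q' = b exp(- b P)], the solution is [exp(b P)] times a
    constant plus the increment of [Q]. It is taken from the time [2] on, with a margin on the left,
    so that later arguments work on an open set of times containing [2]. *)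
Lemma linear_ode (b s : R) r : 0 < b -> 0 < s -> smooth_on [set t : R | 0 < t] r ->
  exists a (q : R -> R), [/\ 0 < a < 2, smooth_on [set t : R | a < t] q,
    forall t, a < t -> 0 < q t, q 2 = s &
    forall t, a < t -> is_derive t 1 q (b * (1 + r t * q t))].
Proof.
move=> b0 s0 rS.
(* Two successive primitives, each on a half-line strictly inside the previous one: they start at
   [1/2] and [1], which leaves room before [2]. *)
have o12 : 0 < 2^-1 :> R by rewrite invr_gt0.
have [P PS dP] := smooth_primitive o12 rS.
have oH : open [set t : R | 2^-1 < t] by exact: open_gt.
have expS (c : R) : smooth_on [set t : R | 2^-1 < t] (fun t => expR (c * P t)).
  have cS : smooth_on [set t : R | 2^-1 < t] (fun t => c * P t).
    have cS' : smooth_on [set t : R | 2^-1 < t] (fun=> c : R) by exact: smooth_on_cst.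
    exact: (smooth_onM oH cS' PS).
  exact: (smooth_on_comp1 oH (smooth_on_expR openT) cS (fun _ _ => I)).
have h1 : 2^-1 < 1 :> R by rewrite invf_lt1// ltr1n.
have bS : smooth_on [set t : R | 2^-1 < t] (fun=> b : R) by exact: smooth_on_cst.
have [Q QS dQ] := smooth_primitive h1 (smooth_onM oH bS (expS (- b))).
have oU : open [set t : R | 1 < t] by exact: open_gt.
pose q t := expR (b * P t) * (s * expR (- b * P 2) + (Q t - Q 2)).
have qS : smooth_on [set t : R | 1 < t] q.
  have E1 : smooth_on [set t : R | 1 < t] (fun t => expR (b * P t)).
    by apply: smooth_onS (expS b) => t; exact: lt_trans.
  have cS (c : R) : smooth_on [set t : R | 1 < t] (fun=> c) by exact: smooth_on_cst.
  exact: (smooth_onM oU E1 (smooth_onD oU (cS _) (smooth_onB oU QS (cS _)))).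
have q2 : q 2 = s.
  by rewrite /q subrr addr0 mulrCA -expRD mulNr subrr expR0 mulr1.
have dq t : 1 < t -> is_derive t 1 q (b * (1 + r t * q t)).
  move=> t1; have t2 := lt_trans h1 t1.
  have dE : is_derive t 1 (fun t => expR (b * P t)) (expR (b * P t) * (b * r t)).
    have H : is_derive t 1 (fun t => b * P t) (b * r t) := is_deriveZ b (dP t t2).
    have := @is_derive1_comp R expR (fun t => b * P t) t _ _ (is_derive_expR _) H; move/is_derive_eq; apply.
    by rewrite mulrC.
  have dQ' : is_derive t 1 (fun t => s * expR (- b * P 2) + (Q t - Q 2))
      (b * expR (- b * P t)).
    have := is_deriveD (is_derive_cst (s * expR (- b * P 2)) t 1)
      (is_deriveB (dQ t t1) (is_derive_cst (Q 2) t 1)).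
    by move/is_derive_eq; apply; rewrite add0r subr0.
  have := is_deriveM dE dQ'; move/is_derive_eq; apply.
  rewrite /GRing.scale /= /q.
  have e1 : expR (b * P t) * expR (- b * P t) = 1 by rewrite -expRD mulNr subrr expR0.
  move: e1; move: (expR _) (expR (- b * P t)) (s * _ + _) => X Y Z e1.
  by rewrite mulrCA e1; ring.
have q0 t : 2 <= t -> 0 < q t.
  move=> t2; rewrite /q mulr_gt0// ?expR_gt0// ltr_wpDr//; last by rewrite mulr_gt0// expR_gt0.
  have [|x /andP[x2 xt] ->] := @deriv_MVT Q (fun t => b * expR (- b * P t)) 2 t t2.
    by move=> x /andP[x2 _]; apply: dQ; apply: lt_le_trans x2; rewrite ltr1n.
  by rewrite mulr_ge0 ?subr_ge0// mulr_ge0 ?expR_ge0// ltW.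
have c2 : {for 2, continuous q} by apply: smooth_on_cts qS _; rewrite /= ltr1n.
(* Past [2] the explicit formula gives positivity; on the left of [2] it holds by continuity, and
   this determines [a]. *)
have /nbhs_ballP[e /= e0 qe] : \forall t \near (2 : R), 0 < q t.
  by apply: (cvgr_gt _ c2); rewrite q2.
exists (Num.max 1 (2 - e)), q; split => //.
- by rewrite lt_max ltr01 gt_max ltr1n gtrBl e0.
- by apply: smooth_onS qS => t /=; rewrite gt_max => /andP[].
- move=> t; rewrite gt_max => /andP[_ te]; have [/q0//|t2] := leP 2 t.
  by apply: qe; rewrite /ball /= gtr0_norm ?subr_gt0// ltrBlDr addrC -ltrBlDr.
- by move=> t; rewrite gt_max => /andP[/dq].
Qed.

End linear_ode.

Section minimum.
Context {R : realType}.

Lemma smooth_local_min (V : normedModType R) (U : set V) (f : V -> R) x v :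
  open U -> smooth_on U f -> U x -> (\forall y \near x, f x <= f y) ->
  'D_v f x = 0 /\ 0 <= 'D_v ('D_v f) x.
Proof.
move=> oU fS Ux fm.
have nU : \forall y \near x, U y by apply: (open_near oU Ux).
have [e e0 E] := line_ball v (filterI fm nU).
have x0 : 0 *: v + x = x by rewrite scale0r add0r.
have := @second_derivative_max R (fun s : R => - f (s *: v + x))
  (fun s : R => - 'D_v f (s *: v + x)) (- 'D_v ('D_v f) x) e e0.
rewrite x0 => -[||| d1 d2].
- by move=> s se; apply: is_deriveN; apply: (smooth_line_derive fS); have [] := E s se.
- by move=> s se; rewrite lerN2; have [] := E s se.
- apply: is_deriveN; rewrite -[X in is_derive _ _ _ ('D_v ('D_v f) X)]x0.
  by apply: smooth_line_derive (smooth_on_D v fS) _; rewrite x0.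
by split; [rewrite -['D_v f x]opprK d1 oppr0|rewrite -oppr_le0].
Qed.

Context {n : nat} {M : manifold R n} (g : metric M).

Lemma lap_min (U : set 'rV[R]_n) (i : chart M) (h : 'rV[R]_n -> R) y : open U -> U `<=` img i -> smooth_on U h -> U y ->
  (\forall z \near y, h y <= h z) -> 0 <= lap g i h y.
Proof.
move=> oU Ui hS Uy hm; rewrite (lapE g oU Ui hS Uy).
rewrite [X in _ + X]big1 ?addr0; last first.
  by move=> b _; have [-> _] := smooth_local_min (delta_mx 0 b) oU hS Uy hm; rewrite mulr0.
have [S SE] := posdef_cholesky (ginv_posdef g (Ui _ Uy)).
rewrite (hess_cholesky oU hS Uy SE); apply: sumr_ge0 => c _.
by have [_] := smooth_local_min (row c S) oU hS Uy hm.
Qed.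

Lemma laplacian_min (f : M -> R) x : smooth_fun f -> (forall z, f x <= f z) ->
  0 <= laplacian g f x.
Proof.
move=> fS fm; rewrite laplacian_lap; set i := chart_at x.
have dx : dom i x by exact: chart_atP.
apply: (@lap_min (img i)); [exact: open_img|by []|exact: fS|exact: img_phi|].
by near=> z; rewrite /= (phiK dx).
Unshelve. all: by end_near. Qed.

End minimum.

Section spacetime_max.
Context {R : realType} {n : nat} {M : manifold R n}.
Hypothesis cM : compact [set: M].
Implicit Types F : R -> M -> R.

Lemma st_smooth_within a F t0 t1 : st_smooth a F -> a < t0 ->
  {within `[t0, t1]%classic `*` [set: M], continuous (fun z : R * M => F z.1 z.2)}.
Proof.
move=> FS at0; apply: continuous_in_subspaceT => -[t x]; rewrite inE /= => -[+ _].
rewrite /= in_itv /= => /andP[t0t _].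
exact: st_smooth_continuous FS (lt_le_trans at0 t0t).
Qed.

Lemma st_bounded a F t0 t1 : st_smooth a F -> a < t0 ->
  exists2 C : R, 0 <= C & forall t x, t0 <= t <= t1 -> `|F t x| <= C.
Proof.
move=> FS at0.
have cK : compact (`[t0, t1]%classic `*` [set: M]) by apply: compact_setX => //; exact: segment_compact.
have := continuous_compact (st_smooth_within (t1 := t1) FS at0) cK.
move=> /compact_bounded[N [_ HN]]; exists (Num.max 0 (N + 1)); first by rewrite le_max lexx.
move=> t x tt; apply: (HN (Num.max 0 (N + 1))); first by rewrite lt_max ltrDl ltr01 orbT.
by exists (t, x).
Qed.

Lemma st_max_principle a F t0 t1 (C : R) : st_smooth a F -> a < t0 ->
  (forall x, F t0 x <= 0) ->
  (forall t x, t0 < t <= t1 -> 0 < F t x -> (forall y, F t y <= F t x) ->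
    dt F t x <= C * F t x) ->
  forall t x, t0 <= t <= t1 -> F t x <= 0.
Proof.
move=> FS at0 F0 FC t x tt.
apply: (max_principle cM (st_smooth_within (t1 := t1) FS at0) (fun x _ => F0 x) _ tt I (C := C)).
move=> s z /[dup] st /andP[t0s _] _ Fp Fm; exists (dt F s z).
  exact: st_is_derive FS (lt_trans at0 t0s).
by apply: FC => // y; exact: Fm.
Qed.

End spacetime_max.

(** * Monotonicity and two-sided bounds of the normalized solution *)

Section normalized.
Context {R : realType} {n : nat} {M : manifold R n} (g : metric M).
Hypothesis cM : compact [set: M].
Hypothesis lapC : forall i f x, smooth_fun f -> dom i x ->
  laplacian g f x = lap g i (f \o phiV i) (phi i x).
Variables (c p : R) (psi : M -> R).
Hypotheses (c0 : 0 < c) (p1 : 1 < p) (psiS : smooth_fun psi) (psi0 : forall x, psi x < 0).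
Variables (a : R) (kap : R -> R) (U : R -> M -> R).
Hypotheses (a2 : a < 2) (kapS : smooth_on [set t : R | a < t] kap).
Hypotheses (kap0 : forall t, a < t -> 0 < kap t).
Hypotheses (US : st_smooth a U) (U0 : forall t x, a < t -> 0 < U t x).

(** The right-hand side of the normalized equation without its time factor; for a positive function
    it vanishes exactly when [c lap U - psi U = U^p]. *)
Definition speed t x : R :=
  U t x `^ (1 - p) * (c * laplacian g (U t) x - psi x * U t x) - U t x.

Hypothesis UE : forall t x, a < t -> dt U t x = kap t * speed t x.
Hypothesis speed2 : forall x, speed 2 x <= 0.

Lemma dt_speed t x : a < t -> let v := dt U t x in
  is_derive t 1 (speed^~ x) ((1 - p) * (speed t x + U t x) / U t x * v +
    U t x `^ (1 - p) * (c * laplacian g (dt U t) x - psi x * v) - v).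
Proof.
move=> ta v.
have dU : is_derive t 1 (U^~ x) v by exact: st_is_derive US ta.
have Up := U0 x ta.
have dP : is_derive t 1 (fun s => U s x `^ (1 - p)) ((1 - p) * U t x `^ (- p) * v).
  have := @is_derive1_comp R (fun y => y `^ (1 - p)) (U^~ x) t _ _ (is_derive1_powR (1 - p) Up) dU.
  by move/is_derive_eq; apply; rewrite addrAC subrr add0r.
have dL : is_derive t 1 (fun s => laplacian g (U s) x) (laplacian g (dt U t) x).
  have := st_is_derive x (st_smooth_laplacian lapC US) ta.
  by move/is_derive_eq; apply; exact: dt_laplacian.
have dE : is_derive t 1 (fun s => c * laplacian g (U s) x - psi x * U s x)
    (c * laplacian g (dt U t) x - psi x * v).
  exact: (is_deriveB (is_deriveZ c dL) (is_deriveZ (psi x) dU)).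
have := is_deriveB (is_deriveM dP dE) dU; move/is_derive_eq; apply.
have e1 : U t x `^ (1 - p) = U t x * U t x `^ (- p) by rewrite -{2}(powRr1 (ltW Up)) -powRD// (gt_eqF Up) implybT.
have alg (P X Y Z w k : R) : w != 0 -> P = w * X ->
    P * Y + Z * ((1 - p) * X * k) - k = (1 - p) * (P * Z - w + w) / w * k + P * Y - k.
  by move=> w0 ->; field.
exact: alg (lt0r_neq0 Up) e1.
Qed.

(** At a positive spatial maximum of [dt U] its Laplacian is nonpositive, and the term carrying
    [1 - p] is negative because [speed] and [U] are positive. What is kept is linear in [dt U], as
    the maximum principle requires. *)
Lemma dt_dt_le t x : a < t -> 0 < dt U t x -> (forall y, dt U t y <= dt U t x) ->
  dt (dt U) t x <= ('D_1 kap t * (kap t)^-1 - kap t * U t x `^ (1 - p) * psi x) * dt U t x.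
Proof.
move=> ta vp vm; have dv := st_is_derive x (st_smooth_dt US) ta.
have dk : is_derive t 1 kap ('D_1 kap t).
  by apply: derivableP; exact: smooth_on_derivable kapS _.
have := is_deriveM dk (dt_speed x ta).
have N : {near t, dt U ^~ x =1 (fun s => kap s * speed s x)}.
  apply: (open_near (U := [set t : R | a < t]) _ ta) => [|s sa]; [exact: open_gt|exact: UE].
have -> : dt (dt U) t x = 'D_1 (fun s => kap s * speed s x) t by exact: near_eq_derive.
move=> [_ ->]; have kp := kap0 ta.
have lm : laplacian g (dt U t) x <= 0.
  exact: (laplacian_max g (st_smooth_slice (st_smooth_dt US) ta) vm).
have Up := U0 x ta; have XP := powR_gt0 (1 - p) Up.
rewrite /GRing.scale /=.
have sE : speed t x = dt U t x / kap t by rewrite UE// mulrAC mulfV ?mul1r// gt_eqF.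
have sp : 0 < speed t x by rewrite sE divr_gt0.
move: sE sp lm vp XP; move: (dt U t x) (laplacian _ _ _) (U t x `^ _) (speed t x) => v L X z zE zp lm vp XP.
have e : 0 <= (p - 1) * ((z + U t x) / U t x * v).
  by rewrite mulr_ge0 ?subr_ge0 ?ltW// mulr_gt0// divr_gt0// addr_gt0.
have e2 : 0 <= - (X * (c * L)).
  by rewrite -mulrN -mulrN mulr_ge0 ?(ltW XP)// mulr_ge0 ?oppr_ge0// ltW.
rewrite -subr_ge0.
rewrite (_ : _ - _ = kap t * ((p - 1) * ((z + U t x) / U t x * v) + - (X * (c * L)) + v)).
  by rewrite mulr_ge0 ?(ltW kp)// addr_ge0 ?(ltW vp)// addr_ge0.
by rewrite zE; field; rewrite !gt_eqF.
Qed.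

Lemma dt_le0 t x : 2 <= t -> dt U t x <= 0.
Proof.
move=> t2; have vS := st_smooth_dt US.
have oA : open [set t : R | a < t] by exact: open_gt.
have kS := st_smooth_time (M := M) kapS.
have BS : st_smooth a (fun t x => 'D_1 kap t * (kap t)^-1 - kap t * U t x `^ (1 - p) * psi x).
  apply: st_smoothB.
    apply: st_smoothM; first by apply: st_smooth_time; exact: smooth_on_D.
    by apply: st_smoothV => // s y; exact: kap0.
  apply: st_smoothM (st_smooth_space (a := a) psiS); apply: st_smoothM kS _.
  exact: st_smooth_powR.
have [C C0 CB] := st_bounded cM t BS a2.
apply: (@st_max_principle _ _ _ cM a (dt U) 2 t C vS a2); last by rewrite t2 lexx.
  by move=> y; rewrite UE// pmulr_rle0 ?kap0.
move=> s y /andP[s2 st] vp vm; apply: le_trans (dt_dt_le (lt_trans a2 s2) vp vm) _.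
rewrite ler_pM2r//; apply: le_trans (ler_norm _) _; apply: CB.
by rewrite ltW.
Qed.

Lemma U_nincr s t x : 2 <= s -> s <= t -> U t x <= U s x.
Proof.
move=> s2 st; rewrite -subr_le0.
have [|r /andP[sr _] ->] := @deriv_MVT R (U^~ x) (fun r => dt U r x) s t st.
  by move=> r /andP[sr _]; apply: st_is_derive US _; rewrite (lt_le_trans a2)// (le_trans s2).
by rewrite mulr_le0_ge0 ?subr_ge0//; exact: dt_le0 (le_trans s2 sr).
Qed.

Lemma smooth_pos_lbound (f : M -> R) : smooth_fun f -> (forall x, 0 < f x) ->
  exists2 b : R, 0 < b & forall x, b <= f x.
Proof.
move=> fS f0; have [b b0 Hb] := continuousM_bounded cM (smooth_fun_continuous (smooth_funV fS f0)).
have b1 : 0 < b + 1 by rewrite ltr_wpDl.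
exists (b + 1)^-1 => [|x]; first by rewrite invr_gt0.
rewrite -[leRHS]invrK lef_pV2 ?posrE ?invr_gt0//.
apply: le_trans (ler_norm _) _; apply: le_trans (Hb x) _.
by rewrite lerDl.
Qed.

Lemma dt_cstB (k : R) t x : a < t -> dt (fun t x => k - U t x) t x = - dt U t x.
Proof.
move=> ta; have [_ e] := is_deriveB (is_derive_cst k t (1 : R)) (st_is_derive x US ta).
by apply: etrans e _; rewrite sub0r.
Qed.

(** The upper bound is monotonicity. For the lower one, at a spatial minimum below a suitable level
    the reaction term [- psi U^(1-p)] is at least [1], so [dt U] is nonnegative there and the level
    cannot be crossed downwards. *)
Lemma U_bounds : exists a0 a1 : R, 0 < a0 /\ forall t x, 2 <= t -> a0 <= U t x <= a1.
Proof.
have U2S := st_smooth_slice US a2.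
have [a1 _ Ua1] := continuousM_bounded cM (smooth_fun_continuous U2S).
have [m1 m10 H1] := smooth_pos_lbound U2S (fun x => U0 x a2).
have NS : smooth_fun (fun x => - psi x) by move=> i; apply: smooth_onN; [exact: open_img|exact: psiS].
have [|m2 m20 H2] := smooth_pos_lbound NS; first by move=> x; rewrite oppr_gt0.
have p10 : 0 < p - 1 by rewrite subr_gt0.
(* [m1] settles the time [2]; since [- psi >= m2], a value of [U] below [m2^(1/(p-1))] satisfies
   [U^(p-1) <= - psi]. *)
pose a0 := Num.min m1 (m2 `^ (p - 1)^-1).
have a00 : 0 < a0 by rewrite lt_min m10 powR_gt0.
exists a0, a1; split => // t x t2; apply/andP; split; last first.
  by apply: le_trans (U_nincr x (lexx 2) t2) _; exact: le_trans (ler_norm _) (Ua1 x).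
rewrite -subr_le0.
have FS := st_smoothB (st_smooth_cst (a := a) a0) US.
apply: (@st_max_principle _ _ _ cM a _ 2 t 0 FS a2 _ _ t x); last by rewrite t2 lexx.
  by move=> y; rewrite subr_le0; apply: le_trans (H1 y); rewrite ge_min lexx.
move=> s y /andP[s2 st]; rewrite subr_gt0 => Ua Um.
have sa := lt_trans a2 s2.
rewrite mul0r dt_cstB// oppr_le0 UE//; have kp := kap0 sa; have Up := U0 y sa.
have lm : 0 <= laplacian g (U s) y.
  apply: laplacian_min; first exact: st_smooth_slice US sa.
  by move=> z; have := Um z; rewrite lerD2l lerN2.
have XP := powR_gt0 (1 - p) Up.
rewrite mulr_ge0 ?(ltW kp)// /speed.
have k : 1 <= U s y `^ (1 - p) * - psi y.
  have -> : 1 - p = - (p - 1) by rewrite opprB.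
  rewrite powRN mulrC ler_pdivlMr ?powR_gt0// mul1r; apply: le_trans (H2 y).
  have e : m2 = (m2 `^ (p - 1)^-1) `^ (p - 1) by rewrite -powRrM mulVf ?gt_eqF// powRr1// ltW.
  rewrite [leRHS]e; apply: ge0_ler_powR; rewrite ?nnegrE ?powR_ge0 ?(ltW Up) ?(ltW p10)//.
  by apply: ltW; apply: lt_le_trans Ua _; rewrite ge_min lexx orbT.
move: (U s y) (U s y `^ (1 - p)) (psi y) (laplacian g (U s) y) lm XP k Up => u X q L lm XP k Up.
rewrite (_ : _ - _ = X * (c * L) + (X * - q - 1) * u); last by ring.
by rewrite addr_ge0 ?mulr_ge0 ?subr_ge0 ?(ltW XP) ?(ltW c0) ?(ltW Up).
Qed.

End normalized.

Section laplacian_scale.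
Context {R : realType} {n : nat} {M : manifold R n} (g : metric M).
Hypothesis lapC : forall i f x, smooth_fun f -> dom i x ->
  laplacian g f x = lap g i (f \o phiV i) (phi i x).

Lemma smooth_deriveZ (V : normedModType R) (U : set V) (f : V -> R) (k : R) x v :
  smooth_on U f -> U x -> 'D_v (fun y => k * f y) x = k * 'D_v f x.
Proof.
move=> fS Ux; have [_ e] := is_deriveZ k (derivableP (smooth_on_derivable (v := v) fS Ux)).
exact: e.
Qed.

Lemma smooth_derive2Z (V : normedModType R) (U : set V) (f : V -> R) (k : R) x v w :
  open U -> smooth_on U f -> U x ->
  'D_v ('D_w (fun y => k * f y)) x = k * 'D_v ('D_w f) x.
Proof.
move=> oU fS Ux; apply: etrans _ (smooth_deriveZ k v (smooth_on_D w fS) Ux).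
by apply: near_eq_derive; apply: (open_near oU Ux) => y Uy; exact: smooth_deriveZ fS Uy.
Qed.

Lemma laplacianZ f (k : R) x : smooth_fun f ->
  laplacian g (fun x => k * f x) x = k * laplacian g f x.
Proof.
move=> fS; have dx := chart_atP x; set i := chart_at x in dx.
have oU := @open_img _ _ M i.
have kS : smooth_fun (fun x => k * f x) := smooth_funM (smooth_fun_cst k) fS.
have iy := img_phi dx.
apply: etrans (lapC kS dx) _; apply: etrans _ (f_equal (fun z => k * z) (esym (lapC fS dx))).
apply: etrans (lapE g oU (fun y iy => iy) (kS i) iy) _.
apply: etrans _ (f_equal (fun z => k * z) (esym (lapE g oU (fun y iy => iy) (fS i) iy))).
apply: etrans _ (esym (mulrDr _ _ _)); apply: f_equal2.
  apply: etrans _ (esym (mulr_sumr _ _ _ _)); apply: eq_bigr => a _.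
  apply: etrans _ (esym (mulr_sumr _ _ _ _)); apply: eq_bigr => b _.
  apply: etrans (f_equal (fun z => ginv g i (phi i x) a b * z) (smooth_derive2Z k _ _ oU (fS i) iy)) _.
  exact: mulrCA.
apply: etrans _ (esym (mulr_sumr _ _ _ _)); apply: eq_bigr => b _.
apply: etrans (f_equal (fun z => drift g i (phi i x) b * z) (smooth_deriveZ k _ (fS i) iy)) _.
exact: mulrCA.
Qed.

End laplacian_scale.

(** * The choice of the scale *)

Section normalization.
Context {R : realType} {n : nat} {M : manifold R n} (g : metric M).
Hypothesis cM : compact [set: M].
Hypothesis lapC : forall i f x, smooth_fun f -> dom i x ->
  laplacian g f x = lap g i (f \o phiV i) (phi i x).
Variables (c p : R) (psi : M -> R) (r : R -> R) (u : R -> M -> R).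
Hypotheses (p1 : 1 < p) (psiS : smooth_fun psi).
Hypotheses (uS : st_smooth 0 u) (u0 : forall t x, 0 < t -> 0 < u t x).
Hypothesis uE : forall t x, 0 < t ->
  dt u t x = u t x `^ (1 - p) * (c * laplacian g (u t) x - psi x * u t x) + r t * u t x.

(** The equation at a single point can be solved for [r], whose regularity is thereby that of
    [u]. *)
Lemma flow_r_smooth : smooth_on [set t : R | 0 < t] r.
Proof.
have H1 := st_smooth_powR (1 - p) uS u0.
have H2 := st_smooth_laplacian lapC uS.
have H3 := st_smoothM (st_smooth_space (a := 0) psiS) uS.
have H4 := st_smoothM H1 (st_smoothB (st_smoothM (st_smooth_cst (a := 0) c) H2) H3).
have S := st_smoothM (st_smoothB (st_smooth_dt uS) H4) (st_smoothV uS u0).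
apply: (smooth_on_ext (@open_gtR R 0) _ (st_smooth_point (point : M) S)) => t /= t0.
by rewrite uE// addrAC subrr add0r mulfK// lt0r_neq0// u0.
Qed.

(* The scale [mu] of [u = mu U] solves the Bernoulli equation
   [mu' = mu^(2 - p) + r mu], which is linear in [q = mu^(p - 1)]. *)
Lemma normalize : exists a (q : R -> R),
  let U t x := q t `^ (- (p - 1)^-1) * u t x in
  [/\ 0 < a < 2, smooth_on [set t : R | a < t] q, forall t, a < t -> 0 < q t,
    st_smooth a U &
    (forall t x, a < t -> dt U t x = (q t)^-1 * speed g c p psi U t x) /\
    forall x, speed g c p psi U 2 x <= 0].
Proof.
have p10 : 0 < p - 1 by rewrite subr_gt0.
have lt02 : 0 < 2 :> R by [].
(* [w] is the growth rate of [u] without the contribution of [r]. With [B] a bound for it at the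
   time [2], starting [q] at [(B + 1)^-1] makes [dt U] nonpositive at that time. *)
pose w t x := (dt u t x - r t * u t x) * (u t x)^-1.
have wS : st_smooth 0 w.
  apply: st_smoothM (st_smoothV uS u0); apply: st_smoothB (st_smooth_dt uS) _.
  exact: st_smoothM (st_smooth_time flow_r_smooth) uS.
have [B B0 wB] := continuousM_bounded cM (smooth_fun_continuous (st_smooth_slice wS lt02)).
have B1 : 0 < B + 1 by rewrite ltr_wpDl.
have s0 : 0 < (B + 1)^-1 by rewrite invr_gt0.
have [a [q [/andP[a0 a2] qS q0 q2 dq]]] := linear_ode p10 s0 flow_r_smooth.
pose m := - (p - 1)^-1.
exists a, q => U; rewrite -/m in U *.
have oA : open [set t : R | a < t] by exact: open_gt.
have uSa := st_smoothS (ltW a0) uS.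
have mS : smooth_on [set t : R | a < t] (fun t => q t `^ m).
  by apply: (smooth_on_powR m oA qS) => t; exact: q0.
have US : st_smooth a U := st_smoothM (st_smooth_time mS) uSa.
have UE t x : a < t -> dt U t x = q t `^ m * (dt u t x - r t * u t x - (q t)^-1 * u t x).
  move=> ta; have t0 := lt_trans a0 ta; have qp := q0 t ta.
  have dm : is_derive t 1 (fun t => q t `^ m) (m * q t `^ (m - 1) * ((p - 1) * (1 + r t * q t))).
    exact: (@is_derive1_comp R (fun y => y `^ m) q t _ _ (is_derive1_powR m qp) (dq t ta)).
  have [_ e] := is_deriveM dm (st_is_derive x uS t0).
  apply: etrans e _.
  have e1 : q t `^ (m - 1) = q t `^ m * (q t)^-1.
    by rewrite -{3}(powRr1 (ltW qp)) -powRN -powRD// (gt_eqF qp) implybT.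
  have alg (X Q d k y : R) : y != 0 -> k = X * y^-1 ->
      X * d + Q * (m * k * ((p - 1) * (1 + r t * y))) = X * (d - r t * Q - y^-1 * Q).
    by move=> y0 ->; rewrite /m; field; rewrite y0 gt_eqF.
  exact: alg (lt0r_neq0 qp) e1.
have spE t x : a < t -> dt U t x = (q t)^-1 * speed g c p psi U t x.
  move=> ta; have t0 := lt_trans a0 ta; have qp := q0 t ta; have up := u0 x t0.
  rewrite UE// uE// /speed.
  have -> : laplacian g (U t) x = q t `^ m * laplacian g (u t) x.
    exact: (laplacianZ lapC (q t `^ m) x (st_smooth_slice uS t0)).
  have e1 : U t x `^ (1 - p) = q t * u t x `^ (1 - p).
    rewrite /U powRM ?powR_ge0 ?(ltW up)// -powRrM; congr (_ * _).
    by rewrite (_ : m * (1 - p) = 1) ?powRr1 ?(ltW qp)// /m -(opprB p 1) mulrNN mulVf ?gt_eqF.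
  rewrite e1 /U; move: (q t `^ m) (u t x `^ (1 - p)) (laplacian g (u t) x) => X Y Z.
  by field; exact: lt0r_neq0.
split; [by rewrite a0|exact: qS|exact: q0|exact: US|split; first exact: spE].
move=> x; have qp := q0 2 a2; have up := u0 x lt02.
have : dt U 2 x <= 0.
  rewrite UE// pmulr_rle0 ?powR_gt0// subr_le0 q2 invrK -ler_pdivrMr//.
  by apply: le_trans (ler_norm _) _; apply: le_trans (wB x) _; rewrite lerDl.
by rewrite spE// pmulr_rle0// invr_gt0.
Qed.

End normalization.

(** * Conservation of the integral of [u^(p+1)] and bounds on the scale *)

Section volume_conservation.
Context {R : realType} {n : nat} {M : manifold R n} (g : metric M).
Variable vol : {measure set (borel M) -> \bar R}.
Hypothesis volP : is_volume g vol.
Hypothesis cM : compact [set: M].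

Lemma is_derive_integral a (F : R -> M -> R) t : st_smooth a F -> a < t ->
  is_derive t 1 (fun s => \int[vol]_x F s x) (\int[vol]_x dt F t x).
Proof.
move=> FS ta; pose b := (a + t) / 2.
have ab : a < b by rewrite /b ltr_pdivlMr// mulrDr !mulr1 ltrD2l.
have bt : b < t by rewrite /b ltr_pdivrMr// mulrDr !mulr1 ltrD2r.
have [C C0 CF] := st_bounded cM (t + 1) (st_smooth_dt FS) ab.
have It : t \in `]b, (t + 1)[%R by rewrite in_itv /= bt ltrDl ltr01.
have Ib s : s \in `]b, (t + 1)[%R -> a < s /\ b <= s <= t + 1.
  by rewrite in_itv /= => /andP[bs st]; split; [exact: lt_trans bs|rewrite !ltW].
have iF s : `]b, (t + 1)[%classic s -> vol.-integrable setT (EFin \o (F s : borel M -> R)).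
  move=> /Ib[sa _]; apply: (continuousM_integrable volP cM).
  exact: smooth_fun_continuous (st_smooth_slice FS sa).
have dF s (x : borel M) : `]b, (t + 1)[%classic s -> setT x -> derivable (F^~ x) s 1.
  by move=> /Ib[sa _] _; have [] := st_is_derive x FS sa.
have iC : vol.-integrable setT (EFin \o (fun _ : borel M => C)).
  by apply: (continuousM_integrable volP cM); exact: cst_continuous.
have uF s (x : borel M) : `]b, (t + 1)[%classic s -> setT x -> `|partial1of2 (F : R -> borel M -> R) s x| <= C.
  by move=> /Ib[_ sb] _; rewrite partial1of2E; exact: CF.
have H1 := @derivable_under_integral R _ (borel M) vol F setT measurableT t b (t + 1) It iF dF
  (fun=> C) (fun=> C0) iC uF.
have H2 := @differentiation_under_integral R _ (borel M) vol F setT measurableT t b (t + 1) It iF dF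
  (fun=> C) (fun=> C0) iC uF.
split; first exact: H1.
rewrite -derive1E; apply: etrans H2 _; apply: eq_Rintegral => x _.
exact: partial1of2E.
Qed.

Variables (c p : R) (psi : M -> R) (u : R -> M -> R).
Hypotheses (p1 : 1 < p) (psiS : smooth_fun psi).
Hypotheses (uS : st_smooth 0 u) (u0 : forall t x, 0 < t -> 0 < u t x).

Let r t := \int[vol]_x (c * grad2 g (u t) x + psi x * u t x ^+ 2) /
  \int[vol]_x (u t x `^ (p + 1)).

Hypothesis uE : forall t x, 0 < t ->
  dt u t x = u t x `^ (1 - p) * (c * laplacian g (u t) x - psi x * u t x) + r t * u t x.

Lemma smooth_integrable (f : M -> R) : smooth_fun f -> vol.-integrable setT (EFin \o (f : borel M -> R)).
Proof.
by move=> fS; apply: (continuousM_integrable volP cM); exact: smooth_fun_continuous.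
Qed.

Lemma integral_smoothD (f h : M -> R) : smooth_fun f -> smooth_fun h ->
  \int[vol]_x (f x + h x) = \int[vol]_x f x + \int[vol]_x h x.
Proof. by move=> fS hS; apply: RintegralD => //; exact: smooth_integrable. Qed.

Lemma integral_smoothZ (k : R) (f : M -> R) : smooth_fun f ->
  \int[vol]_x (k * f x) = k * \int[vol]_x f x.
Proof. by move=> fS; apply: RintegralZl => //; exact: smooth_integrable. Qed.

Lemma power_integral_gt0 (f : M -> R) b : smooth_fun f -> (forall x, 0 < f x) ->
  0 < \int[vol]_x (f x `^ b).
Proof.
move=> fS f0; apply: (@Rintegral_gt0 _ _ _ g _ volP cM _ point).
- exact: smooth_fun_continuous (smooth_fun_powR b fS f0).
- by move=> x; exact: powR_ge0.
- by rewrite powR_gt0.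
Qed.

(** After Green's formula the derivative is [- (p + 1)] times the numerator of [r] plus [(p + 1) r]
    times its denominator: [r] is the normalization that cancels the two. *)
Lemma volume_constant t : 2 <= t ->
  \int[vol]_x (u t x `^ (p + 1)) = \int[vol]_x (u 2 x `^ (p + 1)).
Proof.
move=> t2; have PS := st_smooth_powR (p + 1) uS u0.
apply/eqP; rewrite -subr_eq0; apply/eqP.
have [|s /andP[s2 _] ->] := @deriv_MVT R (fun t => \int[vol]_x (u t x `^ (p + 1)))
    (fun s => \int[vol]_x dt (fun s x => u s x `^ (p + 1)) s x) 2 t t2.
  by move=> s /andP[s2 _]; apply: is_derive_integral PS _; exact: lt_le_trans s2.
have s0 : 0 < s by exact: lt_le_trans s2.
have sS := st_smooth_slice uS s0.
apply/eqP; rewrite mulf_eq0; apply/orP; left; apply/eqP.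
have LS : smooth_fun (laplacian g (u s)) by exact: laplacian_smooth volP cM _ sS.
have S1 := smooth_funM sS LS.
have S2 := smooth_funM psiS (smooth_funM sS sS).
have S3 := smooth_fun_powR (p + 1) sS (fun x => u0 x s0).
pose K := (p + 1).
have dE x : dt (fun s x => u s x `^ (p + 1)) s x =
    K * c * (u s x * laplacian g (u s) x) + (- K * (psi x * (u s x * u s x)) + K * r s * u s x `^ (p + 1)).
  have up := u0 x s0.
  have [_ e] := @is_derive1_comp R (fun y => y `^ (p + 1)) (u^~ x) s _ _ (is_derive1_powR (p + 1) up)
    (st_is_derive x uS s0).
  apply: etrans e _; rewrite uE// addrK.
  have e1 : u s x `^ p * u s x `^ (1 - p) = u s x.
    by rewrite -powRD ?subrKC ?(powRr1 (ltW up))// (gt_eqF up) implybT.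
  have e2 : u s x `^ (p + 1) = u s x `^ p * u s x.
    by rewrite -{3}(powRr1 (ltW up)) -powRD// (gt_eqF up) implybT.
  have alg (X Y Z L k w : R) : X * Y = w -> Z = X * w ->
      K * X * (Y * (c * L - psi x * w) + k * w) =
      K * c * (w * L) + (- K * (psi x * (w * w)) + K * k * Z).
    move=> e3 ->; have -> : K * X * (Y * (c * L - psi x * w) + k * w) =
      K * (X * Y) * (c * L - psi x * w) + K * X * k * w by ring.
    by rewrite e3; ring.
  exact: alg e1 e2.
have -> : \int[vol]_x dt (fun s x => u s x `^ (p + 1)) s x =
    \int[vol]_x (K * c * (u s x * laplacian g (u s) x) + (- K * (psi x * (u s x * u s x)) +
      K * r s * u s x `^ (p + 1))) by apply: eq_Rintegral => x _; exact: dE.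
have Z (k : R) (f : M -> R) (fS : smooth_fun f) : smooth_fun (fun x => k * f x) := smooth_funM (smooth_fun_cst k) fS.
rewrite (integral_smoothD (Z _ _ S1) (smooth_funD (Z _ _ S2) (Z _ _ S3))).
rewrite (integral_smoothD (Z _ _ S2) (Z _ _ S3)).
rewrite (integral_smoothZ _ S1) (integral_smoothZ _ S2) (integral_smoothZ _ S3) (green volP cM sS).
have GS : smooth_fun (grad2 g (u s)) by rewrite grad2_Gam; apply: Gam_smooth; exact: sS.
have V0 := power_integral_gt0 (p + 1) sS (fun x => u0 x s0).
have rE : r s * \int[vol]_x (u s x `^ (p + 1)) =
    c * \int[vol]_x grad2 g (u s) x + \int[vol]_x (psi x * (u s x * u s x)).
  rewrite /r divfK ?lt0r_neq0// -(integral_smoothZ _ GS) -(integral_smoothD (Z _ _ GS) S2).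
  by apply: eq_Rintegral => x _; rewrite expr2.
by rewrite -[K * r s * _]mulrA rE; ring.
Qed.

(** The conserved quantity is [q^(b (p+1))] times the integral of [U^(p+1)]. The latter decreases
    and stays above the integral of [a0^(p+1)], so [q] increases and stays bounded. *)
Lemma factor_bounds a (q : R -> R) (U : R -> M -> R) b (a0 a1 : R) : a < 2 -> 0 <= a ->
  (forall t, a < t -> 0 < q t) -> 0 < b ->
  st_smooth a U -> (forall t x, a < t -> 0 < U t x) ->
  (forall t x, a < t -> u t x = q t `^ b * U t x) ->
  (forall t x, 2 <= t -> a0 <= U t x <= a1) -> 0 < a0 ->
  (forall s t x, 2 <= s -> s <= t -> U t x <= U s x) ->
  (forall s t, 2 <= s -> s <= t -> q s <= q t) /\
  exists q1, forall t, 2 <= t -> q t <= q1.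
Proof.
move=> a2 age q0 b0 US U0 uU Ub a00 Un; pose e := b * (p + 1).
have p10 : 0 < p + 1 by rewrite addr_gt0// (lt_trans _ p1).
have e0 : 0 < e by rewrite mulr_gt0.
pose V t := \int[vol]_x (U t x `^ (p + 1)).
have PS t : 2 <= t -> smooth_fun (fun x => U t x `^ (p + 1)).
  move=> t2; have ta : a < t := lt_le_trans a2 t2.
  by apply: smooth_fun_powR (st_smooth_slice US ta) _ => x; exact: U0.
have VE t : 2 <= t -> q t `^ e * V t = \int[vol]_x (u 2 x `^ (p + 1)).
  move=> t2; have ta : a < t := lt_le_trans a2 t2; have qp := q0 t ta.
  rewrite -(volume_constant t2) /V -(integral_smoothZ _ (PS t t2)).
  apply: eq_Rintegral => x _; rewrite uU// powRM ?powR_ge0 ?(ltW (U0 _ _ ta))//.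
  by rewrite -powRrM.
have V0 t : 2 <= t -> 0 < V t.
  move=> t2; have ta : a < t := lt_le_trans a2 t2.
  exact: power_integral_gt0 (st_smooth_slice US ta) (fun x => U0 _ x ta).
have lepow (x y : R) : 0 <= x -> x <= y -> x `^ (p + 1) <= y `^ (p + 1).
  move=> x0 xy; apply: ge0_ler_powR => //; rewrite ?nnegrE ?(ltW p10)//.
  exact: le_trans xy.
have qinv t k : 2 <= t -> 0 <= k -> q t `^ e <= k `^ e -> q t <= k.
  move=> t2 k0 H; rewrite leNgt; apply/negP => kq; move: H; rewrite leNgt => /negP; apply.
  by apply: gt0_ltr_powR; rewrite ?nnegrE// ltW// (le_lt_trans k0).
split=> [s t s2 st|].
  have t2 := le_trans s2 st; have qs := q0 s (lt_le_trans a2 s2); have qt := q0 t (lt_le_trans a2 t2).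
  apply: qinv => //; first exact: ltW.
  have VV : V t <= V s.
    apply: le_Rintegral => //; [exact: smooth_integrable (PS t t2)|exact: smooth_integrable (PS s s2)|move=> x _].
    by apply: lepow; [apply: ltW; exact: U0 (lt_le_trans a2 t2)|exact: Un].
  rewrite -(ler_pM2r (V0 s s2)) (VE s s2) -(VE t t2) ler_pM2l ?powR_gt0//.
pose c0 := \int[vol]_x ((fun _ : borel M => a0 `^ (p + 1)) x).
have cS : @smooth_fun _ _ M (fun=> a0) by exact: smooth_fun_cst.
have c00 : 0 < c0 by exact: power_integral_gt0 cS (fun=> a00).
have cV t : 2 <= t -> c0 <= V t.
  move=> t2; apply: le_Rintegral => //; [exact: smooth_integrable (smooth_fun_cst _)|exact: smooth_integrable (PS t t2)|move=> x _].
  by apply: lepow; [exact: ltW|have /andP[] := Ub t x t2].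
pose V2 := \int[vol]_x (u 2 x `^ (p + 1)).
have V20 : 0 < V2.
  have lt02 : 0 < 2 :> R by [].
  exact: power_integral_gt0 (st_smooth_slice uS lt02) (fun x => u0 x lt02).
exists ((V2 / c0) `^ e^-1) => t t2; apply: qinv => //; first exact: powR_ge0.
have H : 0 <= V2 / c0 by rewrite ltW ?divr_gt0.
have ee : e^-1 * e = 1 by rewrite mulVf ?lt0r_neq0.
rewrite -powRrM ee (powRr1 H) ler_pdivlMr; last exact: c00.
rewrite /V2 -(VE t t2) ler_pM2l ?powR_gt0 ?cV//.
exact: q0 (lt_le_trans a2 t2).
Qed.

End volume_conservation.

(** * Doubling of variables *)

Section doubling.
Context {R : realType} {n : nat}.
Local Notation rV := 'rV[R]_n.
Implicit Types (P S A : 'M[R]_n).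

(** The Euclidean product in the coordinates [u *m P]. When [P] inverts a factor [S] of the leading
    coefficients at a point, the operator is the flat Laplacian for this product at that point. *)
Definition ip P (u v : rV) : R := \sum_i (u *m P) 0 i * (v *m P) 0 i.

Lemma ipC P u v : ip P u v = ip P v u.
Proof. by apply: eq_bigr => i _; rewrite mulrC. Qed.

Lemma ipDl P u v w : ip P (u + v) w = ip P u w + ip P v w.
Proof. by rewrite /ip -big_split; apply: eq_bigr => i _; rewrite mulmxDl mxE mulrDl. Qed.

Lemma ipZl P (k : R) u w : ip P (k *: u) w = k * ip P u w.
Proof. by rewrite /ip mulr_sumr; apply: eq_bigr => i _; rewrite -scalemxAl mxE mulrA. Qed.

Lemma ipNl P u w : ip P (- u) w = - ip P u w.
Proof. by rewrite -scaleN1r ipZl mulN1r. Qed.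

Lemma ip_ge0 P u : 0 <= ip P u u.
Proof. by apply: sumr_ge0 => i _; rewrite -expr2 sqr_ge0. Qed.

Lemma ip0l P u : ip P 0 u = 0.
Proof. by rewrite -(scale0r 0) ipZl mul0r. Qed.

Lemma ip_line P u v (s : R) :
  ip P (s *: v + u) (s *: v + u) = ip P u u + 2 * ip P u v * s + ip P v v * s ^+ 2.
Proof.
by rewrite ipDl ipZl (ipC P v (s *: v + u)) (ipC P u (s *: v + u)) !ipDl !ipZl (ipC P v u); ring.
Qed.

(** The modulus of continuity is the square root of a distance, hence the power [1/4] of the
    quadratic form [q]. The negative term in the second derivative is its concavity in the radial
    direction, on which the doubling argument rests. *)
Lemma quartic_derive (k b m : R) : 0 < k -> exists2 e : R, 0 < e &
  let q s := k + 2 * b * s + m * s ^+ 2 in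
  let f1 s := 4^-1 * q s `^ (4^-1 - 1) * (2 * b + 2 * m * s) in
  (forall s : R, `|s| < e -> is_derive s 1 (fun s : R => q s `^ 4^-1) (f1 s)) /\
  is_derive (0 : R) 1 f1 (m / 2 * k `^ (4^-1 - 1) - 3 / 4 * b ^+ 2 * k `^ (4^-1 - 1 - 1)).
Proof.
move=> k0; pose q s := k + 2 * b * s + m * s ^+ 2.
have dq (s : R) : is_derive s 1 q (2 * b + 2 * m * s).
  rewrite /q; apply: is_derive_eq.
  by rewrite /GRing.scale /=; ring.
have q0 : q 0 = k by rewrite /q expr2 !mulr0 !addr0.
have dp (a s : R) : 0 < q s -> is_derive s 1 (fun s : R => q s `^ a) (a * q s `^ (a - 1) * (2 * b + 2 * m * s)).
  by move=> qs; exact: (@is_derive1_comp R (fun y => y `^ a) q s _ _ (is_derive1_powR a qs) (dq s)).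
have cq : {for 0, continuous q} by apply: differentiable_continuous; apply/derivable1_diffP; have [] := dq 0.
have /nbhs_ballP[e /= e0 qe] : \forall s \near (0 : R), 0 < q s.
  by apply: (cvgr_gt _ cq); rewrite q0.
exists e; [exact: e0|split].
  by move=> s se; apply: dp; apply: qe; rewrite /ball /= sub0r normrN.
have d1 := dp (4^-1 - 1) 0; rewrite q0 in d1.
have dl : is_derive (0 : R) 1 (fun s : R => 2 * b + 2 * m * s) (2 * m).
  by apply: is_derive_eq; rewrite /GRing.scale /=; ring.
have := is_deriveM (is_deriveZ 4^-1 (d1 k0)) dl; move/is_derive_eq; apply.
rewrite /GRing.scale /= q0; move: (k `^ (4^-1 - 1)) (k `^ (4^-1 - 1 - 1)) => X Y.
have -> : 4^-1 *: X = 4^-1 * X by [].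
by field.
Qed.

Lemma doubling_arith (e L K a1 a2 a3 a4 a5 a6 b1 b2 b3 k1 n1 n2 n3 : R) : 0 <= 1 - e ->
  a1 - a2 <= - L * k1 + K * (2 * n1) -> a3 <= (L / 2 * k1 + K * 2) * n2 ->
  - a4 <= L / 2 * k1 * n3 -> a5 = L * (b1 / 2 * k1) + K * (2 * b3) ->
  - a6 = L * (- b2 / 2 * k1) ->
  (1 - e) * a1 + a3 + a5 - ((1 - e) * a2 + a4 + a6) <=
  L * k1 * (- (1 - e) + (n2 + n3) / 2 + (b1 - b2) / 2) + K * 2 * ((1 - e) * n1 + n2 + b3).
Proof.
move=> e1 /(ler_wpM2l e1) G1 G2 G3 G4 G5.
rewrite (_ : _ - _ = (1 - e) * (a1 - a2) + a3 - a4 + a5 - a6); last by ring.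
apply: le_trans (lerD (lerD (lerD (lerD G1 G2) G3) (lexx a5)) (lexx (- a6))) _.
by rewrite G4 G5 le_eqVlt; apply/orP; left; apply/eqP; field.
Qed.

Section maximum.
Variables (U : set rV) (W : rV -> R) (P : 'M[R]_n) (L K : R) (x y y0 : rV).
Hypotheses (oU : open U) (WS : smooth_on U W) (Ux : U x) (Uy : U y).

(** The doubled function: the term in [L] charges the separation of the two points, and the term in
    [K] keeps the first one near [y0]. *)
Let Psi (z : rV * rV) : R :=
  W z.1 - W z.2 - L * ip P (z.1 - z.2) (z.1 - z.2) `^ 4^-1 - K * ip P (z.1 - y0) (z.1 - y0).

Hypothesis Psi_max : \forall z \near (x, y), Psi z <= Psi (x, y).
Let k := ip P (x - y) (x - y).
Hypothesis k0 : 0 < k.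

(** First and second order conditions for the maximum along the line that moves [x] by [s] and [y]
    by [t] simultaneously; the estimates that follow differ by the choice of [s] and [t]. *)
Lemma doubling_line (s t : rV) : let b := ip P (x - y) (s - t) in
  'D_s W x - 'D_t W y = L * (b / 2 * k `^ (4^-1 - 1)) + K * (2 * ip P (x - y0) s) /\
  'D_s ('D_s W) x - 'D_t ('D_t W) y <=
    L * (ip P (s - t) (s - t) / 2 * k `^ (4^-1 - 1) - 3 / 4 * b ^+ 2 * k `^ (4^-1 - 1 - 1)) +
    K * (2 * ip P s s).
Proof.
move=> b; pose m := ip P (s - t) (s - t).
have [e1 e10 [df1 df2]] := quartic_derive b m k0.
have Nx : \forall z \near x, U z by apply: (open_near oU Ux).
have Ny : \forall z \near y, U z by apply: (open_near oU Uy).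
have [e2 e20 E2] := line_ball s Nx.
have [e3 e30 E3] := line_ball t Ny.
have [e4 e40 E4] := line_ball (V := (rV * rV)%type) (s, t) Psi_max.
pose q h := k + 2 * b * h + m * h ^+ 2.
pose f1 h := 4^-1 * q h `^ (4^-1 - 1) * (2 * b + 2 * m * h).
pose G1 h := 'D_s W (h *: s + x) - 'D_t W (h *: t + y) - L * f1 h -
  K * (2 * ip P (x - y0) s + 2 * ip P s s * h).
pose G h := W (h *: s + x) - W (h *: t + y) - L * q h `^ 4^-1 -
  K * (ip P (x - y0) (x - y0) + 2 * ip P (x - y0) s * h + ip P s s * h ^+ 2).
have GE h : G h = Psi (h *: s + x, h *: t + y).
  rewrite /G /Psi /=; congr (_ - _ * _ `^ _ - _ * _).
    have -> : h *: s + x - (h *: t + y) = h *: (s - t) + (x - y).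
      by rewrite scalerBr opprD addrACA.
    by rewrite ip_line.
  by rewrite -(addrA (h *: s)) ip_line.
have e00 : 0 < Num.min e1 (Num.min e2 (Num.min e3 e4)) by rewrite !lt_min e10 e20 e30.
have dpoly (h A B C : R) : is_derive h 1 (fun h => A + 2 * B * h + C * h ^+ 2) (2 * B + 2 * C * h).
  by apply: is_derive_eq; rewrite /GRing.scale /=; ring.
have dlin : is_derive (0 : R) 1 (fun h => 2 * ip P (x - y0) s + 2 * ip P s s * h) (2 * ip P s s).
  by apply: is_derive_eq; rewrite /GRing.scale /=; ring.
have := @second_derivative_max R G G1 ('D_s ('D_s W) x - 'D_t ('D_t W) y -
  L * (m / 2 * k `^ (4^-1 - 1) - 3 / 4 * b ^+ 2 * k `^ (4^-1 - 1 - 1)) - K * (2 * ip P s s)) _ e00.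
case.
- move=> h; rewrite !lt_min => /and4P[h1 h2 h3 h4].
  have dWs := smooth_line_derive (s := h) WS (E2 h h2).
  have dWt := smooth_line_derive (s := h) WS (E3 h h3).
  exact: (is_deriveB (is_deriveB (is_deriveB dWs dWt) (is_deriveZ L (df1 h h1))) (is_deriveZ K (dpoly h _ _ _))).
- move=> h; rewrite !lt_min => /and4P[h1 h2 h3 h4]; rewrite !GE !scale0r !add0r.
  exact: E4 h4.
- have zx : 0 *: s + x = x by rewrite scale0r add0r.
  have zy : 0 *: t + y = y by rewrite scale0r add0r.
  have dWs : is_derive (0 : R) 1 (fun h : R => 'D_s W (h *: s + x)) ('D_s ('D_s W) x).
    by rewrite -[X in is_derive _ _ _ ('D_s ('D_s W) X)]zx; apply: smooth_line_derive (smooth_on_D s WS) _; rewrite zx.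
  have dWt : is_derive (0 : R) 1 (fun h : R => 'D_t W (h *: t + y)) ('D_t ('D_t W) y).
    by rewrite -[X in is_derive _ _ _ ('D_t ('D_t W) X)]zy; apply: smooth_line_derive (smooth_on_D t WS) _; rewrite zy.
  exact: (is_deriveB (is_deriveB (is_deriveB dWs dWt) (is_deriveZ L df2)) (is_deriveZ K dlin)).
rewrite /G1 /f1 /q !scale0r !add0r expr2 !mulr0 !addr0.
move: ('D_s W x) ('D_t W y) ('D_s ('D_s W) x) ('D_t ('D_t W) y) => X1 Y1 X2 Y2 E1 E2'; split.
  by move/eqP: E1; rewrite subr_eq add0r subr_eq => /eqP ->; field.
by rewrite -subr_le0; move: E2'; congr (_ <= _); rewrite /m; ring.
Qed.

Lemma ipNr Q u v : ip Q u (- v) = - ip Q u v.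
Proof. by rewrite ipC ipNl ipC. Qed.

Lemma ipZr Q (c : R) u v : ip Q u (c *: v) = c * ip Q u v.
Proof. by rewrite ipC ipZl ipC. Qed.

(** The rows of [S] reflected in the hyperplane orthogonal to [x - y] for [ip P]. A reflection keeps
    the Gram matrix, so it represents the same operator at [y]. *)
Definition mirror (S : 'M[R]_n) : 'M[R]_n :=
  S - (2 / k) *: (((x - y) *m P)^T *m (x - y)).

Lemma row_mirror S c : row c (mirror S) = row c S - (2 * ((x - y) *m P) 0 c / k) *: (x - y).
Proof.
rewrite /mirror; move: ((x - y) *m P) => w.
have rB (A B : 'M[R]_n) : row c (A - (2 / k) *: B) = row c A - (2 / k) *: row c B.
  by apply/rowP => j; rewrite !mxE.
rewrite rB row_mul; congr (_ - _).
have -> : row c w^T = (w 0 c)%:M by apply/matrixP => i j; rewrite !ord1 !mxE eqxx mulr1n.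
by rewrite mul_scalar_mx scalerA mulrAC.
Qed.

Lemma mirrorE S : S *m P = 1%:M -> (mirror S)^T *m mirror S = S^T *m S.
Proof.
move=> SP; have PS := mulmx1C SP.
pose z := x - y; pose w := z *m P.
have wS : w *m S = z by rewrite -mulmxA PS mulmx1.
have ww : w *m w^T = k%:M.
  apply/matrixP => i j; rewrite !ord1 !mxE eqxx mulr1n /k /ip.
  by apply: eq_bigr => l _; rewrite [w^T _ _]mxE.
have tB (A B : 'M[R]_n) : (A - (2 / k) *: B)^T = A^T - (2 / k) *: B^T.
  by apply/matrixP => i j; rewrite !mxE.
rewrite /mirror -/z -/w; move: (z) (w) wS ww => {PS}v h hS hh.
rewrite tB (trmx_mul h^T v) (trmxK h) mulmxBl !mulmxBr.
rewrite -!scalemxAl -!scalemxAr -!mulmxA hS (mulmxA h h^T) hh mul_scalar_mx.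
rewrite (mulmxA S^T h^T) (_ : S^T *m h^T = v^T); last by rewrite -trmx_mul hS.
rewrite -scalemxAr !scalerA.
rewrite (_ : 2 / k * (2 / k * k) = 2 / k + 2 / k); last by field; exact: lt0r_neq0.
by rewrite scalerDl opprB addrK subrK.
Qed.

(** A row and its mirror image differ by a multiple of [x - y], along which the modulus is concave.
    Each row contributes a negative term proportional to the square of its component on [x - y], and
    these squares add up to [k]. *)
Lemma doubling_mirror S : S *m P = 1%:M -> 0 <= L ->
  \sum_c ('D_(row c S) ('D_(row c S) W) x) -
  \sum_c ('D_(row c (mirror S)) ('D_(row c (mirror S)) W) y) <=
  - L * k `^ (4^-1 - 1) + K * (2 * \sum_c ip P (row c S) (row c S)).
Proof.
move=> SP L0; pose a c := ((x - y) *m P) 0 c.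
have ka : k = \sum_c a c * a c by [].
have kk : k `^ (4^-1 - 1) = k * k `^ (4^-1 - 1 - 1).
  by rewrite -{2}(powRr1 (ltW k0)) -powRD ?(addrC 1) ?subrK// (gt_eqF k0) implybT.
have Sc c : row c S *m P = delta_mx 0 c by rewrite -row_mul SP row1.
have az c : ip P (x - y) (row c S) = a c.
  rewrite /ip (bigD1 c) //= Sc [delta_mx _ _ _ _]mxE !eqxx mulr1 big1 ?addr0// => i ic.
  by rewrite [delta_mx _ _ _ _]mxE eqxx (negPf ic) mulr0.
rewrite -sumrB.
apply: le_trans (_ : \sum_c (- L * (a c * a c * k `^ (4^-1 - 1 - 1)) +
    K * (2 * ip P (row c S) (row c S))) <= _).
  apply: ler_sum => c _; have [_] := doubling_line (row c S) (row c (mirror S)).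
  have -> : row c S - row c (mirror S) = (2 * a c / k) *: (x - y).
    by rewrite row_mirror opprB addrC subrK.
  rewrite !ipZr ipZl -/k.
  move/le_trans; apply; rewrite lerD2r kk.
  by rewrite le_eqVlt; apply/orP; left; apply/eqP; field; exact: lt0r_neq0.
rewrite big_split /= -!mulr_sumr -mulr_suml -ka kk.
by [].
Qed.

Lemma derive_dir0 (h : rV -> R) z : smooth_on U h -> U z -> 'D_0 h z = 0.
Proof.
move=> hS Uz; rewrite (smooth_derive 0 oU hS Uz) big1// => a _.
by rewrite mxE mul0r.
Qed.

(** Only the point [x] moves; the concave part of the second derivative has a favourable sign and is
    dropped. *)
Lemma doubling_left (Q : 'M[R]_n) : 0 <= L ->
  \sum_c 'D_(row c Q) ('D_(row c Q) W) x <=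
  (L / 2 * k `^ (4^-1 - 1) + K * 2) * \sum_c ip P (row c Q) (row c Q).
Proof.
move=> L0; rewrite mulr_sumr; apply: ler_sum => c _.
have [_] := doubling_line (row c Q) 0.
rewrite (derive_dir0 (smooth_on_D 0 WS) Uy) !subr0 => /le_trans; apply.
rewrite -subr_ge0; set b := ip P _ _; set m := ip P _ _.
rewrite (_ : _ - _ = L * (3 / 4 * (m ^+ 2 * k `^ (4^-1 - 1 - 1)))); last by field.
by rewrite mulr_ge0// mulr_ge0 ?divr_ge0// mulr_ge0 ?sqr_ge0 ?powR_ge0.
Qed.

Lemma doubling_right (Q : 'M[R]_n) : 0 <= L ->
  - (\sum_c 'D_(row c Q) ('D_(row c Q) W) y) <=
  L / 2 * k `^ (4^-1 - 1) * \sum_c ip P (row c Q) (row c Q).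
Proof.
move=> L0; rewrite mulr_sumr -sumrN; apply: ler_sum => c _.
have [_] := doubling_line 0 (row c Q).
rewrite (derive_dir0 (smooth_on_D 0 WS) Ux) !sub0r => /le_trans; apply.
rewrite -subr_ge0 ipNl ipNr opprK !ip0l; set b := ip P _ _; set m := ip P _ _.
rewrite (_ : _ - _ = L * (3 / 4 * (m ^+ 2 * k `^ (4^-1 - 1 - 1)))); last by field.
by rewrite mulr_ge0// mulr_ge0 ?divr_ge0// mulr_ge0 ?sqr_ge0 ?powR_ge0.
Qed.

Definition op2 (A : 'M[R]_n) z := \sum_a \sum_b A a b * 'D_(delta_mx 0 a) ('D_(delta_mx 0 b) W) z.

Lemma op2D A B (e : R) z : op2 (e *: A + B) z = e * op2 A z + op2 B z.
Proof.
rewrite /op2 mulr_sumr -big_split; apply: eq_bigr => a _ /=.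
rewrite mulr_sumr -big_split; apply: eq_bigr => b _ /=.
by rewrite !mxE mulrDl mulrA.
Qed.

Lemma op2_gram A (Q : 'M[R]_n) z : U z -> A = Q^T *m Q ->
  op2 A z = \sum_c 'D_(row c Q) ('D_(row c Q) W) z.
Proof. by move=> Uz; exact: (hess_cholesky oU WS Uz). Qed.

Definition frob (Q : 'M[R]_n) := \sum_c ip P (row c Q) (row c Q).

(** The coefficients at the two points share [(1 - e) S^T S], to which the mirror coupling applies;
    the remainders [Qx] and [Qy], of small [frob], are treated by moving one point at a time. *)
Lemma doubling_operator (S Qx Qy : 'M[R]_n) (e : R) (bx bY : rV) :
  S *m P = 1%:M -> 0 <= L -> 0 <= K -> e <= 1 ->
  (op2 ((1 - e) *: (S^T *m S) + Qx^T *m Qx) x + 'D_bx W x) -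
  (op2 ((1 - e) *: (S^T *m S) + Qy^T *m Qy) y + 'D_bY W y) <=
  L * k `^ (4^-1 - 1) * (- (1 - e) + (frob Qx + frob Qy) / 2 +
    (ip P (x - y) bx - ip P (x - y) bY) / 2) +
  K * 2 * ((1 - e) * frob S + frob Qx + ip P (x - y0) bx).
Proof.
move=> SP L0 K0 e1; rewrite !op2D.
have H1 := doubling_mirror SP L0.
have H2 := doubling_left Qx L0.
have H3 := doubling_right Qy L0.
have [H4 _] := doubling_line bx 0.
have [H5 _] := doubling_line 0 bY.
rewrite (derive_dir0 WS Uy) !subr0 in H4.
rewrite (derive_dir0 WS Ux) !sub0r ipNr !(ipC P (x - y0)) ip0l !mulr0 addr0 in H5.
rewrite (op2_gram Ux (erefl (S^T *m S))) (op2_gram Ux (erefl (Qx^T *m Qx))).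
rewrite (op2_gram Uy (esym (mirrorE SP))) (op2_gram Uy (erefl (Qy^T *m Qy))).
have e1' : 0 <= 1 - e by rewrite subr_ge0.
exact: doubling_arith.
Qed.

End maximum.
End doubling.

(** * A Hoelder estimate for elliptic operators *)

Section equicontinuity.
Context {R : realType} {n : nat}.
Local Notation rV := 'rV[R]_n.

Lemma nbhs_box (y0 : rV) (N : set rV) : nbhs y0 N -> exists2 r : R, 0 < r & box y0 r `<=` N.
Proof.
move=> Ny; have [r r0 H] := @box_in_open R n N^° y0 (@open_interior _ N) Ny.
by exists r => // y /H; exact: interior_subset.
Qed.

Lemma box_inside (y0 y : rV) (r s : R) : s < r -> box y0 s y -> nbhs y (box y0 r).
Proof.
move=> sr ys; have rs0 : 0 < r - s by rewrite subr_gt0.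
apply: filterS (box_nbhs y rs0) => z zy a.
rewrite (_ : _ - _ = (z 0 a - y 0 a) + (y 0 a - y0 0 a)); last by rewrite addrA subrK.
by apply: le_trans (ler_normD _ _) _; rewrite -(subrK s r); apply: lerD; [exact: zy|exact: ys].
Qed.

Lemma mul_coord_le (P : 'M[R]_n) (z : rV) (h : R) i : (forall a, `|z 0 a| <= h) ->
  `|(z *m P) 0 i| <= h * \sum_i \sum_a `|P a i|.
Proof.
move=> zh; rewrite mxE; apply: le_trans (ler_norm_sum _ _ _) _.
rewrite [X in _ <= _ * X](bigD1 i)//= mulrDr ler_wpDr//; last first.
  rewrite mulr_sumr ler_sum// => a _; rewrite normrM ler_wpM2r//; exact: zh.
apply: mulr_ge0; first by apply: le_trans (zh i); exact: normr_ge0.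
by apply: sumr_ge0 => j _; apply: sumr_ge0 => a _; exact: normr_ge0.
Qed.

Lemma ip_le (P : 'M[R]_n) (u v : rV) (h k : R) : (forall i, `|(u *m P) 0 i| <= h) ->
  (forall i, `|(v *m P) 0 i| <= k) -> `|ip P u v| <= n%:R * (h * k).
Proof.
move=> uh vk; apply: le_trans (ler_norm_sum _ _ _) _.
apply: le_trans (ler_sum _ (G := fun=> h * k) _) _ => [i _|].
  by rewrite normrM; apply: ler_pM.
by rewrite sumr_const card_ord mulr_natl.
Qed.

Lemma ip_coord (P S : 'M[R]_n) (z : rV) (h : R) a : P *m S = 1%:M -> 0 <= h ->
  ip P z z <= h ^+ 2 -> `|z 0 a| <= h * \sum_i \sum_a `|S a i|.
Proof.
move=> PS h0 zh; have -> : z = (z *m P) *m S by rewrite -mulmxA PS mulmx1.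
apply: mul_coord_le => i; rewrite -(ler_pXn2r (_ : 0 < 2)%N)// ?nnegrE//.
rewrite real_normK ?num_real//; apply: le_trans zh.
rewrite /ip (bigD1 i)//= expr2 lerDl.
by apply: sumr_ge0 => j _; rewrite -expr2 sqr_ge0.
Qed.

Lemma ip_continuous (X : topologicalType) (P : 'M[R]_n) (f h : X -> rV) x :
  {for x, continuous f} -> {for x, continuous h} ->
  {for x, continuous (fun x => ip P (f x) (h x))}.
Proof.
move=> cf ch; have H (k : X -> rV) i : {for x, continuous k} -> {for x, continuous (fun x => (k x *m P) 0 i)}.
  move=> ck; rewrite (_ : (fun _ => _) = (fun x => \sum_a k x 0 a * P a i)); last first.
    by apply/funext => z; rewrite mxE.
  apply: (cvg_bigsum (F := nbhs x)) => a; apply: cvgM; last exact: cvg_cst.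
  exact: (continuous_comp ck (@coord_continuous _ _ _ 0 a _)).
by apply: (cvg_bigsum (F := nbhs x)) => i; apply: cvgM; exact: H.
Qed.

Lemma frob_trace (P Q : 'M[R]_n) : frob P Q = \sum_i (P^T *m (Q^T *m Q) *m P) i i.
Proof.
rewrite /frob /ip exchange_big/=; apply: eq_bigr => i _.
rewrite (_ : P^T *m (Q^T *m Q) *m P = (Q *m P)^T *m (Q *m P)); last by rewrite trmx_mul !mulmxA.
by rewrite mxE; apply: eq_bigr => c _; rewrite -row_mul [row _ _ _ _]mxE [_^T _ _]mxE.
Qed.

(* The diagonal bound on [P^T B P] feeds the trace term of the coupling, the
   entrywise bound makes [B = A - (1 - e) A0] positive definite. *)
Lemma near_identity (A S P : 'M[R]_n) (e t : R) : S *m P = 1%:M -> 0 < e -> 0 <= t ->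
  n%:R * t < e -> A^T = A ->
  (forall i j, `|(P^T *m A *m P) i j - (i == j)%:R| <= t) ->
  exists Q : 'M[R]_n, A = (1 - e) *: (S^T *m S) + Q^T *m Q /\ frob P Q <= n%:R * (t + e).
Proof.
move=> SP e0 t0 te AT At; have PS := mulmx1C SP.
have sub1E (X : 'M[R]_n) i j : (X - 1%:M) i j = X i j - (i == j)%:R by rewrite !mxE.
pose B := A - (1 - e) *: (S^T *m S).
have BE : P^T *m B *m P = (P^T *m A *m P - 1%:M) + e%:M.
  rewrite /B mulmxBr mulmxBl -scalemxAr -scalemxAl.
  rewrite (_ : P^T *m (S^T *m S) *m P = 1%:M); last first.
    by rewrite mulmxA -trmx_mul SP trmx1 mul1mx SP.
  by rewrite scalerBl scale1r opprB addrA [X in _ = X]addrAC scalemx1.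
have pB : is_posdef B.
  split; first by rewrite /B linearB linearZ /= trmx_mul trmxK AT.
  move=> v v0; pose w := v *m S^T.
  have vw : v = w *m P^T by rewrite -mulmxA -trmx_mul PS trmx1 mulmx1.
  have w0 : w != 0 by apply: contra v0 => /eqP wE; rewrite vw wE mul0mx.
  have -> : v *m B *m v^T = w *m (P^T *m B *m P) *m w^T.
    by rewrite {1 2}vw trmx_mul trmxK !mulmxA.
  rewrite BE mulmxDr mulmxDl [X in 0 < X]mxE.
  pose s := \sum_i w 0 i ^+ 2.
  have s0 : 0 < s.
    rewrite lt_neqAle sumr_ge0 ?andbT; last by move=> i _; exact: sqr_ge0.
    rewrite eq_sym; apply: contra w0 => /eqP s0; apply/eqP/rowP => i; rewrite [RHS]mxE.
    have : w 0 i ^+ 2 <= s by rewrite /s (bigD1 i)//= lerDl sumr_ge0// => j _; exact: sqr_ge0.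
    by rewrite s0 real_exprn_even_le0 ?num_real//= => /eqP.
  have E2 : (w *m e%:M *m w^T) 0 0 = e * s.
    rewrite mul_mx_scalar -scalemxAl mxE; congr (_ * _); rewrite mxE.
    by apply: eq_bigr => i _; rewrite [w^T _ _]mxE expr2.
  have E1 : - (n%:R * t * s) <= (w *m (P^T *m A *m P - 1%:M) *m w^T) 0 0.
    rewrite quadE lerNl.
    apply: le_trans (_ : \sum_i \sum_j t * ((w 0 i ^+ 2 + w 0 j ^+ 2) / 2) <= _).
      rewrite -sumrN; apply: ler_sum => i _; rewrite -sumrN; apply: ler_sum => j _.
      apply: le_trans (ler_norm _) _; rewrite normrN -mulrA normrM; apply: ler_pM => //.
        by rewrite sub1E; exact: At.
      rewrite normrM ler_pdivlMr// -[w 0 i ^+ 2]real_normK ?num_real// -[w 0 j ^+ 2]real_normK ?num_real//.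
      rewrite -subr_ge0 (_ : _ - _ = (`|w 0 i| - `|w 0 j|) ^+ 2) ?sqr_ge0//; ring.
    rewrite le_eqVlt; apply/orP; left; apply/eqP.
    transitivity (\sum_(i < n) (t / 2 * (n%:R * w 0 i ^+ 2) + t / 2 * s)).
      apply: eq_bigr => i _; rewrite -mulr_sumr -mulr_suml big_split /= sumr_const card_ord -/s.
      by rewrite -mulr_natl; ring.
    by rewrite big_split /= sumr_const card_ord -!mulr_sumr -/s -mulr_natl; field.
  by rewrite E2; apply: lt_le_trans (lerD E1 (lexx _)); rewrite -mulNr -mulrDl mulr_gt0// addrC subr_gt0.
have [Q BQ] := posdef_cholesky pB.
exists Q; split; first by rewrite -BQ /B addrC subrK.
rewrite frob_trace -BQ BE.
apply: le_trans (ler_sum _ (G := fun=> t + e) _) _ => [i _|].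
  rewrite mxE sub1E; apply: lerD; last by rewrite mxE eqxx.
  by apply: le_trans (ler_norm _) _; exact: At.
by rewrite sumr_const card_ord mulr_natl.
Qed.

(** Two successive square roots, which settles continuity at the zeros of [f] as well. *)
Lemma quartic_root_continuous (X : topologicalType) (f : X -> R) x :
  (forall z, 0 <= f z) -> {for x, continuous f} -> {for x, continuous (fun z => f z `^ 4^-1)}.
Proof.
move=> f0 fc; rewrite (_ : (fun z => _) = (Num.sqrt \o (Num.sqrt \o f))); last first.
  apply/funext => z /=; rewrite -!powR12_sqrt ?powR_ge0// -powRrM; congr (_ `^ _); by field.
by apply: continuous_comp; [apply: continuous_comp => //; exact: sqrt_continuous|exact: sqrt_continuous].
Qed.

Definition Psi (W : rV -> R) P L K (y0 : rV) (z : rV * rV) : R :=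
  W z.1 - W z.2 - L * ip P (z.1 - z.2) (z.1 - z.2) `^ 4^-1 - K * ip P (z.1 - y0) (z.1 - y0).

Lemma Psi_continuous W P L K y0 z : {for z.1, continuous W} -> {for z.2, continuous W} ->
  {for z, continuous (Psi W P L K y0)}.
Proof.
move=> c1 c2; have f1 : {for z, continuous (fun z : rV * rV => z.1)} by exact: cvg_fst.
have f2 : {for z, continuous (fun z : rV * rV => z.2)} by exact: cvg_snd.
have f3 : {for z, continuous (fun z : rV * rV => z.1 - z.2)} by exact: cvgB f1 f2.
have f4 : {for z, continuous (fun z : rV * rV => z.1 - y0)} by exact: cvgB f1 (cvg_cst _).
have g1 : {for z, continuous (fun z : rV * rV => W z.1)} by exact: continuous_comp f1 c1.
have g2 : {for z, continuous (fun z : rV * rV => W z.2)} by exact: continuous_comp f2 c2.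
have h1 := quartic_root_continuous (fun z : rV * rV => ip_ge0 P (z.1 - z.2)) (ip_continuous f3 f3).
have h2 := ip_continuous (P := P) f4 f4.
exact: cvgB (cvgB (cvgB g1 g2) (cvgM (cvg_cst L) h1)) (cvgM (cvg_cst K) h2).
Qed.

Lemma quarter_le (r : R) : 0 < r ->
  [/\ r / 4 < r, r / 2 < r, r / 4 + r / 4 = r / 2 & r / 4 <= 2 * r].
Proof. by move=> r0; split; lra. Qed.

Lemma coupling_le (e a b x y : R) : e <= 4^-1 -> a <= 4^-1 -> b <= 4^-1 -> x <= 4^-1 ->
  - y <= 4^-1 -> - (1 - e) + (a + b) / 2 + (x - y) / 2 <= - 4^-1.
Proof. by move=> *; lra. Qed.

Lemma coupling_false (x y l k c : R) : k + 2 * c < l -> x - y <= - l + k ->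
  - x <= c -> y <= c -> False.
Proof. by move=> *; lra. Qed.

Section estimate.
Variables (U : set rV) (W : rV -> R) (A : rV -> 'M[R]_n) (bet : rV -> rV) (y0 : rV).
Variables (S P : 'M[R]_n) (r h L K M0 C0 e : R).
Hypotheses (oU : open U) (WS : smooth_on U W) (SP : S *m P = 1%:M).
Hypotheses (r0 : 0 < r) (h0 : 0 < h) (L0 : 0 < L) (K0 : 0 <= K) (e0 : 0 <= e).
Hypotheses (e4 : e <= 4^-1) (Ur : box y0 r `<=` U).
Hypothesis AQ : forall y, box y0 r y ->
  exists Q, A y = (1 - e) *: (S^T *m S) + Q^T *m Q /\ frob P Q <= 4^-1.
Hypothesis ipb : forall (z : rV) y, (forall a, `|z 0 a| <= 2 * r) -> box y0 r y -> `|ip P z (bet y)| <= 4^-1.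
Hypothesis ip1 : forall z : rV, (forall a, `|z 0 a| <= 2 * r) -> ip P z z <= 1.
Hypothesis iph : forall z : rV, ip P z z <= h ^+ 2 -> forall a, `|z 0 a| <= r / 4.
Hypothesis WM : forall y, box y0 r y -> `|W y| <= M0.
Hypothesis WC : forall y, box y0 r y -> `|op2 W (A y) y + 'D_(bet y) W y| <= C0.
Hypothesis KM : 2 * M0 < K * h ^+ 2.
Hypothesis LM : 2 * M0 < L * (h ^+ 2) `^ 4^-1.
Hypothesis LK : K * 2 * (frob P S + 4^-1 + 4^-1) + 2 * C0 < L / 4.

Let box0 : box y0 r y0.
Proof. by move=> a; rewrite subrr normr0 ltW. Qed.

(** A violation gives the doubled function a positive maximum over pairs of points of the box. [KM]
    and [LM] keep both points inside the box, and positivity keeps them apart. There the coupling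
    yields at most [- L / 4] plus a quantity depending on [K] but not on [L], while the operator is
    bounded by [C0] at both points; [LK] makes this contradictory. *)
Lemma holder_estimate y : box y0 r y -> W y0 - W y <= L * ip P (y0 - y) (y0 - y) `^ 4^-1.
Proof.
move=> yr; rewrite leNgt; apply/negP => bad.
have Dc : compact (box y0 r `*` box y0 r) by apply: compact_setX; exact: box_compact.
have Pc : {within box y0 r `*` box y0 r, continuous (Psi W P L K y0)}.
  apply: continuous_in_subspaceT => z; rewrite inE => -[z1 z2].
  by apply: Psi_continuous; apply: smooth_on_cts WS _; exact: Ur.
have D0 : (box y0 r `*` box y0 r) !=set0 by exists (y0, y0); split; exact: box0.
have [[x1 y1] /[1!inE] -[/= x1r y1r] Pm] := compact_EVT_max D0 Dc Pc.
have Pp : 0 < Psi W P L K y0 (x1, y1).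
  apply: lt_le_trans (Pm (y0, y) _); last by rewrite inE.
  by rewrite /Psi /= [y0 - y0]subrr ip0l mulr0 subr0 subr_gt0.
pose k := ip P (x1 - y1) (x1 - y1); pose m := ip P (x1 - y0) (x1 - y0).
have k0 : 0 <= k := ip_ge0 _ _.
have m0 : 0 <= m := ip_ge0 _ _.
have q0 : 0 <= k `^ 4^-1 := powR_ge0 _ _.
have dW : W x1 - W y1 <= 2 * M0.
  have /ler_normlP[_ H1] := WM x1r; have /ler_normlP[H2 _] := WM y1r.
  by rewrite mulr_natl mulr2n; apply: lerD.
move: (Pp); rewrite /Psi /= -/k -/m => Pp'.
have Km : K * m < 2 * M0.
  move: Pp'; rewrite subr_gt0 => /lt_le_trans; apply; apply: le_trans dW.
  by rewrite gerDl oppr_le0 mulr_ge0// ltW.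
have Lq : L * k `^ 4^-1 < 2 * M0.
  move: Pp'; rewrite addrAC subr_gt0 => /lt_le_trans; apply; apply: le_trans dW.
  by rewrite gerDl oppr_le0 mulr_ge0.
have mh : m <= h ^+ 2.
  rewrite leNgt; apply/negP => hm; have := ler_wpM2l K0 (ltW hm).
  by rewrite leNgt (lt_trans Km KM).
have kh : k <= h ^+ 2.
  rewrite leNgt; apply/negP => hk.
  have : (h ^+ 2) `^ 4^-1 <= k `^ 4^-1 by apply: ge0_ler_powR; rewrite ?nnegrE ?sqr_ge0// ltW.
  by move=> /(ler_wpM2l (ltW L0)); rewrite leNgt (lt_trans Lq LM).
have kp : 0 < k.
  rewrite lt_neqAle k0 andbT; apply/eqP => k00; move: Pp; rewrite /Psi /= -/k -/m -k00 powR0 ?invr_eq0//.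
  have -> : x1 = y1.
    apply/eqP; rewrite -subr_eq0; apply/eqP/rowP => a; rewrite [RHS]mxE; apply/eqP.
    rewrite -normr_le0; have := @ip_coord P S (x1 - y1) 0 a (mulmx1C SP) (lexx 0).
    by rewrite mul0r; apply; rewrite -/k -k00 expr0n.
  by rewrite subrr mulr0 subr0 sub0r oppr_gt0 ltNge mulr_ge0.
have xr a := iph mh a; have zr a := iph kh a.
have [r4 r2 r24 r42] := quarter_le r0.
have nx : nbhs x1 (box y0 r).
  by apply: (box_inside (s := r / 4)) => [|a]; [exact: r4|have := xr a; rewrite !mxE].
have ny : nbhs y1 (box y0 r).
  apply: (box_inside (s := r / 2)) => [|a]; first exact: r2.
  have := xr a; have := zr a; rewrite !mxE => H1 H2.
  rewrite (_ : _ - _ = (x1 0 a - y0 0 a) - (x1 0 a - y1 0 a)); last by ring.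
  by apply: le_trans (ler_normB _ _) _; rewrite -r24; apply: lerD.
have nP : \forall z \near (x1, y1), Psi W P L K y0 z <= Psi W P L K y0 (x1, y1).
  by exists (box y0 r, box y0 r) => //= -[x2 y2] [/= H1 H2]; apply: Pm; rewrite inE.
have [Qx [Ax fx]] := AQ x1r; have [Qy [Ay fy]] := AQ y1r.
have e1 : e <= 1 by apply: le_trans e4 _; rewrite invf_le1// ler1n.
have := @doubling_operator R n U W P L K x1 y1 y0 oU WS (Ur x1r) (Ur y1r) nP kp S Qx Qy e
  (bet x1) (bet y1) SP (ltW L0) K0 e1; rewrite -Ax -Ay -/k => H.
have z2 (a : 'I_n) : `|(x1 - y1) 0 a| <= 2 * r by exact: le_trans (zr a) r42.
have x2 (a : 'I_n) : `|(x1 - y0) 0 a| <= 2 * r by exact: le_trans (xr a) r42.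
have /ler_normlP[_ B1] := ipb z2 x1r; have /ler_normlP[B2 _] := ipb z2 y1r.
have /ler_normlP[_ B3] := ipb x2 x1r.
(* The distance is at most [1], so the singular power can only strengthen the good term. *)
have k1 : 1 <= k `^ (4^-1 - 1).
  rewrite (_ : 4^-1 - 1 = - (3 / 4) :> R) ?powRN; last by field.
  rewrite -[leLHS]invr1 lef_pV2 ?posrE ?powR_gt0//.
  have e34 : 1 `^ (3 / 4) = 1 :> R by rewrite powR1.
  rewrite -[leRHS]e34; apply: ge0_ler_powR; rewrite ?nnegrE//.
  exact: ip1.
have /ler_normlP[G1 _] := WC x1r; have /ler_normlP[_ G2] := WC y1r.
have fS : 0 <= frob P S by apply: sumr_ge0 => c _; exact: ip_ge0.
have H1 : L * k `^ (4^-1 - 1) * (- (1 - e) + (frob P Qx + frob P Qy) / 2 +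
    (ip P (x1 - y1) (bet x1) - ip P (x1 - y1) (bet y1)) / 2) <= - (L / 4).
  apply: le_trans (_ : L * k `^ (4^-1 - 1) * - 4^-1 <= _).
    apply: ler_wpM2l; first by rewrite mulr_ge0 ?powR_ge0// ltW.
    exact: coupling_le.
  by rewrite mulrN lerN2 ler_wpM2r// ler_peMr// ltW.
have H2 : K * 2 * ((1 - e) * frob P S + frob P Qx + ip P (x1 - y0) (bet x1)) <=
    K * 2 * (frob P S + 4^-1 + 4^-1).
  apply: ler_wpM2l; first by rewrite mulr_ge0.
  by apply: lerD => //; apply: lerD => //; rewrite ler_piMl// gerBl.
exact: coupling_false LK (le_trans H (lerD H1 H2)) G1 G2.
Qed.

End estimate.

End equicontinuity.

Section equicontinuity_bound.
Context {R : realType} {n : nat}.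
Local Notation rV := 'rV[R]_n.

Lemma mulmx_continuous_at (X : topologicalType) (A : X -> 'M[R]_n) (P Q : 'M[R]_n) x i j :
  (forall i j, {for x, continuous (fun y => A y i j)}) ->
  {for x, continuous (fun y => (P *m A y *m Q) i j)}.
Proof.
move=> Ac; rewrite (_ : (fun _ => _) = (fun y => \sum_a (\sum_b P i b * A y b a) * Q a j)); last first.
  by apply/funext => y; rewrite mxE; apply: eq_bigr => a _; rewrite mxE.
apply: (cvg_bigsum (F := nbhs x)) => a; apply: cvgM; last exact: cvg_cst.
by apply: (cvg_bigsum (F := nbhs x)) => b; apply: cvgM; [exact: cvg_cst|exact: Ac].
Qed.

Lemma near_close (X : topologicalType) (f : X -> R) x (t : R) : 0 < t ->
  {for x, continuous f} -> \forall y \near x, `|f y - f x| <= t.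
Proof.
move=> t0 /cvgrPdist_le/(_ t t0); apply: (@filterS _ (nbhs x)) => y.
by rewrite distrC.
Qed.

(** Freezing the coefficients at [y0] supplies [S] and its inverse [P], and every constant of
    [holder_estimate] is then fixed from the coefficients near [y0], from [M0] and from [C0]. Thus
    one radius serves all the functions [W]. *)
Lemma elliptic_lower_equicontinuity (U : set rV) (A : rV -> 'M[R]_n) (bet : rV -> rV) (y0 : rV)
    (M0 C0 e : R) : open U -> U y0 -> (forall y, U y -> is_posdef (A y)) ->
  (forall i j, {for y0, continuous (fun y => A y i j)}) ->
  (forall i, {for y0, continuous (fun y => bet y 0 i)}) ->
  0 <= M0 -> 0 <= C0 -> 0 < e ->
  exists2 d : R, 0 < d & box y0 d `<=` U /\ forall W, smooth_on U W ->
    (forall y, U y -> `|W y| <= M0) ->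
    (forall y, U y -> `|op2 W (A y) y + 'D_(bet y) W y| <= C0) ->
    forall y, box y0 d y -> W y0 - e <= W y.
Proof.
move=> oU Uy0 pA Ac bc M00 C00 e0.
have [S AS] := posdef_cholesky (pA y0 Uy0).
have uS : S \in unitmx.
  by have := posdef_unit (pA y0 Uy0); rewrite AS unitmx_mul => /andP[].
pose P := invmx S; have SP : S *m P = 1%:M by exact: mulmxV.
pose N : R := n.+1%:R.
have N1 : 1 <= N by rewrite /N ler1n.
have N0 : 0 < N by exact: lt_le_trans N1.
have nN : n%:R <= N by rewrite /N ler_nat.
(* [near_identity] needs [n th < eps], and its remainder is bounded by [n (th + eps)], which has to
   be at most [1/4]. *)
pose eps := (8 * N)^-1; pose th := eps / (2 * N).
have eps0 : 0 < eps by rewrite invr_gt0 mulr_gt0.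
have th0 : 0 < th by rewrite divr_gt0// mulr_gt0.
have Neps : N * eps = 8^-1 by rewrite /eps; field; exact: lt0r_neq0.
have Nth : N * th = eps / 2 by rewrite /th; field; exact: lt0r_neq0.
have eps8 : eps <= 8^-1 by rewrite -Neps ler_peMl// ltW.
have nearE : \forall y \near y0, forall i j, `|(P^T *m A y *m P) i j - (i == j)%:R| <= th.
  have E0 : P^T *m A y0 *m P = 1%:M.
    by rewrite AS mulmxA -trmx_mul SP trmx1 mul1mx SP.
  apply: (@filter_forall _ _ (fun i y => forall j, `|(P^T *m A y *m P) i j - (i == j)%:R| <= th) (nbhs y0)) => i.
  apply: (@filter_forall _ _ (fun j y => `|(P^T *m A y *m P) i j - (i == j)%:R| <= th) (nbhs y0)) => j.
  have <- : (P^T *m A y0 *m P) i j = (i == j)%:R by rewrite E0 mxE.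
  exact: near_close th0 (@mulmx_continuous_at _ A P^T P y0 i j Ac).
pose Cb := 1 + \sum_i `|(bet y0 *m P) 0 i|.
have Cb0 : 0 < Cb by rewrite ltr_pwDl// sumr_ge0.
have nearb : \forall y \near y0, forall i, `|(bet y *m P) 0 i| <= Cb.
  apply: (@filter_forall _ _ (fun i y => `|(bet y *m P) 0 i| <= Cb) (nbhs y0)) => i.
  have c : {for y0, continuous (fun y => (bet y *m P) 0 i)}.
    rewrite (_ : (fun _ => _) = (fun y => \sum_a bet y 0 a * P a i)); last first.
      by apply/funext => y; rewrite mxE.
    by apply: (cvg_bigsum (F := nbhs y0)) => a; apply: cvgM; [exact: bc|exact: cvg_cst].
  have := near_close (@ltr01 R) c; apply: (@filterS _ (nbhs y0)) => y H.
  rewrite -[X in `|X|](subrK ((bet y0 *m P) 0 i)); apply: le_trans (ler_normD _ _) _.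
  apply: lerD => //; rewrite (bigD1 i)//= lerDl sumr_ge0//.
have nearU : \forall y \near y0, U y by apply: (open_near oU Uy0).
have [r1 r10 r1P] := nbhs_box (filterI nearU (filterI nearE nearb)).
pose cP := \sum_i \sum_a `|P a i|; pose cS := 1 + \sum_i \sum_a `|S a i|.
have cP0 : 0 <= cP by apply: sumr_ge0 => i _; apply: sumr_ge0 => a _.
have cS0 : 0 < cS by rewrite ltr_pwDl//; apply: sumr_ge0 => i _; apply: sumr_ge0 => a _.
(* The radius is at most [1 / D], so that the drift, of size at most [Cb] after multiplication by
   [P], contributes at most [1/4] to the coupling. *)
pose D := 8 * N * (cP + 1) * (Cb + 1).
have cP1 : 0 < cP + 1 by rewrite ltr_wpDl.
have Cb1 : 0 < Cb + 1 by rewrite addr_gt0.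
have D0 : 0 < D by rewrite /D !mulr_gt0.
pose r := Num.min r1 D^-1.
have r0 : 0 < r by rewrite lt_min r10 invr_gt0.
have rD : r * D <= 1 by rewrite -ler_pdivlMr// div1r ge_min lexx orbT.
have rP y : box y0 r y -> [/\ U y, forall i j, `|(P^T *m A y *m P) i j - (i == j)%:R| <= th &
    forall i, `|(bet y *m P) 0 i| <= Cb].
  move=> yr; have [|H1 [H2 H3]] := r1P y; last by split.
  by move=> a; apply: le_trans (yr a) _; rewrite ge_min lexx.
have small : n%:R * (2 * r * cP) * Cb <= 4^-1 /\ n%:R * (2 * r * cP) <= 4^-1.
  have H (x : R) : 0 <= x -> x <= Cb + 1 -> n%:R * (2 * r * cP) * x <= 4^-1.
    move=> x0 xC; have H1 : r * D / 4 <= 4^-1 by rewrite ler_piMl// invr_ge0.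
    apply: le_trans H1.
    rewrite (_ : r * D / 4 = N * (2 * r * (cP + 1)) * (Cb + 1)); last by rewrite /D; field.
    apply: ler_pM => //; first by rewrite !mulr_ge0// ltW.
    apply: ler_pM => //; first by rewrite !mulr_ge0// ltW.
    by apply: ler_wpM2l; [rewrite mulr_ge0// ltW|rewrite lerDl].
  split; first by apply: H; [exact: ltW|rewrite lerDl].
  by have := H 1 ler01; rewrite mulr1; apply; rewrite lerDr ltW.
have [small1 small2] := small.
pose h := r / (4 * cS).
have h0 : 0 < h by rewrite divr_gt0// mulr_gt0.
have hS : h * cS = r / 4 by rewrite /h; field; exact: lt0r_neq0.
have hh : 0 < h ^+ 2 by rewrite exprn_gt0.
have M1 : 0 < 2 * M0 + 1 by rewrite ltr_wpDl// mulr_ge0.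
pose K := (2 * M0 + 1) / h ^+ 2.
have K0 : 0 <= K by apply: divr_ge0; apply: ltW.
pose Kc := K * 2 * (frob P S + 4^-1 + 4^-1) + 2 * C0.
have fS0 : 0 <= frob P S by apply: sumr_ge0 => c _; exact: ip_ge0.
have Kc0 : 0 <= Kc.
  by apply: addr_ge0; [apply: mulr_ge0; [exact: mulr_ge0|rewrite !addr_ge0 ?invr_ge0]|exact: mulr_ge0].
have hp : 0 < (h ^+ 2) `^ 4^-1 by exact: powR_gt0.
pose L1 := (2 * M0 + 1) / (h ^+ 2) `^ 4^-1.
have L10 : 0 < L1 by rewrite divr_gt0.
pose L := L1 + 4 * (Kc + 1).
have L20 : 0 < 4 * (Kc + 1) by rewrite mulr_gt0// ltr_wpDl.
have L0 : 0 < L by rewrite addr_gt0.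
(* The modulus [L k^(1/4)] is at most [e] as soon as [k <= (e / L)^4]. *)
pose tau := (e / L) `^ 4.
have tau0 : 0 < tau by rewrite powR_gt0// divr_gt0.
pose q := tau / (N * (cP + 1) ^+ 2); pose m := Num.min 1 q; pose d := Num.min r m.
have Nc : 0 < N * (cP + 1) ^+ 2 by rewrite mulr_gt0// exprn_gt0.
have m0 : 0 < m by rewrite lt_min ltr01 divr_gt0.
have d0 : 0 < d by rewrite lt_min r0 m0.
have dm : d <= m by rewrite ge_min lexx orbT.
have d1 : d <= 1 by apply: le_trans dm _; rewrite ge_min lexx.
have dq : d <= q by apply: le_trans dm _; rewrite ge_min lexx orbT.
have dr y : box y0 d y -> box y0 r y.
  by move=> yd a; apply: le_trans (yd a) _; rewrite ge_min lexx.
exists d => //; split=> [y /dr/rP[]//|W WS WM WC y yd].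
have H : W y0 - W y <= L * ip P (y0 - y) (y0 - y) `^ 4^-1.
  apply: (@holder_estimate R n U W A bet y0 S P r h L K M0 C0 eps oU WS SP r0 L0 K0 (ltW eps0)) (dr y yd).
  - by apply: le_trans eps8 _; rewrite lef_pV2 ?posrE// ler_nat.
  - by move=> z /rP[].
  - move=> z zr; have [Uz H1 _] := rP z zr.
    have tE : n%:R * th < eps.
      by apply: le_lt_trans (_ : N * th < eps); [rewrite ler_wpM2r// ltW|rewrite Nth ltr_pdivrMr// ltr_pMr// ltr1n].
    have [Q [H2 H3]] := near_identity SP eps0 (ltW th0) tE (pA z Uz).1 H1.
    exists Q; split => //; apply: le_trans H3 _; apply: le_trans (_ : N * (th + eps) <= _).
      by rewrite ler_wpM2r// addr_ge0// ltW.
    rewrite mulrDr Nth Neps; move: eps8; clear; move: eps => x; lra.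
  - move=> z w z2 wr; have [_ _ H1] := rP w wr.
    apply: le_trans (ip_le (fun i => mul_coord_le P i z2) H1) _.
    by rewrite mulrA.
  - move=> z z2; apply: le_trans (ler_norm _) _.
    apply: le_trans (ip_le (fun i => mul_coord_le P i z2) (fun i => mul_coord_le P i z2)) _.
    rewrite -/cP; set k := 2 * r * cP.
    have k0 : 0 <= k by rewrite !mulr_ge0// ltW.
    case: (posnP n) => [->|n0]; first by rewrite mul0r ler01.
    have k4 : k <= 4^-1 by apply: le_trans small2; rewrite ler_peMl// ler1n.
    rewrite mulrA; apply: le_trans (ler_pM _ k0 small2 k4) _; first by rewrite mulr_ge0.
    by rewrite -invfM invf_le1// -natrM ler1n.
  - move=> z zh a; rewrite -hS; apply: le_trans (ip_coord a (mulmx1C SP) (ltW h0) zh) _.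
    by rewrite ler_wpM2l ?(ltW h0)// lerDr.
  - by move=> z /rP[Uz _ _]; exact: WM.
  - by move=> z /rP[Uz _ _]; exact: WC.
  - by rewrite /K divfK ?lt0r_neq0// ltrDl.
  - apply: lt_le_trans (_ : L1 * (h ^+ 2) `^ 4^-1 <= _).
      by rewrite /L1 (divfK (lt0r_neq0 hp)) ltrDl.
    by apply: ler_wpM2r; [exact: ltW|rewrite /L lerDl ltW].
  - rewrite -/Kc ltr_pdivlMr//; apply: lt_trans (_ : 4 * (Kc + 1) < _).
      by rewrite mulrC ltr_pM2l// ltrDl.
    by rewrite /L ltrDr.
rewrite lerBlDr -lerBlDl; apply: le_trans H _.
have i1 : ip P (y0 - y) (y0 - y) <= tau.
  have yd' (a : 'I_n) : `|(y0 - y) 0 a| <= d by rewrite !mxE distrC; exact: yd.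
  apply: le_trans (ler_norm _) _.
  apply: le_trans (ip_le (fun i => mul_coord_le P i yd') (fun i => mul_coord_le P i yd')) _.
  apply: le_trans (_ : N * (cP + 1) ^+ 2 * d <= _); last first.
    by rewrite mulrC -ler_pdivlMr.
  rewrite -/cP -[leRHS]mulrA; apply: ler_pM => //; first by rewrite !mulr_ge0// ltW.
  rewrite (_ : d * cP * (d * cP) = cP ^+ 2 * d * d); last by ring.
  apply: ler_wpM2r; first exact: ltW.
  apply: le_trans (_ : cP ^+ 2 <= _); first by rewrite ler_piMr// sqr_ge0.
  by rewrite lerXn2r// ?nnegrE// ?lerDl// ltW.
have e1 : tau `^ 4^-1 = e / L by rewrite /tau -powRrM mulfV// powRr1// divr_ge0// ltW.
have := @ge0_ler_powR R 4^-1 _ _ tau _ _ i1; rewrite !nnegrE e1 => /(_ _ (ip_ge0 _ _) (ltW tau0)) H.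
apply: le_trans (ler_wpM2l (ltW L0) (H _)) _; first by [].
by rewrite mulrC divfK ?lt0r_neq0.
Qed.

End equicontinuity_bound.

(** * Small oscillation *)

Section averages.
Context {R : realType}.

(** On each subinterval [f1] differs from its left value by at most [C / N]. The lower bound is the
    useful half, the sum being applied to nonpositive derivatives. A finite sum makes the averages
    finite combinations of slices, whose smoothness and Laplacian are immediate. *)
Lemma riemann_lower (f f1 f2 : R -> R) (t C : R) (N : nat) : (0 < N)%N ->
  (forall s, t <= s <= t + 1 -> is_derive s 1 f (f1 s)) ->
  (forall s, t <= s <= t + 1 -> is_derive s 1 f1 (f2 s)) ->
  (forall s, t <= s <= t + 1 -> `|f2 s| <= C) ->
  f (t + 1) - f t - C / N%:R <= N%:R^-1 * \sum_(j < N) f1 (t + j%:R / N%:R).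
Proof.
move=> N0 d1 d2 fC; pose x j := t + j%:R / N%:R.
have Np : 0 < N%:R :> R by rewrite ltr0n.
have Ni : 0 <= N%:R^-1 :> R by rewrite invr_ge0 ltW.
have xt j : (j <= N)%N -> t <= x j <= t + 1.
  by move=> jN; rewrite lerDl lerD2l divr_ge0// ler_pdivrMr// mul1r ler_nat.
have xS j : x j.+1 = x j + N%:R^-1 by rewrite /x -addn1 natrD mulrDl mul1r addrA.
have tel : f (t + 1) - f t = \sum_(0 <= j < N) (f (x j.+1) - f (x j)).
  rewrite (telescope_sumr (fun j => f (x j)))//; congr (f _ - f _).
    by rewrite /x divff// gt_eqF.
  by rewrite /x mul0r addr0.
have C0 : 0 <= C by apply: le_trans (fC t _); rewrite ?normr_ge0// lexx lerDl ler01.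
have step j : (j < N)%N -> f (x j.+1) - f (x j) - C / N%:R / N%:R <= N%:R^-1 * f1 (x j).
  move=> jN; have /andP[tj _] := xt j (ltnW jN); have /andP[_ tj1] := xt j.+1 jN.
  have xx : x j <= x j.+1 by rewrite xS lerDl.
  have sub s : x j <= s <= x j.+1 -> t <= s <= t + 1.
    by move=> /andP[s1 s2]; rewrite (le_trans tj s1) (le_trans s2 tj1).
  have [|s sj ->] := @deriv_MVT R f f1 _ _ xx; first by move=> s /sub; exact: d1.
  have /andP[js _] := sj.
  have sub2 r : x j <= r <= s -> t <= r <= t + 1.
    by move=> /andP[r1 r2]; apply: sub; rewrite r1; case/andP: sj => _; exact: le_trans.
  have [|r rj E] := @deriv_MVT R f1 f2 _ _ js; first by move=> r /sub2; exact: d2.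
  have e1 : x j.+1 - x j = N%:R^-1 by rewrite xS addrAC subrr add0r.
  rewrite e1 mulrC -/(C / N%:R / N%:R) [C / _ / _]mulrC -mulrBr; apply: ler_wpM2l => //.
  rewrite lerBlDr -lerBlDl E; apply: le_trans (ler_norm _) _; rewrite normrM.
  apply: ler_pM => //; first exact: fC _ (sub2 _ rj).
  by rewrite ger0_norm ?subr_ge0// -e1 lerD2r; case/andP: sj.
rewrite tel big_mkord mulr_sumr.
have -> : C / N%:R = \sum_(j < N) (C / N%:R / N%:R).
  by rewrite sumr_const card_ord -[RHS]mulr_natr divfK// gt_eqF.
by rewrite -sumrB; apply: ler_sum => j _; exact: step.
Qed.

Lemma smooth_derive_bigsum (V : normedModType R) (U : set V) I (s : seq I) (w : I -> R)
    (f : I -> V -> R) x v : (forall j, smooth_on U (f j)) -> U x ->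
  'D_v (fun y => \sum_(j <- s) w j * f j y) x = \sum_(j <- s) w j * 'D_v (f j) x.
Proof.
move=> fS Ux; have [|_ ->//] := @is_derive_bigsum _ _ _ s (fun j y => w j * f j y) (fun j => w j * 'D_v (f j) x) x v.
move=> j; apply: is_deriveZ; apply: derivableP; exact: smooth_on_derivable (fS j) Ux.
Qed.

Lemma op2_bigsum n (U : set 'rV[R]_n) I (s : seq I) (w : I -> R) (f : I -> 'rV[R]_n -> R) A x :
  open U -> (forall j, smooth_on U (f j)) -> U x ->
  op2 (fun y => \sum_(j <- s) w j * f j y) A x = \sum_(j <- s) w j * op2 (f j) A x.
Proof.
move=> oU fS Ux; rewrite /op2.
under [RHS]eq_bigr do rewrite mulr_sumr.
rewrite [RHS]exchange_big/=; apply: eq_bigr => a _.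
under [RHS]eq_bigr do rewrite mulr_sumr.
rewrite [RHS]exchange_big/=; apply: eq_bigr => b _.
have E : {near x, 'D_(delta_mx 0 b) (fun y => \sum_(j <- s) w j * f j y) =1
    (fun y => \sum_(j <- s) w j * 'D_(delta_mx 0 b) (f j) y)}.
  by apply: (open_near oU Ux) => y Uy; exact: smooth_derive_bigsum fS Uy.
rewrite (near_eq_derive _ E) (smooth_derive_bigsum s w _ (fun j => smooth_on_D _ (fS j)) Ux).
by rewrite mulr_sumr; apply: eq_bigr => j _; rewrite mulrCA.
Qed.

End averages.

(** * Time averages and the oscillation of the solution *)

Section oscillation.
Context {R : realType} {n : nat} {M : manifold R n} (g : metric M).
Hypothesis cM : compact [set: M].
Hypothesis lapC : forall i f x, smooth_fun f -> dom i x ->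
  laplacian g f x = lap g i (f \o phiV i) (phi i x).
Variables (c p : R) (psi : M -> R) (a : R) (kap : R -> R) (U : R -> M -> R) (a0 a1 k0 : R).
Hypotheses (c0 : 0 < c) (p1 : 1 < p) (psiS : smooth_fun psi) (a2 : a < 2).
Hypotheses (US : st_smooth a U) (U0 : forall t x, a < t -> 0 < U t x).
Hypothesis UE : forall t x, a < t -> dt U t x = kap t * speed g c p psi U t x.
Hypothesis Un : forall s t x, 2 <= s -> s <= t -> U t x <= U s x.
Hypotheses (a00 : 0 < a0) (Ub : forall t x, 2 <= t -> a0 <= U t x <= a1).
Hypotheses (k00 : 0 < k0) (kap0 : forall t, 2 <= t -> k0 <= kap t).
Hypothesis dU0 : forall t x, 2 <= t -> dt U t x <= 0.

(** The equation multiplied by [U^(p-1)], which turns the time derivative into that of [U^p / p]. *)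
Lemma laplacian_U t x : 2 <= t ->
  kap t * (c * laplacian g (U t) x) =
  kap t * (psi x * U t x + U t x `^ p) + U t x `^ (p - 1) * dt U t x.
Proof.
move=> t2; have ta := lt_le_trans a2 t2; have Up := U0 x ta.
rewrite UE// /speed.
have e1 : U t x `^ p = U t x `^ (p - 1) * U t x.
  by rewrite -{3}(powRr1 (ltW Up)) -powRD ?subrK// (gt_eqF Up) implybT.
have e2 : U t x `^ (p - 1) * U t x `^ (1 - p) = 1.
  by rewrite -powRD ?addrA ?subrK ?subrr ?powRr0// (gt_eqF Up) implybT.
rewrite e1; move: e2; move: (U t x) (U t x `^ (p - 1)) (U t x `^ (1 - p)) (laplacian g (U t) x).
move=> u X Y Z XY.
have -> : X * (kap t * (Y * (c * Z - psi x * u) - u)) = kap t * (X * Y * (c * Z - psi x * u) - X * u) by ring.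
by rewrite XY; ring.
Qed.

Lemma lap_op2 i f y : smooth_fun f -> img i y ->
  laplacian g f (phiV i y) = op2 (f \o phiV i) (ginv g i y) y +
    'D_(\row_b drift g i y b) (f \o phiV i) y.
Proof.
move=> fS iy; have oU := @open_img _ _ M i.
apply: etrans (lapC fS (dom_phiV iy)) _; rewrite phiVK//.
apply: etrans (lapE g oU (fun y iy => iy) (fS i) iy) _; apply: f_equal2; first by [].
apply/esym; apply: etrans (smooth_derive _ oU (fS i) iy) _; apply: eq_bigr => b _.
by rewrite mxE.
Qed.

(* With the weights [kap], the sum of [U^(p-1) dt U = kap (c lap U - psi U - U^p)]
   is comparable to an increment of [U^p / p] in time: averages have a bounded
   Laplacian although [U t] has none a priori. *)
Definition average (t : R) (N : nat) (x : M) : R :=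
  \sum_(j <- index_enum 'I_N) kap (t + j%:R / N%:R) / (\sum_(j < N) kap (t + j%:R / N%:R)) *
    U (t + j%:R / N%:R) x.

Lemma time_ge (t : R) (N : nat) (j : 'I_N) : t <= t + j%:R / N%:R <= t + 1.
Proof.
have N0 : (0 < N)%N by case: (N) j => [[]|].
by rewrite lerDl lerD2l divr_ge0// ler_pdivrMr ?ltr0n// mul1r ler_nat ltnW.
Qed.

Lemma weights_gt0 t N : 2 <= t -> (0 < N)%N -> 0 < \sum_(j < N) kap (t + j%:R / N%:R).
Proof.
move=> t2 N0; apply: lt_le_trans (_ : N%:R * k0 <= _); first by rewrite mulr_gt0// ltr0n.
rewrite mulr_natl -[X in _ *+ X](card_ord N) -sumr_const; apply: ler_sum => j _.
by apply: kap0; have /andP[tj _] := time_ge t j; exact: le_trans t2 tj.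
Qed.

Lemma average_le t N x : 2 <= t -> (0 < N)%N -> average t N x <= U t x.
Proof.
move=> t2 N0; have S0 := weights_gt0 t2 N0.
apply: le_trans (_ : \sum_(j < N) kap (t + j%:R / N%:R) / (\sum_(j < N) kap (t + j%:R / N%:R)) * U t x <= _).
  apply: ler_sum => j _; have /andP[tj _] := time_ge t j; have tj2 := le_trans t2 tj.
  apply: ler_wpM2l; first by rewrite divr_ge0 ?(ltW S0)// (le_trans (ltW k00))// kap0.
  exact: Un.
by rewrite -mulr_suml -mulr_suml divff ?mul1r// gt_eqF.
Qed.

Lemma average_ge t N x l : 2 <= t -> (0 < N)%N -> (forall s, 2 <= s -> l <= U s x) -> l <= average t N x.
Proof.
move=> t2 N0 lU; have S0 := weights_gt0 t2 N0.
apply: le_trans (_ : \sum_(j < N) kap (t + j%:R / N%:R) / (\sum_(j < N) kap (t + j%:R / N%:R)) * l <= _).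
  by rewrite -mulr_suml -mulr_suml divff ?mul1r// gt_eqF.
apply: ler_sum => j _; have /andP[tj _] := time_ge t j; have tj2 := le_trans t2 tj.
apply: ler_wpM2l; first by rewrite divr_ge0 ?(ltW S0)// (le_trans (ltW k00))// kap0.
exact: lU.
Qed.

(** The reaction terms are bounded with [U]. The sum of the [U^(p-1) dt U] is nonpositive and at
    least [- N (a1^p + 1) / p] by the increment of [U^p], and the total weight is at least [N k0],
    so the factor [N] cancels. *)
Lemma average_laplacian : exists2 C : R, 0 <= C & forall t, 2 <= t -> exists2 N, (0 < N)%N &
  forall x, `|\sum_(j < N) kap (t + j%:R / N%:R) / (\sum_(j < N) kap (t + j%:R / N%:R)) *
    laplacian g (U (t + j%:R / N%:R)) x| <= C.
Proof.
have [B B0 Bp] := continuousM_bounded cM (smooth_fun_continuous psiS).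
have a10 : 0 <= a1 by have /andP[h1 h2] := Ub (point : M) (lexx 2); exact: le_trans (ltW a00) (le_trans h1 h2).
have p0 : 0 < p by exact: lt_trans p1.
have Bap : 0 <= B * a1 + a1 `^ p by rewrite addr_ge0 ?powR_ge0// mulr_ge0.
have ap : 0 <= (a1 `^ p + 1) / (p * k0) by rewrite divr_ge0 ?addr_ge0 ?powR_ge0// mulr_ge0// ltW.
exists ((B * a1 + a1 `^ p + (a1 `^ p + 1) / (p * k0)) / c); first by apply: divr_ge0; [exact: addr_ge0|exact: ltW].
move=> t t2; have ta := lt_le_trans a2 t2.
pose F s x := U s x `^ p; have FS : st_smooth a F := st_smooth_powR p US U0.
have [C2 C20 HC2] := st_bounded cM (t + 1) (st_smooth_dt (st_smooth_dt FS)) ta.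
(* The number of sample times depends on [t]: it beats the bound [C2] on the second time derivative
   over [[t, t + 1]], which is not uniform in [t]. The resulting error of at most [1] is the [+ 1]
   in the final constant. *)
pose N := (Num.truncn C2).+1; have N0 : (0 < N)%N by [].
have CN : C2 / N%:R <= 1 by rewrite ler_pdivrMr ?ltr0n// mul1r ltW// truncnS_gt.
exists N => // x; have S0 := weights_gt0 t2 N0; set S := \sum_(j < N) _ in S0 *.
pose T j := t + j%:R / N%:R : R; rewrite -/(T _).
have T2 (j : 'I_N) : 2 <= T j by have /andP[tj _] := time_ge t j; exact: le_trans tj.
have Np : 0 < N%:R :> R by rewrite ltr0n.
have dF s : a < s -> dt F s x = p * (U s x `^ (p - 1) * dt U s x).
  move=> sa; have Up := U0 x sa.
  have [_ e] := @is_derive1_comp R (fun y => y `^ p) (U^~ x) s _ _ (is_derive1_powR p Up) (st_is_derive x US sa).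
  by apply: etrans e _; rewrite -mulrA.
have low : F (t + 1) x - F t x - C2 / N%:R <= N%:R^-1 * \sum_(j < N) dt F (T j) x.
  apply: (riemann_lower (f := F^~ x) (f1 := fun s => dt F s x) (f2 := fun s => dt (dt F) s x) N0).
  - by move=> s /andP[ts _]; apply: st_is_derive FS _; exact: lt_le_trans ts.
  - by move=> s /andP[ts _]; apply: st_is_derive (st_smooth_dt FS) _; exact: lt_le_trans ts.
  - by move=> s ts; exact: HC2.
pose G (j : 'I_N) := U (T j) x `^ (p - 1) * dt U (T j) x.
have G0 : \sum_(j < N) G j <= 0.
  by apply: sumr_le0 => j _; rewrite mulr_ge0_le0 ?powR_ge0// dU0.
have GF : \sum_(j < N) dt F (T j) x = p * \sum_(j < N) G j.
  by rewrite mulr_sumr; apply: eq_bigr => j _; apply: dF; exact: lt_le_trans a2 (T2 j).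
have Ft : F t x <= a1 `^ p.
  have /andP[h1 h2] := Ub x t2.
  apply: ge0_ler_powR; rewrite ?nnegrE//; [exact: ltW|exact: le_trans (ltW a00) h1].
have Gl : - (\sum_(j < N) G j) <= N%:R * ((a1 `^ p + 1) / p).
  rewrite GF in low; rewrite mulrA ler_pdivlMr// -ler_pdivrMl// [- _ * p]mulrC mulrN mulrN.
  rewrite lerNl; apply: le_trans low.
  have := powR_ge0 (U (t + 1) x) p; rewrite -/(F (t + 1) x); move: CN Ft.
  move: (F (t + 1) x) (F t x) (C2 / _) (a1 `^ p) => x1 x2 x3 x4 h1 h2 h3; lra.
have Nk : N%:R * k0 <= S.
  rewrite mulr_natl -[X in _ *+ X](card_ord N) -sumr_const; apply: ler_sum => j _.
  exact: kap0 (T2 j).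
have E : c * (\sum_(j < N) kap (T j) / S * laplacian g (U (T j)) x) =
    \sum_(j < N) kap (T j) / S * (psi x * U (T j) x + U (T j) x `^ p) + S^-1 * \sum_(j < N) G j.
  rewrite !mulr_sumr -big_split /=; apply: eq_bigr => j _.
  have := laplacian_U x (T2 j); rewrite -/(G j) => H.
  rewrite (_ : c * _ = S^-1 * (kap (T j) * (c * laplacian g (U (T j)) x))); last by ring.
  by rewrite H; ring.
rewrite ler_pdivlMr// -[X in `|_| * X](gtr0_norm c0) -normrM mulrC E.
apply: le_trans (ler_normD _ _) _; apply: lerD.
  apply: le_trans (ler_norm_sum _ _ _) _.
  apply: le_trans (_ : \sum_(j < N) kap (T j) / S * (B * a1 + a1 `^ p) <= _); last first.
    by rewrite -mulr_suml -mulr_suml divff ?mul1r// gt_eqF.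
  apply: ler_sum => j _; have kj : 0 <= kap (T j) / S.
    by rewrite divr_ge0 ?(ltW S0)// (le_trans (ltW k00))// kap0.
  rewrite normrM (ger0_norm kj) ler_wpM2l//.
  have /andP[h1 h2] := Ub x (T2 j); have h0 : 0 <= U (T j) x := le_trans (ltW a00) h1.
  apply: le_trans (ler_normD _ _) _; apply: lerD.
    by rewrite normrM (ger0_norm h0); apply: ler_pM.
  rewrite ger0_norm ?powR_ge0//; apply: ge0_ler_powR; rewrite ?nnegrE//; exact: ltW.
rewrite normrM (ler0_norm G0) gtr0_norm ?invr_gt0// mulrC ler_pdivrMr//.
apply: le_trans Gl _; apply: le_trans (_ : (a1 `^ p + 1) / (p * k0) * (N%:R * k0) <= _).
  by rewrite le_eqVlt; apply/orP; left; apply/eqP; field; rewrite !gt_eqF.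
by apply: ler_wpM2l.
Qed.

(** With [l] the infimum of [U] in time at [y0], the averages are at least [l] at [y0], hence at
    least [l - e1] nearby, uniformly in time, and [U] lies above them. From above, one slice is
    below [l + 2 e1] near [y0] by its own continuity, and the later ones are smaller. *)
Lemma small_oscillation i y0 (e : R) : img i y0 -> 0 < e ->
  exists r T m : R, [/\ 0 < r, 2 <= T, box y0 r `<=` img i, 0 < m &
    forall t y, T <= t -> box y0 r y -> m <= U t (phiV i y) <= m + e].
Proof.
move=> iy0 e0; have oU := @open_img _ _ M i.
have [C C0 HC] := average_laplacian.
have a10 : 0 <= a1 by have /andP[h1 h2] := Ub (point : M) (lexx 2); exact: le_trans (ltW a00) (le_trans h1 h2).
pose x0 := phiV i y0.
pose l := inf [set U t x0 | t in [set t : R | 2 <= t]].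
have lb : has_inf [set U t x0 | t in [set t : R | 2 <= t]].
  split; first by exists (U 2 x0); exists 2 => //=.
  by exists a0 => _ [t t2 <-]; have /andP[] := Ub x0 t2.
have lU t : 2 <= t -> l <= U t x0.
  by move=> t2; apply: ge_inf; [exact: lb.2|exists t].
have al : a0 <= l by apply: lb_le_inf; [exact: lb.1|move=> _ [t t2 <-]; have /andP[] := Ub x0 t2].
(* The interval has length [3 e1]; [a0 / 2] keeps its lower end [l - e1] positive. *)
pose e1 := Num.min (e / 4) (a0 / 2).
have e10 : 0 < e1 by rewrite lt_min !divr_gt0.
have [_ [T /= T2 <-] UT] := inf_adherent e10 lb; rewrite -/l in UT.
have bc b : {for y0, continuous (fun y => (\row_b drift g i y b) 0 b)}.
  rewrite (_ : (fun _ => _) = (fun y => drift g i y b)); first exact: smooth_on_cts (drift_smooth g b) iy0.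
  by apply/funext => y; rewrite mxE.
have [r1 r10 [r1i H1]] := @elliptic_lower_equicontinuity R n (img i) (ginv g i)
  (fun y => \row_b drift g i y b) y0 a1 C e1 oU iy0 (fun y iy => ginv_posdef g iy)
  (fun b d => smooth_on_cts (ginv_smooth g b d) iy0) bc a10 C0 e10.
have Ta : a < T := lt_le_trans a2 T2.
have UTS := st_smooth_slice US Ta.
have nT : \forall y \near y0, U T (phiV i y) < l + 2 * e1.
  apply: (cvgr_lt _ (smooth_on_cts (UTS i) iy0)).
  by apply: lt_trans UT _; rewrite ltrD2l mulr_natl mulr2n ltrDl.
have [r2 r20 H2] := nbhs_box nT.
pose r := Num.min r1 r2.
have rr1 : box y0 r `<=` box y0 r1 by move=> y yr b; apply: le_trans (yr b) _; rewrite ge_min lexx.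
have rr2 : box y0 r `<=` box y0 r2 by move=> y yr b; apply: le_trans (yr b) _; rewrite ge_min lexx orbT.
have e14 : e1 + (e1 + e1) <= e.
  have : e1 <= e / 4 by rewrite ge_min lexx.
  move: e10; move: (e1) => z z0 z4; lra.
have e1a : e1 <= a0 / 2 by rewrite ge_min lexx orbT.
exists r, T, (l - e1); split => //; first by rewrite lt_min r10.
- by move=> y /rr1/r1i.
- rewrite subr_gt0; apply: le_lt_trans e1a _; apply: lt_le_trans al.
  by rewrite ltr_pdivrMr// ltr_pMr// ltr1n.
move=> t y Tt yr; have t2 := le_trans T2 Tt; have iy := r1i _ (rr1 _ yr).
apply/andP; split; last first.
  apply: le_trans (Un _ T2 Tt) _; apply: le_trans (ltW (H2 _ (rr2 _ yr))) _.
  by rewrite -lerBlDl opprB addrC addrA subrK mulr_natl mulr2n.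
have [N N0 HN] := HC t t2.
have tj (j : 'I_N) : a < t + j%:R / N%:R.
  by apply: lt_le_trans (lt_le_trans a2 t2) _; have /andP[] := time_ge t j.
have jS (j : 'I_N) : smooth_fun (U (t + j%:R / N%:R)) := st_smooth_slice US (tj j).
have WS : smooth_on (img i) (average t N \o phiV i).
  apply: (smooth_on_sum _ oU) => j; apply: (smooth_onM oU); last exact: (jS j i).
  have cS : smooth_on (img i) (fun=> kap (t + j%:R / N%:R) / (\sum_(j < N) kap (t + j%:R / N%:R)) : R).
    exact: smooth_on_cst.
  exact: cS.
have WM z : img i z -> `|(average t N \o phiV i) z| <= a1.
  move=> iz; have av := average_le (phiV i z) t2 N0.
  have /andP[h1 h2] := Ub (phiV i z) t2.
  have av2 : a0 <= average t N (phiV i z).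
    by apply: average_ge => // s s2; have /andP[] := Ub (phiV i z) s2.
  rewrite ger0_norm /=; first exact: le_trans av h2.
  exact: le_trans (ltW a00) av2.
have WC z : img i z -> `|op2 (average t N \o phiV i) (ginv g i z) z +
    'D_(\row_b drift g i z b) (average t N \o phiV i) z| <= C.
  move=> iz.
  have E1 := op2_bigsum (index_enum 'I_N) (fun j : 'I_N => kap (t + j%:R / N%:R) / (\sum_(j < N) kap (t + j%:R / N%:R)))
    (ginv g i z) oU (fun j => jS j i) iz.
  have E2 := smooth_derive_bigsum (index_enum 'I_N) (fun j : 'I_N => kap (t + j%:R / N%:R) / (\sum_(j < N) kap (t + j%:R / N%:R)))
    (\row_b drift g i z b) (fun j => jS j i) iz.
  have E := f_equal2 (fun u v : R => u + v) E1 E2.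
  apply: (@eq_ind R _ (fun X => `|X| <= C) (HN (phiV i z)) _ _).
  apply/esym; apply: etrans E _; apply: etrans (esym (big_split _ _ _ _ _)) _.
  apply: eq_bigr => j _; apply: etrans (esym (mulrDr _ _ _)) _.
  exact: (f_equal (fun X => _ * X) (esym (lap_op2 (jS j) iz))).
have H3 := H1 _ WS WM WC y (rr1 _ yr).
apply: le_trans (average_le _ t2 N0); apply: le_trans H3; rewrite lerD2r.
by apply: average_ge => // s s2; exact: lU.
Qed.

End oscillation.

(** * Bernstein estimates *)

Section product_rules.
Context {R : realType} {V : normedModType R} {n : nat} (d : 'I_n -> V).
Variables (U : set V) (oU : open U).
Implicit Types (f h : V -> R) (A : 'M[R]_n).

Definition opd A f z := \sum_a \sum_b A a b * 'D_(d a) ('D_(d b) f) z.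

Definition ipd A f h z := \sum_a \sum_b A a b * ('D_(d a) f z * 'D_(d b) h z).

Lemma smooth_deriveM f h z v : smooth_on U f -> smooth_on U h -> U z ->
  'D_v (fun y => f y * h y) z = f z * 'D_v h z + h z * 'D_v f z.
Proof.
move=> fS hS Uz; have df := derivableP (smooth_on_derivable (v := v) fS Uz).
have dh := derivableP (smooth_on_derivable (v := v) hS Uz).
by have [_ e] := is_deriveM df dh; exact: e.
Qed.

Lemma smooth_deriveD f h z v : smooth_on U f -> smooth_on U h -> U z ->
  'D_v (fun y => f y + h y) z = 'D_v f z + 'D_v h z.
Proof.
move=> fS hS Uz; have df := derivableP (smooth_on_derivable (v := v) fS Uz).
have dh := derivableP (smooth_on_derivable (v := v) hS Uz).
by have [_ e] := is_deriveD df dh; exact: e.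
Qed.

Lemma smooth_derive2M f h z v w : smooth_on U f -> smooth_on U h -> U z ->
  'D_v ('D_w (fun y => f y * h y)) z = f z * 'D_v ('D_w h) z + h z * 'D_v ('D_w f) z +
    ('D_v f z * 'D_w h z + 'D_v h z * 'D_w f z).
Proof.
move=> fS hS Uz.
have E : {near z, 'D_w (fun y => f y * h y) =1 (fun y => f y * 'D_w h y + h y * 'D_w f y)}.
  by apply: (open_near oU Uz) => y Uy; exact: smooth_deriveM fS hS Uy.
apply: etrans (near_eq_derive v E) _.
have S1 := smooth_on_D w fS; have S2 := smooth_on_D w hS.
apply: etrans (smooth_deriveD v (smooth_onM oU fS S2) (smooth_onM oU hS S1) Uz) _.
apply: etrans (f_equal2 (fun x y : R => x + y) (smooth_deriveM v fS S2 Uz) (smooth_deriveM v hS S1 Uz)) _.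
move: ('D_v ('D_w h) z) ('D_v ('D_w f) z) ('D_v f z) ('D_w h z) ('D_v h z) ('D_w f z) => x1 x2 x3 x4 x5 x6.
ring.
Qed.

Lemma opdM A f h z : A^T = A -> smooth_on U f -> smooth_on U h -> U z ->
  opd A (fun y => f y * h y) z = f z * opd A h z + h z * opd A f z + 2 * ipd A f h z.
Proof.
move=> AT fS hS Uz.
have S : ipd A f h z = \sum_a \sum_b A a b * ('D_(d a) h z * 'D_(d b) f z).
  rewrite /ipd exchange_big /=; apply: eq_bigr => a _; apply: eq_bigr => b _.
  by rewrite -{1}AT mxE; apply: f_equal; exact: mulrC.
have -> : 2 * ipd A f h z = ipd A f h z + \sum_a \sum_b A a b * ('D_(d a) h z * 'D_(d b) f z).
  by rewrite -S mulr_natl mulr2n.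
rewrite /opd /ipd !mulr_sumr -!big_split /=; apply: eq_bigr => a _.
rewrite !mulr_sumr -!big_split /=; apply: eq_bigr => b _.
apply: etrans (f_equal (fun x => A a b * x) (smooth_derive2M (d a) (d b) fS hS Uz)) _.
move: ('D_(d a) ('D_(d b) h) z) ('D_(d a) ('D_(d b) f) z) => x1 x2.
move: ('D_(d a) f z) ('D_(d b) h z) ('D_(d a) h z) ('D_(d b) f z) => x3 x4 x5 x6.
ring.
Qed.

Lemma ipdMr A f h k z : smooth_on U h -> smooth_on U k -> U z ->
  ipd A f (fun y => h y * k y) z = h z * ipd A f k z + k z * ipd A f h z.
Proof.
move=> hS kS Uz; rewrite /ipd !mulr_sumr -!big_split /=; apply: eq_bigr => a _.
rewrite !mulr_sumr -!big_split /=; apply: eq_bigr => b _.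
apply: etrans (f_equal (fun x => A a b * (_ * x)) (smooth_deriveM (d b) hS kS Uz)) _.
move: ('D_(d a) f z) ('D_(d b) h z) ('D_(d b) k z) => x1 x2 x3; ring.
Qed.

Lemma ipdMl A f h k z : smooth_on U f -> smooth_on U h -> U z ->
  ipd A (fun y => f y * h y) k z = f z * ipd A h k z + h z * ipd A f k z.
Proof.
move=> fS hS Uz; rewrite /ipd !mulr_sumr -!big_split /=; apply: eq_bigr => a _.
rewrite !mulr_sumr -!big_split /=; apply: eq_bigr => b _.
apply: etrans (f_equal (fun x => A a b * (x * _)) (smooth_deriveM (d a) fS hS Uz)) _.
move: ('D_(d a) f z) ('D_(d a) h z) ('D_(d b) k z) => x1 x2 x3; ring.
Qed.

Lemma ipd_le A f h z (L x y : R) : (forall a b, `|A a b| <= L) -> 0 <= L ->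
  (forall a, `|'D_(d a) f z| <= x) -> (forall a, `|'D_(d a) h z| <= y) -> 0 <= x -> 0 <= y ->
  `|ipd A f h z| <= (n * n)%:R * L * (x * y).
Proof.
move=> AL L0 fx hy x0 y0; apply: le_trans (ler_norm_sum _ _ _) _.
rewrite natrM -!mulrA mulr_natl -[X in _ *+ X](card_ord n) -sumr_const; apply: ler_sum => a _.
apply: le_trans (ler_norm_sum _ _ _) _.
rewrite mulr_natl -[X in _ *+ X](card_ord n) -sumr_const; apply: ler_sum => b _.
rewrite normrM; apply: ler_pM => //.
by rewrite normrM; apply: ler_pM.
Qed.

(** The product rule for a squared cutoff times an energy times an auxiliary function; the three
    mixed terms are the ones to be absorbed. *)
Lemma opd_cutoff A f h k z : A^T = A -> smooth_on U f -> smooth_on U h -> smooth_on U k -> U z ->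
  opd A (fun y => f y * f y * (h y * k y)) z =
  f z * f z * (h z * opd A k z + k z * opd A h z + 2 * ipd A h k z) +
  h z * k z * opd A (fun y => f y * f y) z +
  4 * f z * (h z * ipd A f k z + k z * ipd A f h z).
Proof.
move=> AT fS hS kS Uz.
have ffS := smooth_onM oU fS fS; have hkS := smooth_onM oU hS kS.
apply: etrans (opdM AT ffS hkS Uz) _.
apply: etrans (f_equal (fun x => _ * x + _ + _) (opdM AT hS kS Uz)) _.
apply: etrans (f_equal (fun x => _ + _ + 2 * x) (ipdMl A (fun y => h y * k y) fS fS Uz)) _.
apply: etrans (f_equal (fun x => _ + _ + 2 * (f z * x + f z * x)) (ipdMr A f hS kS Uz)) _.
move: (opd A k z) (opd A h z) (opd A (fun y => f y * f y) z) (ipd A h k z) (ipd A f k z) (ipd A f h z).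
move=> x1 x2 x3 x4 x5 x6; ring.
Qed.

End product_rules.

Section arithmetic.
Context {R : realType}.

(* Weighted AM-GM absorbs the cross terms [X1], [X2], [X3] of the product rule
   into the good terms [- dl * q ^+ 2] and [- N * f ^+ 4]. *)
Lemma bernstein_arith (z zm f q h dl C1 C2 C4 N G1 G2 G3 eta T1 T2 T3 X1 X2 X3 : R) :
  0 <= z <= zm -> 0 <= f -> 0 <= q -> 1 <= h <= 2 -> 0 < dl -> 0 < N ->
  0 <= C1 -> 0 <= C2 ->
  4 * C1 + 4 * (G1 * eta) ^+ 2 / dl <= N ->
  T1 <= - dl * q ^+ 2 + C1 * f ^+ 4 + C2 -> T2 <= - N * f ^+ 2 + C2 -> T3 <= C4 ->
  `|X1| <= G1 * eta * (f ^+ 2 * q) -> `|X2| <= G2 * (f * q) -> `|X3| <= G3 * f ->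
  zm ^+ 2 <= z ^+ 2 * f ^+ 2 -> 
  4 * (3 * C2 * zm ^+ 2 + 2 * C4 + 32 * G2 ^+ 2 / dl + 16 * G3 ^+ 2 / N) <= N * (z ^+ 2 * f ^+ 2) ->
  0 <= C4 ->
  z ^+ 2 * (h * T1 + f ^+ 2 * T2 - 2 * X1) + f ^+ 2 * h * T3 -
    4 * z * (f ^+ 2 * X3 + h * X2) <= 0.
Proof.
move=> /andP[z0 zzm] f0 q0 /andP[h1 h2] dl0 N0 C10 C20 NC HT1 HT2 HT3 HX1 HX2 HX3 zf big C40.
have zm0 := le_trans z0 zzm.
have h0 : 0 <= h by apply: le_trans h1.
have f20 : 0 <= f ^+ 2 by exact: sqr_ge0.
have z20 : 0 <= z ^+ 2 by exact: sqr_ge0.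
have q20 : 0 <= q ^+ 2 by exact: sqr_ge0.
have f40 : 0 <= f ^+ 4 by rewrite -[4%N]/(2 * 2)%N exprM sqr_ge0.
have dlN : dl != 0 by rewrite gt_eqF.
have NN : N != 0 by rewrite gt_eqF.
have f1 : zm = 0 \/ 1 <= f ^+ 2.
  have [->|zmN] := eqVneq zm 0; [by left|right].
  have zmp : 0 < zm ^+ 2 by rewrite exprn_even_gt0.
  rewrite -(ler_pM2l zmp) mulr1; apply: le_trans zf _.
  by apply: ler_wpM2r => //; rewrite lerXn2r.
have z2m : z ^+ 2 <= zm ^+ 2 by rewrite lerXn2r.
have amgm (k u v : R) : 0 < k -> 2 * u * v <= k * u ^+ 2 + v ^+ 2 / k.
  move=> k0; rewrite -subr_ge0 (_ : _ - _ = (k * u - v) ^+ 2 / k); last by field; rewrite gt_eqF.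
  by rewrite divr_ge0 ?sqr_ge0// ltW.
have I1 : h * T1 <= - dl * q ^+ 2 + 2 * C1 * f ^+ 4 + 2 * C2.
  apply: le_trans (ler_wpM2l h0 HT1) _; rewrite !mulrDr.
  have e1 : h * (- dl * q ^+ 2) <= - dl * q ^+ 2.
    by rewrite -subr_ge0 (_ : _ - _ = (h - 1) * (dl * q ^+ 2)) ?mulr_ge0 ?subr_ge0 ?(ltW dl0)//; ring.
  have e2 : h * (C1 * f ^+ 4) <= 2 * C1 * f ^+ 4.
    by rewrite -mulrA; apply: ler_wpM2r => //; exact: mulr_ge0.
  by apply: lerD; [apply: lerD|exact: ler_wpM2r].
have I2 : f ^+ 2 * T2 <= - N * f ^+ 4 + C2 * f ^+ 2.
  apply: le_trans (ler_wpM2l f20 HT2) _; rewrite le_eqVlt; apply/orP; left; apply/eqP; ring.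
have ge_opp (x y : R) : `|x| <= y -> - x <= y by rewrite ler_norml => /andP[H _]; rewrite lerNl.
have I3 : - 2 * X1 <= dl / 2 * q ^+ 2 + 2 * (G1 * eta) ^+ 2 / dl * f ^+ 4.
  apply: le_trans (_ : 2 * (G1 * eta * (f ^+ 2 * q)) <= _).
    by rewrite mulNr -mulrN; apply: ler_wpM2l => //; exact: ge_opp.
  apply: le_trans (_ : dl / 2 * q ^+ 2 + (G1 * eta * f ^+ 2) ^+ 2 / (dl / 2) <= _).
    apply: le_trans (amgm _ _ _ (divr_gt0 dl0 (ltr0n R 2))).
    by rewrite le_eqVlt; apply/orP; left; apply/eqP; ring.
  by rewrite le_eqVlt; apply/orP; left; apply/eqP; field.
have I4 : f ^+ 2 * h * T3 <= 2 * C4 * f ^+ 2.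
  apply: le_trans (ler_wpM2l (mulr_ge0 f20 h0) HT3) _.
  rewrite -subr_ge0 (_ : _ - _ = (2 - h) * (C4 * f ^+ 2)); last by ring.
  by rewrite mulr_ge0 ?subr_ge0 ?mulr_ge0.
have I5 : - (4 * z * (h * X2)) <= dl / 2 * z ^+ 2 * q ^+ 2 + 32 * G2 ^+ 2 / dl * f ^+ 2.
  have G20 : 0 <= G2 * (f * q) by apply: le_trans HX2.
  apply: le_trans (_ : 2 * (z * q) * (4 * G2 * f) <= _).
    rewrite (_ : - _ = 4 * z * (h * - X2)); last by ring.
    rewrite (_ : 2 * _ * _ = 4 * z * (2 * (G2 * (f * q)))); last by ring.
    apply: ler_wpM2l; first by rewrite mulr_ge0.
    apply: le_trans (ler_wpM2l h0 (ge_opp _ _ HX2)) _; exact: ler_wpM2r.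
  apply: le_trans (amgm _ _ _ (divr_gt0 dl0 (ltr0n R 2))) _.
  by rewrite le_eqVlt; apply/orP; left; apply/eqP; field.
have I6 : - (4 * z * (f ^+ 2 * X3)) <= N / 4 * z ^+ 2 * f ^+ 4 + 16 * G3 ^+ 2 / N * f ^+ 2.
  apply: le_trans (_ : 2 * (z * f ^+ 2) * (2 * G3 * f) <= _).
    rewrite (_ : - _ = 4 * z * f ^+ 2 * (- X3)); last by ring.
    rewrite (_ : 2 * _ * _ = 4 * z * f ^+ 2 * (G3 * f)); last by ring.
    by apply: ler_wpM2l; [rewrite !mulr_ge0|exact: ge_opp].
  apply: le_trans (amgm _ _ _ (divr_gt0 N0 (ltr0n R 4))) _.
  by rewrite le_eqVlt; apply/orP; left; apply/eqP; field.
pose W := 2 * C4 + 32 * G2 ^+ 2 / dl + 16 * G3 ^+ 2 / N.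
have I7 : 2 * C2 * z ^+ 2 <= 2 * C2 * zm ^+ 2 * f ^+ 2.
  have [zm00|f11] := f1.
    have -> : z = 0 by apply/le_anti; rewrite z0 -zm00 zzm.
    by rewrite expr0n mulr0 zm00 expr0n mulr0 mul0r.
  rewrite -[leRHS]mulrA; apply: ler_wpM2l; first exact: mulr_ge0.
  by apply: le_trans z2m _; rewrite ler_peMr// sqr_ge0.
have I8 : C2 * z ^+ 2 * f ^+ 2 <= C2 * zm ^+ 2 * f ^+ 2.
  by apply: ler_wpM2r => //; exact: ler_wpM2l.
have I9 : z ^+ 2 * f ^+ 4 * (2 * C1 + 2 * (G1 * eta) ^+ 2 / dl) <= z ^+ 2 * f ^+ 4 * (N / 2).
  apply: ler_wpM2l; first exact: mulr_ge0.
  rewrite ler_pdivlMr//; apply: le_trans NC.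
  by rewrite le_eqVlt; apply/orP; left; apply/eqP; field.
have I10 : f ^+ 2 * (3 * C2 * zm ^+ 2 + W) <= f ^+ 2 * (N / 4 * (z ^+ 2 * f ^+ 2)).
  apply: ler_wpM2l => //; rewrite [leRHS]mulrAC ler_pdivlMr//; apply: le_trans big.
  by rewrite /W le_eqVlt; apply/orP; left; apply/eqP; ring.
have J := ler_wpM2l z20 (lerD (lerD I1 I2) I3).
have K := lerD (lerD (lerD J I4) I5) I6.
apply: le_trans (_ : _ <= z ^+ 2 * (h * T1 + f ^+ 2 * T2 + - 2 * X1) + f ^+ 2 * h * T3 +
    - (4 * z * (h * X2)) + - (4 * z * (f ^+ 2 * X3))) _.
  by rewrite le_eqVlt; apply/orP; left; apply/eqP; ring.
apply: le_trans K _.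
have S := lerD (lerD I7 I8) (lerD I9 I10).
rewrite -subr_ge0 in S; rewrite -oppr_ge0; apply: le_trans S _.
by rewrite le_eqVlt; apply/orP; left; apply/eqP; rewrite /W; field; rewrite dlN NN.
Qed.

End arithmetic.

Section bernstein.
Context {R : realType} {n : nat} {M : manifold R n} (i : chart M) (a : R).
Local Notation ST := (R * 'rV[R]_n)%type.
Definition sp (b : 'I_n) : ST := (0, delta_mx 0 b).
Local Notation Dt := (@derive _ _ _ ^~ ((1, 0) : ST)).
Implicit Types (G F h : ST -> R) (A : 'M[R]_n).

Lemma derive_space G t y v : 'D_v (fun y => G (t, y)) y = 'D_((0, v) : ST) G (t, y).
Proof. by apply: (@derive_slice R _ ST R G (fun y => (t, y)) y v (0, v)) => k; exact: slice_rV. Qed.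

Lemma smooth_space G t : smooth_on (stdom a i) G -> a < t -> smooth_on (img i) (fun y => G (t, y)).
Proof.
move=> GS ta; apply: (@smooth_on_affine _ _ _ _ _ (stdom a i) G (fun y => (t, y)) (fun v => (0, v))
  (@open_img _ _ M i) _ _ _ GS); first exact: pair_continuousl.
- by move=> k v y; exact: slice_rV.
- by move=> y iy; split.
Qed.

Lemma opd_space G A t y : opd sp A G (t, y) = op2 (fun y => G (t, y)) A y.
Proof.
rewrite /opd /op2; apply: eq_bigr => b _; apply: eq_bigr => d _; apply: f_equal.
apply: etrans (esym (derive_space _ _ _ _)) _; apply: (f_equal (fun k => 'D_(delta_mx 0 b) k y)).
by apply/funext => z; apply/esym; exact: derive_space.
Qed.

Lemma opd_max G A t y : smooth_on (stdom a i) G -> a < t -> img i y -> is_posdef A ->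
  (\forall z \near y, G (t, z) <= G (t, y)) -> opd sp A G (t, y) <= 0.
Proof.
move=> GS ta iy /posdef_cholesky[S SE] Gm; rewrite opd_space.
have oU := @open_img _ _ M i; have hS := smooth_space GS ta.
rewrite (op2_gram oU hS iy SE); apply: sumr_le0 => b _.
by have [] := smooth_local_max (row b S) oU hS iy Gm.
Qed.

Lemma derive_snd (q : 'rV[R]_n -> R) (z v : ST) : 'D_v (fun z : ST => q z.2) z = 'D_(v.2) q z.2.
Proof. exact: (@derive_slice R ST 'rV[R]_n R q snd z v v.2). Qed.

Lemma box_bounded (q : 'rV[R]_n -> R) y0 r : smooth_on (img i) q -> box y0 r `<=` img i ->
  exists2 C : R, 0 <= C & forall y, box y0 r y -> `|q y| <= C.
Proof.
move=> qS ri; have qc : {within box y0 r, continuous q}.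
  apply: continuous_in_subspaceT => y; rewrite inE => yr; apply: smooth_on_cts qS _; exact: ri.
have [C [_ CP]] := compact_bounded (continuous_compact qc (@box_compact _ _ y0 r)).
exists (`|C| + 1); first by rewrite addr_ge0.
by move=> y yr; apply: (CP (`|C| + 1)); [rewrite ltr_pwDr// ler_norm|exists y].
Qed.

Lemma box_bounded_fin (I : finType) (q : I -> 'rV[R]_n -> R) y0 r : (forall k, smooth_on (img i) (q k)) ->
  box y0 r `<=` img i -> exists2 C : R, 0 <= C & forall k y, box y0 r y -> `|q k y| <= C.
Proof.
move=> qS ri; have H k : {C : R | 0 <= C /\ forall y, box y0 r y -> `|q k y| <= C}.
  by apply: cid; have [C C0 HC] := box_bounded (qS k) ri; exists C.
exists (\sum_k sval (H k)); first by apply: sumr_ge0 => k _; exact: (svalP (H k)).1.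
move=> k y yr; rewrite (bigD1 k)//= ler_wpDr//; last exact: (svalP (H k)).2.
by apply: sumr_ge0 => j _; exact: (svalP (H j)).1.
Qed.

(** The maximum principle for [zeta^2 F h], where [F] stands for an energy, [Fp] for the next one
    and [h] for the auxiliary function. The good terms [- dl Fp] and [- N F] dominate the quadratic
    term [C1 F^2] and the mixed ones wherever [zeta^2 F] is large. The bound depends on the data at
    [T] but not on the final time. *)
Lemma bernstein (A : ST -> 'M[R]_n) (kap : R -> R) F Fp h (zeta : 'rV[R]_n -> R) y0
    (r T dl N C1 C2 L gam eta : R) :
  a < T -> box y0 r `<=` img i ->
  smooth_on (stdom a i) F -> smooth_on (stdom a i) h -> smooth_on (img i) zeta ->
  (forall y, 0 <= zeta y) -> (forall y, box y0 r y -> 0 < zeta y -> nbhs y (box y0 r)) ->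
  let D := [set z : ST | T <= z.1 /\ box y0 r z.2] in
  (forall z, D z -> is_posdef (A z)) -> (forall z b d, D z -> `|A z b d| <= L) -> 0 <= L ->
  (forall t, T <= t -> 0 < kap t) ->
  (forall z, D z -> [/\ 0 <= F z, 0 <= Fp z & 1 <= h z <= 2]) ->
  (forall z, D z -> 'D_((1, 0) : ST) F z <= kap z.1 * (opd sp (A z) F z - dl * Fp z + C1 * F z ^+ 2 + C2)) ->
  (forall z, D z -> 'D_((1, 0) : ST) h z <= kap z.1 * (opd sp (A z) h z - N * F z + C2)) ->
  (forall z b, D z -> `|'D_(sp b) F z| <= gam * (Num.sqrt (F z) * Num.sqrt (Fp z))) ->
  (forall z b, D z -> `|'D_(sp b) h z| <= eta * Num.sqrt (F z)) ->
  0 < dl -> 0 < N -> 0 <= C1 -> 0 <= C2 -> 0 <= gam -> 0 <= eta ->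
  4 * C1 + 4 * ((n * n)%:R * L * gam * eta) ^+ 2 / dl <= N ->
  exists C, forall z, D z -> zeta z.2 ^+ 2 * F z <= C.
Proof.
move=> aT ri FS hS zS z0 zn D pA AL L0 kap0 Fpos Ft ht Fx hx dl0 N0 C10 C20 gam0 eta0 NC.
have oU := @open_stdom _ _ M a i.
pose zs (z : ST) := zeta z.2; have zsS : smooth_on (stdom a i) zs := smooth_on_snd zS.
have DU z : D z -> stdom a i z by move=> [Tz zr]; split; [exact: lt_le_trans Tz|exact: ri].
have [zm zm0 zmP] := box_bounded zS ri.
have [zd zd0 zdP] := box_bounded_fin (fun b : 'I_n => smooth_on_D (delta_mx 0 b) zS) ri.
have zzS : smooth_on (img i) (fun y => zeta y * zeta y) := smooth_onM (@open_img _ _ M i) zS zS.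
have [z2 z20 z2P] := box_bounded_fin (fun bd : 'I_n * 'I_n => smooth_on_D (delta_mx 0 bd.1)
  (smooth_on_D (delta_mx 0 bd.2) zzS)) ri.
pose C4 := (n * n)%:R * L * z2.
have C40 : 0 <= C4 by rewrite !mulr_ge0.
have opz z : D z -> `|opd sp (A z) (fun z => zs z * zs z) z| <= C4.
  move=> Dz; case: z Dz => t y Dz; rewrite opd_space /op2.
  apply: le_trans (ler_norm_sum _ _ _) _.
  rewrite /C4 natrM -!mulrA mulr_natl -[X in _ *+ X](card_ord n) -sumr_const; apply: ler_sum => b _.
  apply: le_trans (ler_norm_sum _ _ _) _.
  rewrite mulr_natl -[X in _ *+ X](card_ord n) -sumr_const; apply: ler_sum => d _.
  rewrite normrM; apply: ler_pM => //; first exact: AL.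
  by apply: (z2P (b, d) y Dz.2).
pose Phi (z : ST) := zs z * zs z * (F z * h z).
have PhiS : smooth_on (stdom a i) Phi.
  exact: smooth_onM oU (smooth_onM oU zsS zsS) (smooth_onM oU FS hS).
have [BT BT0 BTP] := box_bounded (smooth_space PhiS aT) ri.
pose G1 := (n * n)%:R * L * gam; pose G2 := (n * n)%:R * L * (zd * gam); pose G3 := (n * n)%:R * L * (zd * eta).
pose big := 4 * (3 * C2 * zm ^+ 2 + 2 * C4 + 32 * G2 ^+ 2 / dl + 16 * G3 ^+ 2 / N).
have big0 : 0 <= big.
  by rewrite /big mulr_ge0// !addr_ge0 ?divr_ge0 ?mulr_ge0 ?sqr_ge0// ltW.
(* [BT] covers the initial time. Since [h <= 2], exceeding [B] makes [zeta^2 F] larger than [zm^2],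
   hence [F] larger than [1], and larger than [big / N]: these are the two largeness conditions of
   [bernstein_arith]. *)
pose B := 2 * (zm ^+ 2 + big / N) + BT.
have B0 : 0 <= B by rewrite !addr_ge0 ?mulr_ge0 ?addr_ge0 ?divr_ge0 ?sqr_ge0// ltW.
have main t y : T <= t -> box y0 r y -> Phi (t, y) - B <= 0.
  move=> Tt yr.
  apply: (@max_principle R 'rV[R]_n (box y0 r) (fun t y => Phi (t, y) - B) T t 0 (@box_compact _ _ y0 r)); last 2 first.
  - by rewrite Tt lexx.
  - exact: yr.
  - apply: continuous_in_subspaceT => -[s z]; rewrite inE /= in_itv /= => -[/andP[Ts _] zr].
    have c := smooth_on_cts PhiS (DU (s, z) (conj Ts zr)).
    rewrite (_ : (fun _ => _) = (fun z : ST => Phi z - B)); last by apply/funext => -[].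
    exact: cvgB c (cvg_cst _).
  - move=> z zr; rewrite subr_le0; apply: le_trans (ler_norm _) _; apply: le_trans (BTP z zr) _.
    by rewrite /B lerDr mulr_ge0// addr_ge0 ?sqr_ge0// divr_ge0// ltW.
  move=> s z /andP[Ts st] zr Pp Pm.
  have Dz : D (s, z) by split => //=; exact: ltW.
  have Uz := DU _ Dz; have sa : a < s := lt_trans aT Ts.
  exists ('D_((1, 0) : ST) Phi (s, z)).
    have dd : derivable (fun s => Phi (s, z)) s 1.
      apply: (derivable_slice (f := Phi) (s := fun s : R => (s, z)) (w := ((1, 0) : ST))); first by move=> k; exact: slice_R.
      exact: smooth_on_derivable PhiS Uz.
    have e : 'D_1 (fun s => Phi (s, z)) s = 'D_((1, 0) : ST) Phi (s, z).
      by apply: (@derive_slice R R ST R Phi (fun s => (s, z)) s 1 (1, 0)) => k; exact: slice_R.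
    have := is_deriveB (DeriveDef dd e) (is_derive_cst B s (1 : R)).
    by move/is_derive_eq; apply; rewrite subr0.
  rewrite mul0r.
  have [F0 Fp0 h12] := Fpos _ Dz; have /andP[h1 h2] := h12.
  have h0 : 0 <= h (s, z) by apply: le_trans h1.
  have PB : B < Phi (s, z) by rewrite -subr_gt0.
  have zF : B < 2 * (zs (s, z) ^+ 2 * F (s, z)).
    apply: lt_le_trans PB _; rewrite /Phi -expr2.
    rewrite -subr_ge0 (_ : _ - _ = zs (s, z) ^+ 2 * F (s, z) * (2 - h (s, z))); last by ring.
    by apply: mulr_ge0; [apply: mulr_ge0; [exact: sqr_ge0|]|rewrite subr_ge0].
  have zp : 0 < zeta z.
    rewrite lt_neqAle z0 andbT; apply/eqP => zz; move: PB.
    by rewrite /Phi /zs /= -zz !mul0r ltNge B0.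
  (* Where the cutoff is positive, [zn] makes the box a neighbourhood, so the maximum over the
     closed box is a local maximum. *)
  have op0 : opd sp (A (s, z)) Phi (s, z) <= 0.
    apply: opd_max PhiS sa (ri _ zr) (pA _ Dz) _.
    apply: filterS (zn z zr zp) => w wr; have := Pm w wr; by rewrite lerD2r.
  have AT := (pA _ Dz).1.
  have E := opd_cutoff sp oU AT zsS FS hS Uz.
  have Et : 'D_((1, 0) : ST) Phi (s, z) =
      zs (s, z) ^+ 2 * (F (s, z) * 'D_((1, 0) : ST) h (s, z) + h (s, z) * 'D_((1, 0) : ST) F (s, z)).
    apply: etrans (smooth_deriveM ((1, 0) : ST) (smooth_onM oU zsS zsS) (smooth_onM oU FS hS) Uz) _.
    apply: etrans (f_equal (fun x => _ * x + _) (smooth_deriveM ((1, 0) : ST) FS hS Uz)) _.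
    apply: etrans (f_equal (fun x => _ + _ * x) (smooth_deriveM ((1, 0) : ST) zsS zsS Uz)) _.
    have e0 : 'D_((1, 0) : ST) zs (s, z) = 0.
      apply: etrans (derive_snd zeta (s, z) (1, 0)) _.
      by rewrite (derive_dir0 (@open_img _ _ M i) zS)//; exact: ri.
    rewrite e0; move: ('D_((1, 0) : ST) h (s, z)) ('D_((1, 0) : ST) F (s, z)) => x1 x2; ring.
  rewrite Et; have H1 := Ft _ Dz; have H2 := ht _ Dz; have kp := kap0 s (ltW Ts).
  have dz b : `|'D_(sp b) zs (s, z)| <= zd.
    rewrite (derive_snd zeta (s, z) (sp b)); exact: zdP.
  have sF := sqrtr_ge0 (F (s, z)); have sFp := sqrtr_ge0 (Fp (s, z)).
  have X1 := ipd_le (fun b d => AL _ b d Dz) L0 (fun b => Fx _ b Dz) (fun b => hx _ b Dz)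
    (mulr_ge0 gam0 (mulr_ge0 sF sFp)) (mulr_ge0 eta0 sF).
  have X2 := ipd_le (fun b d => AL _ b d Dz) L0 dz (fun b => Fx _ b Dz) zd0 (mulr_ge0 gam0 (mulr_ge0 sF sFp)).
  have X3 := ipd_le (fun b d => AL _ b d Dz) L0 dz (fun b => hx _ b Dz) zd0 (mulr_ge0 eta0 sF).
  have T3 := opz _ Dz.
  have FE := sqr_sqrtr F0; have FpE := sqr_sqrtr Fp0.
  have f4 : Num.sqrt (F (s, z)) ^+ 4 = F (s, z) ^+ 2 by rewrite -[4%N]/(2 * 2)%N exprM FE.
  have zmz : 0 <= zs (s, z) <= zm.
    by rewrite z0 /=; apply: le_trans (ler_norm _) _; exact: zmP.
  have BN : zm ^+ 2 + big / N < zs (s, z) ^+ 2 * F (s, z).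
    rewrite -(ltr_pM2l (ltr0n R 2)); apply: le_lt_trans zF.
    by rewrite /B lerDl.
  pose T1 := - dl * Fp (s, z) + C1 * F (s, z) ^+ 2 + C2.
  pose T2 := - N * F (s, z) + C2.
  have arith := @bernstein_arith R (zs (s, z)) zm (Num.sqrt (F (s, z))) (Num.sqrt (Fp (s, z))) (h (s, z))
    dl C1 C2 C4 N G1 G2 G3 eta T1 T2 (- opd sp (A (s, z)) (fun z => zs z * zs z) (s, z))
    (ipd sp (A (s, z)) F h (s, z)) (ipd sp (A (s, z)) zs F (s, z)) (ipd sp (A (s, z)) zs h (s, z))
    zmz sF sFp h12 dl0 N0 C10 C20 NC.
  rewrite FE FpE f4 in arith.
  have {}arith : zs (s, z) ^+ 2 * (h (s, z) * T1 + F (s, z) * T2 - 2 * ipd sp (A (s, z)) F h (s, z)) +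
      F (s, z) * h (s, z) * - opd sp (A (s, z)) (fun z => zs z * zs z) (s, z) -
      4 * zs (s, z) * (F (s, z) * ipd sp (A (s, z)) zs h (s, z) + h (s, z) * ipd sp (A (s, z)) zs F (s, z)) <= 0.
    apply: arith => //.
    - by apply: le_trans (ler_norm _) _; rewrite normrN.
    - apply: le_trans X1 _; rewrite -[X in _ <= _ * (X * _)]FE /G1 le_eqVlt; apply/orP; left; apply/eqP; ring.
    - apply: le_trans X2 _; rewrite /G2 le_eqVlt; apply/orP; left; apply/eqP; ring.
    - apply: le_trans X3 _; rewrite /G3 le_eqVlt; apply/orP; left; apply/eqP; ring.
    - by apply: le_trans (ltW BN); rewrite lerDl divr_ge0// ltW.
    - rewrite -/big mulrC -ler_pdivrMr//; apply: le_trans (ltW BN).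
      by rewrite lerDr sqr_ge0.
  have Z2 : 0 <= zs (s, z) ^+ 2 := sqr_ge0 _.
  apply: le_trans (ler_wpM2l Z2 (lerD (ler_wpM2l F0 H2) (ler_wpM2l h0 H1))) _.
  rewrite -(pmulr_rle0 _ kp) in arith; rewrite -(pmulr_rle0 _ kp) in op0.
  have S0 := lerD op0 arith; rewrite addr0 in S0; apply: le_trans _ S0.
  rewrite E /T1 /T2 /=.
  move: (opd sp (A (s, z)) h (s, z)) (opd sp (A (s, z)) F (s, z)) (opd sp (A (s, z)) (fun y => zs y * zs y) (s, z)).
  move: (ipd sp (A (s, z)) F h (s, z)) (ipd sp (A (s, z)) zs h (s, z)) (ipd sp (A (s, z)) zs F (s, z)).
  by move=> x1 x2 x3 x4 x5 x6; rewrite le_eqVlt; apply/orP; left; apply/eqP; ring.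
exists B => -[t y] Dz; have [F0 _ /andP[h1 _]] := Fpos _ Dz.
have := main t y Dz.1 Dz.2; rewrite subr_le0; apply: le_trans.
by rewrite /Phi /zs /= -expr2 mulrA ler_peMr// mulr_ge0// sqr_ge0.
Qed.

End bernstein.

(** * Differential polynomials and the differentiated equation *)

Section structure.
Context {R : realType} {n : nat} {M : manifold R n} (i : chart M) (a : R).
Local Notation ST := (R * 'rV[R]_n)%type.
Local Notation O := (stdom a i).
Variables (H : ST -> R).
Hypotheses (HS : smooth_on O H) (H0 : forall z, O z -> 0 < H z).

Definition dH (s : seq 'I_n) : ST -> R := dirder (map sp s) H.

Lemma dH_smooth s : smooth_on O (dH s).
Proof. exact: smooth_on_dirder. Qed.

(* [PW m w f]: [f] is a differential polynomial in [H] of order at most [m] and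
   weight at most [w] (each factor [d^s H] counting for [size s]), with
   coefficients [q(y) H^al]. *)
Inductive PW (m : nat) : nat -> (ST -> R) -> Prop :=
| PW_coef w (q : 'rV[R]_n -> R) (al : R) : smooth_on (img i) q ->
    PW m w (fun z => q z.2 * H z `^ al)
| PW_dH s w w' f : (size s <= m)%N -> (size s + w <= w')%N -> PW m w f ->
    PW m w' (fun z => dH s z * f z)
| PW_add w f h : PW m w f -> PW m w h -> PW m w (fun z => f z + h z)
| PW_ext w f h : (forall z, O z -> f z = h z) -> PW m w f -> PW m w h.

Let oO : open O := @open_stdom _ _ M a i.

Lemma coef_smooth (q : 'rV[R]_n -> R) (al : R) : smooth_on (img i) q ->
  smooth_on O (fun z => q z.2 * H z `^ al).
Proof.
move=> qS; apply: (smooth_onM oO); first exact: smooth_on_snd qS.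
exact: (smooth_on_powR al oO HS H0).
Qed.

Lemma PW_smooth m w f : PW m w f -> smooth_on O f.
Proof.
elim=> {w f}[w q al|s w w' f _ _ _ fS|w f h _ fS _ hS|w f h fh _ fS].
- exact: coef_smooth.
- exact: smooth_onM oO (dH_smooth s) fS.
- exact: smooth_onD oO fS hS.
- exact: smooth_on_ext oO fh fS.
Qed.

Lemma PW_mono m m' w w' f : (m <= m')%N -> (w <= w')%N -> PW m w f -> PW m' w' f.
Proof.
move=> mm + P; elim: P w' => {w f}[w q al qS w' _|s w w0 f sm sw _ IH w' ww|w f h _ IH1 _ IH2 w' ww|w f h fh _ IH w' ww].
- exact: PW_coef.
- apply: (PW_dH (w := w)); [exact: leq_trans mm|exact: leq_trans sw ww|exact: IH].
- by apply: PW_add; [exact: IH1|exact: IH2].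
- by apply: (PW_ext fh); exact: IH.
Qed.

Lemma PW_sum m w I (r : seq I) (f : I -> ST -> R) : (forall j, PW m w (f j)) ->
  PW m w (fun z => \sum_(j <- r) f j z).
Proof.
move=> fP; elim: r => [|j r IH].
  have cS : smooth_on (img i) (fun=> 0 : R) by exact: smooth_on_cst.
  by apply: (PW_ext _ (PW_coef m w 0 cS)) => z _; rewrite mul0r big_nil.
by apply: (PW_ext _ (PW_add (fP j) IH)) => z _; rewrite big_cons.
Qed.

Lemma PW_D m w f b : PW m w f -> PW m.+1 w.+1 ('D_(sp b) f).
Proof.
elim=> {w f}[w q al qS|s w w' f sm sw fP IH|w f h fP IH1 hP IH2|w f h fh fP IH].
- have S1 : smooth_on (img i) ('D_(delta_mx 0 b) q) by exact: smooth_on_D.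
  have S2 : smooth_on (img i) (fun y => al * q y).
    by apply: (smooth_onM (@open_img _ _ M i)) qS; exact: smooth_on_cst.
  have P1 := PW_coef m.+1 w.+1 al S1.
  have P2 : PW m.+1 w.+1 (fun z => dH [:: b] z * ((fun y => al * q y) z.2 * H z `^ (al - 1))).
    by apply: (PW_dH (w := 0)) (PW_coef m.+1 0 (al - 1) S2).
  apply: (PW_ext _ (PW_add P1 P2)) => z Oz.
  apply: etrans _ (esym (smooth_deriveM (sp b) (smooth_on_snd qS) (smooth_on_powR al oO HS H0) Oz)).
  rewrite (derive_snd q z (sp b)).
  have e : 'D_(sp b) (fun z => H z `^ al) z = al * H z `^ (al - 1) * 'D_(sp b) H z.
    have Hz := H0 Oz.
    have dP : differentiable (fun x : R => x `^ al) (H z).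
      by apply/derivable1_diffP; have [] := is_derive1_powR al Hz.
    have [_ E] := is_derive_comp dP (smooth_on_derivable (v := sp b) HS Oz).
    apply: etrans E _; apply: etrans (derive_dir1 _ dP) _; apply: etrans (mulrC _ _) _.
    by apply: (f_equal (fun x => x * _)); have [] := is_derive1_powR al Hz.
  rewrite e /dH /=; move: ('D_(sp b) H z) ('D_(delta_mx 0 b) q z.2) => x1 x2.
  rewrite /=; ring.
- have P1 : PW m.+1 w'.+1 (fun z => dH (b :: s) z * f z).
    by apply: (PW_dH (w := w)); [exact: sm|exact: sw|exact: PW_mono fP].
  have P2 : PW m.+1 w'.+1 (fun z => dH s z * 'D_(sp b) f z).
    by apply: (PW_dH (w := w.+1)); [exact: leqW|rewrite addnS|exact: IH].
  apply: (PW_ext _ (PW_add P2 P1)) => z Oz.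
  apply: etrans _ (esym (smooth_deriveM (sp b) (dH_smooth s) (PW_smooth fP) Oz)).
  by apply: (f_equal (fun x => _ + x)); exact: mulrC.
- apply: (PW_ext _ (PW_add IH1 IH2)) => z Oz.
  by apply/esym; exact: smooth_deriveD (PW_smooth fP) (PW_smooth hP) Oz.
- apply: (PW_ext _ IH) => z Oz; apply: near_eq_derive.
  exact: open_near oO Oz fh.
Qed.

Section equation.
Variables (kap : R -> R) (q : 'I_n -> 'I_n -> 'rV[R]_n -> R) (al : R) (P0 : ST -> R).
Hypotheses (qS : forall b d, smooth_on (img i) (q b d)) (P0S : PW 1 2 P0).

Definition Amx (z : ST) : 'M[R]_n := \matrix_(b, d) (q b d z.2 * H z `^ al).

Hypothesis HE : forall z, O z -> 'D_((1, 0) : ST) H z = kap z.1 * (opd sp (Amx z) H z + P0 z).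

Lemma dH_swap b d e s z : O z -> 'D_(sp b) ('D_(sp d) ('D_(sp e) (dH s))) z =
  'D_(sp d) ('D_(sp e) ('D_(sp b) (dH s))) z.
Proof.
move=> Oz; apply: etrans (schwarz _ _ oO (smooth_on_D (sp e) (dH_smooth s)) Oz) _.
apply: near_eq_derive; apply: (open_near oO Oz) => w Ow.
exact: schwarz oO (dH_smooth s) Ow.
Qed.

Lemma derive_time_factor (G : ST -> R) b z : smooth_on O G -> O z ->
  'D_(sp b) (fun z => kap z.1 * G z) z = kap z.1 * 'D_(sp b) G z.
Proof.
case: z => t y GS [/= ta iy].
apply: etrans (esym (derive_space (fun z => kap z.1 * G z) t y (delta_mx 0 b))) _ => /=.
apply: etrans (smooth_deriveZ (kap t) (delta_mx 0 b) (smooth_space GS ta) iy) _.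
by apply: (f_equal (fun x => kap t * x)); exact: derive_space.
Qed.

(** Induction on the word. The factor [kap] does not see spatial derivatives, and the leading
    operator commutes with them up to derivatives of its coefficients. Those multiply second
    derivatives of [dH s], so the remainder stays one order below the leading part while its weight
    grows by one. *)
Lemma dH_equation s : exists P, PW (size s).+1 (size s).+2 P /\
  forall z, O z -> 'D_((1, 0) : ST) (dH s) z = kap z.1 * (opd sp (Amx z) (dH s) z + P z).
Proof.
elim: s => [|b s [P [PP PE]]]; first by exists P0.
have AP d e : PW 0 0 (fun z => q d e z.2 * H z `^ al) by exact: PW_coef.
have AE d e z : Amx z d e = q d e z.2 * H z `^ al by rewrite mxE.
pose Q z := \sum_d \sum_e dH (d :: e :: s) z * 'D_(sp b) (fun z => q d e z.2 * H z `^ al) z.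
have QP : PW (size s).+2 (size s).+3 Q.
  apply: PW_sum => d; apply: PW_sum => e.
  apply: (PW_dH (w := 1)) => //; first by rewrite /= addn1.
  by apply: PW_mono (PW_D b (AP d e)).
exists (fun z => Q z + 'D_(sp b) P z); split; first exact: PW_add QP (PW_D b PP).
move=> z Oz.
have PS := PW_smooth PP.
have opS : smooth_on O (fun z => \sum_d \sum_e q d e z.2 * H z `^ al * dH (d :: e :: s) z).
  apply: (smooth_on_sum _ oO) => d; apply: (smooth_on_sum _ oO) => e.
  exact: smooth_onM oO (coef_smooth al (qS d e)) (dH_smooth (d :: e :: s)).
have opE w : opd sp (Amx w) (dH s) w = \sum_d \sum_e q d e w.2 * H w `^ al * dH (d :: e :: s) w.
  by apply: eq_bigr => d _; apply: eq_bigr => e _; rewrite AE.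
apply: etrans (schwarz _ _ oO (dH_smooth s) Oz) _.
have N1 : {near z, 'D_((1, 0) : ST) (dH s) =1 (fun z => kap z.1 *
    ((\sum_d \sum_e q d e z.2 * H z `^ al * dH (d :: e :: s) z) + P z))}.
  by apply: (open_near oO Oz) => w Ow; rewrite PE// opE.
apply: etrans (near_eq_derive _ N1) _.
apply: etrans (derive_time_factor b (smooth_onD oO opS PS) Oz) _.
apply: (f_equal (fun x => kap z.1 * x)).
apply: etrans (smooth_deriveD (sp b) opS PS Oz) _; rewrite addrA; apply: (f_equal (fun x => x + _)).
have [|_ E] := @is_derive_bigsum _ _ _ (index_enum 'I_n)
  (fun d z => \sum_e q d e z.2 * H z `^ al * dH (d :: e :: s) z)
  (fun d => \sum_e (q d e z.2 * H z `^ al * 'D_(sp b) (dH (d :: e :: s)) z +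
    dH (d :: e :: s) z * 'D_(sp b) (fun z => q d e z.2 * H z `^ al) z)) z (sp b).
  move=> d; apply: is_derive_bigsum => e.
  have S1 := coef_smooth al (qS d e); have S2 := dH_smooth (d :: e :: s).
  exact: (is_deriveM (derivableP (smooth_on_derivable (v := sp b) S1 Oz)) (derivableP (smooth_on_derivable (v := sp b) S2 Oz))).
apply: etrans E _; rewrite /opd /Q -big_split /=; apply: eq_bigr => d _.
rewrite -big_split /=; apply: eq_bigr => e _; rewrite AE.
by apply: (f_equal (fun x => _ * x + _)); exact: dH_swap.
Qed.

End equation.

(** Induction on the polynomial: [Y j] bounds the derivatives of order [j] and [beta w] the
    monomials of weight [w]. The compatibility between them is the only thing a particular choice of
    weights has to provide. *)
Lemma PW_bound (m W : nat) (D : set ST) (beta Y : nat -> ST -> R) w f :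
  D `<=` O ->
  (forall w z, D z -> 1 <= beta w z) ->
  (forall s z, (size s <= m)%N -> D z -> `|dH s z| <= Y (size s) z) ->
  (forall j w w', (j <= m)%N -> (j + w <= w')%N -> (w' <= W)%N ->
    exists2 C, 0 <= C & forall z, D z -> Y j z * beta w z <= C * beta w' z) ->
  (forall (q : 'rV[R]_n -> R) (al : R), smooth_on (img i) q -> exists2 C, 0 <= C &
    forall z, D z -> `|q z.2 * H z `^ al| <= C) ->
  PW m w f -> (w <= W)%N -> exists2 C, 0 <= C & forall z, D z -> `|f z| <= C * beta w z.
Proof.
move=> DO b1 HY Yb qb; elim=> {w f}[w q al qS wW|s w w' f sm sw _ IH wW|w f h _ IH1 _ IH2 wW|w f h fh _ IH wW].
- have [C C0 HC] := qb q al qS; exists C => // z Dz; apply: le_trans (HC z Dz) _.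
  by rewrite ler_peMr// b1.
- have [C C0 HC] := IH (leq_trans (leq_trans (leq_addl _ _) sw) wW).
  have [C' C0' HC'] := Yb _ _ _ sm sw wW.
  exists (C * C'); first exact: mulr_ge0.
  move=> z Dz; rewrite normrM; apply: le_trans (ler_pM _ _ (HY s z sm Dz) (HC z Dz)) _ => //.
  by rewrite mulrCA -mulrA; apply: ler_wpM2l => //; exact: HC'.
- have [C C0 HC] := IH1 wW; have [C' C0' HC'] := IH2 wW.
  exists (C + C'); first exact: addr_ge0.
  move=> z Dz; rewrite mulrDl; apply: le_trans (ler_normD _ _) _.
  by apply: lerD; [exact: HC|exact: HC'].
- have [C C0 HC] := IH wW; exists C => // z Dz.
  by rewrite -fh; [exact: HC|exact: DO].
Qed.

End structure.

(** * Energies of the spatial derivatives *)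

Section derivative_energy.
Context {R : realType} {n : nat} {M : manifold R n} (i : chart M) (a : R).
Local Notation ST := (R * 'rV[R]_n)%type.
Local Notation O := (stdom a i).
Variables (H : ST -> R) (kap : R -> R) (q : 'I_n -> 'I_n -> 'rV[R]_n -> R) (al a0 a1 : R) (P0 : ST -> R).
Hypotheses (a2 : a < 2) (HS : smooth_on O H) (H0 : forall z, O z -> 0 < H z).
Hypotheses (kap0 : forall t, 2 <= t -> 0 < kap t) (qS : forall b d, smooth_on (img i) (q b d)).
Hypothesis pq : forall y, img i y -> is_posdef (\matrix_(b, d) q b d y).
Hypothesis P0S : PW i a H 1 1 P0.
Hypothesis HE : forall z, O z ->
  'D_((1, 0) : ST) H z = kap z.1 * (opd sp (Amx H q al z) H z + P0 z).
Hypotheses (a00 : 0 < a0) (Hb : forall z, 2 <= z.1 -> img i z.2 -> a0 <= H z <= a1).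
Local Notation Am := (Amx H q al).
Let oO : open O := @open_stdom _ _ M a i.

(** The power is monotone, in a direction that depends on the sign of [be]; the sum of the two end
    values bounds it in both cases. *)
Lemma powR_le_ends (x be : R) : a0 <= x <= a1 -> x `^ be <= a0 `^ be + a1 `^ be.
Proof.
move=> /andP[ax xa]; have x0 : 0 < x := lt_le_trans a00 ax.
have a10 : 0 < a1 := lt_le_trans x0 xa.
have [b0|/ltW b0] := leP 0 be.
  rewrite ler_wpDl ?powR_ge0//; apply: ge0_ler_powR; rewrite ?nnegrE ?(ltW x0) ?(ltW a10)//.
rewrite ler_wpDr ?powR_ge0// -[be]opprK !(powRN _ (- be)) lef_pV2 ?posrE ?powR_gt0//.
apply: ge0_ler_powR; rewrite ?nnegrE ?oppr_ge0 ?(ltW x0) ?(ltW a00)//.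
Qed.

Definition region (T : R) y0 r := [set z : ST | T <= z.1 /\ box y0 r z.2].

Lemma region_O T y0 r : 2 <= T -> box y0 r `<=` img i -> region T y0 r `<=` O.
Proof. by move=> T2 ri z [Tz zr]; split; [exact: lt_le_trans a2 (le_trans T2 Tz)|exact: ri]. Qed.

Lemma region_H T y0 r z : 2 <= T -> box y0 r `<=` img i -> region T y0 r z -> a0 <= H z <= a1.
Proof. by move=> T2 ri [Tz zr]; apply: Hb; [exact: le_trans Tz|exact: ri]. Qed.

Lemma coef_bounded (k : 'rV[R]_n -> R) be T y0 r : 2 <= T -> box y0 r `<=` img i -> smooth_on (img i) k ->
  exists2 C, 0 <= C & forall z, region T y0 r z -> `|k z.2 * H z `^ be| <= C.
Proof.
move=> T2 ri kS; have [C C0 HC] := box_bounded kS ri.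
exists (C * (a0 `^ be + a1 `^ be)); first by rewrite mulr_ge0// addr_ge0 ?powR_ge0.
move=> z zD; rewrite normrM; apply: ler_pM => //; first exact: HC zD.2.
by rewrite ger0_norm ?powR_ge0//; apply: powR_le_ends; exact: region_H zD.
Qed.

Lemma Am_posdef z : O z -> is_posdef (Am z).
Proof.
move=> Oz; have [QT Qp] := pq Oz.2; have hp := powR_gt0 al (H0 Oz).
have E : Am z = H z `^ al *: \matrix_(b, d) q b d z.2.
  by apply/matrixP => b d; rewrite !mxE mulrC.
rewrite E; split; first by rewrite linearZ /= QT.
by move=> v v0; rewrite -scalemxAr -scalemxAl mxE mulr_gt0// Qp.
Qed.

Lemma Am_bounded T y0 r : 2 <= T -> box y0 r `<=` img i ->
  exists2 L, 0 <= L & forall z b d, region T y0 r z -> `|Am z b d| <= L.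
Proof.
move=> T2 ri.
have [L L0 HL] := box_bounded_fin (fun bd : 'I_n * 'I_n => qS bd.1 bd.2) ri.
exists (L * (a0 `^ al + a1 `^ al)); first by rewrite mulr_ge0// addr_ge0 ?powR_ge0.
move=> z b d zD; rewrite mxE normrM; apply: ler_pM => //; first exact: (HL (b, d) _ zD.2).
by rewrite ger0_norm ?powR_ge0//; apply: powR_le_ends; exact: region_H zD.
Qed.

Lemma Am_elliptic T y0 r : 2 <= T -> box y0 r `<=` img i ->
  exists2 dl, 0 < dl & forall z (f : ST -> R), region T y0 r z ->
    dl * \sum_b 'D_(sp b) f z ^+ 2 <= ipd sp (Am z) f f z.
Proof.
move=> T2 ri.
have [|||dl dl0 Hd] := @posdef_uniform R 'rV[R]_n (box y0 r) n (fun y => \matrix_(b, d) q b d y).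
- exact: box_compact.
- move=> y b d yr; rewrite (_ : (fun _ => _) = q b d); last by apply/funext => z; rewrite mxE.
  by apply: smooth_on_cts (qS b d) _; exact: ri.
- by move=> y yr; apply: pq; exact: ri.
pose S := a0 `^ (- al) + a1 `^ (- al).
have S0 : 0 < S by rewrite ltr_pwDl ?powR_gt0 ?powR_ge0.
exists (dl / S); first by rewrite divr_gt0.
move=> z f zD; pose v : 'rV[R]_n := \row_b 'D_(sp b) f z.
have Oz := region_O T2 ri zD.
have Hz := powR_le_ends (- al) (region_H T2 ri zD).
have hp := powR_gt0 al (H0 Oz).
have hS : S^-1 <= H z `^ al.
  by rewrite -[leRHS]invrK lef_pV2 ?posrE ?invr_gt0// -powRN.
have -> : ipd sp (Am z) f f z = H z `^ al * (v *m (\matrix_(b, d) q b d z.2) *m v^T) 0 0.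
  rewrite quadE /ipd mulr_sumr; apply: eq_bigr => b _; rewrite mulr_sumr; apply: eq_bigr => d _.
  rewrite !mxE; move: (H z `^ al) (q b d z.2) ('D_(sp b) f z) ('D_(sp d) f z) => x1 x2 x3 x4; ring.
have -> : \sum_b 'D_(sp b) f z ^+ 2 = \sum_b v 0 b ^+ 2 by apply: eq_bigr => b _; rewrite mxE.
have := Hd z.2 v zD.2; set Q := (v *m _ *m _) 0 0; set s := \sum_b _ => H1.
have s0 : 0 <= s by apply: sumr_ge0 => b _; exact: sqr_ge0.
rewrite mulrAC mulrC; apply: ler_pM => //; first by rewrite invr_ge0 ltW.
by rewrite mulr_ge0// ltW.
Qed.

Fixpoint words (k : nat) : seq (seq 'I_n) :=
  if k is k'.+1 then [seq b :: s | b <- index_enum 'I_n, s <- words k'] else [:: [::]].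

Lemma mem_words s : s \in words (size s).
Proof.
elim: s => [|b s IH] /=; first by rewrite inE.
by apply/allpairsP; exists (b, s); split => //=; exact: mem_index_enum.
Qed.

Lemma size_words k s : s \in words k -> size s = k.
Proof.
elim: k s => [|k IH] s /=; first by rewrite inE => /eqP ->.
by move=> /allpairsP[[b w] [_ /= /IH <- ->]].
Qed.

(** Words are used instead of multi-indices, so that the energy of order [k + 1] is exactly the sum
    of the squared gradients of the terms of order [k]. *)
Definition energy k z := \sum_(s <- words k) dH H s z ^+ 2.

Lemma energy_ge0 k z : 0 <= energy k z.
Proof. by apply: sumr_ge0 => s _; exact: sqr_ge0. Qed.

Lemma energyS k z : energy k.+1 z = \sum_(s <- words k) \sum_b 'D_(sp b) (dH H s) z ^+ 2.
Proof. by rewrite exchange_big /energy big_allpairs_dep. Qed.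

Lemma dH_energy s z : `|dH H s z| <= Num.sqrt (energy (size s) z).
Proof.
rewrite -sqrtr_sqr; apply: ler_wsqrtr; rewrite /energy (big_rem s (mem_words s)) /= lerDl.
by apply: sumr_ge0 => w _; exact: sqr_ge0.
Qed.

Lemma energy_le k z (C : R) : (forall s, size s = k -> `|dH H s z| <= C) ->
  energy k z <= (size (words k))%:R * C ^+ 2.
Proof.
move=> HC; rewrite /energy big_seq.
apply: le_trans (_ : \sum_(s <- words k | s \in words k) C ^+ 2 <= _).
  apply: ler_sum => s /size_words sk; rewrite -real_normK ?num_real//.
  by rewrite lerXn2r ?nnegrE ?HC// (le_trans _ (HC s sk)).
by rewrite -big_seq big_const_seq count_predT iter_addr_0 mulr_natl.
Qed.

Lemma energy_smooth k : smooth_on O (energy k).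
Proof.
apply: (smooth_on_sum _ oO) => s; rewrite (_ : (fun _ => _) = (fun z => dH H s z * dH H s z)).
  exact: smooth_onM oO (dH_smooth HS s) (dH_smooth HS s).
by apply/funext => z; rewrite expr2.
Qed.

Lemma derive_energy k v z : O z ->
  'D_v (energy k) z = \sum_(s <- words k) 2 * (dH H s z * 'D_v (dH H s) z).
Proof.
move=> Oz; have [|_ E] := @is_derive_bigsum _ _ _ (words k) (fun s z => dH H s z ^+ 2)
  (fun s => 2 * (dH H s z * 'D_v (dH H s) z)) z v; last exact: E.
move=> s; have d := derivableP (smooth_on_derivable (v := v) (dH_smooth HS s) Oz).
have := is_deriveM d d; rewrite (_ : dH H s * dH H s = (fun z => dH H s z ^+ 2)); last first.
  by apply/funext => w; rewrite expr2.
move/is_derive_eq; apply; rewrite /GRing.scale /= mulr_natl mulr2n; reflexivity.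
Qed.

Lemma opd_energy k A z : A^T = A -> O z -> opd sp A (energy k) z =
  \sum_(s <- words k) (2 * (dH H s z * opd sp A (dH H s) z) + 2 * ipd sp A (dH H s) (dH H s) z).
Proof.
move=> AT Oz.
have E s : opd sp A (fun z => dH H s z * dH H s z) z =
    2 * (dH H s z * opd sp A (dH H s) z) + 2 * ipd sp A (dH H s) (dH H s) z.
  apply: etrans (opdM sp oO AT (dH_smooth HS s) (dH_smooth HS s) Oz) _.
  by rewrite [2 * (_ * _)]mulr_natl mulr2n.
rewrite -(eq_bigr _ (fun s _ => E s)) /opd.
rewrite [RHS]exchange_big /=; apply: eq_bigr => b _.
rewrite [RHS]exchange_big /=; apply: eq_bigr => d _.
rewrite -mulr_sumr; apply: f_equal.
have S s : smooth_on O (fun z => dH H s z * dH H s z).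
  exact: smooth_onM oO (dH_smooth HS s) (dH_smooth HS s).
have N : {near z, 'D_(sp d) (energy k) =1
    (fun z => \sum_(s <- words k) 'D_(sp d) (fun z => dH H s z * dH H s z) z)}.
  apply: (open_near oO Oz) => w Ow.
  have [|_ e] := @is_derive_bigsum _ _ _ (words k) (fun s z => dH H s z * dH H s z)
    (fun s => 'D_(sp d) (fun z => dH H s z * dH H s z) w) w (sp d).
    by move=> s; apply: derivableP; exact: smooth_on_derivable (S s) Ow.
  rewrite -e; apply: (f_equal (fun f => 'D_(sp d) f w)); apply/funext => v.
  by apply: eq_bigr => s _; rewrite expr2.
apply: etrans (near_eq_derive _ N) _.
have [|_ e] := @is_derive_bigsum _ _ _ (words k) (fun s => 'D_(sp d) (fun z => dH H s z * dH H s z))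
    (fun s => 'D_(sp b) ('D_(sp d) (fun z => dH H s z * dH H s z)) z) z (sp b); last exact: e.
by move=> s; apply: derivableP; exact: smooth_on_derivable (smooth_on_D _ (S s)) Oz.
Qed.

Lemma energy_gradient k b z : O z -> `|'D_(sp b) (energy k) z| <=
  2 * (size (words k))%:R * (Num.sqrt (energy k z) * Num.sqrt (energy k.+1 z)).
Proof.
move=> Oz; rewrite derive_energy//; apply: le_trans (ler_norm_sum _ _ _) _.
rewrite big_seq; apply: le_trans (_ : \sum_(s <- words k | s \in words k)
    2 * (Num.sqrt (energy k z) * Num.sqrt (energy k.+1 z)) <= _); last first.
  by rewrite -big_seq big_const_seq count_predT iter_addr_0 -[leLHS]mulr_natl le_eqVlt; apply/orP; left; apply/eqP; ring.
apply: ler_sum => s /size_words sk; rewrite normrM ger0_norm// ler_wpM2l// normrM.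
apply: ler_pM => //; first by rewrite -sk; exact: dH_energy.
by have := dH_energy (b :: s) z; rewrite /= sk.
Qed.

(** The second-order operator applied to a square produces twice the quadratic form of the gradient,
    which ellipticity bounds from below by the next energy: this is the good term. The remainders of
    the differentiated equations are kept as the forcing [P]. *)
Lemma energy_evolution k T y0 r dl : 2 <= T -> box y0 r `<=` img i ->
  (forall z (f : ST -> R), region T y0 r z -> dl * \sum_b 'D_(sp b) f z ^+ 2 <= ipd sp (Am z) f f z) ->
  exists2 P : seq 'I_n -> ST -> R, forall s, PW i a H (size s).+1 (size s).+2 (P s) &
    forall z, region T y0 r z -> 'D_((1, 0) : ST) (energy k) z <=
      kap z.1 * (opd sp (Am z) (energy k) z - 2 * dl * energy k.+1 z +
        2 * (Num.sqrt (energy k z) * \sum_(s <- words k) `|P s z|)).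
Proof.
move=> T2 ri el.
have Pc s : {P | PW i a H (size s).+1 (size s).+2 P /\ forall z, O z ->
    'D_((1, 0) : ST) (dH H s) z = kap z.1 * (opd sp (Am z) (dH H s) z + P z)}.
  by apply: cid; apply: (dH_equation HS H0 qS (PW_mono (leqnn 1) (leqnSn 1) P0S) HE).
exists (fun s => sval (Pc s)) => [s|z zD]; first exact: (svalP (Pc s)).1.
have Oz := region_O T2 ri zD; have AT := (Am_posdef Oz).1.
rewrite derive_energy// (opd_energy k AT Oz) energyS.
have kp : 0 < kap z.1 by apply: kap0; exact: le_trans T2 zD.1.
have E : \sum_(s <- words k) 2 * (dH H s z * 'D_((1, 0) : ST) (dH H s) z) =
    kap z.1 * \sum_(s <- words k) (2 * (dH H s z * opd sp (Am z) (dH H s) z) + 2 * (dH H s z * sval (Pc s) z)).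
  rewrite mulr_sumr; apply: eq_bigr => s _; rewrite (svalP (Pc s)).2//.
  move: (opd sp (Am z) (dH H s) z) (sval (Pc s) z) (dH H s z) => x1 x2 x3; ring.
rewrite E ler_pM2l//.
have I1 : dl * \sum_(s <- words k) \sum_b 'D_(sp b) (dH H s) z ^+ 2 <=
    \sum_(s <- words k) ipd sp (Am z) (dH H s) (dH H s) z.
  by rewrite mulr_sumr; apply: ler_sum => s _; exact: el.
have I2 : \sum_(s <- words k) (dH H s z * sval (Pc s) z) <=
    Num.sqrt (energy k z) * \sum_(s <- words k) `|sval (Pc s) z|.
  rewrite mulr_sumr big_seq [leRHS]big_seq; apply: ler_sum => s /size_words sk.
  apply: le_trans (ler_norm _) _; rewrite normrM; apply: ler_wpM2r => //.
  by rewrite -sk; exact: dH_energy.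
rewrite !big_split /= -!mulr_sumr.
move: I1 I2.
move: (\sum_(s <- words k) (dH H s z * opd sp (Am z) (dH H s) z)) => x1.
move: (\sum_(s <- words k) \sum_b 'D_(sp b) (dH H s) z ^+ 2) => x2.
move: (\sum_(s <- words k) ipd sp (Am z) (dH H s) (dH H s) z) => x3.
move: (\sum_(s <- words k) (dH H s z * sval (Pc s) z)) (Num.sqrt _ * _) => x4 x5 I1 I2.
rewrite -subr_ge0 (_ : _ - _ = 2 * (x3 - dl * x2) + 2 * (x5 - x4)); last by ring.
by rewrite addr_ge0 ?mulr_ge0 ?subr_ge0.
Qed.

Lemma words_bound k (P : seq 'I_n -> ST -> R) (D : set ST) (be : ST -> R) :
  (forall s, size s = k -> exists2 C, 0 <= C & forall z, D z -> `|P s z| <= C * be z) ->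
  (forall z, D z -> 0 <= be z) ->
  exists2 C, 0 <= C & forall z, D z -> \sum_(s <- words k) `|P s z| <= C * be z.
Proof.
move=> HP be0; have : forall s, s \in words k -> size s = k by exact: size_words.
elim: (words k) => [|s ws IH] Hs; first by exists 0 => // z _; rewrite big_nil mul0r.
have [C C0 HC] := HP s (Hs s (mem_head _ _)).
have [|C' C0' HC'] := IH; first by move=> w ww; apply: Hs; rewrite inE ww orbT.
exists (C + C'); first exact: addr_ge0.
by move=> z Dz; rewrite big_cons mulrDl; apply: lerD; [exact: HC|exact: HC'].
Qed.

(** The case of [bernstein] in which [F] and [Fp] are consecutive energies and the cutoff is a bump,
    with the bound turned into one for each derivative on a smaller box. *)
Lemma energy_local_bound k T y0 r dl C1 C2 N eta L (h : ST -> R) : 0 < r -> 2 <= T -> box y0 r `<=` img i ->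
  0 <= L -> (forall z b d, region T y0 r z -> `|Am z b d| <= L) ->
  smooth_on O h -> (forall z, region T y0 r z -> 1 <= h z <= 2) ->
  (forall z, region T y0 r z -> 'D_((1, 0) : ST) (energy k) z <=
    kap z.1 * (opd sp (Am z) (energy k) z - dl * energy k.+1 z + C1 * energy k z ^+ 2 + C2)) ->
  (forall z, region T y0 r z -> 'D_((1, 0) : ST) h z <=
    kap z.1 * (opd sp (Am z) h z - N * energy k z + C2)) ->
  (forall z b, region T y0 r z -> `|'D_(sp b) h z| <= eta * Num.sqrt (energy k z)) ->
  0 < dl -> 0 < N -> 0 <= C1 -> 0 <= C2 -> 0 <= eta ->
  4 * C1 + 4 * ((n * n)%:R * L * (2 * (size (words k))%:R) * eta) ^+ 2 / dl <= N ->
  exists r' C : R, [/\ 0 < r', r' <= r & forall s z, size s = k -> region T y0 r' z -> `|dH H s z| <= C].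
Proof.
move=> r0 T2 ri L0 AL hS h12 Et Eh hx dl0 N0 C10 C20 eta0 NC.
have zS := bump_rV_smooth y0 r (@open_img _ _ M i).
have zn y : box y0 r y -> 0 < bump_rV y0 r y -> nbhs y (box y0 r).
  move=> yr yp; have c := smooth_on_cts zS (ri _ yr).
  have : \forall w \near y, 0 < bump_rV y0 r w by apply: (cvgr_gt _ c).
  apply: filterS => w wp; apply: contrapT => wr.
  by move: wp; rewrite (bump_rV_out (ltW r0) wr) ltxx.
have [C HC] := @bernstein R n M i a Am kap (energy k) (energy k.+1) h (bump_rV y0 r) y0 r T dl N C1 C2 L
  (2 * (size (words k))%:R) eta (lt_le_trans a2 T2) ri (energy_smooth k) hS zS (bump_rV_ge0 y0 r) zn
  (fun z zD => Am_posdef (region_O T2 ri zD)) AL L0 (fun t Tt => kap0 (le_trans T2 Tt))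
  (fun z zD => And3 (energy_ge0 k z) (energy_ge0 k.+1 z) (h12 z zD)) Et Eh
  (fun z b zD => energy_gradient k b (region_O T2 ri zD)) hx dl0 N0 C10 C20
  (mulr_ge0 (ler0n R 2) (ler0n R _)) eta0 NC.
have y0r : box y0 r y0 by move=> b; rewrite subrr normr0 ltW.
have c := smooth_on_cts zS (ri _ y0r).
(* On the box where the bump exceeds half its central value the cutoff can be divided away. *)
pose m := bump_rV y0 r y0 / 2.
have b0 := bump_rV_gt0 y0 r0.
have m0 : 0 < m by rewrite divr_gt0.
have : \forall y \near y0, m < bump_rV y0 r y.
  by apply: (cvgr_gt _ c); rewrite /m ltr_pdivrMr// ltr_pMr// ltr1n.
move=> /nbhs_box[r1 r10 H1].
exists (Num.min r r1), (Num.sqrt (`|C| / m ^+ 2)); split; [by rewrite lt_min r0|by rewrite ge_min lexx|].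
move=> s z sk [Tz zr].
have z1 : box y0 r z.2 by move=> b; apply: le_trans (zr b) _; rewrite ge_min lexx.
have z2 : box y0 r1 z.2 by move=> b; apply: le_trans (zr b) _; rewrite ge_min lexx orbT.
apply: le_trans (dH_energy s z) _; rewrite sk; apply: ler_wsqrtr.
rewrite ler_pdivlMr ?exprn_gt0//; apply: le_trans (le_trans (HC z (conj Tz z1)) (ler_norm C)).
rewrite mulrC; apply: ler_wpM2r; first exact: energy_ge0.
by rewrite lerXn2r// ?nnegrE ?(ltW m0) ?bump_rV_ge0// ltW// H1.
Qed.

End derivative_energy.

(** * Growth of monomials and absorption of the forcing *)

Section weights.
Context {R : realType}.
Implicit Types (x y : R).

(* With [y] and [x] bounding the derivatives of order one and two, [weight1 y x w]
   bounds the differential monomials of weight [w]. *)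
Definition weight1 y x (w : nat) : R :=
  match w with 0 => 1 | 1 => 1 + y | 2 => (1 + y) ^+ 2 + x | _ => (1 + y) ^+ 3 + (1 + y) * x end.

Lemma weight1_mono y x w w' : 0 <= y -> 0 <= x -> (w <= w')%N -> weight1 y x w <= weight1 y x w'.
Proof.
move=> y0 x0; have S : forall w, weight1 y x w <= weight1 y x w.+1.
  have y1 : 1 <= 1 + y by rewrite lerDl.
  have y10 : 0 <= 1 + y by rewrite addr_ge0.
  move=> [|[|[|k]]] /=; rewrite ?lerDl//.
    by rewrite expr2 ler_wpDr// ler_peMl.
  apply: lerD; last by rewrite ler_peMl.
  by rewrite [leRHS]exprS ler_peMl// sqr_ge0.
elim: w' => [|k IH]; first by rewrite leqn0 => /eqP ->.
rewrite leq_eqVlt => /orP[/eqP -> //|]; rewrite ltnS => /IH /le_trans; apply; exact: S.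
Qed.

Lemma weight1_y y x w : 0 <= y -> 0 <= x -> (w <= 2)%N -> y * weight1 y x w <= weight1 y x w.+1.
Proof.
move=> y0 x0; have y1 : y <= 1 + y by rewrite lerDr.
have y10 : 0 <= 1 + y by rewrite addr_ge0.
case: w => [|[|[|//]]] _ /=; first by rewrite mulr1 lerDr.
  by rewrite expr2 ler_wpDr// ler_wpM2r.
rewrite mulrDr exprS; apply: lerD; apply: ler_wpM2r => //; exact: sqr_ge0.
Qed.

Lemma weight1_x y x w : 0 <= y -> 0 <= x -> (w <= 1)%N -> x * weight1 y x w <= weight1 y x w.+2.
Proof.
move=> y0 x0; have y10 : 0 <= 1 + y by rewrite addr_ge0.
case: w => [|[|//]] _ /=; first by rewrite mulr1 lerDr sqr_ge0.
by rewrite mulrC lerDr exprn_ge0.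
Qed.

(* The same when the derivatives of order below [k > 1] are bounded, [y] and [x]
   bounding those of order [k] and [k + 1]: in weight [k + 2] the second highest
   order occurs at most squared. *)
Definition weight2 (k : nat) y x (w : nat) : R :=
  if (w < k)%N then 1 else if (w == k)%N then 1 + y else
  if (w == k.+1)%N then 1 + y + x else (1 + y) ^+ 2 + x.

Lemma weight2_ge1 k y x w : 0 <= y -> 0 <= x -> 1 <= weight2 k y x w.
Proof.
move=> y0 x0; rewrite /weight2; case: ifP => // _; case: ifP => _; first by rewrite lerDl.
case: ifP => _; first by rewrite -addrA lerDl addr_ge0.
by rewrite ler_wpDr// exprn_ege1// lerDl.
Qed.

Lemma weight2_mono k y x w w' : 0 <= y -> 0 <= x -> (w <= w')%N -> weight2 k y x w <= weight2 k y x w'.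
Proof.
move=> y0 x0 ww; have [wk|kw] := ltnP w k.
  by rewrite {1}/weight2 wk weight2_ge1.
have y1 : 1 <= 1 + y by rewrite lerDl.
have y10 : 0 <= 1 + y by rewrite addr_ge0.
have yy : 1 + y <= (1 + y) ^+ 2 by rewrite expr2 ler_peMl.
have kw' := leq_trans kw ww.
rewrite /weight2 !ltnNge kw kw' /=.
have [wk|wk] := eqVneq w k.
  case: ifP => // _; case: ifP => _; first by rewrite lerDl.
  by rewrite ler_wpDr.
have k1w : (k.+1 <= w)%N by rewrite ltn_neqAle eq_sym wk.
have -> : (w' == k) = false by apply/negbTE; rewrite neq_ltn (leq_trans k1w ww) orbT.
have [wk1|wk1] := eqVneq w k.+1; first by case: ifP => // _; rewrite lerD2r.
have k2w : (k.+2 <= w)%N by rewrite ltn_neqAle eq_sym wk1.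
by have -> : (w' == k.+1) = false by apply/negbTE; rewrite neq_ltn (leq_trans k2w ww) orbT.
Qed.

(** A factor of order [k] leaves weight at most [2] for the rest. Either this is below [k] and the
    rest is bounded, or [k = 2] and the rest may contain [y] once more: the product is then
    quadratic, which the top weight allows. *)
Lemma weight2_y k y x w w' : (1 < k)%N -> 0 <= y -> 0 <= x -> (k + w <= w')%N -> (w' <= k.+2)%N ->
  y * weight2 k y x w <= weight2 k y x w'.
Proof.
move=> k1 y0 x0 kw wk.
have y1 : y <= 1 + y by rewrite lerDr.
have y10 : 0 <= 1 + y by rewrite addr_ge0.
have B : y <= weight2 k y x w'.
  apply: (@le_trans _ _ (weight2 k y x k)); first by rewrite /weight2 ltnn eqxx.
  by apply: weight2_mono => //; exact: leq_trans (leq_addr _ _) kw.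
have [wk'|kw'] := ltnP w k; first by rewrite {1}/weight2 wk' mulr1.
have w2 : (w <= 2)%N by rewrite -(leq_add2l k) addn2; exact: leq_trans wk.
have wkE : w = k by apply/eqP; rewrite eqn_leq kw' (leq_trans w2 k1).
have k2 : k = 2%N by apply/eqP; rewrite eqn_leq k1 -wkE w2.
have -> : w' = k.+2 by apply/eqP; rewrite eqn_leq wk; move: kw; rewrite wkE {2}k2 addn2.
have F1 : (k.+2 < k)%N = false by apply/negbTE; rewrite -leqNgt -addn2 leq_addr.
have F2 : (k.+2 == k) = false by rewrite -addn2 -{2}[k]addn0 eqn_add2l.
have F3 : (k.+2 == k.+1) = false by rewrite eqSS -addn1 -{2}[k]addn0 eqn_add2l.
rewrite wkE /weight2 ltnn eqxx F1 F2 F3.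
by rewrite ler_wpDr// expr2 ler_wpM2r.
Qed.

Lemma weight2_x k y x w w' : (1 < k)%N -> 0 <= y -> 0 <= x -> (k.+1 + w <= w')%N -> (w' <= k.+2)%N ->
  x * weight2 k y x w <= weight2 k y x w'.
Proof.
move=> k1 y0 x0 kw wk.
have w1 : (w <= 1)%N by rewrite -(leq_add2l k.+1) addn1; exact: leq_trans wk.
rewrite {1}/weight2 (leq_ltn_trans w1 k1) mulr1.
apply: (@le_trans _ _ (weight2 k y x k.+1)); last first.
  by apply: weight2_mono => //; exact: leq_trans (leq_addr _ _) kw.
rewrite /weight2 ltnNge leqnSn /= (_ : (k.+1 == k) = false) ?eqxx ?lerDr ?addr_ge0//.
by rewrite eqn_leq ltnn.
Qed.

Lemma cross_term (dl C x y : R) : 0 < dl -> 2 * C * y * x <= dl * x ^+ 2 + C ^+ 2 / dl * y ^+ 2.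
Proof.
move=> dl0; rewrite -subr_ge0 (_ : _ - _ = (dl * x - C * y) ^+ 2 / dl).
  by rewrite divr_ge0 ?sqr_ge0// ltW.
by field; rewrite gt_eqF.
Qed.

(** In weight [3] the product with [y] is of degree four in [y]. Young's inequality absorbs [x] but
    leaves a quartic coefficient [K] that cannot be prescribed. *)
Lemma forcing1 (dl C : R) : 0 < dl -> 0 <= C -> exists2 K, 0 <= K & forall x y, 0 <= x -> 0 <= y ->
  2 * (y * (C * weight1 y x 3)) <= dl * x ^+ 2 + K * (y ^+ 2) ^+ 2 + K.
Proof.
move=> dl0 C0; pose K := 16 * C + 4 * (C ^+ 2 / dl).
have CC : 0 <= C ^+ 2 / dl by rewrite divr_ge0 ?sqr_ge0// ltW.
exists K => [|x y x0 y0]; first by apply: addr_ge0; apply: mulr_ge0.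
have y40 : 0 <= (y ^+ 2) ^+ 2 by exact: sqr_ge0.
have [H1 H2] : y * (1 + y) ^+ 3 <= 8 * (1 + (y ^+ 2) ^+ 2) /\ (y * (1 + y)) ^+ 2 <= 4 * (1 + (y ^+ 2) ^+ 2).
  have y10 : 0 <= 1 + y by rewrite addr_ge0.
  have [y1|/ltW y1] := leP y 1.
    have H : 1 + y <= 2 by rewrite -[leRHS]/(1 + 1) lerD2l.
    split.
      apply: le_trans (_ : 1 * 2 ^+ 3 <= _); last by rewrite mul1r -natrX ler_peMr// lerDl.
      by apply: ler_pM => //; [exact: exprn_ge0|rewrite lerXn2r// nnegrE].
    apply: le_trans (_ : (1 * 2) ^+ 2 <= _); last by rewrite mul1r -natrX ler_peMr// lerDl.
    by rewrite lerXn2r ?nnegrE ?mulr_ge0// ler_pM.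
  have H : 1 + y <= 2 * y by rewrite mulr_natl mulr2n lerD2r.
  have y20 : 0 <= 2 * y by rewrite mulr_ge0.
  split.
    apply: le_trans (_ : y * (2 * y) ^+ 3 <= _); first by rewrite ler_wpM2l// lerXn2r ?nnegrE.
    rewrite (_ : y * _ = 8 * (y ^+ 2) ^+ 2); last by ring.
    by rewrite ler_wpM2l// lerDr.
  apply: le_trans (_ : (y * (2 * y)) ^+ 2 <= _).
    by rewrite lerXn2r ?nnegrE ?mulr_ge0// ler_wpM2l.
  rewrite (_ : (y * _) ^+ 2 = 4 * (y ^+ 2) ^+ 2); last by ring.
  by rewrite ler_wpM2l// lerDr.
rewrite /= (_ : 2 * _ = 2 * C * (y * (1 + y) ^+ 3) + 2 * C * (y * (1 + y)) * x); last by ring.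
have I1 : 2 * C * (y * (1 + y) ^+ 3) <= 2 * C * (8 * (1 + (y ^+ 2) ^+ 2)) by rewrite ler_wpM2l ?mulr_ge0.
have I2 := cross_term C x (y * (1 + y)) dl0.
have I3 := ler_wpM2l CC H2.
apply: le_trans (lerD I1 (le_trans I2 (lerD (lexx _) I3))) _.
by rewrite /K le_eqVlt; apply/orP; left; apply/eqP; ring.
Qed.

(** Here the product is at most cubic in [y] once [x] is absorbed, so the quartic coefficient [C1]
    can be prescribed as small as desired, at the price of the constant [K]. This is what separates
    the higher orders from the gradient. *)
Lemma forcing2 (dl C C1 : R) : 0 < dl -> 0 <= C -> 0 < C1 -> exists2 K, 0 <= K & forall x y, 0 <= x -> 0 <= y ->
  2 * (y * (C * ((1 + y) ^+ 2 + x))) <= dl * x ^+ 2 + C1 * (y ^+ 2) ^+ 2 + K.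
Proof.
move=> dl0 C0 C10; pose D := 8 * C + C ^+ 2 / dl + 1.
have CC : 0 <= C ^+ 2 / dl by rewrite divr_ge0 ?sqr_ge0// ltW.
have D0 : 0 < D by rewrite ltr_wpDl// addr_ge0// mulr_ge0.
pose e := C1 / D; have e0 : 0 < e by rewrite divr_gt0.
exists (D + D / e ^+ 3) => [|x y x0 y0]; first by rewrite addr_ge0 ?divr_ge0 ?exprn_ge0// ltW.
have y30 : 0 <= y ^+ 3 by exact: exprn_ge0.
have [H1 H2] : y * (1 + y) ^+ 2 <= 4 * (1 + y ^+ 3) /\ y ^+ 2 <= 1 + y ^+ 3.
  have y10 : 0 <= 1 + y by rewrite addr_ge0.
  have [y1|/ltW y1] := leP y 1.
    have H : 1 + y <= 2 by rewrite -[leRHS]/(1 + 1) lerD2l.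
    split.
      apply: le_trans (_ : 1 * 2 ^+ 2 <= _); last by rewrite mul1r -natrX ler_peMr// lerDl.
      by apply: ler_pM => //; [exact: exprn_ge0|rewrite lerXn2r// nnegrE].
    by rewrite ler_wpDr// exprn_ile1.
  have H : 1 + y <= 2 * y by rewrite mulr_natl mulr2n lerD2r.
  split.
    apply: le_trans (_ : y * (2 * y) ^+ 2 <= _).
      by rewrite ler_wpM2l// lerXn2r ?nnegrE// mulr_ge0.
    rewrite (_ : y * _ = 4 * y ^+ 3); last by ring.
    by rewrite ler_wpM2l// lerDr.
  by rewrite ler_wpDl// [leRHS]exprS ler_peMl// sqr_ge0.
have H3 : y ^+ 3 <= e * (y ^+ 2) ^+ 2 + (e ^+ 3)^-1.
  have [ye|/ltW ye] := leP (e * y) 1.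
    apply: ler_wpDl; first by rewrite mulr_ge0 ?sqr_ge0// ltW.
    rewrite -[leRHS]mul1r ler_pdivlMr ?exprn_gt0// -exprMn mulrC exprn_ile1//.
    by rewrite mulr_ge0// ltW.
  apply: ler_wpDr; first by rewrite invr_ge0 exprn_ge0// ltW.
  rewrite (_ : e * _ = e * y * y ^+ 3); last by ring.
  by rewrite ler_peMl.
rewrite (_ : 2 * _ = 2 * C * (y * (1 + y) ^+ 2) + 2 * C * y * x); last by ring.
have I1 : 2 * C * (y * (1 + y) ^+ 2) <= 2 * C * (4 * (1 + y ^+ 3)) by rewrite ler_wpM2l ?mulr_ge0.
have I2 := cross_term C x y dl0.
have I3 := ler_wpM2l CC H2.
have I4 : D * (1 + y ^+ 3) <= D * (1 + (e * (y ^+ 2) ^+ 2 + (e ^+ 3)^-1)).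
  by rewrite ler_wpM2l ?(ltW D0)// lerD2l.
apply: le_trans (lerD I1 (le_trans I2 (lerD (lexx _) I3))) _.
have De : D * e = C1 by rewrite /e mulrC divfK// gt_eqF.
have -> : dl * x ^+ 2 + C1 * (y ^+ 2) ^+ 2 + (D + D / e ^+ 3) =
    dl * x ^+ 2 + D * (1 + (e * (y ^+ 2) ^+ 2 + (e ^+ 3)^-1)).
  by rewrite -De; ring.
apply: le_trans (_ : dl * x ^+ 2 + D * (1 + y ^+ 3) <= _); last by rewrite lerD2l.
rewrite -subr_ge0 (_ : _ - _ = 1 + y ^+ 3); last by rewrite /D; ring.
by rewrite addr_ge0.
Qed.

Lemma forcing0 (dl C : R) : 0 < dl -> 0 <= C -> exists2 K, 0 <= K & forall y, 0 <= y ->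
  2 * (C * (1 + y)) <= dl * y ^+ 2 + K.
Proof.
move=> dl0 C0; exists (2 * C + C ^+ 2 / dl); first by apply: addr_ge0; [exact: mulr_ge0|rewrite divr_ge0 ?sqr_ge0// ltW].
move=> y y0; have := cross_term C y 1 dl0.
by rewrite mulr1 expr1n mulr1 => H; rewrite mulrDr mulr1 mulrDr [2 * (C * y)]mulrA addrCA lerD2l.
Qed.

End weights.

(** * Bounds for all the spatial derivatives *)

Section derivative_bounds.
Context {R : realType} {n : nat} {M : manifold R n} (i : chart M) (a : R).
Local Notation ST := (R * 'rV[R]_n)%type.
Local Notation O := (stdom a i).
Variables (H : ST -> R) (kap : R -> R) (q : 'I_n -> 'I_n -> 'rV[R]_n -> R) (al a0 a1 : R) (P0 : ST -> R).
Hypotheses (a2 : a < 2) (HS : smooth_on O H) (H0 : forall z, O z -> 0 < H z).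
Hypotheses (kap0 : forall t, 2 <= t -> 0 < kap t) (qS : forall b d, smooth_on (img i) (q b d)).
Hypothesis pq : forall y, img i y -> is_posdef (\matrix_(b, d) q b d y).
Hypothesis P0S : PW i a H 1 1 P0.
Hypothesis HE : forall z, O z ->
  'D_((1, 0) : ST) H z = kap z.1 * (opd sp (Amx H q al z) H z + P0 z).
Hypotheses (a00 : 0 < a0) (Hb : forall z, 2 <= z.1 -> img i z.2 -> a0 <= H z <= a1).
Hypothesis osc : forall y0 (e : R), img i y0 -> 0 < e ->
  exists r T m : R, [/\ 0 < r, 2 <= T, box y0 r `<=` img i, 0 < m &
    forall z, region T y0 r z -> m <= H z <= m + e].
Local Notation Am := (Amx H q al).
Local Notation E := (energy H).
Let oO : open O := @open_stdom _ _ M a i.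

Lemma regionS T T' (y0 : 'rV[R]_n) r r' : T' <= T -> r <= r' -> region T y0 r `<=` region T' y0 r'.
Proof.
move=> TT rr z [Tz zr]; split; first exact: le_trans Tz.
by move=> b; exact: le_trans (zr b) rr.
Qed.

(** The order of the choices matters: the quartic coefficient [K] of the forcing determines [N],
    then [N] determines the oscillation [e], and [e] determines the box and the time from which the
    estimate runs. *)
Lemma first_bound y0 : img i y0 -> exists r T C : R,
  [/\ 0 < r, 2 <= T, box y0 r `<=` img i & forall s z, size s = 1%N -> region T y0 r z -> `|dH H s z| <= C].
Proof.
move=> iy0; have [r1 r10 ri1] := box_in_open (@open_img _ _ M i) iy0.
have T2 := lexx (2 : R).
have [L L0 AL] := Am_bounded al qS a00 Hb T2 ri1.
have [dl dl0 el] := Am_elliptic al a2 H0 qS pq a00 Hb T2 ri1.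
have [P PP PE] := energy_evolution a2 HS H0 kap0 qS pq P0S HE 1 T2 ri1 el.
pose be w z := weight1 (Num.sqrt (E 1 z)) (Num.sqrt (E 2 z)) w.
have be1 w z : 1 <= be w z.
  by apply: (@weight1_mono _ _ _ 0); rewrite ?sqrtr_ge0.
pose Y j z := match j with 0 => a1 | 1 => Num.sqrt (E 1 z) | _ => Num.sqrt (E 2 z) end.
have HY s z : (size s <= 2)%N -> region 2 y0 r1 z -> `|dH H s z| <= Y (size s) z.
  case: s => [|b [|d [|? ?]]] // _ zD; [|exact: (dH_energy H [:: b])|exact: (dH_energy H [:: b; d])].
  have /andP[h1 h2] := region_H Hb T2 ri1 zD.
  by rewrite /dH /= ger0_norm// (le_trans (ltW a00)).
have Yb j w w' : (j <= 2)%N -> (j + w <= w')%N -> (w' <= 3)%N -> exists2 C, 0 <= C &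
    forall z, region 2 y0 r1 z -> Y j z * be w z <= C * be w' z.
  have s0 k z : 0 <= Num.sqrt (E k z) by exact: sqrtr_ge0.
  case: j => [|[|[|//]]] _ jw w3.
  - exists `|a1| => // z zD; apply: le_trans (ler_wpM2r (le_trans ler01 (be1 w z)) (ler_norm a1)) _.
    by apply: ler_wpM2l => //; exact: weight1_mono.
  - exists 1 => // z _; rewrite mul1r; apply: le_trans (weight1_y (s0 1%N z) (s0 2%N z) _) _.
      by rewrite -(leq_add2l 1) (leq_trans jw w3).
    exact: weight1_mono (s0 1%N z) (s0 2%N z) jw.
  - exists 1 => // z _; rewrite mul1r; apply: le_trans (weight1_x (s0 1%N z) (s0 2%N z) _) _.
      by rewrite -(leq_add2l 2) (leq_trans jw w3).
    exact: weight1_mono (s0 1%N z) (s0 2%N z) jw.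
have qb (k : 'rV[R]_n -> R) ga : smooth_on (img i) k -> exists2 C, 0 <= C &
    forall z, region 2 y0 r1 z -> `|k z.2 * H z `^ ga| <= C by move=> kS; exact: (coef_bounded a00 Hb ga T2 ri1 kS).
have DO := region_O a2 T2 ri1.
have [C0 C00 HC0] := PW_bound DO (fun w z _ => be1 w z) HY Yb qb (PW_mono (leqW (leqnn 1)) (leqnn 1) P0S) (isT : (1 <= 3)%N).
have PB s : size s = 1%N -> exists2 C, 0 <= C & forall z, region 2 y0 r1 z -> `|P s z| <= C * be 3%N z.
  move=> s1; have := PP s; rewrite s1 => PPs.
  exact: PW_bound DO (fun w z _ => be1 w z) HY Yb qb PPs (leqnn 3).
have [C C0' HC] := words_bound (k := 1) PB (fun z _ => le_trans ler01 (be1 3%N z)).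
have [K K0 HK] := forcing1 dl0 C0'.
(* The good coefficient [N dl = 8 K + 8] has to cover [4 K] for the forcing and [4] for the mixed
   term. *)
pose N := 8 * (K + 1) / dl.
have N0 : 0 < N by rewrite divr_gt0// mulr_gt0// ltr_wpDl.
have [K2 K20 HK2] := forcing0 (dl := dl) (C := C0) dl0 C00.
pose X := (n * n)%:R * L * (2 * (size (words (n := n) 1))%:R) * (2 * N).
have X0 : 0 <= X.
  by apply: mulr_ge0; apply: mulr_ge0 => //; [apply: mulr_ge0|exact: ltW].
have X21 : 0 < X ^+ 2 + 1 by rewrite ltr_wpDl ?sqr_ge0.
(* As [e^2 <= e], the bound [N e <= 1] keeps the auxiliary function at most [2], and [X^2 e <= dl]
   bounds the mixed term of [h] with the energy. *)
pose e1 := Num.min N^-1 (dl / (X ^+ 2 + 1)); pose e := Num.min 1 e1.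
have e0 : 0 < e by rewrite lt_min ltr01 lt_min invr_gt0 N0 divr_gt0.
have ee1 : e <= e1 by rewrite ge_min lexx orbT.
have e_1 : e <= 1 by rewrite ge_min lexx.
have eN : N * e <= 1.
  by rewrite mulrC -ler_pdivlMr// div1r; apply: le_trans ee1 _; rewrite ge_min lexx.
have eX : X ^+ 2 * e <= dl.
  apply: le_trans (_ : (X ^+ 2 + 1) * e <= _); first by rewrite ler_wpM2r ?(ltW e0)// lerDl.
  by rewrite mulrC -ler_pdivlMr//; apply: le_trans ee1 _; rewrite ge_min lexx orbT.
have ee : e ^+ 2 <= e by rewrite expr2 ler_piMl// ltW.
have [r2 [T [m [r20 T2' _ m0 Hm]]]] := osc iy0 e0.
pose r := Num.min r1 r2.
have r0 : 0 < r by rewrite lt_min r10.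
have rr1 : r <= r1 by rewrite ge_min lexx.
have rr2 : r <= r2 by rewrite ge_min lexx orbT.
have D1 : region T y0 r `<=` region 2 y0 r1 by exact: regionS.
have D2 : region T y0 r `<=` region T y0 r2 by exact: regionS.
have ri : box y0 r `<=` img i.
  by move=> y yr; apply: ri1 => b; exact: le_trans (yr b) rr1.
(* In the region where the oscillation of [H] is at most [e], [h <= 2] even for
   large [N], and [N |dH|^2] absorbs the quartic term of the evolution of [E 1]. *)
pose h z := 1 + N * ((H z - m) * (H z - m)).
have cS (k : R) : smooth_on O (fun=> k) by exact: smooth_on_cst.
have HmS : smooth_on O (fun z => H z - m) by exact: (smooth_onB oO HS (cS m)).
have H2S : smooth_on O (fun z => (H z - m) * (H z - m)) by exact: (smooth_onM oO HmS HmS).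
have NS : smooth_on O (fun z => N * ((H z - m) * (H z - m))) by exact: (smooth_onM oO (cS N) H2S).
have hS : smooth_on O h by exact: (smooth_onD oO (cS 1) NS).
have osc1 z : region T y0 r z -> `|H z - m| <= e.
  move=> /D2/Hm/andP[h1 h2]; rewrite ger0_norm ?subr_ge0//.
  by rewrite lerBlDr addrC.
have dHm v z : O z -> 'D_v (fun z => H z - m) z = 'D_v H z.
  move=> Oz; have d := derivableP (smooth_on_derivable (v := v) HS Oz).
  by have [_ ->] := is_deriveB d (is_derive_cst m z v); rewrite subr0.
have dcst v z : 'D_v (fun _ : ST => 1 : R) z = 0 by have [_ ->] := is_derive_cst (1 : R) z v.
have dh v z : O z -> 'D_v h z = 2 * N * ((H z - m) * 'D_v H z).
  move=> Oz; apply: etrans (smooth_deriveD v (cS 1) NS Oz) _; rewrite dcst add0r.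
  apply: etrans (smooth_deriveZ N v H2S Oz) _.
  apply: etrans (f_equal (fun x => N * x) (smooth_deriveM v HmS HmS Oz)) _.
  by rewrite dHm//; move: ('D_v H z) => x; ring.
have E1 z : E 1 z = \sum_b 'D_(sp b) H z ^+ 2 by rewrite energyS big_seq1.
have sE1 z b : `|'D_(sp b) H z| <= Num.sqrt (E 1 z) by exact: (dH_energy H [:: b]).
have oph z : O z -> opd sp (Am z) h z =
    2 * N * ((H z - m) * opd sp (Am z) H z) + 2 * N * ipd sp (Am z) H H z.
  move=> Oz; rewrite /opd /ipd !mulr_sumr -big_split /=; apply: eq_bigr => b _.
  rewrite !mulr_sumr -big_split /=; apply: eq_bigr => d _.
  have e2 : {near z, 'D_(sp d) h =1 (fun z => 2 * N * ((H z - m) * 'D_(sp d) H z))}.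
    by apply: (open_near oO Oz) => w Ow; exact: dh.
  have S2 := smooth_on_D (sp d) HS.
  have e3 : 'D_(sp b) ('D_(sp d) h) z = 2 * N * ((H z - m) * 'D_(sp b) ('D_(sp d) H) z + 'D_(sp d) H z * 'D_(sp b) H z).
    apply: etrans (near_eq_derive _ e2) _.
    apply: etrans (smooth_deriveZ (2 * N) (sp b) (smooth_onM oO HmS S2) Oz) _.
    apply: etrans (f_equal (fun x => 2 * N * x) (smooth_deriveM (sp b) HmS S2 Oz)) _.
    by rewrite dHm.
  rewrite e3; move: ('D_(sp b) ('D_(sp d) H) z) ('D_(sp d) H z) ('D_(sp b) H z) (Am z b d) => x1 x2 x3 x4; ring.
have C20 : 0 <= N * K2 + K by rewrite addr_ge0// mulr_ge0// ltW.
have [|||||||||||r' [C' [r'0 rr' HC']]] := @energy_local_bound R n M i a H kap q al a2 HS H0 kap0 pq 1 T y0 r dl K (N * K2 + K) (N * dl) (2 * N * e) L h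
  r0 T2' ri L0 _ hS.
- by move=> z b d /D1; exact: AL.
- move=> z /osc1 zo.
  have z1 : 0 <= (H z - m) * (H z - m) by rewrite -expr2 sqr_ge0.
  rewrite lerDl mulr_ge0 ?(ltW N0)//= -[leRHS]/(1 + 1) lerD2l.
  apply: le_trans eN; apply: ler_wpM2l; first exact: ltW.
  by apply: le_trans ee; rewrite -expr2 -real_normK ?num_real// lerXn2r ?nnegrE ?(ltW e0).
- move=> z zD; have z1 := D1 _ zD; have kp := kap0 (le_trans T2' zD.1).
  apply: le_trans (PE z z1) _; rewrite ler_pM2l//.
  have I := HK (Num.sqrt (E 2 z)) (Num.sqrt (E 1 z)) (sqrtr_ge0 _) (sqrtr_ge0 _).
  rewrite !sqr_sqrtr ?energy_ge0// in I.
  have I2 := ler_wpM2l (sqrtr_ge0 (E 1 z)) (HC z z1).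
  have I3 : 0 <= N * K2 by rewrite mulr_ge0// ltW.
  move: I I2 I3; rewrite -/(be 3%N z); move: (opd _ _ _ _) (\sum_(s <- _) _) (be 3%N z) => x1 x2 x3.
  move: (E 1 z) (E 2 z) (Num.sqrt _) => x4 x5 x6 I I2 I3; lra.
- move=> z zD; have z1 := D1 _ zD; have kp := kap0 (le_trans T2' zD.1); have Oz := DO _ z1.
  rewrite dh// HE// oph//.
  have I1 := el z H z1; rewrite -E1 in I1.
  have I2 := HC0 z z1; rewrite /be /= in I2.
  have I3 := osc1 z zD.
  have I4 : (H z - m) * P0 z <= C0 * (1 + Num.sqrt (E 1 z)).
    apply: le_trans (ler_norm _) _; rewrite normrM -[leRHS]mul1r; apply: ler_pM => //.
    exact: le_trans I3 e_1.
  have I5 := HK2 _ (sqrtr_ge0 (E 1 z)); rewrite sqr_sqrtr ?energy_ge0// in I5.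
  have I6 : N * (2 * ((H z - m) * P0 z) - 2 * ipd sp (Am z) H H z) <= N * (- (dl * E 1 z) + K2).
    apply: ler_wpM2l; first exact: ltW.
    by move: I1 I4 I5; move: (ipd _ _ _ _ _) ((H z - m) * P0 z) (C0 * _) (dl * _) => x1 x2 x3 x4; intros; lra.
  rewrite (_ : 2 * N * _ = kap z.1 * (2 * N * ((H z - m) * opd sp (Am z) H z) + 2 * N * ipd sp (Am z) H H z +
    N * (2 * ((H z - m) * P0 z) - 2 * ipd sp (Am z) H H z))); last first.
    by move: (opd _ _ _ _) (ipd _ _ _ _ _) (P0 z) => x1 x2 x3; ring.
  rewrite ler_pM2l// -!addrA !lerD2l; apply: le_trans I6 _.
  by rewrite mulrDr mulrN mulrA lerD2l lerDl.
- move=> z b zD; rewrite dh; last exact: DO (D1 _ zD).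
  rewrite normrM (gtr0_norm (mulr_gt0 (ltr0n R 2) N0)) -[leRHS]mulrA.
  apply: ler_wpM2l; first by rewrite ltW// mulr_gt0.
  by rewrite normrM; apply: ler_pM => //; exact: osc1.
- exact: dl0.
- by rewrite mulr_gt0.
- exact: K0.
- exact: C20.
- by apply: mulr_ge0; [apply: mulr_ge0 => //|]; exact: ltW.
- have NE : N * dl = 8 * K + 8 by rewrite /N divfK ?mulrDr ?mulr1// gt_eqF.
  rewrite NE (_ : _ * (2 * N * e) = X * e); last by rewrite /X; ring.
  have : (X * e) ^+ 2 / dl <= 1.
    rewrite ler_pdivrMr// mul1r exprMn; apply: le_trans eX; apply: ler_wpM2l => //; exact: sqr_ge0.
  rewrite -mulrA => /(ler_wpM2l (ler0n R 4)) /(lerD (lexx (4 * K))) /le_trans; apply.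
  rewrite -subr_ge0 (_ : _ - _ = 4 * K + 4); last by ring.
  by rewrite addr_ge0// mulr_ge0.
exists r', T, C'; split => //.
by move=> y yr; apply: ri => b; exact: le_trans (yr b) rr'.
Qed.

Lemma opd_affine (k l : R) f A z : smooth_on O f -> O z ->
  opd sp A (fun z => k + l * f z) z = l * opd sp A f z.
Proof.
move=> fS Oz.
have cS (x : R) : smooth_on O (fun=> x) by exact: smooth_on_cst.
have lS : smooth_on O (fun z => l * f z) by exact: (smooth_onM oO (cS l) fS).
have D v w : O w -> 'D_v (fun z => k + l * f z) w = l * 'D_v f w.
  move=> Ow; apply: etrans (smooth_deriveD v (cS k) lS Ow) _.
  have [_ ->] := is_derive_cst k w v; rewrite add0r; exact: smooth_deriveZ fS Ow.
rewrite /opd mulr_sumr; apply: eq_bigr => b _; rewrite mulr_sumr; apply: eq_bigr => d _.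
apply: etrans _ (mulrCA _ _ _); apply: f_equal.
apply: etrans _ (smooth_deriveZ l (sp b) (smooth_on_D (sp d) fS) Oz).
apply: near_eq_derive; apply: (open_near oO Oz) => w Ow; exact: D.
Qed.

Lemma derive_affine (k l : R) f v z : smooth_on O f -> O z ->
  'D_v (fun z => k + l * f z) z = l * 'D_v f z.
Proof.
move=> fS Oz.
have cS (x : R) : smooth_on O (fun=> x) by exact: smooth_on_cst.
have lS : smooth_on O (fun z => l * f z) by exact: (smooth_onM oO (cS l) fS).
apply: etrans (smooth_deriveD v (cS k) lS Oz) _.
have [_ ->] := is_derive_cst k z v; rewrite add0r; exact: smooth_deriveZ fS Oz.
Qed.

(** The auxiliary function is [1 + E k / Kc], whose evolution carries [- E k.+1]. It lies between
    [1] and [2] because the lower derivatives are bounded; the prescribed smallness of the quartic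
    coefficient plays the role that small oscillation played for the gradient. *)
Lemma next_bound k y0 (T r B : R) : (0 < k)%N -> 0 < r -> 2 <= T -> box y0 r `<=` img i -> 0 <= B ->
  (forall s z, (size s <= k)%N -> region T y0 r z -> `|dH H s z| <= B) ->
  exists r' C : R, [/\ 0 < r', r' <= r & forall s z, size s = k.+1 -> region T y0 r' z -> `|dH H s z| <= C].
Proof.
move=> k0 r0 T2 ri B0 HB.
have [L L0 AL] := Am_bounded al qS a00 Hb T2 ri.
have [dl dl0 el] := Am_elliptic al a2 H0 qS pq a00 Hb T2 ri.
have [P PP PE] := energy_evolution a2 HS H0 kap0 qS pq P0S HE k.+1 T2 ri el.
have [P' PP' PE'] := energy_evolution a2 HS H0 kap0 qS pq P0S HE k T2 ri el.
have DO := region_O a2 T2 ri.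
have s0 j z : 0 <= Num.sqrt (E j z) by exact: sqrtr_ge0.
have qb (f : 'rV[R]_n -> R) ga : smooth_on (img i) f -> exists2 C, 0 <= C &
    forall z, region T y0 r z -> `|f z.2 * H z `^ ga| <= C.
  by move=> fS; exact: (coef_bounded a00 Hb ga T2 ri fS).
have k1 : (1 < k.+1)%N by rewrite ltnS.
pose be w z := weight2 k.+1 (Num.sqrt (E k.+1 z)) (Num.sqrt (E k.+2 z)) w.
have be1 w z : 1 <= be w z by exact: weight2_ge1.
pose Y j z := if (j <= k)%N then B else if (j == k.+1)%N then Num.sqrt (E k.+1 z) else Num.sqrt (E k.+2 z).
have HY s z : (size s <= k.+2)%N -> region T y0 r z -> `|dH H s z| <= Y (size s) z.
  move=> sk zD; rewrite /Y; case: ifP => [sk'|/negbT]; first exact: HB.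
  rewrite -ltnNge => ks; case: eqP => [<-|/eqP sk1]; first exact: dH_energy.
  have -> : k.+2 = size s by apply/eqP; rewrite eqn_leq sk andbT ltn_neqAle eq_sym sk1.
  exact: dH_energy.
have Yb j w w' : (j <= k.+2)%N -> (j + w <= w')%N -> (w' <= k.+3)%N -> exists2 C, 0 <= C &
    forall z, region T y0 r z -> Y j z * be w z <= C * be w' z.
  move=> jk jw wk; have [kj|kj] := leqP j k.
    exists B => // z _; rewrite /Y kj; apply: ler_wpM2l => //; apply: weight2_mono => //.
    exact: leq_trans (leq_addl _ _) jw.
  have kj' : (j <= k)%N = false by rewrite leqNgt kj.
  have [jE|jE] := eqVneq j k.+1; exists 1 => // z _; rewrite mul1r /Y kj'.
    by rewrite jE eqxx; apply: weight2_y => //; rewrite -jE.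
  have jE2 : j = k.+2 by apply/eqP; rewrite eqn_leq jk ltn_neqAle eq_sym jE.
  by rewrite (negbTE jE); apply: weight2_x => //; rewrite -jE2.
have PB s : size s = k.+1 -> exists2 C, 0 <= C & forall z, region T y0 r z -> `|P s z| <= C * be k.+3 z.
  move=> sk; have := PP s; rewrite sk => PPs.
  exact: PW_bound DO (fun w z _ => be1 w z) HY Yb qb PPs (leqnn _).
have [C C0 HC] := words_bound PB (fun z _ => le_trans ler01 (be1 k.+3 z)).
have beE z : be k.+3 z = (1 + Num.sqrt (E k.+1 z)) ^+ 2 + Num.sqrt (E k.+2 z).
  have F1 : (k.+3 < k.+1)%N = false by apply/negbTE; rewrite -leqNgt -addn2 leq_addr.
  have F2 : (k.+3 == k.+1) = false by rewrite -addn2 -{2}[k.+1]addn0 eqn_add2l.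
  have F3 : (k.+3 == k.+2) = false by rewrite -addn1 -{2}[k.+2]addn0 eqn_add2l.
  by rewrite /be /weight2 F1 F2 F3.
(* In the evolution of the lower energy the order [k + 1] occurs linearly: such a factor leaves
   weight at most [1] for the rest. *)
pose be' w z := if (w < k.+1)%N then 1 else 1 + Num.sqrt (E k.+1 z).
have be1' w z : 1 <= be' w z by rewrite /be'; case: ifP => // _; rewrite lerDl.
pose Y' j z := if (j <= k)%N then B else Num.sqrt (E k.+1 z).
have HY' s z : (size s <= k.+1)%N -> region T y0 r z -> `|dH H s z| <= Y' (size s) z.
  move=> sk zD; rewrite /Y'; case: ifP => [sk'|/negbT]; first exact: HB.
  rewrite -ltnNge => ks; have -> : k.+1 = size s by apply/eqP; rewrite eqn_leq ks sk.
  exact: dH_energy.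
have Yb' j w w' : (j <= k.+1)%N -> (j + w <= w')%N -> (w' <= k.+2)%N -> exists2 C, 0 <= C &
    forall z, region T y0 r z -> Y' j z * be' w z <= C * be' w' z.
  move=> jk jw wk; have [kj|kj] := leqP j k.
    exists B => // z _; rewrite /Y' kj; apply: ler_wpM2l => //.
    have ww : (w <= w')%N by exact: leq_trans (leq_addl _ _) jw.
    rewrite {1}/be'; case: ifP => // /negbT; rewrite -leqNgt => kw.
    by rewrite /be' ltnNge (leq_trans kw ww).
  have kj' : (j <= k)%N = false by rewrite leqNgt kj.
  exists 1 => // z _; rewrite mul1r /Y' kj'.
  have jE : j = k.+1 by apply/eqP; rewrite eqn_leq jk.
  have w1 : (w <= 1)%N by move: (leq_trans jw wk); rewrite jE -[k.+2]addn1 leq_add2l.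
  rewrite /be' (leq_ltn_trans w1 k1) mulr1 ltnNge (leq_trans _ jw) /=; first by rewrite lerDr.
  by rewrite jE leq_addr.
have PB' s : size s = k -> exists2 C, 0 <= C & forall z, region T y0 r z -> `|P' s z| <= C * be' k.+2 z.
  move=> sk; have := PP' s; rewrite sk => PPs.
  exact: PW_bound DO (fun w z _ => be1' w z) HY' Yb' qb PPs (leqnn _).
have [C' C'0 HC'] := words_bound PB' (fun z _ => le_trans ler01 (be1' k.+2 z)).
have beE' z : be' k.+2 z = 1 + Num.sqrt (E k.+1 z) by rewrite /be' ltnNge leqnSn.
pose w0 := (size (words (n := n) k))%:R : R; pose w1 := (size (words (n := n) k.+1))%:R : R.
pose Bk := w0 * B ^+ 2.
have Bk0 : 0 <= Bk by rewrite mulr_ge0 ?sqr_ge0.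
have EB z : region T y0 r z -> E k z <= Bk.
  by move=> zD; apply: energy_le => s sk; apply: HB => //; rewrite sk.
pose Z := (n * n)%:R * L * (2 * w1) * (2 * w0 * Num.sqrt Bk).
(* [Kc >= Bk] keeps [h] at most [2]. By [8 Z^2 <= dl^2 Kc] the mixed term uses at most one half of
   the good coefficient [dl / Kc], and [C1 = dl / (8 Kc)] uses the other half. *)
pose Kc := Bk + 1 + 8 * Z ^+ 2 / dl ^+ 2.
have dl20 : 0 < dl ^+ 2 by rewrite exprn_gt0.
have Z20 : 0 <= 8 * Z ^+ 2 / dl ^+ 2 by apply: divr_ge0; [apply: mulr_ge0 => //; exact: sqr_ge0|exact: ltW].
have Kc0 : 0 < Kc by rewrite ltr_pwDl// ltr_wpDl.
have KcB : Bk <= Kc by rewrite /Kc -addrA lerDl addr_ge0.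
have KcZ : 8 * Z ^+ 2 <= dl ^+ 2 * Kc.
  by rewrite [leRHS]mulrC -ler_pdivrMr// /Kc lerDr addr_ge0.
pose C1 := dl / (8 * Kc); have C10 : 0 < C1 by rewrite divr_gt0// mulr_gt0.
have [K2 K20 HK2] := forcing2 dl0 C0 C10.
have [K3 K30 HK3] := forcing0 dl0 (mulr_ge0 (sqrtr_ge0 Bk) C'0).
pose h z := 1 + Kc^-1 * E k z.
have ES := energy_smooth HS k.
have cS (x : R) : smooth_on O (fun=> x) by exact: smooth_on_cst.
have ES' : smooth_on O (fun z => Kc^-1 * E k z) by exact: (smooth_onM oO (cS _) ES).
have hS : smooth_on O h by exact: (smooth_onD oO (cS 1) ES').
have C20 : 0 <= Kc^-1 * K3 + K2 by rewrite addr_ge0// mulr_ge0// invr_ge0 ltW.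
have Ki : 0 <= Kc^-1 by rewrite invr_ge0 ltW.
apply: (@energy_local_bound R n M i a H kap q al a2 HS H0 kap0 pq k.+1 T y0 r dl C1 (Kc^-1 * K3 + K2)
  (dl / Kc) (2 * w0 * Num.sqrt Bk / Kc) L h r0 T2 ri L0 AL hS _ _ _ _ dl0 _ (ltW C10) C20).
- move=> z zD; rewrite lerDl mulr_ge0 ?energy_ge0//= -[leRHS]/(1 + 1) lerD2l.
  by rewrite mulrC ler_pdivrMr// mul1r; apply: le_trans (EB z zD) KcB.
- move=> z zD; have kp := kap0 (le_trans T2 zD.1).
  apply: le_trans (PE z zD) _; rewrite ler_pM2l//.
  have I := HK2 (Num.sqrt (E k.+2 z)) (Num.sqrt (E k.+1 z)) (s0 _ _) (s0 _ _).
  have I2 := ler_wpM2l (s0 k.+1 z) (HC z zD); rewrite beE in I2.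
  rewrite !sqr_sqrtr ?energy_ge0// in I.
  have I3 : 0 <= Kc^-1 * K3 by rewrite mulr_ge0.
  have I4 := le_trans (ler_wpM2l (ler0n R 2) I2) I.
  rewrite -!addrA lerD2l.
  apply: le_trans (lerD (lexx _) I4) _.
  rewrite -subr_ge0 (_ : _ - _ = Kc^-1 * K3) //.
  by move: (E k.+2 z) (E k.+1 z) => x1 x2; ring.
- move=> z zD; have Oz := DO _ zD; have kp := kap0 (le_trans T2 zD.1).
  rewrite (derive_affine 1 Kc^-1 _ ES Oz) (opd_affine 1 Kc^-1 _ ES Oz).
  have I := PE' z zD.
  have I2 : 2 * (Num.sqrt (E k z) * \sum_(s <- words k) `|P' s z|) <= dl * E k.+1 z + K3.
    have J := HK3 _ (s0 k.+1 z); rewrite sqr_sqrtr ?energy_ge0// in J.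
    apply: le_trans J; apply: ler_wpM2l => //; rewrite -mulrA; apply: ler_pM => //.
    - by apply: sumr_ge0 => s _; exact: normr_ge0.
    - by apply: ler_wsqrtr; exact: EB.
    - by rewrite -beE'; exact: HC'.
  apply: le_trans (ler_wpM2l Ki I) _; rewrite mulrCA ler_pM2l//.
  have I3 := ler_wpM2l Ki I2.
  move: I3; move: (opd _ _ _ _) (2 * (_ * _)) (E k.+1 z) => x1 x2 x3 I3.
  rewrite (_ : Kc^-1 * (x1 - 2 * dl * x3 + x2) = Kc^-1 * x1 - 2 * (dl / Kc) * x3 + Kc^-1 * x2); last by ring.
  apply: le_trans (lerD (lexx _) I3) _.
  rewrite -subr_ge0 (_ : _ - _ = K2) //; ring.
- move=> z b zD; have Oz := DO _ zD.
  rewrite (derive_affine 1 Kc^-1 _ ES Oz) normrM (ger0_norm Ki).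
  rewrite (_ : _ / Kc * _ = Kc^-1 * (2 * w0 * (Num.sqrt Bk * Num.sqrt (E k.+1 z)))); last by ring.
  apply: ler_wpM2l => //; apply: le_trans (energy_gradient HS k b Oz) _.
  apply: ler_wpM2l; first by rewrite mulr_ge0.
  by apply: ler_wpM2r => //; apply: ler_wsqrtr; exact: EB.
- by rewrite divr_gt0.
- by rewrite divr_ge0 ?(ltW Kc0)// mulr_ge0// mulr_ge0.
- rewrite (_ : _ * (2 * w0 * Num.sqrt Bk / Kc) = Z / Kc); last by rewrite /Z; ring.
  have KN : Kc != 0 by rewrite gt_eqF.
  have dN : dl != 0 by rewrite gt_eqF.
  have I : (dl * Kc ^+ 2)^-1 * (8 * Z ^+ 2) <= (dl * Kc ^+ 2)^-1 * (dl ^+ 2 * Kc).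
    by apply: ler_wpM2l => //; rewrite invr_ge0 mulr_ge0 ?(ltW dl0)// sqr_ge0.
  rewrite -subr_ge0 in I; rewrite -subr_ge0.
  rewrite (_ : _ - _ = 2^-1 * ((dl * Kc ^+ 2)^-1 * (dl ^+ 2 * Kc) - (dl * Kc ^+ 2)^-1 * (8 * Z ^+ 2))).
    by rewrite mulr_ge0// invr_ge0.
  by rewrite /C1; field; rewrite KN dN.
Qed.

Lemma derivative_bound k y0 : img i y0 -> exists r T C : R,
  [/\ 0 < r, 2 <= T, box y0 r `<=` img i &
    forall s z, (size s <= k)%N -> region T y0 r z -> `|dH H s z| <= C].
Proof.
move=> iy0; elim: k => [|k [r [T [C [r0 T2 ri HC]]]]].
  have [r r0 ri] := box_in_open (@open_img _ _ M i) iy0.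
  exists r, 2, a1; split => // -[|//] z _ zD.
  have /andP[h1 h2] := region_H Hb (lexx 2) ri zD.
  by rewrite /dH /= ger0_norm// (le_trans (ltW a00)).
have C0 : 0 <= C.
  apply: le_trans (HC [::] (T, y0) (leq0n _) _); first exact: normr_ge0.
  by split => //= b; rewrite subrr normr0 ltW.
have [r' [T' [C' [r'0 T'2 r'i HC']]]] : exists r' T' C' : R, [/\ 0 < r', 2 <= T', box y0 r' `<=` img i &
    forall s z, size s = k.+1 -> region T' y0 r' z -> `|dH H s z| <= C'].
  case: k HC => [|k] HC; first exact: first_bound.
  have [r' [C' [r'0 rr HC']]] := next_bound (ltn0Sn k) r0 T2 ri C0 HC.
  exists r', T, C'; split => // y yr; apply: ri => b; exact: le_trans (yr b) rr.
have m1 : Num.min r r' <= r by rewrite ge_min lexx.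
have m2 : Num.min r r' <= r' by rewrite ge_min lexx orbT.
have M1 : T <= Num.max T T' by rewrite le_max lexx.
have M2 : T' <= Num.max T T' by rewrite le_max lexx orbT.
exists (Num.min r r'), (Num.max T T'), (Num.max C C'); split.
- by rewrite lt_min r0.
- exact: le_trans T2 M1.
- by move=> y yr; apply: ri => b; exact: le_trans (yr b) m1.
move=> s z; rewrite leq_eqVlt => /orP[/eqP sk|sk] zD.
  apply: le_trans (HC' s z sk (regionS M2 m2 zD)) _; by rewrite le_max lexx orbT.
by apply: le_trans (HC s z sk (regionS M1 m1 zD)) _; rewrite le_max lexx.
Qed.

End derivative_bounds.

(** * Convergence *)

Section locally_uniform_limits.
Context {R : realType} {n : nat}.
Local Notation rV := 'rV[R]_n.
Implicit Types (O K : set rV) (F : R -> rV -> R) (f : rV -> R).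

Definition ucvg O F f := forall K (e : R), compact K -> K `<=` O -> 0 < e ->
  \forall t \near +oo, forall y, K y -> `|f y - F t y| <= e.

Definition ulocb O F := forall y0, O y0 -> exists r C : R,
  [/\ 0 < r, box y0 r `<=` O & \forall t \near +oo, forall y, box y0 r y -> `|F t y| <= C].

Definition usmooth O F := \forall t \near +oo, smooth_on O (F t).

Lemma ucvg_local O F f : (forall y0 (e : R), O y0 -> 0 < e ->
    \forall y \near y0 & t \near +oo, `|f y - F t y| <= e) -> ucvg O F f.
Proof.
move=> H K e cK KO e0.
have /(_ _ _ (fun t y => `|f y - F t y| <= e) _) C := (compact_near_coveringP K).1 cK.
by apply: C => y /KO Oy; exact: H.
Qed.

Lemma ucvg_pointwise O F f y : ucvg O F f -> O y -> F t y @[t --> +oo] --> f y.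
Proof.
move=> H Oy; apply/cvgrPdist_le => e e0.
by apply: filterS (H _ e (@compact_set1 _ y) _ e0) => [t|z ->//]; exact.
Qed.

Lemma ucvg_continuous O F f y0 : open O -> usmooth O F -> ucvg O F f -> O y0 -> {for y0, continuous f}.
Proof.
move=> oO FS Ff Oy0; have [r r0 rO] := box_in_open oO Oy0.
apply: (iffRL (@cvgrPdist_le R R _ (nbhs y0) _ f (f y0))) => e e0.
have e30 : 0 < e / 3 by rewrite divr_gt0.
have [t [tS tf]] := @filter_ex _ _ _ _ (filterI FS (Ff _ _ (@box_compact _ _ y0 r) rO e30)).
have /cvgrPdist_le/(_ _ e30) c := smooth_on_cts tS Oy0.
have b0 : box y0 r y0 by move=> a; rewrite subrr normr0 ltW.
have I0 := tf _ b0.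
apply: filterS (filterI c (box_nbhs y0 r0)) => y [cy by_].
have I1 := tf _ by_.
rewrite (_ : f y0 - f y = (f y0 - F t y0) + (F t y0 - F t y) - (f y - F t y)); last by ring.
rewrite (_ : e = e / 3 + e / 3 + e / 3); last by field.
apply: le_trans (ler_normB _ _) _; apply: lerD => //.
by apply: le_trans (ler_normD _ _) _; apply: lerD.
Qed.

Lemma taylor2 O f v y (h C : R) : smooth_on O f ->
  (forall s, `|s| <= `|h| -> O (s *: v + y) /\ `|'D_v ('D_v f) (s *: v + y)| <= C) ->
  `|f (h *: v + y) - f y - h * 'D_v f y| <= `|h| * `|h| * C.
Proof.
move=> fS H.
have [s sh ->] := @line_MVT_sym R _ f y v h (fun s sh => smooth_on_derivable (v := v) fS (H s sh).1).
have fS2 := smooth_on_D v fS.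
have [s' sh' E] := @line_MVT_sym R _ ('D_v f) y v s
  (fun s' sh' => smooth_on_derivable (v := v) fS2 (H s' (le_trans sh' sh)).1).
have [_ B] := H s' (le_trans sh' sh).
rewrite -mulrBr E !normrM mulrA; apply: ler_pM => //.
by apply: ler_wpM2l.
Qed.

Lemma box_line (y0 v y : rV) (r h : R) : 0 < r -> `|h| <= r / (`|v| + 1) -> box y0 r y ->
  box y0 (r + r) (h *: v + y).
Proof.
move=> r0 hr yr a; rewrite !mxE -addrA; apply: le_trans (ler_normD _ _) _.
apply: lerD; last exact: yr.
have v1 : 0 < `|v| + 1 by rewrite ltr_wpDl.
rewrite ler_pdivlMr// in hr; apply: le_trans hr; rewrite normrM; apply: ler_wpM2l => //.
by apply: le_trans (ler_norm_coord v a) _; rewrite lerDl.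
Qed.

(** By Taylor's formula the bound on the second derivatives makes ['D_v (F t)] close to its own
    difference quotients at a fixed step [h]; for large [t] these are close to those of the
    limit. *)
Lemma quotient_estimate O F f v y0 : open O -> usmooth O F -> ucvg O F f ->
  ulocb O (fun t => 'D_v ('D_v (F t))) -> O y0 ->
  exists r d C : R, [/\ 0 < r, 0 < d, 0 <= C, box y0 r `<=` O &
    forall h e, h != 0 -> `|h| <= d -> 0 < e -> \forall t \near +oo,
      forall y, box y0 r y -> `|'D_v (F t) y - h^-1 * (f (h *: v + y) - f y)| <= `|h| * C + e].
Proof.
move=> oO FS Ff FB Oy0; have [r0 [C [r00 r0O HC]]] := FB _ Oy0.
pose r := r0 / 2; have r1 : 0 < r by rewrite divr_gt0.
have rr : r + r = r0 by rewrite /r -splitr.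
have v1 : 0 < `|v| + 1 by rewrite ltr_wpDl.
have rO : box y0 r `<=` box y0 r0.
  by move=> y yr a; apply: le_trans (yr a) _; rewrite -rr lerDl ltW.
exists r, (r / (`|v| + 1)), `|C|; split => //; first by rewrite divr_gt0.
  by move=> y /rO/r0O.
move=> h e h0 hd e0; have hp : 0 < `|h| by rewrite normr_gt0.
have e10 : 0 < `|h| * e / 2 by rewrite divr_gt0// mulr_gt0.
apply: filterS (filterI FS (filterI HC (Ff _ _ (@box_compact _ _ y0 r0) r0O e10))) => t [tS [tC tf]] y yr.
have L s : `|s| <= `|h| -> box y0 r0 (s *: v + y).
  by move=> sh; rewrite -rr; apply: box_line => //; exact: le_trans sh hd.
have T := @taylor2 O (F t) v y h `|C| tS (fun s sh => conj (r0O _ (L s sh)) (le_trans (tC _ (L s sh)) (ler_norm C))).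
have I1 := tf _ (L h (lexx _)); have I2 := tf _ (rO _ yr).
rewrite -(ler_pM2l hp) -normrM.
move: T I1 I2; move: ('D_v (F t) y) (F t (h *: v + y)) (F t y) (f (h *: v + y)) (f y) => x1 x2 x3 x4 x5 T I1 I2.
rewrite (_ : h * _ = (x4 - x2) * - 1 + (x5 - x3) - (x2 - x3 - h * x1)); last by field.
apply: le_trans (ler_normB _ _) _.
apply: le_trans (lerD (le_trans (ler_normD _ _) (lerD _ I2)) T) _; first by rewrite mulrN1 normrN; exact: I1.
by rewrite -subr_ge0 (_ : _ - _ = 0) //; field.
Qed.

Lemma near0_small (d : R) : 0 < d -> \forall h \near (0 : R)^', h != 0 /\ `|h| <= d.
Proof.
move=> d0; near=> h; split; first by near: h; exact: nbhs_dnbhs_neq.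
near: h; apply: dnbhs0_le; exact: d0.
Unshelve. all: by end_near. Qed.

(** The difference quotients of [f] approximate ['D_v (F t)] for all large [t], so these derivatives
    have a limit, which is at once the derivative of [f]. Derivatives converge along the whole
    family, without extraction of subsequences. *)
Lemma limit_derivative O F f v : open O -> usmooth O F -> ucvg O F f ->
  ulocb O (fun t => 'D_v ('D_v (F t))) ->
  (forall y, O y -> derivable f y v) /\ ucvg O (fun t => 'D_v (F t)) ('D_v f).
Proof.
move=> oO FS Ff FB.
have K y0 : O y0 -> exists r d C : R, [/\ 0 < r, 0 < d, 0 <= C, box y0 r `<=` O &
    (forall h e, h != 0 -> `|h| <= d -> 0 < e -> \forall t \near +oo,
      forall y, box y0 r y -> `|'D_v (F t) y - h^-1 * (f (h *: v + y) - f y)| <= `|h| * C + e) /\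
    forall y, box y0 r y -> derivable f y v /\ forall h, h != 0 -> `|h| <= d ->
      `|'D_v f y - h^-1 * (f (h *: v + y) - f y)| <= `|h| * (C + 1)].
  move=> Oy0; have [r [d [C [r0 d0 C0 rO H]]]] := quotient_estimate oO FS Ff FB Oy0.
  exists r, d, C; split => //; split => // y yr.
  pose Q h := h^-1 * (f (h *: v + y) - f y).
  have cs : cauchy ('D_v (F t) y @[t --> +oo]).
    apply: cauchy_exP => e e0.
    (* For a step this small the quotient [Q h] is within [e] of the derivatives for all large [t],
       which is the Cauchy property. *)
    have [h [h0 hd]] : exists h : R, h != 0 /\ (`|h| <= d /\ `|h| * C <= e / 3).
      have m0 : 0 < Num.min d (e / 3 / (C + 1)).
        by rewrite lt_min d0 divr_gt0 ?divr_gt0// ltr_wpDl.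
      exists (Num.min d (e / 3 / (C + 1))); rewrite gt_eqF// (gtr0_norm m0); split => //; split.
        by rewrite ge_min lexx.
      have C1 : 0 < C + 1 by rewrite ltr_wpDl.
      apply: le_trans (_ : e / 3 / (C + 1) * C <= _); first by rewrite ler_wpM2r// ge_min lexx orbT.
      rewrite -mulrA ler_piMr//; first by rewrite divr_ge0// ltW.
      by rewrite mulrC ler_pdivrMr// mul1r lerDl.
    have e30 : 0 < e / 3 by rewrite divr_gt0.
    exists (Q h); apply: filterS (H h (e / 3) h0 hd.1 e30) => t /(_ y yr) I.
    rewrite -ball_normE /= distrC; apply: le_lt_trans I _.
    apply: le_lt_trans (lerD hd.2 (lexx _)) _; by rewrite -subr_gt0 (_ : _ - _ = e / 3) //; field.
  have cc : cvg ('D_v (F t) y @[t --> +oo]) by exact: cauchy_cvg.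
  have [l cl] : exists l : R, 'D_v (F t) y @[t --> +oo] --> l by exists (lim ('D_v (F t) y @[t --> +oo])); exact: cc.
  have lQ h : h != 0 -> `|h| <= d -> `|l - Q h| <= `|h| * (C + 1).
    move=> h0 hd; have hp : 0 < `|h| / 2 by rewrite divr_gt0 ?normr_gt0.
    move/cvgrPdist_le: cl => /(_ _ hp) cl.
    have [t [I1 I2]] := @filter_ex _ _ _ _ (filterI cl (H h (`|h| / 2) h0 hd hp)).
    rewrite (_ : l - Q h = (l - 'D_v (F t) y) + ('D_v (F t) y - Q h)); last by rewrite addrA subrK.
    apply: le_trans (ler_normD _ _) _; apply: le_trans (lerD I1 (I2 y yr)) _.
    by rewrite -subr_ge0 (_ : _ - _ = 0) //; field.
  have cQ : Q h @[h --> (0 : R)^'] --> l.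
    apply/cvgrPdist_le => e e0.
    have C1 : 0 < C + 1 by rewrite ltr_wpDl.
    apply: filterS (filterI (near0_small d0) (near0_small (divr_gt0 e0 C1))) => h [[h0 hd] [_ he]].
    by apply: le_trans (lQ h h0 hd) _; rewrite -ler_pdivlMr.
  have dl : 'D_v f y = l by exact: cvg_lim cQ.
  split; first by apply/cvg_ex; exists l; exact: cQ.
  by rewrite dl.
split=> [y0 Oy0|].
  have [r [d [C [r0 _ _ _ [_ H]]]]] := K _ Oy0.
  by have [|] := H y0 _ => // a; rewrite subrr normr0 ltW.
apply: ucvg_local => y0 e Oy0 e0.
have [r [d [C [r0 d0 C0 rO [H1 H2]]]]] := K _ Oy0.
have C1 : 0 < C + 1 by rewrite ltr_wpDl.
have [h [[h0 hd] [_ he]]] := @filter_ex _ _ _ _ (filterI (near0_small d0) (near0_small (divr_gt0 (divr_gt0 e0 (ltr0n R 3)) C1))).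
rewrite ler_pdivlMr// in he.
have e30 : 0 < e / 3 by rewrite divr_gt0.
exists (box y0 r, [set t | forall y, box y0 r y -> `|'D_v (F t) y - h^-1 * (f (h *: v + y) - f y)| <= `|h| * C + e / 3]) => /=.
  by split; [exact: box_nbhs|exact: H1].
move=> [y t] /= [yr It]; have I1 := It y yr; have [_ /(_ h h0 hd) I2] := H2 y yr.
have I3 : `|h| * C <= e / 3 by apply: le_trans he; rewrite ler_wpM2l// lerDl.
move: I1 I2; move: (h^-1 * _) ('D_v f y) ('D_v (F t) y) => x1 x2 x3 I1 I2.
rewrite (_ : x2 - x3 = (x2 - x1) - (x3 - x1)); last by ring.
apply: le_trans (ler_normB _ _) _; apply: le_trans (lerD (le_trans I2 he) (le_trans I1 (lerD I3 (lexx _)))) _.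
by rewrite -subr_ge0 (_ : _ - _ = 0) //; field.
Qed.

Lemma dirder_derive O f v (s : seq rV) y : open O -> smooth_on O f -> O y ->
  dirder s ('D_v f) y = \sum_b v 0 b * dirder s ('D_(delta_mx 0 b) f) y.
Proof.
move=> oO fS; elim: s y => [|u s IH] y Oy; first exact: smooth_derive oO fS Oy.
have N : {near y, dirder s ('D_v f) =1 (fun y => \sum_b v 0 b * dirder s ('D_(delta_mx 0 b) f) y)}.
  by apply: (open_near oO Oy) => z; exact: IH.
apply: etrans (near_eq_derive u N) _.
exact: (smooth_derive_bigsum _ _ _ (fun b => smooth_on_dirder s (smooth_on_D (delta_mx 0 b) fS)) Oy).
Qed.

(** Bounds in the coordinate directions only, as the energies provide them; derivatives in other
    directions are combinations of these. *)
Definition coordb O F := forall w : seq 'I_n,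
  ulocb O (fun t => dirder (map (delta_mx 0) w) (F t)).

Lemma ulocb_sum O (I : eqType) (w : seq I) (c : I -> R) (F : I -> R -> rV -> R) : open O ->
  (forall j, ulocb O (F j)) -> ulocb O (fun t y => \sum_(j <- w) c j * F j t y).
Proof.
move=> oO FB y0 Oy0; elim: w => [|j w [r [C [r0 rO HC]]]].
  have [r r0 rO] := box_in_open oO Oy0.
  by exists r, 0; split => //; near=> t => y _; rewrite big_nil normr0.
have [r' [C' [r'0 r'O HC']]] := FB j y0 Oy0.
exists (Num.min r r'), (`|c j| * C' + C); split; first by rewrite lt_min r0.
  by move=> y yr; apply: rO => a; apply: le_trans (yr a) _; rewrite ge_min lexx.
apply: filterS (filterI HC HC') => t [I1 I2] y yr; rewrite big_cons.
apply: le_trans (ler_normD _ _) _; apply: lerD.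
  by rewrite normrM; apply: ler_wpM2l => //; apply: I2 => a; apply: le_trans (yr a) _; rewrite ge_min lexx orbT.
by apply: I1 => a; apply: le_trans (yr a) _; rewrite ge_min lexx.
Unshelve. all: by end_near. Qed.

Lemma ulocb_ext O F G : (\forall t \near +oo, forall y, O y -> F t y = G t y) -> ulocb O F -> ulocb O G.
Proof.
move=> FG FB y0 Oy0; have [r [C [r0 rO HC]]] := FB _ Oy0; exists r, C; split => //.
by apply: filterS (filterI FG HC) => t [E I] y yr; rewrite -E; [exact: I|exact: rO].
Qed.

Lemma coordb_D O F v : open O -> usmooth O F -> coordb O F -> coordb O (fun t => 'D_v (F t)).
Proof.
move=> oO FS FB w.
apply: (@ulocb_ext _ (fun t y => \sum_b v 0 b * dirder (map (delta_mx 0) (rcons w b)) (F t) y)).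
  apply: filterS FS => t tS y Oy; rewrite (dirder_derive v _ oO tS Oy); apply: eq_bigr => b _.
  by rewrite map_rcons dirder_rcons.
by apply: ulocb_sum.
Qed.

Lemma usmooth_D O F v : usmooth O F -> usmooth O (fun t => 'D_v (F t)).
Proof. by apply: filterS => t; exact: smooth_on_D. Qed.

(** The hypotheses on [F] pass to ['D_v F], so the exchange of limit and derivative can be repeated
    along any word. *)
Lemma coordb_limit O F f : open O -> usmooth O F -> coordb O F -> ucvg O F f ->
  smooth_on O f /\ forall s, ucvg O (fun t => dirder s (F t)) (dirder s f).
Proof.
move=> oO.
have B2 G v : usmooth O G -> coordb O G -> ulocb O (fun t => 'D_v ('D_v (G t))).
  by move=> GS GB; have := coordb_D v oO (usmooth_D v GS) (coordb_D v oO GS GB) [::].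
have lim s : forall F f, usmooth O F -> coordb O F -> ucvg O F f ->
    [/\ usmooth O (fun t => dirder s (F t)), coordb O (fun t => dirder s (F t)) &
    ucvg O (fun t => dirder s (F t)) (dirder s f)].
  elim/last_ind: s => [//|s v IH] G h GS GB Gh.
  have [_ c] := limit_derivative oO GS Gh (B2 _ v GS GB).
  have [h1 h2 h3] := IH _ _ (usmooth_D v GS) (coordb_D v oO GS GB) c.
  split.
  - by apply: filterS h1 => t; rewrite dirder_rcons.
  - by move=> w; apply: ulocb_ext (h2 w); near=> t => y _; rewrite dirder_rcons.
  - rewrite dirder_rcons => K e cK KO e0; apply: filterS (h3 K e cK KO e0) => t H y Ky.
    by rewrite dirder_rcons; exact: H.
move=> FS FB Ff; split; last by move=> s; have [] := lim s _ _ FS FB Ff.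
move=> s y Oy; have [h1 h2 h3] := lim s _ _ FS FB Ff; split.
  exact: ucvg_continuous oO h1 h3 Oy.
by move=> v; have [d _] := limit_derivative oO h1 h3 (B2 _ v h1 h2); exact: d.
Unshelve. all: by end_near. Qed.

End locally_uniform_limits.

Section joint_limits.
Context {R : realType} {n : nat}.
Local Notation rV := 'rV[R]_n.
Implicit Types (O : set rV) (F : R -> rV -> R) (f q : rV -> R).

Lemma ucvg_joint O F f y0 : open O -> ucvg O F f -> O y0 -> {for y0, continuous f} ->
  F z.2 z.1 @[z --> (nbhs y0, pinfty_nbhs R)] --> f y0.
Proof.
move=> oO Ff Oy0 fc; have [r r0 rO] := box_in_open oO Oy0.
apply: (iffRL (@cvgrPdist_le R R _ (filter_prod (nbhs y0) (pinfty_nbhs R)) _ _ (f y0))) => e e0.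
have e20 : 0 < e / 2 by rewrite divr_gt0.
have /cvgrPdist_le/(_ _ e20) c := fc.
exists ([set y | `|f y0 - f y| <= e / 2 /\ box y0 r y], [set t | forall y, box y0 r y -> `|f y - F t y| <= e / 2]) => /=.
  split; first by apply: filterS (filterI c (box_nbhs y0 r0)) => y [].
  exact: (Ff _ _ (@box_compact _ _ y0 r) rO e20).
move=> [y t] /= [[I1 yr] /(_ y yr) I2].
rewrite (_ : f y0 - F t y = (f y0 - f y) + (f y - F t y)); last by rewrite addrA subrK.
by rewrite [leRHS]splitr; apply: le_trans (ler_normD _ _) _; apply: lerD.
Qed.

Lemma powR_continuous (x be : R) : 0 < x -> {for x, continuous (fun x => x `^ be)}.
Proof.
move=> x0; apply: (@differentiable_continuous _ _ _ _ (fun x => x `^ be)).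
by apply/derivable1_diffP; have [] := is_derive1_powR be x0.
Qed.

Lemma ucvg_weighted O F f q (nu : R -> R) (nuoo be : R) : open O -> ucvg O F f ->
  (forall y, O y -> {for y, continuous f} /\ 0 < f y) -> (forall y, O y -> {for y, continuous q}) ->
  nu t @[t --> +oo] --> nuoo ->
  ucvg O (fun t y => nu t * (q y * F t y `^ be)) (fun y => nuoo * (q y * f y `^ be)).
Proof.
move=> oO Ff fc qc nuc; apply: ucvg_local => y0 e Oy0 e0.
have [fc0 f0] := fc _ Oy0.
pose FF := filter_prod (nbhs y0) (pinfty_nbhs R).
have FFF : Filter FF by exact: filter_prod_filter.
have c1 : nu z.2 @[z --> FF] --> nuoo.
  apply: (@cvg_comp _ _ _ snd nu FF (pinfty_nbhs R)) nuc; exact: cvg_snd.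
have c2 : q z.1 @[z --> FF] --> q y0.
  apply: (@cvg_comp _ _ _ fst q FF (nbhs y0)) (qc _ Oy0); exact: cvg_fst.
have c3 : F z.2 z.1 `^ be @[z --> FF] --> f y0 `^ be.
  have c0 := ucvg_joint oO Ff Oy0 fc0.
  exact: (cvg_comp _ _ c0 (@powR_continuous _ be f0)).
have c4 : f z.1 `^ be @[z --> FF] --> f y0 `^ be.
  apply: (@cvg_comp _ _ _ (fun z : rV * R => f z.1) (fun x => x `^ be) FF (nbhs (f y0)) _ _ (@powR_continuous _ be f0)).
  apply: (@cvg_comp _ _ _ fst f FF (nbhs y0)) fc0; exact: cvg_fst.
have c5 : nuoo * (q z.1 * f z.1 `^ be) @[z --> FF] --> nuoo * (q y0 * f y0 `^ be).
  by apply: cvgM; [exact: cvg_cst|exact: (cvgM c2 c4)].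
have c : nuoo * (q z.1 * f z.1 `^ be) - nu z.2 * (q z.1 * F z.2 z.1 `^ be) @[z --> FF] --> (0 : R).
  rewrite -(subrr (nuoo * (q y0 * f y0 `^ be))); apply: cvgB c5 _.
  by apply: cvgM; [exact: c1|exact: (cvgM c2 c3)].
have H := (iffLR (@cvgrPdist_le R R _ FF FFF _ 0)) c _ e0.
have K : FF (fun z => `|nuoo * (q z.1 * f z.1 `^ be) - nu z.2 * (q z.1 * F z.2 z.1 `^ be)| <= e).
  have S : (fun z => `|0 - (nuoo * (q z.1 * f z.1 `^ be) - nu z.2 * (q z.1 * F z.2 z.1 `^ be))| <= e) `<=`
      (fun z : rV * R => `|nuoo * (q z.1 * f z.1 `^ be) - nu z.2 * (q z.1 * F z.2 z.1 `^ be)| <= e).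
    by move=> z; rewrite sub0r normrN.
  exact (@filterS _ FF FFF _ _ S H).
exact K.
Qed.

Lemma dirderZ (V : normedModType R) (O : set V) (f : V -> R) (k : R) s y : open O -> smooth_on O f -> O y ->
  dirder s (fun y => k * f y) y = k * dirder s f y.
Proof.
move=> oO fS; elim: s y => [//|v s IH] y Oy.
have N : {near y, dirder s (fun y => k * f y) =1 (fun y => k * dirder s f y)}.
  by apply: (open_near oO Oy) => z; exact: IH.
apply: etrans (near_eq_derive v N) _.
exact: smooth_deriveZ (smooth_on_dirder s fS) Oy.
Qed.

Lemma coordb_scale O F (nu : R -> R) (nuoo : R) : open O -> usmooth O F -> coordb O F ->
  nu t @[t --> +oo] --> nuoo -> coordb O (fun t y => nu t * F t y).
Proof.
move=> oO FS FB nuc w y0 Oy0; have [r [C [r0 rO HC]]] := FB w _ Oy0.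
exists r, ((`|nuoo| + 1) * C); split => //.
have nb : \forall t \near +oo, `|nu t| <= `|nuoo| + 1.
  have /cvgrPdist_le/(_ _ ltr01) H := nuc.
  apply: filterS H => t I; rewrite -lerBlDl; apply: le_trans (lerB_dist _ _) _.
  by rewrite distrC.
apply: filterS (filterI nb (filterI FS HC)) => t [I1 [tS I2]] y yr.
rewrite (dirderZ (nu t) _ oO tS (rO _ yr)) normrM; apply: ler_pM => //; exact: I2.
Qed.

End joint_limits.

(** * The limit of the normalized solution *)

Section convergence.
Context {R : realType} {n : nat} {M : manifold R n} (g : metric M).
Hypothesis cM : compact [set: M].
Hypothesis lapC : forall i f x, smooth_fun f -> dom i x ->
  laplacian g f x = lap g i (f \o phiV i) (phi i x).
Variables (c p : R) (psi : M -> R) (a : R) (kap : R -> R) (U : R -> M -> R) (a0 a1 k0 : R).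
Hypotheses (c0 : 0 < c) (p1 : 1 < p) (psiS : smooth_fun psi) (a2 : a < 2).
Hypotheses (US : st_smooth a U) (U0 : forall t x, a < t -> 0 < U t x).
Hypothesis UE : forall t x, a < t -> dt U t x = kap t * speed g c p psi U t x.
Hypothesis Un : forall s t x, 2 <= s -> s <= t -> U t x <= U s x.
Hypotheses (a00 : 0 < a0) (Ub : forall t x, 2 <= t -> a0 <= U t x <= a1).
Hypotheses (k00 : 0 < k0) (kap0 : forall t, 2 <= t -> k0 <= kap t).
Hypothesis dU0 : forall t x, 2 <= t -> dt U t x <= 0.
Local Notation ST := (R * 'rV[R]_n)%type.
Implicit Types (i : chart M).

Let q i b d (y : 'rV[R]_n) : R := c * ginv g i y b d.

(** The lower-order part of the equation in the normal form of [PW]: [U] itself enters as the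
    derivative along the empty word, and constants as coefficients of the power [0]. *)
Let P0 i (z : ST) : R :=
  \sum_b dH (st U i) [:: b] z * ((c * drift g i z.2 b) * st U i z `^ (1 - p)) +
  (dH (st U i) [::] z * ((- psi (phiV i z.2)) * st U i z `^ (1 - p)) +
   dH (st U i) [::] z * (-1 * st U i z `^ 0)).

Lemma P0_PW i : PW i a (st U i) 1 1 (P0 i).
Proof.
have oU := @open_img _ _ M i.
have cS (v : R) : smooth_on (img i) (fun=> v) by exact: smooth_on_cst.
apply: PW_add; [|apply: PW_add].
- apply: PW_sum => b; apply: (PW_dH (w := 0)) => //.
  apply: (PW_coef _ _ _ _ (q := fun y => c * drift g i y b)).
  exact: (smooth_onM oU (cS c) (drift_smooth g b)).
- apply: (PW_dH (w := 0)) => //; apply: (PW_coef _ _ _ _ (q := fun y => - psi (phiV i y))).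
  exact: (smooth_onN oU (@psiS i)).
- by apply: (PW_dH (w := 0)) => //; apply: (PW_coef _ _ _ _ (q := fun y => -1)).
Qed.

Lemma chart_equation i z : stdom a i z ->
  'D_((1, 0) : ST) (st U i) z = kap z.1 * (opd sp (Amx (st U i) (q i) (1 - p) z) (st U i) z + P0 i z).
Proof.
case: z => t y [/= ta iy]; rewrite -dtE (UE _ ta) /speed; apply: (f_equal (fun x => kap t * x)).
rewrite (laplacian_st lapC US ta iy) /P0 /st_lap /dH /= -/(st U i (t, y)).
rewrite powRr0 mulr1 mulrDr.
have -> : opd sp (Amx (st U i) (q i) (1 - p) (t, y)) (st U i) (t, y) = st U i (t, y) `^ (1 - p) *
   (c * \sum_b \sum_d ginv g i y b d * 'D_(sp b) ('D_(sp d) (st U i)) (t, y)).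
  rewrite /opd !mulr_sumr; apply: eq_bigr => b _; rewrite !mulr_sumr; apply: eq_bigr => d _.
  rewrite mxE /q /=; move: ('D_(sp b) ('D_(sp d) _) _) (st U i (t, y) `^ _) (ginv g i y b d) => x1 x2 x3; ring.
have -> : \sum_b 'D_(sp b) (st U i) (t, y) * (c * drift g i y b * st U i (t, y) `^ (1 - p)) =
    st U i (t, y) `^ (1 - p) * (c * \sum_b drift g i y b * 'D_(sp b) (st U i) (t, y)).
  rewrite !mulr_sumr; apply: eq_bigr => b _.
  move: ('D_(sp b) (st U i) (t, y)) (st U i (t, y) `^ _) (drift g i y b) => x1 x2 x3; ring.
rewrite /st /=.
move: (U t (phiV i y) `^ (1 - p)) => x3; ring.
Qed.

Lemma words_locally_bounded i k y0 : img i y0 -> exists r T C : R,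
  [/\ 0 < r, 2 <= T, box y0 r `<=` img i &
    forall s z, (size s <= k)%N -> region T y0 r z -> `|dH (st U i) s z| <= C].
Proof.
have oU := @open_img _ _ M i.
have cS (v : R) : smooth_on (img i) (fun=> v) by exact: smooth_on_cst.
apply: (@derivative_bound R n M i a (st U i) kap (q i) (1 - p) a0 a1 (P0 i) a2 (@US i)).
- by move=> z [za _]; exact: U0.
- by move=> t t2; exact: lt_le_trans k00 (kap0 t2).
- by move=> b d; exact: (smooth_onM oU (cS c) (ginv_smooth g b d)).
- move=> y iy; have [gT gp] := ginv_posdef g iy.
  have E : \matrix_(b, d) q i b d y = c *: ginv g i y by apply/matrixP => b d; rewrite !mxE.
  rewrite E; split; first by rewrite linearZ /= gT.
  by move=> v v0; rewrite -scalemxAr -scalemxAl mxE mulr_gt0// gp.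
- exact: P0_PW.
- exact: chart_equation.
- exact: a00.
- by move=> z z2 iz; exact: Ub.
- move=> y e iy e0; have [r [T [m [r0 T2 ri m0 H]]]] :=
    small_oscillation cM lapC c0 p1 psiS a2 US U0 UE Un a00 Ub k00 kap0 dU0 iy e0.
  by exists r, T, m; split => // z [Tz zr]; exact: H.
Qed.

Lemma dirder_space (G : ST -> R) t s y : dirder s (fun y => G (t, y)) y = dirder (map (fun v => ((0, v) : ST)) s) G (t, y).
Proof.
elim: s y => [//|v s IH] y /=.
rewrite (_ : dirder s _ = (fun y => dirder (map (fun v => ((0, v) : ST)) s) G (t, y))); last by apply/funext.
exact: derive_space.
Qed.

(** The derivatives of a power of [U] are differential polynomials, and once all the derivatives of
    [U] are bounded the weights can be taken constant. *)
Lemma power_coordb i (k : 'rV[R]_n -> R) be : smooth_on (img i) k ->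
  coordb (img i) (fun t y => k y * U t (phiV i y) `^ be).
Proof.
move=> kS w y0 iy0; pose f (z : ST) := k z.2 * st U i z `^ be.
have H0 z : stdom a i z -> 0 < st U i z by move=> [za _]; exact: U0.
have [r [T [C [r0 T2 ri HC]]]] := words_locally_bounded (size w) iy0.
have PWw (v : seq 'I_n) : PW i a (st U i) (size v) (size v) (dirder (map sp v) f).
  elim: v => [|b w' IH]; first by exact: PW_coef.
  exact: (PW_D (@US i) H0 b IH).
have C0 : 0 <= C.
  apply: le_trans (HC [::] (T, y0) (leq0n _) _); first exact: normr_ge0.
  by split => //= b; rewrite subrr normr0 ltW.
have [| | | |C' C'0 HC'] := @PW_bound R n M i a (st U i) (size w) (size w) (region T y0 r) (fun _ _ => 1) (fun _ _ => C)
  _ _ (region_O a2 T2 ri) _ _ _ _ (PWw w) (leqnn _).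
- by [].
- exact: HC.
- by move=> j v v' _ _ _; exists C => // z _; rewrite !mulr1.
- move=> k' al kS'.
  have Hb (z : ST) : 2 <= z.1 -> img i z.2 -> a0 <= st U i z <= a1 by move=> z2 _; exact: Ub.
  exact: (coef_bounded a00 Hb al T2 ri kS').
exists r, C'; split => //; exists T; split; first exact: num_real.
move=> t Tt y yr; rewrite (dirder_space f t (map (delta_mx 0) w) y) -map_comp.
rewrite -[leRHS]mulr1; apply: (HC' (t, y)); split => //=; exact: ltW.
Qed.

Definition limitU x := inf [set U t x | t in [set t : R | 2 <= t]].

Lemma limitU_le t x : 2 <= t -> limitU x <= U t x.
Proof.
move=> t2; apply: ge_inf; last by exists t.
by exists a0 => _ [s s2 <-]; have /andP[] := Ub x s2.
Qed.

Lemma limitU_ge m T x : 2 <= T -> (forall t, T <= t -> m <= U t x) -> m <= limitU x.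
Proof.
move=> T2 H; apply: lb_le_inf; first by exists (U 2 x); exists 2 => //=.
move=> _ [s s2 <-]; apply: le_trans (H (Num.max s T) _) (Un _ s2 _); by rewrite le_max lexx ?orbT.
Qed.

Lemma limitU_gt0 x : 0 < limitU x.
Proof.
apply: lt_le_trans a00 (limitU_ge (lexx 2) _) => t t2; by have /andP[] := Ub x t2.
Qed.

(** On a small box, and from some time on, [U] and its limit lie in a common interval of length
    [e]. *)
Lemma limitU_ucvg i : ucvg (img i) (fun t => U t \o phiV i) (limitU \o phiV i).
Proof.
apply: ucvg_local => y0 e iy0 e0.
have [r [T [m [r0 T2 ri m0 H]]]] :=
    small_oscillation cM lapC c0 p1 psiS a2 US U0 UE Un a00 Ub k00 kap0 dU0 iy0 e0.
exists (box y0 r, [set t | T <= t]) => /=.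
  split; first exact: box_nbhs.
  by exists T; split; [exact: num_real|move=> t /ltW].
move=> [y t] /= [yr Tt]; have /andP[h1 h2] := H t y Tt yr.
have h3 := limitU_le (phiV i y) (le_trans T2 Tt).
have h4 : m <= limitU (phiV i y) by apply: (limitU_ge T2) => s Ts; have /andP[] := H s y Ts yr.
rewrite distrC ger0_norm ?subr_ge0// lerBlDr; apply: le_trans h2 _; by rewrite addrC lerD2l.
Qed.

Lemma near_U_smooth i : usmooth (img i) (fun t => U t \o phiV i).
Proof.
exists a; split; first exact: num_real.
by move=> t ta; have S : smooth_fun (U t) := st_smooth_slice US ta; exact: (S i).
Qed.

Lemma power_limit i (k : 'rV[R]_n -> R) (be : R) (nu : R -> R) (nuoo : R) : smooth_on (img i) k ->
  nu t @[t --> +oo] --> nuoo ->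
  smooth_on (img i) (fun y => nuoo * (k y * limitU (phiV i y) `^ be)) /\
  forall s, ucvg (img i) (fun t => dirder s (fun y => nu t * (k y * U t (phiV i y) `^ be)))
    (dirder s (fun y => nuoo * (k y * limitU (phiV i y) `^ be))).
Proof.
move=> kS nuc; have oU := @open_img _ _ M i.
have FS : usmooth (img i) (fun t y => k y * U t (phiV i y) `^ be).
  exists a; split; first exact: num_real.
  move=> t ta; have S : smooth_fun (U t) := st_smooth_slice US ta.
  apply: (smooth_onM oU kS); apply: (smooth_on_powR be oU (S i)) => y _.
  exact: U0.
apply: (coordb_limit (@open_img _ _ M i)).
- apply: filterS FS => t tS.
  have cS (v : R) : smooth_on (img i) (fun=> v) by exact: smooth_on_cst.
  exact: (smooth_onM (@open_img _ _ M i) (cS (nu t)) tS).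
- exact: coordb_scale oU FS (power_coordb be kS) nuc.
- apply: (ucvg_weighted be oU (limitU_ucvg (i := i))) => //.
    move=> y iy; split; last exact: limitU_gt0.
    exact: ucvg_continuous oU (near_U_smooth i) (limitU_ucvg (i := i)) iy.
  by move=> y iy; exact: smooth_on_cts kS iy.
Qed.

Lemma unweighted (f : M -> R) i : (forall x, 0 < f x) -> (fun y => 1 * (1 * f (phiV i y) `^ 1)) = f \o phiV i.
Proof. by move=> f0; apply/funext => y; rewrite !mul1r powRr1// ltW. Qed.

Lemma limitU_smooth : smooth_fun limitU.
Proof.
move=> i; have cS (v : R) : smooth_on (img i) (fun=> v) by exact: smooth_on_cst.
have [S _] := power_limit 1 (cS 1) (cvg_cst (1 : R)).
by rewrite -(unweighted i limitU_gt0).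
Qed.

Lemma limitU_derivatives i s : ucvg (img i) (fun t => dirder s (U t \o phiV i)) (dirder s (limitU \o phiV i)).
Proof.
have cS (v : R) : smooth_on (img i) (fun=> v) by exact: smooth_on_cst.
have [_ /(_ s)] := power_limit 1 (cS 1) (cvg_cst (1 : R)).
rewrite (unweighted i limitU_gt0) => H K e cK KO e0.
have na : \forall t \near +oo, a < t by exists a; split; [exact: num_real|].
apply: filterS (filterI na (H K e cK KO e0)) => t [ta].
by rewrite (unweighted i (fun x => U0 x ta)).
Qed.

(** The convergence of the derivatives makes the speed converge at each point, to a nonpositive
    limit; a negative one would bound [dt U] away from [0], as [kap] is bounded below. *)
Lemma limitU_speed t x : speed g c p psi (fun=> limitU) t x = 0.
Proof.
have dx := chart_atP x; set i := chart_at x in dx; pose y := phi i x.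
have iy : img i y by exact: img_phi.
have yx : phiV i y = x by exact: phiK.
have D s := ucvg_pointwise (limitU_derivatives (i := i) s) iy.
have cU : U t x @[t --> +oo] --> limitU x by have := D [::]; rewrite /= yx.
have na : \forall t \near +oo, (2 : R) <= t by exists (2 : R); split; [exact: num_real|move=> s /ltW].
have cL : laplacian g (U t) x @[t --> +oo] --> laplacian g limitU x.
  rewrite -yx (lap_op2 lapC limitU_smooth iy).
  have c1 : op2 (U t \o phiV i) (ginv g i y) y + 'D_(\row_b drift g i y b) (U t \o phiV i) y @[t --> +oo] -->
      op2 (limitU \o phiV i) (ginv g i y) y + 'D_(\row_b drift g i y b) (limitU \o phiV i) y.
    apply: cvgD; last exact: (D [:: _]).
    apply: (@cvg_bigsum R R R (pinfty_nbhs R)) => b; apply: (@cvg_bigsum R R R (pinfty_nbhs R)) => d.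
    by apply: cvgM; [exact: cvg_cst|exact: (D [:: _; _])].
  apply: cvg_trans c1; apply: near_eq_cvg; apply: filterS na => s s2.
  exact: esym (lap_op2 lapC (st_smooth_slice US (lt_le_trans a2 s2)) iy).
have cS : speed g c p psi U s x @[s --> +oo] --> speed g c p psi (fun=> limitU) t x.
  have cP : U t x `^ (1 - p) @[t --> +oo] --> limitU x `^ (1 - p).
    exact: (cvg_comp _ _ cU (powR_continuous (be := 1 - p) (limitU_gt0 x))).
  have cE : c * laplacian g (U s) x - psi x * U s x @[s --> +oo] --> c * laplacian g limitU x - psi x * limitU x.
    by apply: cvgB; [apply: (cvgM _ cL)|apply: (cvgM _ cU)]; exact: cvg_cst.
  exact: (cvgB (cvgM cP cE) cU).
set sg := speed g c p psi (fun=> limitU) t x in cS *.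
have kp s : 2 <= s -> 0 < kap s by move=> s2; exact: lt_le_trans k00 (kap0 s2).
have s0 s : 2 <= s -> speed g c p psi U s x <= 0.
  by move=> s2; have := dU0 x s2; rewrite UE ?(lt_le_trans a2)// pmulr_rle0// kp.
have sg0 : sg <= 0.
  rewrite leNgt; apply/negP => sp.
  have [s [s2 hs]] := @filter_ex _ _ _ _ (filterI na (cvgr_gt _ cS _ sp)).
  by have := s0 s s2; rewrite leNgt hs.
apply/eqP; rewrite eq_le sg0 leNgt; apply/negP => sgn.
have sg2 : sg < sg / 2 by rewrite ltr_pdivlMr// mulr_natr mulr2n gtrDl.
have [T [_ HT]] := cvgr_lt _ cS _ sg2.
pose T2 := Num.max 2 (T + 1).
have T22 : 2 <= T2 by rewrite le_max lexx.
have TT : T < T2 by rewrite lt_max ltrDl ltr01 orbT.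
(* The duration after which a decrease at the rate [k0 sg / 2] exceeds [U T2 x + 1], more than
   positivity permits. *)
pose l := (U T2 x + 1) / (- (k0 * (sg / 2))).
have l1 : 0 < - (k0 * (sg / 2)) by rewrite oppr_gt0 pmulr_rlt0// pmulr_llt0// invr_gt0.
have l0 : 0 <= l by rewrite divr_ge0 ?(ltW l1)// addr_ge0// ltW// U0// (lt_le_trans a2).
have TT2 : T2 <= T2 + l by rewrite lerDl.
have [|s /andP[s1 s2] E] := @deriv_MVT R (U^~ x) (fun s => dt U s x) T2 (T2 + l) TT2.
  by move=> s /andP[s1 _]; apply: st_is_derive US _; exact: lt_le_trans a2 (le_trans T22 s1).
have s22 := le_trans T22 s1.
have I : dt U s x <= k0 * (sg / 2).
  rewrite UE ?(lt_le_trans a2)//; apply: le_trans (_ : kap s * (sg / 2) <= _).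
    by rewrite ler_pM2l ?kp// ltW// HT// (lt_le_trans TT).
  by rewrite ler_wnM2r ?kap0// pmulr_lle0 ?invr_gt0.
have J : dt U s x * l <= k0 * (sg / 2) * l by exact: ler_wpM2r.
have e1 : k0 * (sg / 2) * l = - (U T2 x + 1) by rewrite /l invrN mulrN mulrN mulrCA mulfV ?mulr1// -oppr_eq0 gt_eqF.
have P := U0 x (lt_le_trans a2 (le_trans T22 (_ : T2 <= T2 + l))).
move: E; rewrite addrAC subrr add0r => E.
have := P _; rewrite lerDl => /(_ l0).
rewrite e1 -E lerBlDl opprD addrA subrr add0r in J.
by move=> P2; have := lt_le_trans P2 J; rewrite oppr_gt0 ltr10.
Qed.

End convergence.

(** * From the normalized solution back to the flow *)

Section convergence_tools.
Context {R : realType}.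

Lemma uniform_of_dist (V W : normedModType R) (K : set V) (F : R -> V -> W) (f : V -> W) :
  (forall e : R, 0 < e -> \forall t \near +oo, forall y, K y -> `|f y - F t y| <= e) ->
  {uniform K, F @ +oo --> f}.
Proof.
move=> H P /uniform_nbhs[E [entE EP]].
move: entE; rewrite -entourage_ballE => -[e /= e0 eE].
have e20 : 0 < e / 2 by rewrite divr_gt0.
apply: filterS (H _ e20) => t I; apply: EP => y Ky; apply: eE.
rewrite /= -ball_normE /=; apply: le_lt_trans (I y Ky) _.
by rewrite ltr_pdivrMr// mulr_natr mulr2n ltrDl.
Qed.

Lemma dirder_mx (V : normedModType R) m n (U : set V) (A : V -> 'M[R]_(m, n)) s b d y :
  open U -> smooth_on U A -> U y -> dirder s A y b d = dirder s (fun y => A y b d) y.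
Proof.
move=> oU AS; elim: s y => [//|v s IH] y Uy /=.
rewrite (derive_mx (smooth_on_derivable (v := v) (smooth_on_dirder s AS) Uy)) mxE.
by apply: near_eq_derive; apply: (open_near oU Uy) => z; exact: IH.
Qed.

Lemma nondecreasing_limit (q : R -> R) (q1 : R) : (forall s t : R, 2 <= s -> s <= t -> q s <= q t) ->
  (forall t, 2 <= t -> q t <= q1) -> exists qoo : R, q 2 <= qoo /\ q t @[t --> +oo] --> qoo.
Proof.
move=> qm qb; pose A := [set q t | t in [set t : R | 2 <= t]].
have sA : has_sup A.
  by split; [exists (q 2); exists 2 => //=|exists q1 => _ [t t2 <-]; exact: qb].
have qle t : 2 <= t -> q t <= sup A by move=> t2; apply: sup_upper_bound sA _ _; exists t.
exists (sup A); split; first exact: qle.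
apply/cvgrPdist_le => e e0; have [_ [T /= T2 <-] qT] := sup_adherent e0 sA.
exists T; split; first exact: num_real.
move=> t /ltW Tt; have h := qm _ _ T2 Tt; have t2 := le_trans T2 Tt.
rewrite ger0_norm ?subr_ge0 ?qle// lerBlDl -lerBlDr.
by apply: le_trans (ltW qT) _.
Qed.

End convergence_tools.


Theorem theorem3 (R : realType) (n : nat) (M : manifold R n) (g : metric M)
    (vol : {measure set (borel M) -> \bar R})
    (psi u0 : M -> R) (u : R -> M -> R) :
  (3 <= n)%N ->
  compact [set: M] -> connected [set: M] ->
  is_volume g vol ->
  smooth_fun psi ->
  (lambda1 g vol psi < 0)%E ->
  (forall x, psi x < 0) ->
  smooth_fun u0 -> (forall x, 0 < u0 x) ->
  is_yamabe_flow g vol psi u0 u ->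
  exists uoo : M -> R,
    [/\ smooth_fun uoo, forall x, 0 < uoo x,
        smooth_cvg u uoo,
        exists kappa : R, forall x, pseudo_curvature g psi uoo x = kappa &
        conf_metric_cvg g u uoo].
Proof.
move=> n3 cM _ volP psiS _ psi0 _ _ [uS u0' _ uE].
have lapC i f x : smooth_fun f -> dom i x -> laplacian g f x = lap g i (f \o phiV i) (phi i x).
  by move=> fS dx; exact (laplacian_chart volP cM fS dx).
pose c : R := conf_const (n := n); pose p : R := crit_exp (n := n).
have n2 : 0 < n%:R - 2 :> R by rewrite subr_gt0 ltr_nat.
have c0 : 0 < c by rewrite divr_gt0// mulr_gt0// subr_gt0 ltr1n (leq_trans _ n3).
have p1 : 1 < p by rewrite ltr_pdivlMr// mul1r ltrD2l (lt_trans (_ : -2 < 0)) ?oppr_lt0.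
have uSt := smooth_spacetime_st uS.
have up (t : R) x : 0 < t -> 0 < u t x by move=> /ltW; exact: u0'.
have uE' (t : R) x : 0 < t -> dt u t x = u t x `^ (1 - p) * (c * laplacian g (u t) x - psi x * u t x) +
    flow_r g vol psi (u t) * u t x.
  by move=> t0; apply: etrans (uE t x t0); rewrite derive1E.
have [a [q [/andP[a0 a2] qS q0 US [UE sp2]]]] := normalize cM lapC p1 psiS uSt up uE'.
(* The scale is [mu = q^b], because [q = mu^(p-1)]. *)
pose b := (p - 1)^-1; have b0 : 0 < b by rewrite invr_gt0 subr_gt0.
pose U (t : R) x := q t `^ (- b) * u t x; rewrite -/U in US UE sp2.
have Up (t : R) x : a < t -> 0 < U t x.
  by move=> ta; rewrite mulr_gt0 ?powR_gt0 ?q0 ?up// (lt_trans a0).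
have oA : open [set t : R | a < t] by exact: open_gt.
have kS : smooth_on [set t : R | a < t] (fun t => (q t)^-1).
  by apply: (smooth_on_V oA qS) => t ta; rewrite gt_eqF// q0.
have k0 (t : R) : a < t -> 0 < (q t)^-1 by move=> ta; rewrite invr_gt0 q0.
have dU0 (t : R) x : 2 <= t -> dt U t x <= 0 by exact: (dt_le0 cM lapC c0 p1 psiS a2 kS k0 US Up UE sp2).
have Un (s t : R) x : 2 <= s -> s <= t -> U t x <= U s x by exact: (U_nincr cM lapC c0 p1 psiS a2 kS k0 US Up UE sp2).
have [l0 [l1 [l00 Ub]]] := U_bounds cM lapC c0 p1 psiS psi0 a2 kS k0 US Up UE sp2.
have uU (t : R) x : a < t -> u t x = q t `^ b * U t x.
  by move=> ta; rewrite mulrA -powRD ?subrr ?powRr0 ?mul1r// (gt_eqF (q0 t ta)) implybT.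
have [qm [q1 qq1]] := factor_bounds volP cM p1 psiS uSt up uE' a2 (ltW a0) q0 b0 US Up uU Ub l00 Un.
have q2 : 0 < q 2 by exact: q0.
have q1p : 0 < q1 by exact: lt_le_trans q2 (qq1 2 (lexx 2)).
(* The upper bound on the scale is a positive lower bound on the time factor [1 / q]: the flow of
   [U] does not stall. *)
have kl (t : R) : 2 <= t -> q1^-1 <= (q t)^-1.
  by move=> t2; rewrite lef_pV2 ?posrE ?qq1 ?q0 ?(lt_le_trans a2).
have q1i : 0 < q1^-1 by rewrite invr_gt0.
have [qoo [qoo2 qc]] := nondecreasing_limit qm qq1.
have qoo0 : 0 < qoo by exact: lt_le_trans q2 qoo2.
pose w := limitU U.
have w0 x : 0 < w x by exact: (limitU_gt0 Un l00 Ub).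
have wS : smooth_fun w by exact: (limitU_smooth cM lapC c0 p1 psiS a2 US Up UE Un l00 Ub q1i kl dU0).
have spw x : speed g c p psi (fun=> w) 0 x = 0.
  exact: (limitU_speed cM lapC c0 p1 psiS a2 US Up UE Un l00 Ub q1i kl dU0).
pose mu := qoo `^ b; have mu0 : 0 < mu by rewrite powR_gt0.
have na : \forall t \near +oo, a < t by exists a; split; [exact: num_real|].
have lim i k be := power_limit cM lapC c0 p1 psiS a2 US Up UE Un l00 Ub q1i kl dU0 (i := i) (k := k) be.
have cS i (v : R) : smooth_on (img (M := M) i) (fun=> v) by exact: smooth_on_cst.
have powc be : (fun t => (q t `^ b) `^ be) t @[t --> +oo] --> mu `^ be.
  have c1 : q t `^ b @[t --> +oo] --> mu by exact: (cvg_comp _ _ qc (powR_continuous (be := b) qoo0)).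
  exact: (cvg_comp _ _ c1 (powR_continuous (be := be) mu0)).
exists (fun x => mu * w x); split.
- exact: smooth_funM (smooth_fun_cst mu) wS.
- by move=> x; exact: mulr_gt0.
- move=> i s K cK KO; apply: uniform_of_dist => e e0.
  have [_ /(_ s K e cK KO e0)] := lim i _ 1 _ _ (cS i 1) (powc 1).
  have -> : (fun y => mu `^ 1 * (1 * w (phiV i y) `^ 1)) = (fun x => mu * w x) \o phiV i.
    by apply/funext => y /=; rewrite mul1r !powRr1 ?(ltW mu0)// ltW.
  move=> H; apply: filterS (filterI na H) => t [ta].
  have -> : (fun y => (q t `^ b) `^ 1 * (1 * U t (phiV i y) `^ 1)) = u t \o phiV i.
    by apply/funext => y /=; rewrite uU// mul1r !powRr1 ?powR_ge0// ltW// Up.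
  by [].
(* The limit [w] has pseudo-scalar curvature [- 1], and multiplication by [mu] scales it by
   [mu^(1-p)]. *)
- exists (- (mu `^ (- p) * mu)) => x; rewrite /pseudo_curvature -/p -/c.
  rewrite (laplacianZ lapC mu x wS) powRM ?(ltW mu0) ?(ltW (w0 x))//.
  have := spw x; rewrite /speed => /eqP; rewrite subr_eq0 => /eqP E.
  have e1 : w x `^ (1 - p) = w x * w x `^ (- p).
    by rewrite -{2}(powRr1 (ltW (w0 x))) -powRD// (gt_eqF (w0 x)) implybT.
  rewrite e1 in E; have wn : w x != 0 by rewrite gt_eqF.
  have {}E : w x `^ (- p) * (c * laplacian g w x - psi x * w x) = 1.
    by apply: (mulfI wn); rewrite mulrA E mulr1.
  have alg (m k x1 x2 x3 y v : R) : x2 * (k * x3 - y * v) = 1 ->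
      x1 * x2 * (- k * (m * x3) + y * (m * v)) = - (x1 * m).
    move=> H; rewrite (_ : x1 * x2 * _ = - (x1 * m * (x2 * (k * x3 - y * v)))); last by ring.
    by rewrite H mulr1.
  exact: alg.
- move=> i s K cK KO; apply: uniform_of_dist => e e0.
  (* Each coefficient of the conformal metric is a coefficient of [g] times the power [al] of the
     solution, so the convergence is that of [power_limit], entry by entry. *)
  pose al : R := 4 / (n%:R - 2).
  have gS d f : smooth_on (img i) (fun y => gmx g i y d f).
    by apply: smooth_on_coord; [exact: open_img|exact: gmx_smooth].
  have E1 d f : (fun y => mu `^ al * (gmx g i y d f * w (phiV i y) `^ al)) =
      (fun y => conf_gmx g (fun x => mu * w x) i y d f).
    apply/funext => y; rewrite /conf_gmx mxE powRM ?(ltW mu0) ?(ltW (w0 _))// -mulrA.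
    by rewrite [gmx _ _ _ _ _ * _]mulrC.
  have E2 (t : R) d f : a < t -> (fun y => (q t `^ b) `^ al * (gmx g i y d f * U t (phiV i y) `^ al)) =
      (fun y => conf_gmx g (u t) i y d f).
    move=> ta; apply/funext => y; rewrite /conf_gmx mxE uU// powRM ?powR_ge0 ?(ltW (Up _ _ ta))// -mulrA.
    by rewrite [gmx _ _ _ _ _ * _]mulrC.
  have S1 : smooth_on (img i) (conf_gmx g (fun x => mu * w x) i).
    apply: smooth_on_mx; first exact: open_img.
    by move=> d f; rewrite -E1; have [] := lim i _ al _ _ (gS d f) (powc al).
  have S2 (t : R) : a < t -> smooth_on (img i) (conf_gmx g (u t) i).
    move=> ta; apply: smooth_on_mx; first exact: open_img.
    move=> d f; rewrite -(E2 t d f ta); have oU := @open_img _ _ M i.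
    have US' : smooth_fun (U t) := st_smooth_slice US ta.
    apply: (smooth_onM oU (cS i _)); apply: (smooth_onM oU (gS d f)).
    by apply: (smooth_on_powR al oU (US' i)) => y _; exact: Up.
  have H : \forall t \near +oo, forall df : 'I_n * 'I_n, forall y, K y ->
      `|dirder s (fun y => conf_gmx g (fun x => mu * w x) i y df.1 df.2) y -
        dirder s (fun y => conf_gmx g (u t) i y df.1 df.2) y| <= e.
    apply: (@filter_forall _ _ (fun (df : 'I_n * 'I_n) t => forall y, K y ->
      `|dirder s (fun y => conf_gmx g (fun x => mu * w x) i y df.1 df.2) y -
        dirder s (fun y => conf_gmx g (u t) i y df.1 df.2) y| <= e) (pinfty_nbhs R)) => -[d f] /=.
    have [_ /(_ s K e cK KO e0)] := lim i _ al _ _ (gS d f) (powc al).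
    rewrite E1 => H; apply: filterS (filterI na H) => t [ta].
    by rewrite (E2 t d f ta).
  apply: filterS (filterI na H) => t [ta {}H] y Ky.
  rewrite [leLHS]/Num.norm/= mx_normrE; apply/bigmax_leP; split; first exact: ltW.
  move=> [d f] _; rewrite !mxE /= (dirder_mx s _ _ (@open_img _ _ M i) S1 (KO _ Ky)).
  by rewrite (dirder_mx s _ _ (@open_img _ _ M i) (S2 t ta) (KO _ Ky)); exact: (H (d, f)).
Qed.
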